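(* The operator $\mathcal{T}_f:\mathcal{A}^2(\Omega;\mathbb{B})\to\mathcal{A}_f^2(\Omega;\mathbb{B})$ is bounded and invertible with bounded inverse. The same properties are valid for $\mathcal{T}_{\frac1f}:\mathcal{A}^2(\Omega;\mathbb{B})\to\mathcal{A}_{\frac1f}^2(\Omega;\mathbb{B})$.
   Context: $\mathbb{B}$ is the algebra of bicomplex numbers $W=u+\mathbf{j}v$, $u,v\in\mathbb{C}$, $\mathbf{j}^2=-1$, $\mathbf{j}i=i\mathbf{j}$; $\operatorname{Sc}W=u$, $\operatorname{Vec}W=v$, $\overline{W}=u-\mathbf{j}v$, $|W|_{\mathbb{B}}=\sqrt{|u|^2+|v|^2}$. $C^k(\Omega;\mathbb{B})$ and $L_2(\Omega;\mathbb{B})$ are defined componentwise, with $\|F\|_{L_2(\Omega;\mathbb{B})}=\left(\iint_\Omega|F(z)|_{\mathbb{B}}^2\,dA_z\right)^{1/2}$. $\overline{\boldsymbol{\partial}}=\frac12\left(\frac{\partial}{\partial x}+\mathbf{j}\frac{\partial}{\partial y}\right)$, $z=x+iy$. Setting. $\Omega\subset\mathbb{C}$ is a bounded domain star-shaped with respect to $z=0$ (that is, $0\in\Omega$ and $[0,z]\subset\Omega$ for all $z\in\Omega$), and $\varrho_\Omega=\sup_{z\in\Omega}|z|$. The function $q_f\in C^1[0,\varrho_\Omega]$ is complex-valued, and $f\in C^2[0,\varrho_\Omega]$ is complex-valued, nowhere zero on $[0,\varrho_\Omega]$, satisfies $f''(r)+\frac1rf'(r)-q_f(r)f(r)=0$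 on $(0,\varrho_\Omega)$, and is normalized by $f(0)=1$, $\lim_{r\to0^+}rf'(r)=0$; $f$ is identified with the radial function $z\mapsto f(|z|)$, assumed to be in $C^2(\overline\Omega)$. Put $q_{\frac1f}=2\left(\frac{f'}{f}\right)^2-q_f$, the potential associated in the same way to $\frac1f$. For $g\in\{f,\frac1f\}$ let $G^g\in C^2([0,\varrho_\Omega]\times[0,1])$ be the kernel (known to exist) satisfying $$r\left(G^g_{rr}(r,t)-q_g(r)G^g(r,t)\right)-G^g_r(r,t)+2(1-t)G^g_{rt}(r,t)=0,$$ $$G^g(r,0)=\int_0^r\tau q_g(\tau)\,d\tau,\qquad G^g(0,t)=0,$$ and define, for complex-valued $h\in C(\Omega)$, $\mathbf{T}_gh(z)=h(z)+\int_0^1\sigma\,G^g(|z|,1-\sigma^2)\,h(\sigma^2z)\,d\sigma$. Put $\mathcal{T}_fW=\mathbf{T}_f\operatorname{Sc}W+\mathbf{j}\,\mathbf{T}_{\frac1f}\operatorname{Vec}W$ and $\mathcal{T}_{\frac1f}W=\mathbf{T}_{\frac1f}\operatorname{Sc}W+\mathbf{j}\,\mathbf{T}_{f}\operatorname{Vec}W$. For a non-vanishing scalar function $g$, $\mathcal{A}_g^2(\Omega;\mathbb{B})$ is the space of $W\in C^1(\Omega;\mathbb{B})\cap L_2(\Omega;\mathbb{B})$ with $\overline{\boldsymbol{\partial}}W=\frac{\overline{\boldsymbol{\partial}}g}{g}\overline{W}$ in $\Omega$, with the $L_2(\Omega;\mathbb{B})$-norm; $\mathcal{A}^2(\Omega;\mathbb{B})$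 is the case $g\equiv1$ (bicomplex holomorphic $L_2$ functions). *)

(* Defs.v *)
(* MathComp / MathComp-Analysis development over an arbitrary [R : realType].
   A point z = x + iy of the plane is the pair (x, y) : R * R; the complex
   values of functions live in R[i] (mathcomp-real-closed). *)
From HB Require Import structures.
From mathcomp Require Import all_boot all_order all_algebra.
From mathcomp Require Import all_classical all_reals all_analysis.
From mathcomp Require Import ring.
From mathcomp Require Export complex.

Set Implicit Arguments.
Unset Strict Implicit.
Unset Printing Implicit Defensive.

Import Order.TTheory GRing.Theory Num.Theory.
Import numFieldNormedType.Exports.

Local Open Scope classical_set_scope.
Local Open Scope ring_scope.
Local Open Scope complex_scope.

Record bicomplex (R : Type) := Bicomplex { Sc : R[i]; Vec : R[i] }.

Section BicomplexAlgebra.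
Variable R : rcfType.
Implicit Types (V W Z : bicomplex R) (a b : R[i]).

Definition bpair W := (Sc W, Vec W).
Definition pairb (p : R[i] * R[i]) := Bicomplex p.1 p.2.
Lemma bpairK : cancel bpair pairb. Proof. by case. Qed.
HB.instance Definition _ := Choice.copy (bicomplex R) (can_type bpairK).

Definition addb V W := Bicomplex (Sc V + Sc W) (Vec V + Vec W).
Definition oppb W := Bicomplex (- Sc W) (- Vec W).
(* (u + j v)(u' + j v') with j^2 = -1, j commuting with R[i]. *)
Definition mulb V W :=
  Bicomplex (Sc V * Sc W - Vec V * Vec W) (Sc V * Vec W + Vec V * Sc W).
Definition scaleb a W := Bicomplex (a * Sc W) (a * Vec W).

Lemma addbA : associative addb.
Proof. by move=> [? ?] [? ?] [? ?]; congr Bicomplex; apply: addrA. Qed.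
Lemma addbC : commutative addb.
Proof. by move=> [? ?] [? ?]; congr Bicomplex; apply: addrC. Qed.
Lemma add0b : left_id (Bicomplex 0 0) addb.
Proof. by move=> [? ?]; congr Bicomplex; apply: add0r. Qed.
Lemma addNb : left_inverse (Bicomplex 0 0) oppb addb.
Proof. by move=> [? ?]; congr Bicomplex; apply: addNr. Qed.
HB.instance Definition _ :=
  GRing.isZmodule.Build (bicomplex R) addbA addbC add0b addNb.

Lemma mulbA : associative mulb.
Proof. by move=> [? ?] [? ?] [? ?]; congr Bicomplex => /=; ring. Qed.
Lemma mulbC : commutative mulb.
Proof. by move=> [? ?] [? ?]; congr Bicomplex => /=; ring. Qed.
Lemma mul1b : left_id (Bicomplex 1 0) mulb.
Proof. by move=> [? ?]; congr Bicomplex => /=; ring. Qed.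
Lemma mulbDl : left_distributive mulb +%R.
Proof. by move=> [? ?] [? ?] [? ?]; congr Bicomplex => /=; ring. Qed.
Lemma oneb_neq0 : Bicomplex 1 0 != 0 :> bicomplex R.
Proof. by apply/eqP => -[/eqP]; rewrite oner_eq0. Qed.
HB.instance Definition _ := GRing.Zmodule_isComNzRing.Build (bicomplex R)
  mulbA mulbC mul1b mulbDl oneb_neq0.

Lemma scalebA a b W : scaleb a (scaleb b W) = scaleb (a * b) W.
Proof. by congr Bicomplex => /=; ring. Qed.
Lemma scale1b : left_id 1 scaleb.
Proof. by move=> [? ?]; congr Bicomplex => /=; ring. Qed.
Lemma scalebDr : right_distributive scaleb +%R.
Proof. by move=> ? [? ?] [? ?]; congr Bicomplex => /=; ring. Qed.
Lemma scalebDl W : {morph scaleb^~ W : a b / a + b}.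
Proof. by move=> a b; congr Bicomplex => /=; ring. Qed.
HB.instance Definition _ := GRing.Zmodule_isLmodule.Build R[i] (bicomplex R)
  scalebA scale1b scalebDr scalebDl.

Lemma scalebAl a V W : a *: (V * W) = a *: V * W.
Proof. by congr Bicomplex => /=; ring. Qed.
HB.instance Definition _ :=
  GRing.Lmodule_isLalgebra.Build R[i] (bicomplex R) scalebAl.

Definition jB : bicomplex R := Bicomplex 0 1.
Definition conjB W := Bicomplex (Sc W) (- Vec W).
Definition absB W := Num.sqrt (Normc.normc (Sc W) ^+ 2 + Normc.normc (Vec W) ^+ 2).

End BicomplexAlgebra.
Arguments jB {R}.

Section Derivatives.
Variables (R : realType) (V : normedModType R).

Definition Cderive (u : V -> R[i]) (v p : V) : R[i] :=
  'D_v (fun q => complex.Re (u q)) p +i* 'D_v (fun q => complex.Im (u q)) p.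

(* C^k on the open set D; [e] lists the coordinate directions of V, so that
   the 'D_v with v \in e are the partial derivatives. *)
Fixpoint Ck (e : seq V) (k : nat) (D : set V) (u : V -> R) : Prop :=
  {within D, continuous u} /\
  (if k is k'.+1 then
     forall v, v \in e ->
       (forall p, D p -> derivable u p v) /\ Ck e k' D ('D_v u)
   else True).

(* u is of class C^k on the open set D and its partial derivatives of order at
   most k extend continuously from D to closure D. *)
Fixpoint Ck_ext (e : seq V) (k : nat) (D : set V) (u : V -> R) : Prop :=
  (exists w : V -> R, {within closure D, continuous w} /\ {in D, u =1 w}) /\
  (if k is k'.+1 then
     forall v, v \in e ->
       (forall p, D p -> derivable u p v) /\ Ck_ext e k' D ('D_v u)
   else True).

(* C^k(closure D), D open: u itself is defined on closure D and is its own
   continuous extension.  Derivatives are only ever taken inside D; what ['D]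
   returns on the boundary is irrelevant. *)
Definition Ck_closure e k D u :=
  {within closure D, continuous u} /\ Ck_ext e k D u.

Definition CkC e k D (u : V -> R[i]) :=
  Ck e k D (fun p => complex.Re (u p)) /\ Ck e k D (fun p => complex.Im (u p)).

Definition CkC_closure e k D (u : V -> R[i]) :=
  Ck_closure e k D (fun p => complex.Re (u p)) /\
  Ck_closure e k D (fun p => complex.Im (u p)).

End Derivatives.

Section Plane.
Variable R : realType.
Local Notation plane := (R * R)%type.
Implicit Types (Omega : set plane) (W : plane -> bicomplex R).

Definition e_x : plane := (1, 0).
Definition e_y : plane := (0, 1).
Definition axes : seq plane := [:: e_x; e_y].

(* Euclidean modulus; the library norm `|z| on R * R is the max norm. *)
Definition cabs (z : plane) : R := Num.sqrt (z.1 ^+ 2 + z.2 ^+ 2).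

Definition starshaped0 Omega :=
  Omega (0, 0) /\
  forall z (t : R), Omega z -> 0 <= t <= 1 -> Omega (t *: z).

Definition rhoOf Omega : R := sup [set cabs z | z in Omega].

(* The same type as [plane], with the sigma-algebra of [lebesgue_measure]. *)
Local Notation mplane := (measurableTypeR R * measurableTypeR R)%type.

Definition area : {measure set mplane -> \bar R} :=
  (@lebesgue_measure R \x @lebesgue_measure R)%E.

Definition L2C Omega (u : plane -> R[i]) :=
  [/\ measurable_fun (Omega : set mplane) (fun z : mplane => complex.Re (u z)),
      measurable_fun (Omega : set mplane) (fun z : mplane => complex.Im (u z)) &
      area.-integrable Omega (fun z => (Normc.normc (u z) ^+ 2)%:E)].

Definition L2B Omega W :=
  L2C Omega (fun z => Sc (W z)) /\ L2C Omega (fun z => Vec (W z)).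

Definition L2norm Omega W : R :=
  Num.sqrt (\int[area]_(z in Omega) (absB (W z) ^+ 2)).

Definition C1B Omega W :=
  CkC axes 1 Omega (fun z => Sc (W z)) /\
  CkC axes 1 Omega (fun z => Vec (W z)).

Definition Bderive W (v z : plane) : bicomplex R :=
  Bicomplex (Cderive (fun p => Sc (W p)) v z)
            (Cderive (fun p => Vec (W p)) v z).

(* 1/2 (d/dx + j d/dy) *)
Definition dbar W (z : plane) : bicomplex R :=
  2^-1 *: (Bderive W e_x z + jB * Bderive W e_y z).

(* A^2_g(Omega; B), for a scalar non-vanishing g. *)
Definition A2 Omega (g : plane -> R[i]) : set (plane -> bicomplex R) :=
  [set W | [/\ C1B Omega W, L2B Omega W &
    forall z, Omega z ->
      dbar W z
      = ((g z)^-1 *: dbar (fun p => Bicomplex (g p) 0) z) * conjB (W z)]].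

Definition Cintegral (a b : R) (h : R -> R[i]) : R[i] :=
  (\int[@lebesgue_measure R]_(s in `[a, b]) complex.Re (h s))
  +i* (\int[@lebesgue_measure R]_(s in `[a, b]) complex.Im (h s)).

Definition T_op (G : plane -> R[i]) (h : plane -> R[i]) (z : plane) : R[i] :=
  h z + Cintegral 0 1 (fun s =>
    s%:C * G (cabs z, 1 - s ^+ 2) * h (s ^+ 2 *: z)).

(* T_{G1} on the scalar part, T_{G2} on the vector part. *)
Definition TB (G1 G2 : plane -> R[i]) W (z : plane) : bicomplex R :=
  Bicomplex (T_op G1 (fun p => Sc (W p)) z) (T_op G2 (fun p => Vec (W p)) z).

(* C^k[0, rho] *)
Definition Ck_itv k (rho : R) (u : R -> R[i]) :=
  CkC_closure [:: (1 : R)] k `]0, rho[%classic u.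

(* C^k([0, rho] x [0, 1]) *)
Definition Ck_rect k (rho : R) (G : plane -> R[i]) :=
  CkC_closure axes k (`]0, rho[%classic `*` `]0, 1[%classic) G.

Definition Cder (u : R -> R[i]) (r : R) : R[i] := Cderive u 1 r.

(* Potential attached to 1/f.  Only its values on ]0, rho[, where Cder f is a
   genuine derivative, matter below: the endpoints are Lebesgue-null. *)
Definition q_inv (f q : R -> R[i]) (r : R) : R[i] :=
  2 * (Cder f r / f r) ^+ 2 - q r.

(* The equation is imposed in the open rectangle; for G of class C^2 up to the
   boundary it extends to the closed one by continuity. *)
Definition is_kernel (rho : R) (q : R -> R[i]) (G : plane -> R[i]) :=
  let G_r := Cderive G e_x in
  let G_rr := Cderive G_r e_x in
  let G_rt := Cderive G_r e_y in
  [/\ Ck_rect 2 rho G,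
      forall r t : R, 0 < r < rho -> 0 < t < 1 ->
        r%:C * (G_rr (r, t) - q r * G (r, t)) - G_r (r, t)
        + 2 * (1 - t)%:C * G_rt (r, t) = 0,
      forall r : R, 0 <= r <= rho ->
        G (r, 0) = Cintegral 0 r (fun tau => tau%:C * q tau) &
      forall t : R, 0 <= t <= 1 -> G (0, t) = 0].

(* Operators between spaces of bicomplex functions on Omega.  An element of
   such a space is represented by a function on the whole plane of which only
   the restriction to Omega matters: equality is equality on Omega. *)
Definition bounded_operator Omega (A A' : set (plane -> bicomplex R))
    (T : (plane -> bicomplex R) -> (plane -> bicomplex R)) :=
  [/\ forall W, A W -> A' (T W),
      forall (a : R[i]) V W, A V -> A W -> forall z, Omega z ->
        T (fun p => a *: V p + W p) z = a *: T V z + T W z &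
      exists C : R, forall W, A W -> L2norm Omega (T W) <= C * L2norm Omega W].

Definition bounded_invertible Omega (A A' : set (plane -> bicomplex R))
    (T : (plane -> bicomplex R) -> (plane -> bicomplex R)) :=
  bounded_operator Omega A A' T /\
  exists S, [/\ bounded_operator Omega A' A S,
    forall W, A W -> forall z, Omega z -> S (T W) z = W z &
    forall W, A' W -> forall z, Omega z -> T (S W) z = W z].

End Plane.

(* Main.v *)
Require Import Defs.
From HB Require Import structures.
From mathcomp Require Import all_boot all_order all_algebra.
From mathcomp Require Import all_classical all_reals all_analysis.
From mathcomp Require Import complex.
From mathcomp Require Import measurable_realfun ring lra.
Import Order.TTheory GRing.Theory Num.Theory.
Import numFieldNormedType.Exports.
Local Open Scope classical_set_scope.
Local Open Scope ring_scope.
Local Open Scope complex_scope.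
Set Implicit Arguments.
Unset Strict Implicit.
Unset Printing Implicit Defensive.

(** Write [W = u + j v] and [phi r = r f'(r) / f(r)], and let [E = r d/dr] and
    [A = d/dtheta] be the radial and the angular derivatives. Off the origin the
    Vekua equation of [f(|z|)] is equivalent to the system
      [E u - phi u = A v],  [E v + phi v = - A u],
    which for [f = 1] is the Cauchy-Riemann system [E u = A v], [E v = - A u]
    ([polar_system]). Let [a] and [b] be the kernels of [f] and [1 / f], and [T_a]
    and [T_b] their operators. These commute with [A], as the kernels are radial
    ([Tk_angular]), and they satisfy
      [(E - phi) T_a = T_b E],  [(E + phi) T_b = T_a E]
    ([Tk_radial]). Hence [(T_a u, T_b v)] solves the Vekua system if [(u, v)]
    solves the Cauchy-Riemann system, and the converse holds because [T_a] and
    [T_b] are injective. At the origin the equations follow by continuity.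

    The relations between [T_a] and [T_b] express, after an integration by parts in
    the variable of integration, two first-order identities between [a] and [b]
    ([transmutation_pair]). These come from the second-order kernel equations:
    the defects of the identities for [a + b] and [a - b] solve a homogeneous
    first-order Goursat system with zero data, so that they vanish
    ([goursat_uniqueness], [kernel_transmutation]).

    The operators are of Volterra type along the segments from the origin. In a
    weighted supremum norm the integral part is a contraction, which gives
    injectivity, and surjectivity on functions of class [C^1], where successive
    approximations and their derivatives converge locally uniformly
    ([Tk_injective], [Tk_surjective]). The operator on bicomplex functions is
    thus a bijection between the two spaces as soon as finiteness of the [L^2]
    norm is preserved both ways.

    It remains to compare the [L^2] norms of [h] and [T h] ([TK_equivalence]). As
    [T h] at [z] involves the values of [h] near the origin, this is done only
    for [h] one of a pair of conjugate functions. The mean value property against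
    a radial weight bounds the value of such an [h] at a point by its [L^2] norm
    over a square ([sqr_le_mean_square]). Near the origin, where the integral part
    is small, this controls [h] by the [L^2] norm of [h], and also by that of [T h]
    ([submean_local], [local_bound]). Away from the origin, [T h] is
    bounded by [h] along segments and, by Gronwall's inequality, [h] by [T h]
    ([TK_ray_le], [ray_le_TK]). Integrating over the domain with Tonelli's theorem
    and dilations turns these pointwise bounds into [L^2] bounds
    ([E2_from_rays]).

    The statement for [1 / f] follows by exchanging [a] and [b], which changes the
    sign of [phi]. *)

(** * Complex-valued calculus *)

Section ComplexCalculus.
Variable R : realType.
Local Notation normc := (@Normc.normc R).
Implicit Types (z w : R[i]).

(** Continuity at a point of a complex-valued function, componentwise. *)
Definition ccont {T : topologicalType} (u : T -> R[i]) (p : T) :=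
  {for p, continuous (fun q => complex.Re (u q))} /\
  {for p, continuous (fun q => complex.Im (u q))}.

(** [u] has derivative [d] at [p] in the direction [v], componentwise; the
    direction ranges over a real normed module, so the derivative is real. *)
Definition cderiv {V : normedModType R} (u : V -> R[i]) (p v : V) (d : R[i]) :=
  is_derive p v (fun q => complex.Re (u q)) (complex.Re d) /\
  is_derive p v (fun q => complex.Im (u q)) (complex.Im d).

Lemma ReD z w : complex.Re (z + w) = complex.Re z + complex.Re w.
Proof. by case: z w => [? ?] [? ?]. Qed.
Lemma ImD z w : complex.Im (z + w) = complex.Im z + complex.Im w.
Proof. by case: z w => [? ?] [? ?]. Qed.
Lemma ReN z : complex.Re (- z) = - complex.Re z.
Proof. by case: z. Qed.
Lemma ImN z : complex.Im (- z) = - complex.Im z.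
Proof. by case: z. Qed.
Lemma ReM z w : complex.Re (z * w) =
  complex.Re z * complex.Re w - complex.Im z * complex.Im w.
Proof. by case: z w => [? ?] [? ?]. Qed.
Lemma ImM z w : complex.Im (z * w) =
  complex.Re z * complex.Im w + complex.Im z * complex.Re w.
Proof. by case: z w => [? ?] [? ?]. Qed.
Lemma ReV z : complex.Re z^-1 =
  complex.Re z / (complex.Re z ^+ 2 + complex.Im z ^+ 2).
Proof. by case: z. Qed.
Lemma ImV z : complex.Im z^-1 =
  - complex.Im z / (complex.Re z ^+ 2 + complex.Im z ^+ 2).
Proof. by case: z => a b /=; rewrite mulNr. Qed.
Lemma complex_ext z w :
  complex.Re z = complex.Re w -> complex.Im z = complex.Im w -> z = w.
Proof. by case: z w => [? ?] [? ?] /= -> ->. Qed.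

Lemma sqr_normc_gt0 z : z != 0 -> 0 < complex.Re z ^+ 2 + complex.Im z ^+ 2.
Proof.
case: z => a b; rewrite eq_complex /= negb_and => ab.
by rewrite lt_def paddr_eq0 ?sqr_ge0 // !sqrf_eq0 negb_and ab addr_ge0 ?sqr_ge0.
Qed.

Lemma normcE z : normc z = Num.sqrt (complex.Re z ^+ 2 + complex.Im z ^+ 2).
Proof. by case: z. Qed.
Lemma sqr_normc z : normc z ^+ 2 = complex.Re z ^+ 2 + complex.Im z ^+ 2.
Proof. by rewrite normcE sqr_sqrtr // addr_ge0 ?sqr_ge0. Qed.
Lemma normc_ge0 z : 0 <= normc z.
Proof. by rewrite normcE sqrtr_ge0. Qed.
Lemma normRe z : `|complex.Re z| <= normc z.
Proof.
by rewrite normcE -(sqrtr_sqr (complex.Re z)) ler_wsqrtr // lerDl sqr_ge0.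
Qed.
Lemma normIm z : `|complex.Im z| <= normc z.
Proof.
by rewrite normcE -(sqrtr_sqr (complex.Im z)) ler_wsqrtr // lerDr sqr_ge0.
Qed.
Lemma normc_le z : normc z <= `|complex.Re z| + `|complex.Im z|.
Proof.
rewrite -(@ler_pXn2r _ 2) ?nnegrE ?addr_ge0 ?normc_ge0 // sqr_normc.
rewrite -(real_normK (num_real (complex.Re z))).
rewrite -(real_normK (num_real (complex.Im z))).
have := normr_ge0 (complex.Re z); have := normr_ge0 (complex.Im z).
by set a := `|_|; set b := `|_|; nra.
Qed.
Lemma normc_le2 z (e : R) :
  `|complex.Re z| <= e -> `|complex.Im z| <= e -> normc z <= 2 * e.
Proof. by have := normc_le z; lra. Qed.
Lemma normcB z w : normc (z - w) <= normc z + normc w.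
Proof. by rewrite (le_trans (le_normcD _ _))// normcN. Qed.
Lemma normcR (x : R) : normc x%:C = `|x|.
Proof. by rewrite normcE /= expr0n addr0 sqrtr_sqr. Qed.
Lemma normc_eq0P z : normc z = 0 -> z = 0.
Proof. exact: Normc.eq0_normc. Qed.
Lemma normcX z n : normc (z ^+ n) = normc z ^+ n.
Proof.
by elim: n => [|n IH]; rewrite ?expr0 ?Normc.normc1// !exprS Normc.normcM IH.
Qed.

Lemma continuous_sqr (T : topologicalType) (f : T -> R) (p : T) :
  {for p, continuous f} -> {for p, continuous (fun q => f q ^+ 2)}.
Proof.
move=> cf; under [X in {for _, continuous X}]funext do rewrite expr2.
exact: (continuousM cf cf).
Qed.

Section Cont.
Variable T : topologicalType.
Implicit Types (u v : T -> R[i]) (p : T).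

Lemma ccont_cst z p : ccont (fun=> z) p.
Proof. by split; apply: cvg_cst. Qed.

Lemma ccontD u v p : ccont u p -> ccont v p -> ccont (fun q => u q + v q) p.
Proof.
move=> [ur ui] [vr vi]; split.
  under [X in {for _, continuous X}]funext do rewrite ReD.
  exact: continuousD ur vr.
under [X in {for _, continuous X}]funext do rewrite ImD.
exact: continuousD ui vi.
Qed.

Lemma ccontN u p : ccont u p -> ccont (fun q => - u q) p.
Proof.
move=> [ur ui]; split.
  under [X in {for _, continuous X}]funext do rewrite ReN.
  exact: continuousN ur.
under [X in {for _, continuous X}]funext do rewrite ImN.
exact: continuousN ui.
Qed.

Lemma ccontB u v p : ccont u p -> ccont v p -> ccont (fun q => u q - v q) p.
Proof. by move=> cu /ccontN; apply: ccontD. Qed.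

Lemma ccontM u v p : ccont u p -> ccont v p -> ccont (fun q => u q * v q) p.
Proof.
move=> [ur ui] [vr vi]; split.
  under [X in {for _, continuous X}]funext do rewrite ReM.
  exact: continuousB (continuousM ur vr) (continuousM ui vi).
under [X in {for _, continuous X}]funext do rewrite ImM.
exact: continuousD (continuousM ur vi) (continuousM ui vr).
Qed.

Lemma ccontX u p n : ccont u p -> ccont (fun q => u q ^+ n) p.
Proof.
move=> cu; elim: n => [|n IH]; first exact: ccont_cst.
under [X in ccont X]funext do rewrite exprS.
exact: ccontM.
Qed.

Lemma ccontV u p : u p != 0 -> ccont u p -> ccont (fun q => (u q)^-1) p.
Proof.
move=> up [ur ui].
have n0 := sqr_normc_gt0 up.
have cn : {for p, continuous (fun q =>
    (complex.Re (u q) ^+ 2 + complex.Im (u q) ^+ 2)^-1)}.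
  apply: cvgV; first by rewrite gt_eqF.
  exact: cvgD (continuous_sqr ur) (continuous_sqr ui).
split.
  under [X in {for _, continuous X}]funext do rewrite ReV.
  exact: continuousM ur cn.
under [X in {for _, continuous X}]funext do rewrite ImV.
exact: continuousM (continuousN ui) cn.
Qed.

Lemma ccontR (u : T -> R) p :
  {for p, continuous u} -> ccont (fun q => (u q)%:C) p.
Proof. by move=> cu; split => //; apply: cvg_cst. Qed.

Lemma ccont_comp (S : topologicalType) (g : S -> T) (u : T -> R[i]) (s : S) :
  {for s, continuous g} -> ccont u (g s) -> ccont (fun x => u (g x)) s.
Proof. by move=> cg [ur ui]; split; [exact: (continuous_comp cg ur)|exact: (continuous_comp cg ui)]. Qed.

Lemma continuous_normc u p : ccont u p -> {for p, continuous (fun q => normc (u q))}.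
Proof.
move=> [ur ui]; under [X in {for _, continuous X}]funext do rewrite normcE.
apply: (@continuous_comp _ _ _
  (fun q => complex.Re (u q) ^+ 2 + complex.Im (u q) ^+ 2) Num.sqrt).
  exact: cvgD (continuous_sqr ur) (continuous_sqr ui).
exact: sqrt_continuous.
Qed.

Lemma near_ccont u v p : (\forall q \near p, u q = v q) -> ccont u p -> ccont v p.
Proof.
move=> uv [ur ui]; have uvp : u p = v p := nbhs_singleton uv.
have tr (c : R[i] -> R) : {for p, continuous (fun q => c (u q))} ->
    {for p, continuous (fun q => c (v q))}.
  move=> cu; suff : (fun q => c (v q)) @ p --> c (u p) by rewrite uvp.
  apply: cvg_trans cu; apply: near_eq_cvg.
  by apply: filterS uv => q /= ->.
by split; apply: tr.
Qed.

End Cont.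

Section Deriv.
Variable V : normedModType R.
Implicit Types (u g : V -> R[i]) (p v : V).

Lemma cderiv_eq u p v d d' : cderiv u p v d -> d = d' -> cderiv u p v d'.
Proof. by move=> ? <-. Qed.

Lemma cderiv_cst z p v : cderiv (fun=> z) p v 0.
Proof. by split; apply: is_derive_cst. Qed.

Lemma cderivD u g p v du dw : cderiv u p v du -> cderiv g p v dw ->
  cderiv (fun q => u q + g q) p v (du + dw).
Proof.
move=> [ur ui] [wr wi]; split.
  under [X in is_derive _ _ X]funext do rewrite ReD.
  by rewrite ReD; apply: is_deriveD.
under [X in is_derive _ _ X]funext do rewrite ImD.
by rewrite ImD; apply: is_deriveD.
Qed.

Lemma cderivN u p v du : cderiv u p v du -> cderiv (fun q => - u q) p v (- du).
Proof.
move=> [ur ui]; split.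
  under [X in is_derive _ _ X]funext do rewrite ReN.
  by rewrite ReN; apply: is_deriveN.
under [X in is_derive _ _ X]funext do rewrite ImN.
by rewrite ImN; apply: is_deriveN.
Qed.

Lemma cderivB u g p v du dw : cderiv u p v du -> cderiv g p v dw ->
  cderiv (fun q => u q - g q) p v (du - dw).
Proof. by move=> cu /cderivN; apply: cderivD. Qed.

Lemma cderivM u g p v du dw : cderiv u p v du -> cderiv g p v dw ->
  cderiv (fun q => u q * g q) p v (du * g p + u p * dw).
Proof.
move=> [ur ui] [wr wi]; split.
  under [X in is_derive _ _ X]funext do rewrite ReM.
  apply: is_derive_eq; rewrite ReD !ReM /GRing.scale /=; ring.
under [X in is_derive _ _ X]funext do rewrite ImM.
apply: is_derive_eq; rewrite ImD !ImM /GRing.scale /=; ring.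
Qed.

Lemma cderivV u p v du : u p != 0 -> cderiv u p v du ->
  cderiv (fun q => (u q)^-1) p v (- du / u p ^+ 2).
Proof.
move=> up [ur ui]; have n0 := sqr_normc_gt0 up.
have dn : is_derive p v (fun q =>
   (complex.Re (u q) ^+ 2 + complex.Im (u q) ^+ 2)^-1)
   (- (complex.Re (u p) ^+ 2 + complex.Im (u p) ^+ 2) ^- 2 *
      (2 * complex.Re (u p) * complex.Re du + 2 * complex.Im (u p) * complex.Im du)).
  have dd : is_derive p v
     ((fun q => complex.Re (u q)) ^+ 2 + (fun q => complex.Im (u q)) ^+ 2 : V -> R)
     (2 * complex.Re (u p) * complex.Re du + 2 * complex.Im (u p) * complex.Im du).
    apply: is_derive_eq (is_deriveD (is_deriveX 2 ur) (is_deriveX 2 ui)) _.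
    by rewrite /GRing.scale /=; ring.
  have := @derivableV R V _ p v _ (@ex_derive _ _ _ _ _ _ _ dd).
  have := @deriveV R V _ p v _ (@ex_derive _ _ _ _ _ _ _ dd).
  rewrite (@derive_val _ _ _ _ _ _ _ dd).
  have nz : ((fun q => complex.Re (u q)) ^+ 2 +
    (fun q => complex.Im (u q)) ^+ 2 : V -> R) p != 0 by rewrite gt_eqF.
  move=> /(_ nz) e /(_ nz) ed.
  by apply: DeriveDef.
have nz : complex.Re (u p) ^+ 2 + complex.Im (u p) ^+ 2 != 0 by rewrite gt_eqF.
split.
  under [X in is_derive _ _ X]funext do rewrite ReV.
  apply: is_derive_eq; rewrite !(ReM, ImM, ReN, ImN, ReV, ImV, expr2) /GRing.scale /=.
  move: nz; rewrite !expr2; set a := complex.Re _; set b := complex.Im _ => nz.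
  by field; rewrite ?nz // -?expr2; nra.
under [X in is_derive _ _ X]funext do rewrite ImV.
apply: is_derive_eq; rewrite !(ReM, ImM, ReN, ImN, ReV, ImV, expr2) /GRing.scale /=.
move: nz; rewrite !expr2; set a := complex.Re _; set b := complex.Im _ => nz.
field; rewrite ?nz // -?expr2; nra.
Qed.

Lemma cderivR (u : V -> R) p v du :
  is_derive p v u du -> cderiv (fun q => (u q)%:C) p v du%:C.
Proof. by move=> cu; split => //=; apply: is_derive_cst. Qed.

Lemma near_cderiv u g p v d :
  (\forall q \near p, u q = g q) -> cderiv u p v d -> cderiv g p v d.
Proof.
move=> uw [ur ui]; split.
  by apply: near_eq_is_derive ur => //; apply: filterS uw => q ->.
by apply: near_eq_is_derive ui => //; apply: filterS uw => q ->.
Qed.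

Lemma cderiv_Cderive u p v d : cderiv u p v d -> Cderive u v p = d.
Proof. by move=> [ur ui]; rewrite /Cderive !derive_val; case: d ur ui. Qed.

End Deriv.
End ComplexCalculus.

(** * Calculus on the line and in the plane *)

Section RealCalculus.
Variable R : realType.
Local Notation plane := (R * R)%type.

Lemma cont_comp (S T U : topologicalType) (f : S -> T) (g : T -> U) (s : S) :
  {for s, continuous f} -> {for f s, continuous g} ->
  {for s, continuous (fun x => g (f x))}.
Proof. by move=> cf cg; exact: (continuous_comp cf cg). Qed.

Lemma cont_pair (S T U : topologicalType) (f : S -> T) (g : S -> U) (s : S) :
  {for s, continuous f} -> {for s, continuous g} ->
  {for s, continuous (fun x => (f x, g x))}.
Proof. by move=> cf cg; exact: (cvg_pair cf cg). Qed.

Lemma is_derive_comp1 (u g : R -> R) (s d e : R) :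
  is_derive (g s) 1 u d -> is_derive s 1 g e ->
  is_derive s 1 (fun x => u (g x)) (e * d).
Proof. by move=> du dg; rewrite mulrC; exact: (@is_derive1_comp R u g s d e du dg). Qed.

Lemma is_derive_continuous (f : R -> R) (x d : R) :
  is_derive x 1 f d -> {for x, continuous f}.
Proof. by move=> [df _]; apply/differentiable_continuous/derivable1_diffP. Qed.

Lemma le_norm_increment (f g f' g' : R -> R) (a b : R) : a <= b ->
  {within `[a, b], continuous f} -> {within `[a, b], continuous g} ->
  (forall x, a < x < b -> is_derive x 1 f (f' x)) ->
  (forall x, a < x < b -> is_derive x 1 g (g' x)) ->
  (forall x, a < x < b -> `|f' x| <= g' x) ->
  `|f b - f a| <= g b - g a.
Proof.
move=> ab cf cg df dg fg.
have key (h h' : R -> R) : {within `[a, b], continuous h} ->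
    (forall x, a < x < b -> is_derive x 1 h (h' x)) ->
    (forall x, a < x < b -> 0 <= h' x) -> h a <= h b.
  move=> ch dh h0; move: ab; rewrite le_eqVlt => /predU1P[-> //|ab].
  have dh' x : x \in `]a, b[ -> is_derive x 1 h (h' x).
    by rewrite in_itv /=; apply: dh.
  have [c cab e] := @MVT R h h' a b ab dh' ch.
  rewrite -subr_ge0 e mulr_ge0 ?subr_ge0 ?(ltW ab)//.
  by apply: h0; move: cab; rewrite in_itv.
have h1 : g a - f a <= g b - f b.
  apply: (key (g - f) (fun x => g' x - f' x)).
  - by move=> x; exact: (continuousB (cg x) (cf x)).
  - by move=> x xab; apply: is_deriveB; [exact: dg|exact: df].
  - by move=> x xab; rewrite subr_ge0 (le_trans (ler_norm _))// fg.
have h2 : g a + f a <= g b + f b.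
  apply: (key (g + f) (fun x => g' x + f' x)).
  - by move=> x; exact: (continuousD (cg x) (cf x)).
  - by move=> x xab; apply: is_deriveD; [exact: dg|exact: df].
  - move=> x xab; have := fg _ xab; rewrite ler_norml => /andP[+ _]; lra.
by rewrite ler_norml; apply/andP; split; lra.
Qed.

(** Mean value inequality, on either side of [0]. *)
Lemma mean_value_ineq (g g' : R -> R) (h l e : R) :
  (forall t : R, `|t| <= `|h| -> is_derive t 1 g (g' t)) ->
  (forall t, `|t| <= `|h| -> `|g' t - l| <= e) ->
  `|g h - g 0 - h * l| <= e * `|h|.
Proof.
move=> dg ge.
have cont (a b : R) : `|a| <= `|h| -> `|b| <= `|h| ->
    {within `[a, b], continuous (fun t => g t - t * l)}.
  move=> ah bh; apply/continuous_subspace_itv => t; rewrite in_itv /= => tab.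
  apply: (@is_derive_continuous _ t (g' t - l)).
  have th : `|t| <= `|h|.
    move: ah bh tab; rewrite !ler_norml => /andP[? ?] /andP[? ?] /andP[? ?].
    by apply/andP; split; lra.
  have := dg _ th => ?.
  by apply: is_derive_eq; rewrite /GRing.scale /=; ring.
have key (a b : R) : a <= b -> `|a| <= `|h| -> `|b| <= `|h| ->
    `|(g b - b * l) - (g a - a * l)| <= e * b - e * a.
  move=> ab ah bh.
  have inh t : a < t < b -> `|t| <= `|h|.
    move: ah bh; rewrite !ler_norml => /andP[? ?] /andP[? ?] /andP[? ?].
    by apply/andP; split; lra.
  apply: (@le_norm_increment (fun t => g t - t * l) ( *%R e)
    (fun t => g' t - l) (fun=> e)) => //.
  - exact: cont.
  - by apply: continuous_subspaceT => t; exact: mulrl_continuous.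
  - move=> t /inh th; have := dg _ th => ?.
    by apply: is_derive_eq; rewrite /GRing.scale /=; ring.
  - by move=> t _; apply: is_derive_eq; rewrite /GRing.scale /=; ring.
  - by move=> t /inh; exact: ge.
have [h0|h0] := leP 0 h.
  have := key 0 h h0; rewrite normr0 normr_ge0 lexx => /(_ isT isT).
  by rewrite mul0r subr0 mulr0 subr0 (ger0_norm h0) addrAC.
have := key h 0 (ltW h0); rewrite normr0 normr_ge0 lexx => /(_ isT isT).
rewrite mul0r subr0 mulr0 sub0r (ltr0_norm h0) mulrN => H.
by rewrite -normrN (le_trans _ H)// le_eqVlt; apply/orP; left; apply/eqP; congr `|_|; ring.
Qed.

Lemma is_derive_line (V : normedModType R) (F : V -> R) (p v : V) (t d : R) :
  is_derive (t *: v + p) v F d -> is_derive t 1 (fun s => F (s *: v + p)) d.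
Proof.
have e : (fun h : R => h^-1 *: (F (h *: v + (t *: v + p)) - F (t *: v + p))) =
   (fun h : R => h^-1 *: (((fun s => F (s *: v + p)) \o shift t) (h *: 1) - F (t *: v + p))).
  by apply/funext => h /=; rewrite [h%:A]mulr1 scalerDl addrA.
move=> [dF dv]; apply: DeriveDef.
  by move: dF; rewrite /derivable /= e.
by move: dv; rewrite /derive /= e.
Qed.

Lemma is_derive_line0 (V : normedModType R) (F : V -> R) (p v : V) (d : R) :
  is_derive p v F d <-> is_derive (0:R) 1 (fun s => F (s *: v + p)) d.
Proof.
split; first by move=> H; apply: is_derive_line; rewrite scale0r add0r.
have e : (fun h : R => h^-1 *: (F (h *: v + p) - F p)) =
   (fun h : R => h^-1 *: (((fun s => F (s *: v + p)) \o shift 0) (h *: 1) - F (0 *: v + p))).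
  by apply/funext => h /=; rewrite [h%:A]mulr1 scale0r add0r addr0.
move=> [dF dv]; apply: DeriveDef.
  by move: dF; rewrite /derivable -e.
by move: dv; rewrite /derive -e.
Qed.

Lemma is_derive_translate (f : R -> R) (x t d : R) :
  is_derive (x + t) 1 f d -> is_derive t 1 (fun s => f (x + s)) d.
Proof.
rewrite (is_derive_line0 f) (is_derive_line0 (fun s => f (x + s))).
by under eq_fun do rewrite addrCA.
Qed.

Lemma is_derive_e_x (F : plane -> R) (x y d : R) :
  is_derive (x, y) (e_x R) F d <-> is_derive x 1 (fun r => F (r, y)) d.
Proof.
rewrite is_derive_line0 (is_derive_line0 (fun r => F (r, y))).
suff -> : (fun s : R => F (s *: e_x R + (x, y))) = (fun s : R => F (s *: 1 + x, y)) by [].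
apply/funext => s; congr F; rewrite /e_x; congr pair => /=.
by rewrite [_ *: _]mulr0 add0r.
Qed.

Lemma is_derive_e_y (F : plane -> R) (x y d : R) :
  is_derive (x, y) (e_y R) F d <-> is_derive y 1 (fun r => F (x, r)) d.
Proof.
rewrite is_derive_line0 (is_derive_line0 (fun r => F (x, r))).
suff -> : (fun s : R => F (s *: e_y R + (x, y))) = (fun s : R => F (x, s *: 1 + y)) by [].
apply/funext => s; congr F; rewrite /e_y; congr pair => /=.
by rewrite [_ *: _]mulr0 add0r.
Qed.

Lemma near_planeP (P : plane -> Prop) (x y : R) :
  (\forall p \near (x, y), P p) <->
  exists2 e, 0 < e & forall a b, `|a| < e -> `|b| < e -> P (x + a, y + b).
Proof.
split.
  move=> /nbhs_ballP[e e0 H]; exists e => // a b ae be; apply: H.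
  by split => /=; rewrite -ball_normE /= opprD addNKr normrN.
move=> [e e0 H]; apply/nbhs_ballP; exists e => // -[a b] [] /=.
rewrite -!ball_normE /= => ae be.
have -> : (a, b) = (x + (a - x), y + (b - y)) by rewrite !addrA (addrC x) (addrC y) !addrK.
by apply: H; rewrite distrC.
Qed.

Section Differentiable.
Variables (F Fx Fy : plane -> R) (p : plane).
Hypothesis dFx : \forall q \near p, is_derive q (e_x R) F (Fx q).
Hypothesis dFy : \forall q \near p, is_derive q (e_y R) F (Fy q).
Hypothesis cFx : {for p, continuous Fx}.
Hypothesis cFy : {for p, continuous Fy}.

(** A function with continuous partial derivatives is differentiable, with
    the expected first-order expansion. *)
Lemma C1_first_order (e : R) : 0 < e -> exists2 d, 0 < d &
  forall a b, `|a| < d -> `|b| < d ->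
  `|F (p.1 + a, p.2 + b) - F p - (a * Fx p + b * Fy p)| <= e * (`|a| + `|b|).
Proof.
move=> e0.
have : \forall q \near p, [/\ is_derive q (e_x R) F (Fx q),
    is_derive q (e_y R) F (Fy q), `|Fx q - Fx p| <= e & `|Fy q - Fy p| <= e].
  near=> q; split; [by near: q|by near: q|near: q|near: q].
  - by move/cvgrPdist_le : cFx => /(_ _ e0); apply: filterS => q; rewrite distrC.
  - by move/cvgrPdist_le : cFy => /(_ _ e0); apply: filterS => q; rewrite distrC.
rewrite {1}(surjective_pairing p) => /near_planeP[d d0 H].
exists d => // a b ad bd.
have h1 : `|F (p.1 + a, p.2 + b) - F (p.1, p.2 + b) - a * Fx p| <= e * `|a|.
  have := @mean_value_ineq (fun t => F (p.1 + t, p.2 + b))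
    (fun t => Fx (p.1 + t, p.2 + b)) a (Fx p) e; rewrite addr0; apply.
    move=> t ta; have [] := H t b (le_lt_trans ta ad) bd.
    move=> /is_derive_e_x /= h _ _ _.
    exact: (@is_derive_translate (fun r => F (r, p.2 + b))).
  by move=> t ta; have [] := H t b (le_lt_trans ta ad) bd.
have h2 : `|F (p.1, p.2 + b) - F p - b * Fy p| <= e * `|b|.
  have := @mean_value_ineq (fun t => F (p.1, p.2 + t))
    (fun t => Fy (p.1, p.2 + t)) b (Fy p) e; rewrite addr0 -surjective_pairing; apply.
    move=> t ta; have [] := H 0 t _ (le_lt_trans ta bd); rewrite ?normr0// addr0.
    move=> _ /is_derive_e_y /= h _ _.
    exact: (@is_derive_translate (fun r => F (p.1, r))).
  by move=> t ta; have [] := H 0 t _ (le_lt_trans ta bd); rewrite ?normr0// addr0.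
rewrite mulrDr.
have -> : F (p.1 + a, p.2 + b) - F p - (a * Fx p + b * Fy p) =
  (F (p.1 + a, p.2 + b) - F (p.1, p.2 + b) - a * Fx p) +
  (F (p.1, p.2 + b) - F p - b * Fy p) by ring.
by rewrite (le_trans (ler_normD _ _))// lerD.
Unshelve. all: by end_near. Qed.

End Differentiable.

(** The derivative along [v] as a first-order expansion, without division. *)
Lemma is_derive_epsP (V : normedModType R) (F : V -> R) (p v : V) (d : R) :
  is_derive p v F d <-> forall e, 0 < e ->
    \forall h \near (0 : R), `|F (h *: v + p) - F p - h * d| <= e * `|h|.
Proof.
split=> [[dF dv] e e0|H].
  move: dF; rewrite /derivable => /cvg_ex[/= l Hl].
  have ld : l = d by rewrite -dv /derive; apply/esym/cvg_lim.
  move/cvgrPdist_le: Hl => /(_ _ e0); rewrite ld => {ld l}.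
  rewrite near_withinE; apply: filterS => h Hh.
  have [->|h0] := eqVneq h 0.
    by rewrite scale0r add0r mul0r subr0 subrr normr0 mulr0.
  have := Hh h0; rewrite [_ *: _]mulrC -(ler_pM2r (_ : 0 < `|h|)) ?normr_gt0//.
  rewrite -normrM mulrBl divfK// distrC => H; apply: le_trans H.
  by rewrite le_eqVlt; apply/orP; left; apply/eqP; congr `|_|; ring.
have cvgd : (fun h : R => h^-1 *: (F (h *: v + p) - F p)) @ 0^' --> d.
  apply/cvgrPdist_le => e e0; rewrite near_withinE.
  apply: filterS (H _ e0) => h Hh h0.
  rewrite [_ *: _]mulrC -(ler_pM2r (_ : 0 < `|h|)) ?normr_gt0//.
  rewrite -normrM mulrBl divfK// distrC; apply: le_trans Hh.
  by rewrite le_eqVlt; apply/orP; left; apply/eqP; congr `|_|; ring.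
apply: DeriveDef; first by apply/cvg_ex; exists d.
exact/cvg_lim.
Qed.

Lemma near_segment (V : normedModType R) (z v : V) (P : V -> Prop) :
  (\forall y \near z, P y) ->
  \forall h \near (0 : R), forall t : R, `|t| <= `|h| -> P (t *: v + z).
Proof.
move=> Pz.
have : \forall t \near (0:R), P (t *: v + z).
  have : t *: v + z @[t --> (0:R)] --> z.
    rewrite -[X in _ --> X]add0r -(scale0r v).
    by apply: cvgD; [apply: cvgZl; exact: cvg_id|exact: cvg_cst].
  exact.
move=> /nbhs_ballP[e e0 H]; near=> h => t th; apply: H.
rewrite /= -ball_normE /= sub0r normrN (le_lt_trans th)//.
Unshelve. all: by end_near. Qed.

(** Chain rule along a plane curve, for a function with continuous partial
    derivatives. *)
Lemma is_derive_curve (F Fx Fy : plane -> R) (g1 g2 : R -> R) (t d1 d2 : R) :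
  let p := (g1 t, g2 t) in
  (\forall q \near p, is_derive q (e_x R) F (Fx q)) ->
  (\forall q \near p, is_derive q (e_y R) F (Fy q)) ->
  {for p, continuous Fx} -> {for p, continuous Fy} ->
  is_derive t 1 g1 d1 -> is_derive t 1 g2 d2 ->
  is_derive t 1 (fun s => F (g1 s, g2 s)) (d1 * Fx p + d2 * Fy p).
Proof.
move=> p dFx dFy cFx cFy dg1 dg2.
have c1 := is_derive_continuous dg1; have c2 := is_derive_continuous dg2.
suff H : is_derive t 1
    (fun s => F (g1 s, g2 s) - g1 s * Fx p - g2 s * Fy p) 0.
  have -> : (fun s => F (g1 s, g2 s)) =
    (fun s => (F (g1 s, g2 s) - g1 s * Fx p - g2 s * Fy p) + g1 s * Fx p + g2 s * Fy p).
    by apply/funext => s; ring.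
  by apply: is_derive_eq; rewrite /GRing.scale /=; ring.
apply/is_derive_epsP => e e0.
pose M := `|d1| + `|d2| + 2; have M0 : 0 < M by rewrite /M ltr_wpDl// addr_ge0.
have [d d0 Hd] := C1_first_order dFx dFy cFx cFy (divr_gt0 e0 M0).
near=> h.
have inc1 : `|g1 (h *: 1 + t) - g1 t| <= (`|d1| + 1) * `|h|.
  have : `|g1 (h *: 1 + t) - g1 t - h * d1| <= 1 * `|h|.
    by near: h; move/is_derive_epsP : dg1; apply.
  move=> H; rewrite -(subrK (h * d1) (g1 _ - _)) (le_trans (ler_normD _ _))//.
  by rewrite mulrDl addrC lerD// normrM mulrC.
have inc2 : `|g2 (h *: 1 + t) - g2 t| <= (`|d2| + 1) * `|h|.
  have : `|g2 (h *: 1 + t) - g2 t - h * d2| <= 1 * `|h|.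
    by near: h; move/is_derive_epsP : dg2; apply.
  move=> H; rewrite -(subrK (h * d2) (g2 _ - _)) (le_trans (ler_normD _ _))//.
  by rewrite mulrDl addrC lerD// normrM mulrC.
have small : (`|d1| + 1) * `|h| < d /\ (`|d2| + 1) * `|h| < d.
  have : `|h| < d / M.
    near: h; apply/nbhs_ballP; exists (d / M); first exact: divr_gt0.
    by move=> h; rewrite -ball_normE /= sub0r normrN.
  rewrite ltr_pdivlMr// => hM.
  by split; apply: le_lt_trans hM; rewrite mulrC ler_wpM2l// /M;
    have := normr_ge0 d1; have := normr_ge0 d2; lra.
set a := g1 (h *: 1 + t) - g1 t in inc1; set b := g2 (h *: 1 + t) - g2 t in inc2.
have := Hd a b (le_lt_trans inc1 small.1) (le_lt_trans inc2 small.2).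
rewrite /= /a /b !(addrC _ (_ - _)) !subrK -/a -/b => H.
rewrite mulr0 subr0.
have -> : F (g1 (h *: 1 + t), g2 (h *: 1 + t)) - g1 (h *: 1 + t) * Fx p -
  g2 (h *: 1 + t) * Fy p - (F (g1 t, g2 t) - g1 t * Fx p - g2 t * Fy p) =
  F (g1 (h *: 1 + t), g2 (h *: 1 + t)) - F p - (a * Fx p + b * Fy p).
  by rewrite /a /b /p; ring.
apply: (le_trans H); rewrite -mulrA ler_pM2l// mulrC ler_pdivrMr//.
by rewrite (le_trans (lerD inc1 inc2))// /M; lra.
Unshelve. all: by end_near. Qed.

(** Symmetry of the mixed second derivatives. *)
Lemma schwarz (F Fx Fy Fxy Fyx : plane -> R) (p : plane) :
  (\forall q \near p, is_derive q (e_x R) F (Fx q)) ->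
  (\forall q \near p, is_derive q (e_y R) F (Fy q)) ->
  (\forall q \near p, is_derive q (e_y R) Fx (Fxy q)) ->
  (\forall q \near p, is_derive q (e_x R) Fy (Fyx q)) ->
  {for p, continuous Fxy} -> {for p, continuous Fyx} -> Fxy p = Fyx p.
Proof.
case: p => x y dFx dFy dFxy dFyx cxy cyx; apply/eqP; rewrite -subr_eq0 -normr_le0.
apply/ler_addgt0Pr => e e0; rewrite add0r; have e2 : 0 < e / 2 by rewrite divr_gt0.
have : \forall q \near (x, y), [/\ is_derive q (e_x R) F (Fx q) /\ is_derive q (e_y R) F (Fy q),
    is_derive q (e_y R) Fx (Fxy q), is_derive q (e_x R) Fy (Fyx q),
    `|Fxy q - Fxy (x, y)| <= e / 2 & `|Fyx q - Fyx (x, y)| <= e / 2].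
  near=> q; split; [by split; near: q|by near: q|by near: q|near: q|near: q].
  - by move/cvgrPdist_le : cxy => /(_ _ e2); apply: filterS => q; rewrite distrC.
  - by move/cvgrPdist_le : cyx => /(_ _ e2); apply: filterS => q; rewrite distrC.
move=> /near_planeP[d d0 H].
pose h := d / 2; have h0 : 0 < h by rewrite divr_gt0.
have hd : `|h| < d by rewrite gtr0_norm// /h; lra.
have z0 : `|0 : R| < d by rewrite normr0.
have h1 : `|(F (x + h, y + h) - F (x + h, y)) - (F (x, y + h) - F (x, y)) -
     h * (h * Fxy (x, y))| <= e / 2 * h * `|h|.
  have := @mean_value_ineq (fun t => F (x + t, y + h) - F (x + t, y))
    (fun t => Fx (x + t, y + h) - Fx (x + t, y)) h (h * Fxy (x, y)) (e / 2 * h).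
  rewrite !addr0; apply => t ta; have td := le_lt_trans ta hd.
    have [[/is_derive_e_x ? _] _ _ _ _] := H t h td hd.
    have [[/is_derive_e_x + _] _ _ _ _] := H t 0 td z0; rewrite addr0 => ?.
    apply: is_deriveB.
      exact: (@is_derive_translate (fun r => F (r, y + h))).
    exact: (@is_derive_translate (fun r => F (r, y))).
  have := @mean_value_ineq (fun s => Fx (x + t, y + s))
    (fun s => Fxy (x + t, y + s)) h (Fxy (x, y)) (e / 2).
  rewrite addr0 (gtr0_norm h0); apply => s sh;
    have sd : `|s| < d by rewrite (le_lt_trans sh)// -(gtr0_norm h0).
    have [_ /is_derive_e_y ? _ _ _] := H t s td sd.
    exact: (@is_derive_translate (fun r => Fx (x + t, r))).
  by have [] := H t s td sd.
have h2 : `|(F (x + h, y + h) - F (x, y + h)) - (F (x + h, y) - F (x, y)) -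
     h * (h * Fyx (x, y))| <= e / 2 * h * `|h|.
  have := @mean_value_ineq (fun t => F (x + h, y + t) - F (x, y + t))
    (fun t => Fy (x + h, y + t) - Fy (x, y + t)) h (h * Fyx (x, y)) (e / 2 * h).
  rewrite !addr0; apply => t ta; have td := le_lt_trans ta hd.
    have [[_ /is_derive_e_y ?] _ _ _ _] := H h t hd td.
    have [[_ /is_derive_e_y +] _ _ _ _] := H 0 t z0 td; rewrite addr0 => ?.
    apply: is_deriveB.
      exact: (@is_derive_translate (fun r => F (x + h, r))).
    exact: (@is_derive_translate (fun r => F (x, r))).
  have := @mean_value_ineq (fun s => Fy (x + s, y + t))
    (fun s => Fyx (x + s, y + t)) h (Fyx (x, y)) (e / 2).
  rewrite addr0 (gtr0_norm h0); apply => s sh;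
    have sd : `|s| < d by rewrite (le_lt_trans sh)// -(gtr0_norm h0).
    have [_ _ /is_derive_e_x ? _ _] := H s t sd td.
    exact: (@is_derive_translate (fun r => Fy (r, y + t))).
  by have [] := H s t sd td.
have hh : 0 < h * h by rewrite mulr_gt0.
rewrite -(ler_pM2r hh) -[X in _ * X <= _](gtr0_norm hh) -normrM.
move: h1 h2; rewrite (gtr0_norm h0) !ler_norml => /andP[? ?] /andP[? ?].
by apply/andP; split; lra.
Unshelve. all: by end_near. Qed.

Lemma interior_approach (a b t : R) : a < b -> a <= t <= b ->
  forall s, 0 < s < 1 -> a < t + s * ((a + b) / 2 - t) < b.
Proof. by move=> ab /andP[? ?] s /andP[? ?]; apply/andP; split; nra. Qed.

Lemma le_closed_itv (g : R -> R) (a b M t : R) : a < b -> {for t, continuous g} ->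
  (forall s, a < s < b -> g s <= M) -> a <= t <= b -> g t <= M.
Proof.
move=> ab cg gM tab.
have c : g (t + s * ((a + b) / 2 - t)) @[s --> (0:R)^'+] --> g t.
  have e0 : t + 0 * ((a + b) / 2 - t) = t by rewrite mul0r addr0.
  rewrite -[X in _ --> g X]e0; apply: cvg_at_right_filter.
  have cc : {for (0 : R), continuous (fun s : R => g (t + s * ((a + b) / 2 - t)))}; last exact: cc.
  apply: (@cont_comp _ _ _ (fun s : R => t + s * ((a + b) / 2 - t)) g).
    by apply: cvgD; [exact: cvg_cst|apply: cvgM; [exact: cvg_id|exact: cvg_cst]].
  by rewrite e0.
apply: (cvgr_to_le c); near=> s; apply: gM; apply: interior_approach => //.
by apply/andP; split; near: s; [exact: nbhs_right_gt|exact: nbhs_right_lt].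
Unshelve. all: by end_near. Qed.

Lemma eq0_closed_itv (g : R -> R) (a b t : R) : a < b -> {for t, continuous g} ->
  (forall s, a < s < b -> g s = 0) -> a <= t <= b -> g t = 0.
Proof.
move=> ab cg g0 tab; apply/eqP; rewrite eq_le; apply/andP; split.
  by apply: (le_closed_itv ab cg) => // s /g0 ->.
rewrite -oppr_le0; apply: (le_closed_itv ab (continuousN cg)) => // s /g0 h.
by rewrite /= [X in X <= _](_ : _ = - g s)// h oppr0.
Qed.

(** If the [x]-derivative of [k] on an open rectangle extends continuously to
    the sides [y = c] and [y = d], the extension is the [x]-derivative of the
    restriction of [k] to these sides. *)
Lemma is_derive_trace (k kx : R -> R -> R) (a b c d x y : R) : c < d ->
  (forall x y, {for (x, y), continuous (fun p => k p.1 p.2)}) ->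
  (forall x y, {for (x, y), continuous (fun p => kx p.1 p.2)}) ->
  (forall x y, a < x < b -> c < y < d -> is_derive x 1 (k^~ y) (kx x y)) ->
  a < x < b -> c <= y <= d -> is_derive x 1 (k^~ y) (kx x y).
Proof.
move=> cd ck ckx dk xab ycd; apply/is_derive_epsP => e e0.
have : \forall q \near (x, y), `|kx q.1 q.2 - kx x y| <= e /\ a < q.1 < b.
  near=> q; split.
    near: q; move/cvgrPdist_le : (ckx x y) => /(_ _ e0); apply: filterS => q /=.
    by rewrite distrC.
  near: q; have cf : {for (x, y), continuous (@fst R R)} by exact: cvg_fst.
  apply: (cf [set r | a < r < b]).
  have -> : [set r | a < r < b] = `]a, b[%classic.
    by apply/seteqP; split=> r /=; rewrite in_itv.
  by apply: (@open_nbhs_nbhs R); split; [exact: interval_open|rewrite /= in_itv].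
move=> /near_planeP[r r0 H].
near=> h.
have hr : `|h| < r.
  near: h; apply/nbhs_ballP; exists r => //= h.
  by rewrite -ball_normE /= sub0r normrN.
have ky (u : R) : {for y, continuous (fun y => k u y)}.
  apply: (cont_comp (f := fun y => (u, y)) (g := fun p => k p.1 p.2)); last exact: ck.
  by apply: cont_pair; [exact: cvg_cst|exact: cvg_id].
pose G w := `|k (h *: 1 + x) w - k x w - h * kx x y|.
have cG : {for y, continuous G}.
  apply: cvg_norm; apply: cvgB; last exact: cvg_cst.
  by apply: cvgB; exact: ky.
pose c' := Num.max c (y - r); pose d' := Num.min d (y + r).
have y' : c' <= y <= d' by rewrite ge_max le_min; apply/andP; split; lra.
have cd' : c' < d' by rewrite gt_max !lt_min; apply/andP; split; lra.
apply: (@le_closed_itv G c' d' _ y cd' cG _ y') => w.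
rewrite gt_max lt_min => /andP[/andP[? ?] /andP[? ?]].
have wcd : c < w < d by apply/andP.
have wr : `|w - y| < r by rewrite ltr_norml; apply/andP; split; lra.
rewrite /G [h *: _]mulr1 (addrC h).
have := @mean_value_ineq (fun t => k (x + t) w) (fun t => kx (x + t) w) h (kx x y) e.
rewrite addr0; apply => t ta; have tr := le_lt_trans ta hr.
  have [_ /= xt] := H t (w - y) tr wr.
  exact: (@is_derive_translate (k^~ w)) (dk _ _ xt wcd).
by have [/=] := H t (w - y) tr wr; rewrite (addrC y) subrK.
Unshelve. all: by end_near. Qed.

End RealCalculus.

(** * Integrals over segments and their dependence on parameters *)

Section Integrals.
Variable R : realType.
Local Notation mu := (@lebesgue_measure R).
Local Notation normc := (@Normc.normc R).

(** Continuity on the real line at every point of the closed interval. *)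
Definition contI (a b : R) (F : R -> R) :=
  forall s, a <= s <= b -> {for s, continuous F}.

(** The integral of a real function over a closed interval. *)
Definition intab (a b : R) (F : R -> R) : R := \int[mu]_(s in `[a, b]) F s.

Lemma contI_within a b F : contI a b F -> {within `[a, b], continuous F}.
Proof.
move=> cF; apply: continuous_in_subspaceT => s; rewrite inE /= in_itv /=.
exact: cF.
Qed.

Lemma contI_integrable a b F : contI a b F ->
  mu.-integrable `[a, b] (EFin \o F).
Proof.
move=> cF; apply: continuous_compact_integrable; first exact: segment_compact.
exact: contI_within.
Qed.

Lemma eq_intab a b F G : (forall s, a <= s <= b -> F s = G s) ->
  intab a b F = intab a b G.
Proof. by move=> FG; apply: eq_Rintegral => s; rewrite inE /= in_itv /= => /FG. Qed.

Lemma intabD a b F G : contI a b F -> contI a b G ->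
  intab a b (fun s => F s + G s) = intab a b F + intab a b G.
Proof. by move=> /contI_integrable ? /contI_integrable ?; exact: RintegralD. Qed.

Lemma intabB a b F G : contI a b F -> contI a b G ->
  intab a b (fun s => F s - G s) = intab a b F - intab a b G.
Proof. by move=> /contI_integrable ? /contI_integrable ?; exact: RintegralB. Qed.

Lemma intabZ a b k F : contI a b F ->
  intab a b (fun s => k * F s) = k * intab a b F.
Proof. by move=> /contI_integrable ?; exact: RintegralZl. Qed.

Lemma le_intab a b F G : contI a b F -> contI a b G ->
  (forall s, a <= s <= b -> F s <= G s) -> intab a b F <= intab a b G.
Proof.
move=> /contI_integrable iF /contI_integrable iG FG.
by apply: (le_Rintegral _ iF iG).
Qed.

Lemma intab_ge0 a b F : (forall s, a <= s <= b -> 0 <= F s) -> 0 <= intab a b F.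
Proof. by move=> F0; apply: Rintegral_ge0 => s; rewrite /= in_itv /=; exact: F0. Qed.

Lemma contI_norm a b F : contI a b F -> contI a b (fun s => `|F s|).
Proof. by move=> cF s /cF; apply: cvg_norm. Qed.

Lemma contI_cst a b k : contI a b (fun=> k).
Proof. by move=> s _; apply: cvg_cst. Qed.

Lemma norm_intab a b F : contI a b F -> `|intab a b F| <= intab a b (fun s => `|F s|).
Proof. by move=> /contI_integrable ?; exact: le_normr_Rintegral. Qed.

Lemma intab_cst a b k : a <= b -> intab a b (fun=> k) = k * (b - a).
Proof.
move=> ab; rewrite /intab Rintegral_cst; last exact: measurable_itv.
have -> : fine (lebesgue_measure (`[a, b]%classic : set R)) = b - a.
  rewrite lebesgue_measure_itv /= lte_fin.
  by move: ab; rewrite le_eqVlt => /predU1P[->|->//]; rewrite ltxx subrr.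
by [].
Qed.

Lemma norm_intab_le a b F G : contI a b F -> contI a b G ->
  (forall s, a <= s <= b -> `|F s| <= G s) -> `|intab a b F| <= intab a b G.
Proof.
move=> cF cG FG; rewrite (le_trans (norm_intab cF))// le_intab//.
exact: contI_norm.
Qed.

Lemma norm_intab_le_cst a b F M : a <= b -> contI a b F ->
  (forall s, a <= s <= b -> `|F s| <= M) -> `|intab a b F| <= M * (b - a).
Proof.
move=> ab cF FM; rewrite -(intab_cst M ab); apply: norm_intab_le => //.
exact: contI_cst.
Qed.

Lemma intab_FTC a b F f : a < b -> contI a b F -> contI a b f ->
  (forall s, a < s < b -> is_derive s 1 F (f s)) -> intab a b f = F b - F a.
Proof.
move=> ab cF cf dF; rewrite /intab /Rintegral.
rewrite (@continuous_FTC2 R f F a b ab (contI_within cf))//.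
  split; first by move=> s; rewrite in_itv /= => /dF [].
    by apply: cvg_at_right_filter; apply: cF; rewrite lexx ltW.
  by apply: cvg_at_left_filter; apply: cF; rewrite lexx ltW.
by move=> s; rewrite in_itv /= derive1E => /dF [].
Qed.

Lemma intab_deriv a b f x : contI a b f -> a < x < b ->
  is_derive x 1 (fun y => intab a y f) (f x).
Proof.
move=> cf /andP[ax xb].
have cfx : {for x, continuous f} by apply: cf; rewrite !ltW.
have [d1 d2] : derivable (fun y => intab a y f) x 1 /\
    derive1 (fun y => intab a y f) x = f x.
  exact: (continuous_FTC1_closed xb (contI_integrable cf) ax cfx).
by apply: DeriveDef; [exact: d1|rewrite -derive1E; exact: d2].
Qed.

(** Uniformity over a segment of the continuity in a parameter. *)
Lemma tube_continuity (V : topologicalType) (a b : R) (f : V -> R -> R) (z0 : V) :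
  (forall s, a <= s <= b -> {for (z0, s), continuous (fun p => f p.1 p.2)}) ->
  forall e, 0 < e -> \forall z \near z0, forall s, a <= s <= b ->
    `|f z s - f z0 s| <= e.
Proof.
move=> cf e e0; have e2 : 0 < e / 2 by rewrite divr_gt0.
have /compact_near_coveringP := @segment_compact R a b.
move=> /(_ V (nbhs z0) (fun z s => `|f z s - f z0 s| <= e)) H.
have : \forall z \near z0, `[a, b] `<=` (fun s => `|f z s - f z0 s| <= e).
  apply: H => s; rewrite /= in_itv /= => sab.
  have /cvgrPdist_le/(_ _ e2) := cf _ sab.
  move=> [[A B] /= [nA nB] AB].
  have Az0 : A z0 := nbhs_singleton nA.
  exists (B, A) => //= -[s' z] [/= Bs' Az].
  have /= h1 := AB (z, s') (conj Az Bs').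
  have /= h2 := AB (z0, s') (conj Az0 Bs').
  rewrite -(subrKA (f z0 s)) (le_trans (ler_normD _ _))//.
  by rewrite (splitr e) lerD// distrC.
by apply: filterS => z Hz s sab; apply: Hz; rewrite /= in_itv.
Qed.

Lemma joint_cont_snd (V : topologicalType) (f : V -> R -> R) (z : V) (s : R) :
  {for (z, s), continuous (fun p => f p.1 p.2)} -> {for s, continuous (f z)}.
Proof.
move=> cf; apply: (@cont_comp _ _ _ (fun s => (z, s)) (fun p => f p.1 p.2)) => //.
by apply: cont_pair; [exact: cvg_cst|exact: cvg_id].
Qed.

Lemma continuous_intab (V : topologicalType) (a b : R) (f : V -> R -> R) (z0 : V) :
  a <= b ->
  (\forall z \near z0, forall s, a <= s <= b ->
     {for (z, s), continuous (fun p => f p.1 p.2)}) ->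
  {for z0, continuous (fun z => intab a b (f z))}.
Proof.
move=> ab cf; apply/cvgrPdist_le => e e0.
have ba0 : 0 < b - a + 1 by lra.
near=> z.
have cz : contI a b (f z).
  move=> s sab; apply: joint_cont_snd; move: s sab; near: z; exact: cf.
have cz0 : contI a b (f z0).
  by move=> s sab; apply: joint_cont_snd; apply: (nbhs_singleton cf).
rewrite -intabB//.
have : forall s, a <= s <= b -> `|f z s - f z0 s| <= e / (b - a + 1).
  near: z; apply: tube_continuity; first exact: (nbhs_singleton cf).
  exact: divr_gt0.
move=> H; apply: (@le_trans _ _ (e / (b - a + 1) * (b - a))).
  apply: norm_intab_le_cst => //.
    by move=> s sab; apply: cvgB; [exact: cz0|exact: cz].
  by move=> s /H; rewrite distrC.
by rewrite mulrAC ler_pdivrMr// ler_pM2l//; lra.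
Unshelve. all: by end_near. Qed.

(** Differentiation under the integral sign. *)
Lemma is_derive_intab (V : normedModType R) (a b : R) (f fv : V -> R -> R) (z0 v : V) :
  a <= b ->
  (\forall z \near z0, forall s, a <= s <= b ->
     [/\ {for (z, s), continuous (fun p => f p.1 p.2)},
         {for (z, s), continuous (fun p => fv p.1 p.2)} &
         is_derive z v (f^~ s) (fv z s)]) ->
  is_derive z0 v (fun z => intab a b (f z)) (intab a b (fv z0)).
Proof.
move=> ab cf; apply/is_derive_epsP => e e0.
have ba0 : 0 < b - a + 1 by lra.
have cz0 s : a <= s <= b -> [/\ {for (z0, s), continuous (fun p => f p.1 p.2)},
    {for (z0, s), continuous (fun p => fv p.1 p.2)} &
    is_derive z0 v (f^~ s) (fv z0 s)] by exact: (nbhs_singleton cf).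
have tb : \forall z \near z0, forall s, a <= s <= b ->
    `|fv z s - fv z0 s| <= e / (b - a + 1).
  apply: tube_continuity; last exact: divr_gt0.
  by move=> s /cz0[].
have := near_segment v (@filterI _ _ (nbhs_filter z0) _ _ cf tb).
apply: filterS => h Hh.
have [fh _] : _ /\ _ := Hh h (lexx _).
have ch : contI a b (f (h *: v + z0)) by move=> s /fh[/joint_cont_snd].
have c0 : contI a b (f z0) by move=> s /cz0[/joint_cont_snd].
have cv0 : contI a b (fv z0) by move=> s /cz0[_ /joint_cont_snd].
have ci : contI a b (fun s => f (h *: v + z0) s - f z0 s).
  by move=> s sab; apply: cvgB; [exact: ch|exact: c0].
have cz : contI a b (fun s => h * fv z0 s).
  by move=> s sab; apply: cvgM; [exact: cvg_cst|exact: cv0].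
rewrite -intabB// -intabZ// -intabB//.
apply: (@le_trans _ _ (e / (b - a + 1) * `|h| * (b - a))).
  apply: norm_intab_le_cst => //.
    by move=> s sab; apply: cvgB; [exact: ci|exact: cz].
  move=> s sab.
  have := @mean_value_ineq R (fun t => f (t *: v + z0) s)
    (fun t => fv (t *: v + z0) s) h (fv z0 s) (e / (b - a + 1)).
  rewrite scale0r add0r; apply => t ht; have [Ht1 Ht2] := Hh t ht.
    by apply: (@is_derive_line _ _ (fun z => f z s)); have [] := Ht1 s sab.
  exact: Ht2.
rewrite mulrAC ler_wpM2r// mulrAC ler_pdivrMr// ler_pM2l//; lra.
Qed.

(** The complex counterpart of [contI]. *)
Definition ccontI (a b : R) (F : R -> R[i]) := forall s, a <= s <= b -> ccont F s.

Lemma ccontI_Re a b F : ccontI a b F -> contI a b (fun s => complex.Re (F s)).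
Proof. by move=> cF s /cF[]. Qed.
Lemma ccontI_Im a b F : ccontI a b F -> contI a b (fun s => complex.Im (F s)).
Proof. by move=> cF s /cF[]. Qed.

Lemma eq_Cint a b (F G : R -> R[i]) : (forall s, a <= s <= b -> F s = G s) ->
  Cintegral a b F = Cintegral a b G.
Proof.
by move=> FG; apply: complex_ext; apply: eq_intab => s /FG ->.
Qed.

Lemma CintD a b F G : ccontI a b F -> ccontI a b G ->
  Cintegral a b (fun s => F s + G s) = Cintegral a b F + Cintegral a b G.
Proof.
move=> cF cG; apply: complex_ext; rewrite ?(ReD, ImD) /=.
  rewrite -[RHS]intabD; [|exact: ccontI_Re..].
  by apply: eq_intab => s _; rewrite ReD.
rewrite -[RHS]intabD; [|exact: ccontI_Im..].
by apply: eq_intab => s _; rewrite ImD.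
Qed.

Lemma CintZ a b k F : ccontI a b F ->
  Cintegral a b (fun s => k * F s) = k * Cintegral a b F.
Proof.
move=> cF; have c1 := ccontI_Re cF; have c2 := ccontI_Im cF.
apply: complex_ext; rewrite ?(ReM, ImM) /=.
  rewrite -![\int[_]_(_ in _) _]/(intab _ _ _) -!intabZ// -intabB.
  - by apply: eq_intab => s _; rewrite ReM.
  - by move=> s sab; apply: cvgM; [exact: cvg_cst|exact: c1].
  - by move=> s sab; apply: cvgM; [exact: cvg_cst|exact: c2].
rewrite -![\int[_]_(_ in _) _]/(intab _ _ _) -!intabZ// -intabD.
- by apply: eq_intab => s _; rewrite ImM.
- by move=> s sab; apply: cvgM; [exact: cvg_cst|exact: c2].
- by move=> s sab; apply: cvgM; [exact: cvg_cst|exact: c1].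
Qed.

Lemma CintN a b F : ccontI a b F ->
  Cintegral a b (fun s => - F s) = - Cintegral a b F.
Proof.
move=> cF; rewrite -mulN1r -CintZ//; apply: eq_Cint => s _; by rewrite mulN1r.
Qed.

Lemma CintB a b F G : ccontI a b F -> ccontI a b G ->
  Cintegral a b (fun s => F s - G s) = Cintegral a b F - Cintegral a b G.
Proof.
by move=> cF cG; rewrite CintD ?CintN// => s /cG; apply: ccontN.
Qed.

(** The factor [2] comes from bounding real and imaginary parts separately. *)
Lemma normc_Cint_le a b F G : ccontI a b F -> contI a b G ->
  (forall s, a <= s <= b -> normc (F s) <= G s) ->
  normc (Cintegral a b F) <= 2 * intab a b G.
Proof.
move=> cF cG FG; apply: normc_le2.
  apply: norm_intab_le => //; first exact: ccontI_Re.
  by move=> s /FG; apply: le_trans; exact: normRe.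
apply: norm_intab_le => //; first exact: ccontI_Im.
by move=> s /FG; apply: le_trans; exact: normIm.
Qed.

Lemma Cint_FTC a b F f : a < b -> ccontI a b F -> ccontI a b f ->
  (forall s, a < s < b -> cderiv F s 1 (f s)) -> Cintegral a b f = F b - F a.
Proof.
move=> ab cF cf dF; apply: complex_ext; rewrite ?(ReD, ImD, ReN, ImN).
  apply: (@intab_FTC _ _ (fun s => complex.Re (F s))) => //; try exact: ccontI_Re.
  by move=> s /dF[].
apply: (@intab_FTC _ _ (fun s => complex.Im (F s))) => //; try exact: ccontI_Im.
by move=> s /dF[].
Qed.

Lemma ccont_Cint (V : topologicalType) (a b : R) (f : V -> R -> R[i]) (z0 : V) :
  a <= b ->
  (\forall z \near z0, forall s, a <= s <= b -> ccont (fun p => f p.1 p.2) (z, s)) ->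
  ccont (fun z => Cintegral a b (f z)) z0.
Proof.
move=> ab cf; split; [apply: (@continuous_intab _ a b (fun z s => complex.Re (f z s)))|
  apply: (@continuous_intab _ a b (fun z s => complex.Im (f z s)))] => //;
  by apply: filterS cf => z H s /H[].
Qed.

Lemma cderiv_Cint (V : normedModType R) (a b : R) (f fv : V -> R -> R[i]) (z0 v : V) :
  a <= b ->
  (\forall z \near z0, forall s, a <= s <= b ->
     [/\ ccont (fun p => f p.1 p.2) (z, s), ccont (fun p => fv p.1 p.2) (z, s) &
         cderiv (f^~ s) z v (fv z s)]) ->
  cderiv (fun z => Cintegral a b (f z)) z0 v (Cintegral a b (fv z0)).
Proof.
move=> ab cf; split.
  apply: (@is_derive_intab _ a b (fun z s => complex.Re (f z s))
    (fun z s => complex.Re (fv z s))) => //.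
  by apply: filterS cf => z H s /H[[? _] [? _] []].
apply: (@is_derive_intab _ a b (fun z s => complex.Im (f z s))
  (fun z s => complex.Im (fv z s))) => //.
by apply: filterS cf => z H s /H[[_ ?] [_ ?] []].
Qed.

Lemma ccont_joint_snd (V : topologicalType) (f : V -> R -> R[i]) (z : V) (s : R) :
  ccont (fun p => f p.1 p.2) (z, s) -> ccont (f z) s.
Proof.
by move=> [c1 c2]; split; [apply: (joint_cont_snd (f := fun z s => complex.Re (f z s)))|
  apply: (joint_cont_snd (f := fun z s => complex.Im (f z s)))].
Qed.

End Integrals.

(** * Complex-valued functions of two real variables *)

Section ComplexPlaneCalculus.
Variable R : realType.
Local Notation plane := (R * R)%type.
Local Notation normc := (@Normc.normc R).
Implicit Types F : plane -> R[i].

Lemma cderiv_e_x F (x y : R) d :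
  cderiv F (x, y) (e_x R) d <-> cderiv (fun r : R => F (r, y)) x 1 d.
Proof.
by split=> -[d1 d2]; split;
  solve [exact/(is_derive_e_x (fun p => complex.Re (F p)))|
         exact/(is_derive_e_x (fun p => complex.Im (F p)))].
Qed.

Lemma cderiv_e_y F (x y : R) d :
  cderiv F (x, y) (e_y R) d <-> cderiv (fun r : R => F (x, r)) y 1 d.
Proof.
by split=> -[d1 d2]; split;
  solve [exact/(is_derive_e_y (fun p => complex.Re (F p)))|
         exact/(is_derive_e_y (fun p => complex.Im (F p)))].
Qed.

(** Chain rule along a plane curve. *)
Lemma cderiv_curve F Fx Fy (g1 g2 : R -> R) (t d1 d2 : R) :
  let p := (g1 t, g2 t) in
  (\forall q \near p, cderiv F q (e_x R) (Fx q)) ->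
  (\forall q \near p, cderiv F q (e_y R) (Fy q)) ->
  ccont Fx p -> ccont Fy p ->
  is_derive t 1 g1 d1 -> is_derive t 1 g2 d2 ->
  cderiv (fun s => F (g1 s, g2 s)) t 1 (d1%:C * Fx p + d2%:C * Fy p).
Proof.
move=> p dFx dFy [cx1 cx2] [cy1 cy2] dg1 dg2; split.
  have -> : complex.Re (d1%:C * Fx p + d2%:C * Fy p) =
    d1 * complex.Re (Fx p) + d2 * complex.Re (Fy p).
    by rewrite ReD !ReM /= !mul0r !subr0.
  apply: (@is_derive_curve R (fun q => complex.Re (F q))
    (fun q => complex.Re (Fx q)) (fun q => complex.Re (Fy q))) => //.
    by apply: filterS dFx => q [].
  by apply: filterS dFy => q [].
have -> : complex.Im (d1%:C * Fx p + d2%:C * Fy p) =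
  d1 * complex.Im (Fx p) + d2 * complex.Im (Fy p).
  by rewrite ImD !ImM /= !mul0r !addr0.
apply: (@is_derive_curve R (fun q => complex.Im (F q))
  (fun q => complex.Im (Fx q)) (fun q => complex.Im (Fy q))) => //.
  by apply: filterS dFx => q [].
by apply: filterS dFy => q [].
Qed.

(** The increment of a complex function is controlled by that of a real
    function dominating its derivative. *)
Lemma normc_increment (u u' : R -> R[i]) (g g' : R -> R) (a b : R) : a <= b ->
  (forall x, a <= x <= b -> ccont u x) -> contI a b g ->
  (forall x, a < x < b -> cderiv u x 1 (u' x)) ->
  (forall x, a < x < b -> is_derive x 1 g (g' x)) ->
  (forall x, a < x < b -> normc (u' x) <= g' x) ->
  normc (u b - u a) <= 2 * (g b - g a).
Proof.
move=> ab cu cg du dg ug; apply: normc_le2; rewrite ?(ReD, ImD, ReN, ImN).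
  apply: (@le_norm_increment R (fun x => complex.Re (u x)) g
    (fun x => complex.Re (u' x)) g' a b ab) => //.
  - by apply: contI_within => x /cu[].
  - exact: contI_within.
  - by move=> x /du[].
  - by move=> x /ug; apply: le_trans; exact: normRe.
apply: (@le_norm_increment R (fun x => complex.Im (u x)) g
  (fun x => complex.Im (u' x)) g' a b ab) => //.
- by apply: contI_within => x /cu[].
- exact: contI_within.
- by move=> x /du[].
- by move=> x /ug; apply: le_trans; exact: normIm.
Qed.

Lemma normc_increment_cst (u u' : R -> R[i]) (M a b : R) : a <= b ->
  (forall x, a <= x <= b -> ccont u x) ->
  (forall x, a < x < b -> cderiv u x 1 (u' x)) ->
  (forall x, a < x < b -> normc (u' x) <= M) ->
  normc (u b - u a) <= 2 * (M * (b - a)).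
Proof.
move=> ab cu du uM; rewrite mulrBr.
apply: (@normc_increment u u' ( *%R M) (fun=> M)) => //.
  by move=> s _; exact: mulrl_continuous.
by move=> x _; apply: is_derive_eq; rewrite /GRing.scale /=; ring.
Qed.

Lemma ceq0_closed_itv (g : R -> R[i]) (a b t : R) : a < b -> ccont g t ->
  (forall s, a < s < b -> g s = 0) -> a <= t <= b -> g t = 0.
Proof.
move=> ab [c1 c2] g0 tab; apply: complex_ext => /=.
  by apply: (eq0_closed_itv ab c1) => // s /g0 ->.
by apply: (eq0_closed_itv ab c2) => // s /g0 ->.
Qed.

Let etaP (G : plane -> R) : G = (fun p => G (p.1, p.2)).
Proof. by apply/funext => -[]. Qed.

(** Complex version of [is_derive_trace]. *)
Lemma cderiv_trace_x F Fx (a b c d x y : R) : c < d ->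
  (forall p, ccont F p) -> (forall p, ccont Fx p) ->
  (forall x y, a < x < b -> c < y < d -> cderiv F (x, y) (e_x R) (Fx (x, y))) ->
  a < x < b -> c <= y <= d -> cderiv (fun r => F (r, y)) x 1 (Fx (x, y)).
Proof.
move=> cd cF cFx dF xab ycd; split.
  apply: (@is_derive_trace R (fun x y => complex.Re (F (x, y)))
     (fun x y => complex.Re (Fx (x, y))) a b c d) => //.
  - by move=> x' y'; have [h _] := cF (x', y'); exact: (eq_ind _ (fun g => {for (x', y'), continuous g}) h _ (etaP (fun p => complex.Re (F p)))).
  - by move=> x' y'; have [h _] := cFx (x', y'); exact: (eq_ind _ (fun g => {for (x', y'), continuous g}) h _ (etaP (fun p => complex.Re (Fx p)))).
  - by move=> x' y' h1 h2; have /cderiv_e_x[] := dF _ _ h1 h2.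
apply: (@is_derive_trace R (fun x y => complex.Im (F (x, y)))
   (fun x y => complex.Im (Fx (x, y))) a b c d) => //.
- by move=> x' y'; have [_ h] := cF (x', y'); exact: (eq_ind _ (fun g => {for (x', y'), continuous g}) h _ (etaP (fun p => complex.Im (F p)))).
- by move=> x' y'; have [_ h] := cFx (x', y'); exact: (eq_ind _ (fun g => {for (x', y'), continuous g}) h _ (etaP (fun p => complex.Im (Fx p)))).
- by move=> x' y' h1 h2; have /cderiv_e_x[] := dF _ _ h1 h2.
Qed.

Lemma ccont_swap F (p : plane) : ccont F (p.2, p.1) ->
  ccont (fun q => F (q.2, q.1)) p.
Proof.
move=> cF; apply: (@ccont_comp _ _ _ (fun q : plane => (q.2, q.1))) => //.
by apply: cont_pair; [exact: cvg_snd|exact: cvg_fst].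
Qed.

Lemma cderiv_trace_y F Fy (a b c d x y : R) : a < b ->
  (forall p, ccont F p) -> (forall p, ccont Fy p) ->
  (forall x y, a < x < b -> c < y < d -> cderiv F (x, y) (e_y R) (Fy (x, y))) ->
  a <= x <= b -> c < y < d -> cderiv (fun r => F (x, r)) y 1 (Fy (x, y)).
Proof.
move=> ab cF cFy dF xab ycd.
apply: (@cderiv_trace_x (fun q => F (q.2, q.1)) (fun q => Fy (q.2, q.1)) c d a b) => //.
- by move=> p; exact: ccont_swap.
- by move=> p; exact: ccont_swap.
- move=> y' x' h1 h2; apply/cderiv_e_x => /=; apply/cderiv_e_y; exact: dF.
Qed.

Lemma ccont_bounded F (a b c d : R) : (forall p, ccont F p) ->
  exists2 M, 0 <= M & forall x y, a <= x <= b -> c <= y <= d -> normc (F (x, y)) <= M.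
Proof.
move=> cF.
have cpt : compact (`[a, b]%classic `*` `[c, d]%classic : set plane).
  by apply: compact_setX; exact: segment_compact.
have cn : {within (`[a, b]%classic `*` `[c, d]%classic : set plane),
    continuous (fun p => normc (F p))}.
  by apply: continuous_subspaceT => p; exact: continuous_normc.
have /compact_bounded[M [_ HM]] := continuous_compact cn cpt.
exists (Num.max 0 (M + 1)); first by rewrite le_max lexx.
move=> x y xab ycd; rewrite le_max; apply/orP; right.
have := HM (M + 1); rewrite ltrDl ltr01 => /(_ isT (normc (F (x, y)))) /=.
rewrite ger0_norm ?normc_ge0//; by apply; exists (x, y) => //; split; rewrite /= in_itv.
Qed.

End ComplexPlaneCalculus.

(** * Uniqueness for a Goursat problem *)

(** Here [S] and [D] stand for the sum and the difference of the kernels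
    attached to [f] and to [1 / f], and [phi r = r f'(r) / f(r)]. Adding and
    subtracting the two kernel equations, in which
    [r ^+ 2 q_f = phi ^+ 2 + r phi'] and
    [r ^+ 2 q_(1/f) = phi ^+ 2 - r phi'], yields [eqS] and [eqD].
    Under these second-order equations the defects

      [X = r S_r - phi D],
      [Y = r D_r - 2 D + 2 (1 - t) D_t - phi S]

    of two first-order identities solve a homogeneous first-order system:
    [Y_r = - (phi / r) X], and [(s ^+ 2 X)' = s phi Y] along the
    characteristics [s |-> (a / s, 1 - s ^+ 2)]. As [X] vanishes for [t = 0] and
    [Y] vanishes for [r = 0], iterating the resulting integral inequalities
    shows that [X = Y = 0]. *)
Section GoursatUniqueness.
Variable R : realType.
Local Notation plane := (R * R)%type.
Local Notation normc := (@Normc.normc R).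
Variables (rho : R) (S Sr Srr Srt D Dr Dt Drr Drt Dtr : plane -> R[i]).
Variables (phi dphi : R -> R[i]) (C : R).
Hypothesis cS : forall p, ccont S p.
Hypothesis cSr : forall p, ccont Sr p.
Hypothesis cSrr : forall p, ccont Srr p.
Hypothesis cSrt : forall p, ccont Srt p.
Hypothesis cD : forall p, ccont D p.
Hypothesis cDr : forall p, ccont Dr p.
Hypothesis cDt : forall p, ccont Dt p.
Hypothesis cphi : forall r : R, ccont phi r.
Hypothesis dS : forall r t : R, 0 < r < rho -> 0 < t < 1 -> cderiv S (r, t) (e_x R) (Sr (r, t)).
Hypothesis dSr : forall r t : R, 0 < r < rho -> 0 < t < 1 -> cderiv Sr (r, t) (e_x R) (Srr (r, t)).
Hypothesis dSrt : forall r t : R, 0 < r < rho -> 0 < t < 1 -> cderiv Sr (r, t) (e_y R) (Srt (r, t)).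
Hypothesis dD : forall r t : R, 0 < r < rho -> 0 < t < 1 -> cderiv D (r, t) (e_x R) (Dr (r, t)).
Hypothesis dDt : forall r t : R, 0 < r < rho -> 0 < t < 1 -> cderiv D (r, t) (e_y R) (Dt (r, t)).
Hypothesis dDr : forall r t : R, 0 < r < rho -> 0 < t < 1 -> cderiv Dr (r, t) (e_x R) (Drr (r, t)).
Hypothesis dDtr : forall r t : R, 0 < r < rho -> 0 < t < 1 -> cderiv Dt (r, t) (e_x R) (Dtr (r, t)).
Hypothesis DrtE : forall r t : R, 0 < r < rho -> 0 < t < 1 -> Drt (r, t) = Dtr (r, t).
Hypothesis dphiE : forall r : R, 0 < r < rho -> cderiv phi r 1 (dphi r).
Hypothesis phiC : forall r : R, 0 < r < rho -> normc (phi r) <= C * r.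
Hypothesis eqS : forall r t : R, 0 < r < rho -> 0 < t < 1 ->
  r%:C * (r%:C * Srr (r, t) - Sr (r, t) + 2 * (1 - t%:C) * Srt (r, t)) =
  phi r ^+ 2 * S (r, t) + r%:C * dphi r * D (r, t).
Hypothesis eqD : forall r t : R, 0 < r < rho -> 0 < t < 1 ->
  r%:C * (r%:C * Drr (r, t) - Dr (r, t) + 2 * (1 - t%:C) * Drt (r, t)) =
  phi r ^+ 2 * D (r, t) + r%:C * dphi r * S (r, t).
Hypothesis bX : forall r : R, 0 < r < rho -> r%:C * Sr (r, 0) = phi r * D (r, 0).
Hypothesis bD : forall t : R, 0 < t < 1 -> D (0, t) = 0.
Hypothesis bDt : forall t : R, 0 < t < 1 -> Dt (0, t) = 0.
Hypothesis phi0 : phi 0 = 0.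

Let X (p : plane) := p.1%:C * Sr p - phi p.1 * D p.
Let Y (p : plane) := p.1%:C * Dr p - 2 * D p + 2 * (1 - p.2%:C) * Dt p - phi p.1 * S p.

Let cR1 (p : plane) : ccont (fun p : plane => p.1%:C) p.
Proof. by apply: ccontR; exact: cvg_fst. Qed.
Let cR2 (p : plane) : ccont (fun p : plane => p.2%:C) p.
Proof. by apply: ccontR; exact: cvg_snd. Qed.
Let cphi1 (p : plane) : ccont (fun p : plane => phi p.1) p.
Proof. exact: (@ccont_comp R _ _ (@fst R R) phi p cvg_fst (cphi p.1)). Qed.

Let cX p : ccont X p.
Proof.
exact: (ccontB (ccontM (cR1 p) (cSr p)) (ccontM (cphi1 p) (cD p))).
Qed.

Let cY p : ccont Y p.
Proof.
apply: ccontB; last exact: (ccontM (cphi1 p) (cS p)).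
apply: ccontD; last first.
  apply: (ccontM _ (cDt p)); apply: (ccontM (ccont_cst _ _)).
  exact: (ccontB (ccont_cst _ _) (cR2 p)).
exact: (ccontB (ccontM (cR1 p) (cDr p)) (ccontM (ccont_cst _ _) (cD p))).
Qed.

Let slice_x (F : plane -> R[i]) p : ccont F p -> ccont (fun r : R => F (r, p.2)) p.1.
Proof.
case: p => x y cF; apply: (ccont_comp (g := fun r : R => (r, y))) => //.
by apply: cont_pair; [exact: cvg_id|exact: cvg_cst].
Qed.

Let dY (r t : R) : 0 < r < rho -> 0 < t < 1 ->
  cderiv (fun r : R => Y (r, t)) r 1 (- (phi r / r%:C) * X (r, t)).
Proof.
move=> rr tt.
have r0 : r%:C != 0 :> R[i].
  by rewrite -(rmorph0 (real_complex R)) (inj_eq (@complexI R)); case/andP: rr => /gt_eqF ->.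
have d1 := (cderiv_e_x _ _ _ _).1 (dDr rr tt).
have d2 := (cderiv_e_x _ _ _ _).1 (dD rr tt).
have d3 := (cderiv_e_x _ _ _ _).1 (dDtr rr tt).
have d4 := (cderiv_e_x _ _ _ _).1 (dS rr tt).
have d5 : cderiv (fun r : R => r%:C) r 1 (1 : R)%:C by apply: cderivR; exact: is_derive_id.
have d6 := dphiE rr.
have e := eqD rr tt; have eD := DrtE rr tt.
apply: cderiv_eq.
  rewrite /Y /=.
  apply: cderivB; last exact: (cderivM d6 d4).
  apply: cderivD.
    by apply: cderivB; [exact: (cderivM d5 d1)|exact: (cderivM (cderiv_cst _ _ _) d2)].
  exact: (cderivM (cderiv_cst _ _ _) d3).
rewrite /X /= -eD !mul0r !add0r mul1r.
apply: (mulfI r0); rewrite mulrA mulrN mulrCA divff// mulr1.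
have -> : r%:C * (Dr (r, t) + r%:C * Drr (r, t) - 2 * Dr (r, t) +
    2 * (1 - t%:C) * Drt (r, t) - (dphi r * S (r, t) + phi r * Sr (r, t))) =
  r%:C * (r%:C * Drr (r, t) - Dr (r, t) + 2 * (1 - t%:C) * Drt (r, t)) -
  r%:C * (dphi r * S (r, t) + phi r * Sr (r, t)) by ring.
by rewrite e; ring.
Qed.

(** The first-order operator of the equation is a derivative along the
    characteristics [s |-> (a / s, 1 - s ^+ 2)]. *)
Let dW (a s : R) : 0 < a -> 0 < s < 1 -> a < s * rho ->
  cderiv (fun s : R => s%:C ^+ 2 * X (a / s, 1 - s ^+ 2)) s 1
    (s%:C * phi (a / s) * Y (a / s, 1 - s ^+ 2)).
Proof.
move=> a0 /andP[s0 s1] asr.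
have s2 : 0 < s ^+ 2 < 1 by rewrite exprn_gt0// expr_lt1// ltW.
have rr : 0 < a / s < rho by rewrite divr_gt0//= ltr_pdivrMr// mulrC.
have tt : 0 < 1 - s ^+ 2 < 1 by apply/andP; split; case/andP: s2; lra.
have near_rect (P : plane -> Prop) :
    (forall r t : R, 0 < r < rho -> 0 < t < 1 -> P (r, t)) ->
    \forall q \near (a / s, 1 - s ^+ 2), P q.
  move=> H; apply/near_planeP.
  case/andP: rr => r1 r2; case/andP: tt => t1 t2.
  exists (Num.min (Num.min (a / s) (rho - a / s)) (Num.min (1 - s ^+ 2) (s ^+ 2))).
    by rewrite !lt_min; apply/andP; split; apply/andP; split; lra.
  move=> x y; rewrite !lt_min !ltr_norml => /andP[/andP[/andP[? ?] /andP[? ?]] _].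
  move=> /andP[_ /andP[/andP[? ?] /andP[? ?]]].
  by apply: H; apply/andP; split; lra.
have sn0 : s != 0 by rewrite gt_eqF.
have dg1 : is_derive s 1 (fun s : R => a / s) (- (a / s ^+ 2)).
  have := @deriveV R R (fun s => s) s 1 sn0 (@derivable_id _ _ _ _).
  have := @derivableV R R (fun s => s) s 1 sn0 (@derivable_id _ _ _ _).
  move=> h1 h2; have h3 : is_derive s 1 (fun s : R => s^-1) (- s ^- 2).
    by apply: DeriveDef => //; rewrite h2 derive_id /GRing.scale /= mulr1.
  by apply: is_derive_eq; rewrite /GRing.scale /=; ring.
have dg2 : is_derive s 1 (fun s : R => 1 - s ^+ 2) (- (2 * s)).
  by apply: is_derive_eq; rewrite /GRing.scale /=; ring.
have k1 := @cderiv_curve R Sr Srr Srt (fun s : R => a / s) (fun s : R => 1 - s ^+ 2) s _ _ (near_rect _ dSr) (near_rect _ dSrt) (cSrr _) (cSrt _) dg1 dg2.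
have k2 := @cderiv_curve R D Dr Dt (fun s : R => a / s) (fun s : R => 1 - s ^+ 2) s _ _ (near_rect _ dD) (near_rect _ dDt) (cDr _) (cDt _) dg1 dg2.
have k3 : cderiv (fun s : R => phi (a / s)) s 1 ((- (a / s ^+ 2))%:C * dphi (a / s)).
  have [p1 p2] := dphiE rr.
  have e : (- (a / s ^+ 2))%:C * dphi (a / s) =
    (- (a / s ^+ 2) * complex.Re (dphi (a / s))) +i* (- (a / s ^+ 2) * complex.Im (dphi (a / s))).
    by apply: complex_ext; rewrite ?(ReM, ImM) /= !mul0r ?subr0 ?addr0.
  have chain (u : R -> R) (d : R) : is_derive (a / s) 1 u d ->
      is_derive s 1 (fun s : R => u (a / s)) (- (a / s ^+ 2) * d).
    by move=> du; exact: (@is_derive_comp1 R u (fun s => a / s) s _ _ du dg1).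
  by rewrite e; split; [exact: chain p1|exact: chain p2].
have k4 : cderiv (fun s : R => (a / s)%:C) s 1 (- (a / s ^+ 2))%:C by exact: cderivR.
have k5 : cderiv (fun s : R => s%:C) s 1 (1 : R)%:C by apply: cderivR; exact: is_derive_id.
have eS := eqS rr tt.
apply: cderiv_eq.
  rewrite /X /=; under [X in cderiv X]funext do rewrite expr2.
  apply: cderivM; first exact: (cderivM k5 k5).
  by apply: cderivB; [exact: (cderivM k4 k1)|exact: (cderivM k3 k2)].
rewrite /X /Y /=; set r := a / s in eS rr *; set t := 1 - s ^+ 2 in eS tt *.
have et : 1 - t%:C = s%:C ^+ 2 by rewrite /t rmorphB rmorph1 rmorphXn /=; ring.
have er : (a / s ^+ 2)%:C * s%:C = r%:C :> R[i].
  by rewrite -rmorphM /=; congr (_%:C); rewrite /r; field.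
have e1 : (- (a / s ^+ 2))%:C = - (a / s ^+ 2)%:C :> R[i] by rewrite rmorphN.
have e2 : (- (2 * s))%:C = - (2 * s%:C) :> R[i] by rewrite rmorphN rmorphM rmorph_nat.
rewrite e1 e2.
rewrite et in eS *; move: eS er; set q := (a / s ^+ 2)%:C; set sc := s%:C.
set rc := r%:C; move: (S (r, t)) (Sr (r, t)) (Srr (r, t)) (Srt (r, t)) (D (r, t))
  (Dr (r, t)) (Dt (r, t)) (phi r) (dphi r) => vS vSr vSrr vSrt vD vDr vDt p dp eS er.
have : sc * (rc * (rc * vSrr - vSr + 2 * sc ^+ 2 * vSrt)) =
   sc * (p ^+ 2 * vS + rc * dp * vD) by rewrite eS.
rewrite -er => E; rewrite (_ : (1:R)%:C = 1)//.
apply/eqP; rewrite -subr_eq0; apply/eqP.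
move/eqP: E; rewrite -subr_eq0 => /eqP E.
by rewrite -[RHS]oppr0 -E; ring.
Qed.

(** The two first-order identities linking sum and difference. *)
Lemma goursat_uniqueness (r t : R) : 0 < r < rho -> 0 < t < 1 ->
  r%:C * Sr (r, t) = phi r * D (r, t) /\
  r%:C * Dr (r, t) - 2 * D (r, t) + 2 * (1 - t%:C) * Dt (r, t) = phi r * S (r, t).
Proof.
move=> rr tt.
have rho0 : 0 < rho by case/andP: rr; lra.
have [A A0 HA] := ccont_bounded 0 rho 0 1 cX.
pose s0 := Num.sqrt (1 - t).
have s02 : s0 ^+ 2 = 1 - t by rewrite sqr_sqrtr//; case/andP: tt; lra.
have s00 : 0 < s0 by rewrite sqrtr_gt0; case/andP: tt; lra.
have s01 : s0 < 1 by rewrite -(@ltr_pXn2r _ 2) ?nnegrE ?(ltW s00)// s02 expr1n; case/andP: tt; lra.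
pose K0 := (`|C| + 1) * rho * (2 * (rho * (`|C| + 1))).
have C1 : 0 < `|C| + 1 by rewrite ltr_wpDl.
have K00 : 0 < K0 by rewrite /K0 !mulr_gt0.
(* Integrating [g] gains the factor [1 / lam]; [s0 ^+ 2] compensates the
   division by [s ^+ 2] on [s0, 1]. *)
pose lam := 4 * K0 / s0 ^+ 2.
have lam0 : 0 < lam by rewrite /lam divr_gt0 ?mulr_gt0 ?exprn_gt0.
pose g (s : R) := expR (lam * (1 - s)).
have dg (s : R) : is_derive s 1 (fun s => - g s / lam) (g s).
  rewrite /g; apply: is_derive_eq; rewrite /GRing.scale /=; field.
  by rewrite gt_eqF.
have g0 (s : R) : 0 < g s by exact: expR_gt0.
have tsE (s : R) : s0 <= s <= 1 -> 0 <= 1 - s ^+ 2 <= 1.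
  by move=> /andP[h1 h2]; apply/andP; split; nra.
have tsE' (s : R) : s0 <= s < 1 -> 0 < 1 - s ^+ 2 < 1.
  by move=> /andP[h1 h2]; apply/andP; split; nra.
have phiC' (x : R) : 0 < x < rho -> normc (phi x) <= (`|C| + 1) * x.
  move=> xr; rewrite (le_trans (phiC xr))// ler_wpM2r//; first by case/andP: xr => /ltW.
  by rewrite (le_trans (ler_norm _))// lerDl.
have Y0 (x : R) : 0 < x < 1 -> Y (0, x) = 0.
  by move=> hx; rewrite /Y /= bD// bDt// phi0 !mulr0 !mul0r subr0 addr0 subrr.
have stepY B : 0 <= B -> forall s x : R, s0 <= s < 1 -> 0 < x < rho ->
    (forall y : R, 0 < y < rho -> normc (X (y, 1 - s ^+ 2)) <= B) ->
    normc (Y (x, 1 - s ^+ 2)) <= 2 * (rho * (`|C| + 1)) * B.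
  move=> B0 s x hs xr HB; have ht := tsE' s hs.
  have := @normc_increment_cst R (fun x => Y (x, 1 - s ^+ 2))
    (fun x => - (phi x / x%:C) * X (x, 1 - s ^+ 2)) ((`|C| + 1) * B) 0 x.
  rewrite Y0// subr0 subr0 => H; apply: (le_trans (H _ _ _ _)).
  - by case/andP: xr => /ltW.
  - by move=> y _; exact: (@slice_x Y (y, 1 - s ^+ 2)).
  - move=> y /andP[y0 yx]; apply: dY => //; rewrite y0 /=.
    by case/andP: xr => _; exact: lt_trans.
  - move=> y /andP[y0 yx]; have yr : 0 < y < rho.
      by rewrite y0 /=; case/andP: xr => _; exact: lt_trans.
    rewrite Normc.normcM normcN Normc.normcM Normc.normcV normcR (gtr0_norm y0).
    rewrite ler_pM ?mulr_ge0 ?normc_ge0 ?invr_ge0 ?(ltW y0)//; last exact: HB.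
    by rewrite ler_pdivrMr//; exact: phiC'.
  - rewrite -!mulrA ler_pM2l// [leLHS]mulrA [leLHS]mulrC mulrA.
    rewrite -[leRHS]mulrA ler_wpM2r ?mulr_ge0 ?(ltW C1)//; by case/andP: xr => _ /ltW.
(* The weight [g] absorbs the constant [K0]: each round trip through [Y] gains
   a factor [1 / 2]. *)
have iter (n : nat) : forall s x : R, s0 <= s <= 1 -> 0 < x < rho ->
    normc (X (x, 1 - s ^+ 2)) <= A * (1 / 2) ^+ n * g s.
  elim: n => [|n IH] s x hs xr.
    rewrite expr0 mulr1 -[leLHS]mulr1 ler_pM ?normc_ge0//.
      by apply: HA; [case/andP: xr => /ltW -> /ltW ->|exact: tsE].
    by rewrite /g -[leLHS]expR0 ler_expR mulr_ge0 ?(ltW lam0)// subr_ge0; case/andP: hs.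
  have [->|sn1] := eqVneq s 1.
    rewrite expr1n subrr /X /= bX// subrr Normc.normc0.
    by rewrite mulr_ge0 ?mulr_ge0 ?exprn_ge0 ?(ltW (g0 _))// divr_ge0.
  have hs' : s0 <= s < 1 by case/andP: hs => -> h; rewrite lt_neqAle sn1 h.
  have ss : 0 < s by case/andP: hs => h _; exact: lt_le_trans h.
  pose a := x * s; have a0 : 0 < a by rewrite /a mulr_gt0//; case/andP: xr.
  pose B := A * (1 / 2) ^+ n.
  have B0 : 0 <= B by rewrite mulr_ge0// exprn_ge0// divr_ge0.
  have rng (u : R) : s < u <= 1 -> 0 < a / u < rho.
    move=> /andP[su u1]; have u0 : 0 < u by exact: lt_trans su.
    rewrite divr_gt0//= ltr_pdivrMr// /a.
    by case/andP: xr => x0 xr; rewrite ltr_pM// ltW.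
  have := @normc_increment R (fun s : R => s%:C ^+ 2 * X (a / s, 1 - s ^+ 2))
    (fun s : R => s%:C * phi (a / s) * Y (a / s, 1 - s ^+ 2))
    (fun s => K0 * B * (- g s / lam)) (fun s => K0 * B * g s) s 1.
  have X1 : X (a / 1, 1 - 1 ^+ 2) = 0.
    have h : 0 < a < rho by have := rng 1; rewrite divr1; apply; case/andP: hs' => _ ->; rewrite lexx.
    by rewrite divr1 expr1n subrr /X /= bX// subrr.
  rewrite X1 mulr0 sub0r normcN => H.
  have {}H : normc (s%:C ^+ 2 * X (a / s, 1 - s ^+ 2)) <=
     2 * (K0 * B * (- g 1 / lam) - K0 * B * (- g s / lam)).
    apply: H.
    - by case/andP: hs' => _ /ltW.
    - move=> u /andP[su u1]; have u0 : 0 < u by exact: lt_le_trans su.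
      apply: ccontM; first by apply: ccontX; apply: ccontR; exact: cvg_id.
      apply: (@ccont_comp _ _ _ (fun s : R => (a / s, 1 - s ^+ 2))) => //.
      apply: cont_pair.
        apply: cvgM; first exact: cvg_cst.
        by apply: cvgV; [rewrite gt_eqF|exact: cvg_id].
      by apply: cvgB; [exact: cvg_cst|exact: exprn_continuous].
    - move=> u _; apply: cvgM; first exact: cvg_cst.
      exact: (is_derive_continuous (dg u)).
    - move=> u /andP[su u1]; have u0 : 0 < u by exact: lt_trans su.
      apply: dW => //; first by rewrite u0.
      have : 0 < a / u < rho by apply: rng; rewrite su ltW.
      by move=> /andP[_]; rewrite ltr_pdivrMr// mulrC.
    - move=> u /andP[su u1]; have u0 : 0 < u by exact: lt_trans su.
      have ur : 0 < a / u < rho by apply: rng; rewrite su ltW.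
      have us0 : s0 <= u < 1 by rewrite u1 andbT; case/andP: hs' => h _; rewrite (le_trans h)// ltW.
      have := stepY (B * g u) _ u (a / u) us0 ur.
      rewrite mulr_ge0 ?(ltW (g0 _))// => /(_ isT) HY.
      have {}HY := HY (fun y yr => IH u y _ yr).
      rewrite !Normc.normcM normcR (gtr0_norm u0) -[leLHS]mulrA.
      have pu := phiC' _ ur.
      have pu2 : normc (phi (a / u)) <= (`|C| + 1) * rho.
        by rewrite (le_trans pu)// ler_pM2l//; case/andP: ur => _ /ltW.
      have HY2 : normc (Y (a / u, 1 - u ^+ 2)) <= 2 * (rho * (`|C| + 1)) * (B * g u).
        by apply: HY; case/andP: us0 => -> /ltW ->.
      have nY := normc_ge0 (Y (a / u, 1 - u ^+ 2)).
      have nphi := normc_ge0 (phi (a / u)).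
      have h1 : u * (normc (phi (a / u)) * normc (Y (a / u, 1 - u ^+ 2))) <=
         normc (phi (a / u)) * normc (Y (a / u, 1 - u ^+ 2)).
        by rewrite ler_piMl ?mulr_ge0// ltW.
      apply: (le_trans h1).
      have h2 := ler_pM nphi nY pu2 HY2.
      by apply: (le_trans h2); rewrite le_eqVlt; apply/orP; left; apply/eqP; rewrite /K0; ring.
  have sa : a / s = x by rewrite /a mulfK// gt_eqF.
  move: H; rewrite sa Normc.normcM normcX normcR (gtr0_norm ss) => H.
  have s2 : 0 < s ^+ 2 by rewrite exprn_gt0.
  rewrite -(ler_pM2l s2); apply: (le_trans H).
  have ls : s0 ^+ 2 <= s ^+ 2.
    by rewrite ler_pXn2r ?nnegrE ?(ltW s00) ?(ltW ss)//; case/andP: hs.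
  have e : 2 * (K0 * B * (- g 1 / lam) - K0 * B * (- g s / lam)) =
     (1 / 2 * s0 ^+ 2) * B * (g s - g 1).
    rewrite /lam; field; rewrite ?gt_eqF//.
  rewrite e.
  have h1 : s0 ^+ 2 * (B * (g s - g 1)) <= s ^+ 2 * (B * g s).
    apply: ler_pM => //; first by rewrite exprn_ge0// ltW.
      rewrite mulr_ge0// subr_ge0 /g ler_expR ler_pM2l// lerD2l lerN2.
      by case/andP: hs.
    by rewrite ler_wpM2l// gerDl oppr_le0 ltW.
  have -> : 1 / 2 * s0 ^+ 2 * B * (g s - g 1) = 1 / 2 * (s0 ^+ 2 * (B * (g s - g 1))) by ring.
  have -> : s ^+ 2 * (A * (1 / 2) ^+ n.+1 * g s) = 1 / 2 * (s ^+ 2 * (B * g s)).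
    by rewrite (exprS (1 / 2) n) /B; ring.
  by rewrite ler_pM2l.
have Xz (y : R) : 0 < y < rho -> X (y, t) = 0.
  move=> yr; apply: normc_eq0P; apply/eqP; rewrite eq_le normc_ge0 andbT.
  have lim : A * (1 / 2) ^+ n * g s0 @[n --> \oo] --> (0 : R).
    rewrite -[X in _ --> X](mul0r (g s0)); apply: cvgM; last exact: cvg_cst.
    rewrite -[X in _ --> X](mulr0 A); apply: cvgM; first exact: cvg_cst.
    by apply: cvg_expr; rewrite ger0_norm; lra.
  apply: (cvgr_to_ge lim); apply: nearW => n.
  have := iter n s0 y; rewrite s02 opprB addrCA subrr addr0; apply => //.
  by rewrite lexx ltW.
have Yz : Y (r, t) = 0.
  apply: normc_eq0P; apply/eqP; rewrite eq_le normc_ge0 andbT.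
  have := stepY 0 (lexx _) s0 r; rewrite s02 opprB addrCA subrr addr0 mulr0; apply => //.
    by rewrite lexx.
  by move=> y yr; rewrite Xz// Normc.normc0.
split; first by apply/eqP; rewrite -subr_eq0; apply/eqP; exact: Xz.
by apply/eqP; rewrite -subr_eq0; apply/eqP; exact: Yz.
Qed.

End GoursatUniqueness.

(** * Extension of functions beyond the closed rectangle *)

Section Extension.
Variable R : realType.
Local Notation plane := (R * R)%type.
Local Notation normc := (@Normc.normc R).

(** For [a <= b], the nearest point to [x] between [a] and [b]. *)
Definition clamp (a b x : R) : R := Num.max a (Num.min b x).

Lemma clamp_in a b x : a <= b -> a <= clamp a b x <= b.
Proof. by move=> ab; rewrite /clamp le_max lexx /= ge_max ab /= ge_min lexx. Qed.

Lemma clampE a b x : a <= x <= b -> clamp a b x = x.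
Proof. by move=> /andP[ax xb]; rewrite /clamp min_r// max_r. Qed.

Lemma continuous_clamp a b : continuous (clamp a b).
Proof.
move=> x; apply/cvgrPdist_le => e e0.
have : \forall y \near x, `|x - y| <= e.
  have h : y @[y --> x] --> x by exact: cvg_id.
  by move/cvgrPdist_le : h; apply.
apply: filterS => y; apply: le_trans.
rewrite /clamp.
have lip (u v w : R) : `|Num.max w u - Num.max w v| <= `|u - v| /\
    `|Num.min w u - Num.min w v| <= `|u - v|.
  have h1 := ler_norm (u - v); have h2 := ler_norm (v - u); rewrite distrC in h2.
  by rewrite !ler_norml; case: (leP w u) => ?; case: (leP w v) => ?;
    split; apply/andP; split; lra.
by rewrite (le_trans (lip _ _ _).1)// (lip _ _ _).2.
Qed.

(** Precomposing with a continuous retraction onto [D] turns continuity within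
    [D] into continuity everywhere. *)
Lemma extend_clamp (T : topologicalType) (D : set T) (w : T -> R) (c : T -> T) :
  {within D, continuous w} -> continuous c -> (forall x, D (c x)) ->
  continuous (fun x => w (c x)).
Proof.
move=> /subspace_continuousP cw cc Dc x.
move=> A nA; have hA : nbhs (c x) (fun y => D y -> A (w y)) := cw _ (Dc x) A nA.
have near_x : nbhs x (fun y => D (c y) -> A (w (c y))) := cc x _ hA.
by apply: (@filterS _ _ (nbhs_filter x) _ _ _ near_x) => y; apply; exact: Dc.
Qed.

Lemma closure_segment (D : set plane) (p m : plane) :
  (forall s : R, 0 < s < 1 -> D (p.1 + s * (m.1 - p.1), p.2 + s * (m.2 - p.2))) ->
  closure D p.
Proof.
move=> H B nB.
have path : {for (0 : R), continuous (fun s : R =>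
    (p.1 + s * (m.1 - p.1), p.2 + s * (m.2 - p.2)))}.
  by apply: cont_pair; apply: cvgD; try exact: cvg_cst; apply: cvgM; [exact: cvg_id|exact: cvg_cst|exact: cvg_id|exact: cvg_cst].
have : \forall s \near (0:R)^'+, B (p.1 + s * (m.1 - p.1), p.2 + s * (m.2 - p.2)).
  apply: (cvg_at_right_filter path).
  by rewrite !mul0r !addr0 -surjective_pairing.
move=> nearB.
have : \forall s \near (0:R)^'+, 0 < s < 1.
  by near=> s; apply/andP; split; near: s; [exact: nbhs_right_gt|exact: nbhs_right_lt].
move=> near1; have [s [Bs s1]] := filter_ex (filterI nearB near1).
by exists (p.1 + s * (m.1 - p.1), p.2 + s * (m.2 - p.2)); split => //; exact: H.
Unshelve. all: by end_near. Qed.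

(** The open rectangle on which the kernel equations hold. *)
Definition rect (rho : R) : set plane := `]0, rho[%classic `*` `]0, 1[%classic.

Lemma rectP rho (r t : R) : rect rho (r, t) <-> 0 < r < rho /\ 0 < t < 1.
Proof. by rewrite /rect /= !in_itv. Qed.

Lemma closure_rect rho (r t : R) : 0 < rho -> 0 <= r <= rho -> 0 <= t <= 1 ->
  closure (rect rho) (r, t).
Proof.
move=> rho0 rr tt; apply: (@closure_segment _ _ ((0 + rho) / 2, (0 + 1) / 2)) => s s01 /=.
by apply/rectP; split; apply: interior_approach.
Qed.

Lemma closure_itv0 rho (r : R) : 0 < rho -> 0 <= r <= rho ->
  closure (`]0, rho[%classic : set R) r.
Proof.
move=> rho0 rr B nB.
have path : {for (0 : R), continuous (fun s : R => r + s * ((0 + rho) / 2 - r))}.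
  by apply: cvgD; [exact: cvg_cst|apply: cvgM; [exact: cvg_id|exact: cvg_cst]].
have nearB : \forall s \near (0:R)^'+, B (r + s * ((0 + rho) / 2 - r)).
  by apply: (cvg_at_right_filter path); rewrite mul0r addr0.
have near1 : \forall s \near (0:R)^'+, 0 < s < 1.
  by near=> s; apply/andP; split; near: s; [exact: nbhs_right_gt|exact: nbhs_right_lt].
have [s [Bs s1]] := filter_ex (filterI nearB near1).
exists (r + s * ((0 + rho) / 2 - r)); split => //.
by rewrite /= in_itv /=; apply: interior_approach.
Unshelve. all: by end_near. Qed.

Lemma near_rect rho (p : plane) (P : plane -> Prop) :
  (forall r t : R, 0 < r < rho -> 0 < t < 1 -> P (r, t)) -> rect rho p ->
  \forall q \near p, P q.
Proof.
case: p => r t H rp; have : nbhs (r, t) (rect rho).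
  have [rr tt] := (rectP _ _ _).1 rp.
  exists (`]0, rho[%classic, `]0, 1[%classic); last by move=> [].
  by split; apply: open_nbhs_nbhs; split => //=; rewrite ?in_itv //; exact: interval_open.
by apply: filterS => -[x y] /rectP[]; exact: H.
Qed.

(** The retraction of the plane onto the closed rectangle. *)
Definition clamp2 (rho : R) (p : plane) : plane := (clamp 0 rho p.1, clamp 0 1 p.2).

Lemma clamp2_idem rho p : 0 <= rho -> clamp2 rho (clamp2 rho p) = clamp2 rho p.
Proof. by move=> r0; congr pair; apply: clampE; apply: clamp_in. Qed.

Lemma continuous_clamp2 rho : continuous (clamp2 rho).
Proof.
move=> p; apply: (@cont_pair _ _ _ (fun p : plane => clamp 0 rho p.1) (fun p : plane => clamp 0 1 p.2)).
  apply: (@cont_comp _ _ _ (@fst R R) (clamp 0 rho)); first exact: cvg_fst.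
  exact: continuous_clamp.
apply: (@cont_comp _ _ _ (@snd R R) (clamp 0 1)); first exact: cvg_snd.
exact: continuous_clamp.
Qed.

Lemma clamp2_closure rho p : 0 < rho -> closure (rect rho) (clamp2 rho p).
Proof. by move=> r0; apply: closure_rect => //; apply: clamp_in => //; exact: ltW. Qed.

(** A continuous function on the plane, constant along the directions in which
    a point is moved by [clamp2]. *)
Definition clamped (rho : R) (k : plane -> R) :=
  continuous k /\ forall p, k p = k (clamp2 rho p).

Lemma clamped_ext rho (u : plane -> R) : 0 < rho ->
  {within closure (rect rho), continuous u} ->
  exists k, clamped rho k /\ forall r t, 0 <= r <= rho -> 0 <= t <= 1 -> k (r, t) = u (r, t).
Proof.
move=> r0 cu; exists (fun p => u (clamp2 rho p)); split; first split.
- by apply: extend_clamp cu _ _; [exact: continuous_clamp2|move=> p; exact: clamp2_closure].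
- by move=> p; rewrite clamp2_idem// ltW.
- by move=> r t rr tt; rewrite /clamp2 /= !clampE.
Qed.

Lemma clamped_ext_in rho (u : plane -> R) : 0 < rho ->
  (exists w : plane -> R, {within closure (rect rho), continuous w} /\ {in rect rho, u =1 w}) ->
  exists k, clamped rho k /\ forall p, rect rho p -> k p = u p.
Proof.
move=> r0 [w [cw uw]]; have [k [ck kw]] := clamped_ext r0 cw.
exists k; split => // -[r t] rp; rewrite uw ?inE//.
by have /rectP[/andP[? ?] /andP[? ?]] := rp; apply: kw; rewrite !ltW.
Qed.

Lemma is_derive_rect rho (u k d : plane -> R) (v p : plane) :
  (forall p, rect rho p -> derivable u p v) -> (forall p, rect rho p -> k p = u p) ->
  (forall p, rect rho p -> d p = 'D_v u p) -> rect rho p -> is_derive p v k (d p).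
Proof.
move=> du ku dE rp; rewrite dE//.
apply: (near_eq_is_derive _ (derivableP (du _ rp))).
apply: (near_rect _ rp) => r t rr tt; apply/esym/ku/rectP; split => //.
Qed.

Let e_y_axes : e_y R \in axes R.
Proof. by rewrite !inE eqxx orbT. Qed.

(** A function of class [C^2] up to the boundary of the rectangle, and its partial
    derivatives, as restrictions of continuous functions on the plane. *)
Lemma Ck_closure_data rho (u : plane -> R) : 0 < rho ->
  Ck_closure (axes R) 2 (rect rho) u ->
  exists k kr kt krr krt ktr : plane -> R,
  [/\ [/\ clamped rho k, clamped rho kr & clamped rho kt],
      [/\ continuous krr, continuous krt & continuous ktr],
      forall r t, 0 <= r <= rho -> 0 <= t <= 1 -> k (r, t) = u (r, t),
      forall p, rect rho p -> [/\ is_derive p (e_x R) k (kr p), is_derive p (e_y R) k (kt p),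
        is_derive p (e_x R) kr (krr p), is_derive p (e_y R) kr (krt p) &
        is_derive p (e_x R) kt (ktr p)] &
      forall p, rect rho p -> [/\ kr p = 'D_(e_x R) u p,
        krr p = 'D_(e_x R) ('D_(e_x R) u) p & krt p = 'D_(e_y R) ('D_(e_x R) u) p]].
Proof.
move=> r0 [cu [_ H]].
have [dx [ex Hx]] := H (e_x R) (mem_head _ _).
have [dy [ey Hy]] := H (e_y R) e_y_axes.
have [dxx [exx _]] := Hx (e_x R) (mem_head _ _).
have [dxy [exy _]] := Hx (e_y R) e_y_axes.
have [dyx [eyx _]] := Hy (e_x R) (mem_head _ _).
have [k [ck ku]] := clamped_ext r0 cu.
have [kr [ckr kru]] := clamped_ext_in r0 ex.
have [kt [ckt ktu]] := clamped_ext_in r0 ey.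
have [krr [ckrr krru]] := clamped_ext_in r0 exx.
have [krt [ckrt krtu]] := clamped_ext_in r0 exy.
have [ktr [cktr ktru]] := clamped_ext_in r0 eyx.
have ku' p : rect rho p -> k p = u p.
  case: p => r t /rectP[/andP[? ?] /andP[? ?]]; apply: ku; rewrite !ltW//.
exists k, kr, kt, krr, krt, ktr; split => //.
- by split; [case: ckrr|case: ckrt|case: cktr].
- move=> p rp; split.
  + exact: is_derive_rect dx ku' kru rp.
  + exact: is_derive_rect dy ku' ktu rp.
  + exact: is_derive_rect dxx kru krru rp.
  + exact: is_derive_rect dxy kru krtu rp.
  + exact: is_derive_rect dyx ktu ktru rp.
- by move=> p rp; split; [exact: kru|exact: krru|exact: krtu].
Qed.

(** The complex counterpart of [clamped]. *)
Definition cclamped (rho : R) (k : plane -> R[i]) :=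
  (forall p, ccont k p) /\ forall p, k p = k (clamp2 rho p).

Lemma Ck_rect_data rho (G : plane -> R[i]) : 0 < rho -> Ck_rect 2 rho G ->
  exists k kr kt krr krt ktr : plane -> R[i],
  [/\ [/\ cclamped rho k, cclamped rho kr & cclamped rho kt],
      [/\ forall p, ccont krr p, forall p, ccont krt p & forall p, ccont ktr p],
      forall r t, 0 <= r <= rho -> 0 <= t <= 1 -> k (r, t) = G (r, t),
      forall p, rect rho p -> [/\ cderiv k p (e_x R) (kr p), cderiv k p (e_y R) (kt p),
        cderiv kr p (e_x R) (krr p), cderiv kr p (e_y R) (krt p) &
        cderiv kt p (e_x R) (ktr p)] &
      forall p, rect rho p -> [/\ kr p = Cderive G (e_x R) p,
        krr p = Cderive (Cderive G (e_x R)) (e_x R) p &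
        krt p = Cderive (Cderive G (e_x R)) (e_y R) p]].
Proof.
move=> r0 [H1 H2].
have [k [kr [kt [krr [krt [ktr [[c1 c2 c3] [c4 c5 c6] ku kd ke]]]]]]] := Ck_closure_data r0 H1.
have [l [lr [lt [lrr [lrt [ltr [[d1 d2 d3] [d4 d5 d6] lu ld le]]]]]]] := Ck_closure_data r0 H2.
have cl (a b : plane -> R) : clamped rho a -> clamped rho b -> cclamped rho (fun p => a p +i* b p).
  move=> [ca ea] [cb eb]; split; first by move=> p; split; [exact: ca|exact: cb].
  by move=> p; rewrite (ea p) (eb p).
have cc (a b : plane -> R) : continuous a -> continuous b -> forall p, ccont (fun p => a p +i* b p) p.
  by move=> ca cb p; split; [exact: ca|exact: cb].
exists (fun p => k p +i* l p), (fun p => kr p +i* lr p), (fun p => kt p +i* lt p),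
  (fun p => krr p +i* lrr p), (fun p => krt p +i* lrt p), (fun p => ktr p +i* ltr p).
split.
- by split; exact: cl.
- by split; exact: cc.
- by move=> r t rr tt; rewrite ku// lu//; case: (G (r, t)).
- move=> p rp; have [? ? ? ? ?] := kd _ rp; have [? ? ? ? ?] := ld _ rp.
  by split; split.
- move=> p rp; have [-> -> ->] := ke _ rp; have [-> -> ->] := le _ rp.
  by split.
Qed.

Lemma Ck_itv_ext rho (u : R -> R) : 0 < rho ->
  (exists w : R -> R, {within closure (`]0, rho[%classic : set R), continuous w} /\
     {in (`]0, rho[%classic : set R), u =1 w}) ->
  exists k : R -> R, continuous k /\ forall r, 0 < r < rho -> k r = u r.
Proof.
move=> r0 [w [cw uw]]; exists (fun r => w (clamp 0 rho r)); split.
  apply: extend_clamp cw _ _; first exact: continuous_clamp.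
  by move=> r; apply: closure_itv0 => //; apply: clamp_in; exact: ltW.
move=> r rr; rewrite uw ?inE /= ?in_itv// clampE//.
by case/andP: rr => /ltW -> /ltW ->.
Qed.

Lemma Ck_itv_ext0 rho (u : R -> R) : 0 < rho ->
  {within closure (`]0, rho[%classic : set R), continuous u} ->
  continuous (fun r => u (clamp 0 rho r)).
Proof.
move=> r0 cu; apply: extend_clamp cu _ _; first exact: continuous_clamp.
by move=> r; apply: closure_itv0 => //; apply: clamp_in; exact: ltW.
Qed.

Lemma Ck_itv1_data rho (u : R -> R[i]) n : 0 < rho -> Ck_itv n rho u ->
  forall r, ccont (fun r => u (clamp 0 rho r)) r.
Proof.
by move=> r0 [[c1 _] [c2 _]] r; split; [exact: (Ck_itv_ext0 r0 c1)|exact: (Ck_itv_ext0 r0 c2)].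
Qed.

Lemma Ck_itv2_data rho (u : R -> R[i]) : 0 < rho -> Ck_itv 2 rho u ->
  exists u1 u2 : R -> R[i],
  [/\ forall r, ccont u1 r, forall r, ccont u2 r,
      forall r, 0 < r < rho -> cderiv u r 1 (u1 r) /\ cderiv u1 r 1 (u2 r) &
      forall r, 0 < r < rho -> u1 r = Cder u r /\ u2 r = Cder (Cder u) r].
Proof.
move=> r0 [[_ [_ H1]] [_ [_ H2]]].
have near_itv (P : R -> Prop) (r : R) : (forall s, 0 < s < rho -> P s) -> 0 < r < rho ->
    \forall s \near r, P s.
  move=> HP rr; have : nbhs r (`]0, rho[%classic : set R).
    by apply: open_nbhs_nbhs; split; [exact: interval_open|rewrite /= in_itv].
  by apply: filterS => s; rewrite /= in_itv /=; exact: HP.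
have data (v : R -> R) : (forall w, w \in [:: (1:R)] -> (forall p, (`]0, rho[%classic : set R) p -> derivable v p w) /\
   Ck_ext [:: (1:R)] 1 `]0, rho[%classic ('D_w v)) ->
   exists v1 v2 : R -> R, [/\ continuous v1, continuous v2,
     forall r, 0 < r < rho -> is_derive r 1 v (v1 r) /\ is_derive r 1 v1 (v2 r) &
     forall r, 0 < r < rho -> v1 r = 'D_1 v r /\ v2 r = 'D_1 ('D_1 v) r].
  move=> H; have [d1 [e1 He]] := H 1 (mem_head _ _).
  have [d2 [e2 _]] := He 1 (mem_head _ _).
  have [v1 [cv1 v1E]] := Ck_itv_ext r0 e1.
  have [v2 [cv2 v2E]] := Ck_itv_ext r0 e2.
  exists v1, v2; split => //; last by move=> r rr; rewrite v1E// v2E.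
  move=> r rr; split.
    by rewrite v1E//; apply: derivableP; apply: d1; rewrite /= in_itv.
  rewrite v2E//; have d2r : derivable ('D_1 v) r 1 by apply: d2; rewrite /= in_itv.
  apply: (near_eq_is_derive _ (derivableP d2r)).
  by apply: near_itv rr => s /v1E ->.
have [a1 [a2 [ca1 ca2 da ea]]] := data _ H1.
have [b1 [b2 [cb1 cb2 db eb]]] := data _ H2.
exists (fun r => a1 r +i* b1 r), (fun r => a2 r +i* b2 r); split.
- by move=> r; split; [exact: ca1|exact: cb1].
- by move=> r; split; [exact: ca2|exact: cb2].
- by move=> r rr; have [? ?] := da r rr; have [? ?] := db r rr; do 2 split.
- by move=> r rr; have [-> ->] := ea r rr; have [-> ->] := eb r rr.
Qed.

End Extension.

(** * Kernels vanishing on an axis *)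

Section Kernels.
Variable R : realType.
Local Notation plane := (R * R)%type.
Local Notation normc := (@Normc.normc R).

(** A kernel [k] on the plane, with partial derivatives [kr] and [kt] over the
    rectangle, vanishing to second order at [r = 0]. This vanishing makes
    [z |-> k (|z|, t)] of class [C^1] at the origin. *)
Record regular_kernel (rho C : R) (k kr kt : plane -> R[i]) : Prop := RegularKernel {
  rk_cont : forall p, ccont k p;
  rk_cont_r : forall p, ccont kr p;
  rk_cont_t : forall p, ccont kt p;
  rk_deriv_r : forall r t : R, 0 < r < rho -> 0 <= t <= 1 ->
    cderiv (fun r : R => k (r, t)) r 1 (kr (r, t));
  rk_deriv_t : forall r t : R, 0 < r < rho -> 0 < t < 1 ->
    cderiv (fun t : R => k (r, t)) t 1 (kt (r, t));
  rk_bound : forall r t : R, 0 <= r -> normc (k (r, t)) <= C * r ^+ 2;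
  rk_bound_r : forall r t : R, 0 <= r -> normc (kr (r, t)) <= C * r }.

Lemma slice1 (F : plane -> R[i]) (t r : R) : (forall p, ccont F p) -> ccont (fun r : R => F (r, t)) r.
Proof.
move=> cF; apply: (@ccont_comp R _ _ (fun r : R => (r, t)) F) => //.
by apply: cont_pair; [exact: cvg_id|exact: cvg_cst].
Qed.

Lemma slice2 (F : plane -> R[i]) (r t : R) : (forall p, ccont F p) -> ccont (fun t : R => F (r, t)) t.
Proof.
move=> cF; apply: (@ccont_comp R _ _ (fun t : R => (r, t)) F) => //.
by apply: cont_pair; [exact: cvg_cst|exact: cvg_id].
Qed.

Lemma ccont_id (x : R) : ccont (fun r : R => r%:C) x.
Proof. by apply: ccontR; exact: cvg_id. Qed.

Lemma cderiv_id (x : R) : cderiv (fun r : R => r%:C) x 1 (1 : R[i]).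
Proof. by rewrite -(rmorph1 (real_complex R)); apply: cderivR; exact: is_derive_id. Qed.

Lemma realC_neq0 (x : R) : x != 0 -> x%:C != 0 :> R[i].
Proof. by move=> x0; apply/eqP => -[] /eqP; rewrite (negbTE x0). Qed.

Lemma near_itv_oo (a b x : R) (P : R -> Prop) : a < x < b ->
  (forall s, a < s < b -> P s) -> \forall s \near x, P s.
Proof.
move=> xab HP; have : nbhs x (`]a, b[%classic : set R).
  by apply: open_nbhs_nbhs; split; [exact: interval_open|rewrite /= in_itv].
by apply: filterS => s; rewrite /= in_itv /=; exact: HP.
Qed.

Lemma cderiv_primitive (h : R -> R[i]) (a b x : R) : ccontI a b h -> a < x < b ->
  cderiv (fun y => Cintegral a y h) x 1 (h x).
Proof.
move=> ch xab; split.
  exact: (intab_deriv (ccontI_Re ch) xab).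
exact: (intab_deriv (ccontI_Im ch) xab).
Qed.

Lemma cconst_of_deriv0 (u : R -> R[i]) (a b : R) : a <= b ->
  (forall x, a <= x <= b -> ccont u x) ->
  (forall x, a < x < b -> cderiv u x 1 0) -> u b = u a.
Proof.
move=> ab cu du; apply/eqP; rewrite -subr_eq0; apply/eqP/normc_eq0P.
apply/eqP; rewrite eq_le normc_ge0 andbT.
have := @normc_increment_cst R u (fun=> 0) 0 a b ab cu du.
by rewrite mul0r mulr0; apply => x _; rewrite Normc.normc0.
Qed.

(** Here [q] is continuous on the line, and [k] and its derivatives have already
    been extended from the closed rectangle to the plane. *)
Section Goursat.
Variables (rho : R) (q : R -> R[i]) (k kr kt krr krt ktr : plane -> R[i]).
Hypothesis rho0 : 0 < rho.
Hypothesis cq : forall r : R, ccont q r.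
Hypothesis ck : cclamped rho k.
Hypothesis ckr : cclamped rho kr.
Hypothesis ckt : cclamped rho kt.
Hypothesis ckrr : forall p, ccont krr p.
Hypothesis ckrt : forall p, ccont krt p.
Hypothesis dk : forall p, rect rho p -> [/\ cderiv k p (e_x R) (kr p), cderiv k p (e_y R) (kt p),
  cderiv kr p (e_x R) (krr p), cderiv kr p (e_y R) (krt p) & cderiv kt p (e_x R) (ktr p)].
Hypothesis pde : forall r t : R, 0 < r < rho -> 0 < t < 1 ->
  r%:C * (krr (r, t) - q r * k (r, t)) - kr (r, t) + 2 * (1 - t%:C) * krt (r, t) = 0.
Hypothesis k_bottom : forall r : R, 0 <= r < rho ->
  k (r, 0) = Cintegral 0 r (fun tau => tau%:C * q tau).
Hypothesis k_left : forall t : R, 0 <= t <= 1 -> k (0, t) = 0.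

Let dkx (r t : R) : 0 < r < rho -> 0 <= t <= 1 -> cderiv (fun r : R => k (r, t)) r 1 (kr (r, t)).
Proof.
move=> rr tt; apply: (@cderiv_trace_x R k kr 0 rho 0 1 r t ltr01) => //.
- by case: ck.
- by case: ckr.
- by move=> x y hx hy; have [] := dk ((rectP _ _ _).2 (conj hx hy)).
Qed.

Let dkrx (r t : R) : 0 < r < rho -> 0 <= t <= 1 -> cderiv (fun r : R => kr (r, t)) r 1 (krr (r, t)).
Proof.
move=> rr tt; apply: (@cderiv_trace_x R kr krr 0 rho 0 1 r t ltr01) => //.
- by case: ckr.
- by move=> x y hx hy; have [] := dk ((rectP _ _ _).2 (conj hx hy)).
Qed.

Let dky (r t : R) : 0 <= r <= rho -> 0 < t < 1 -> cderiv (fun t : R => k (r, t)) t 1 (kt (r, t)).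
Proof.
move=> rr tt; apply: (@cderiv_trace_y R k kt 0 rho 0 1 r t rho0) => //.
- by case: ck.
- by case: ckt.
- by move=> x y hx hy; have [] := dk ((rectP _ _ _).2 (conj hx hy)).
Qed.

Let dkry (r t : R) : 0 <= r <= rho -> 0 < t < 1 -> cderiv (fun t : R => kr (r, t)) t 1 (krt (r, t)).
Proof.
move=> rr tt; apply: (@cderiv_trace_y R kr krt 0 rho 0 1 r t rho0) => //.
- by case: ckr.
- by move=> x y hx hy; have [] := dk ((rectP _ _ _).2 (conj hx hy)).
Qed.

Lemma kr_bottom (r : R) : 0 < r < rho -> kr (r, 0) = r%:C * q r.
Proof.
move=> rr; have t0 : 0 <= (0 : R) <= 1 by rewrite lexx ler01.
have d1 := dkx rr t0.
have ci : ccontI 0 rho (fun tau : R => tau%:C * q tau).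
  by move=> s _; apply: ccontM => //; exact: ccont_id.
have d2 : cderiv (fun r : R => k (r, 0)) r 1 (r%:C * q r).
  apply: near_cderiv (cderiv_primitive ci rr).
  by apply: near_itv_oo rr _ => s /andP[s0 s1]; rewrite k_bottom// ltW.
by rewrite -(cderiv_Cderive d1) (cderiv_Cderive d2).
Qed.

(** On the side [r = 0] the equation reduces to [2 (1 - t) k_rt = k_r]; hence
    [(1 - t) k_r ^+ 2] does not depend on [t], and it vanishes for [t = 0]. *)
Lemma kr_left (t : R) : 0 <= t <= 1 -> kr (0, t) = 0.
Proof.
have kr00 : kr (0, 0) = 0.
  have := @ceq0_closed_itv R (fun r : R => kr (r, 0) - r%:C * q r) 0 rho 0 rho0.
  rewrite /= mul0r subr0; apply.
  - apply: ccontB; first by apply: slice1; case: ckr.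
    by apply: ccontM => //; exact: ccont_id.
  - by move=> s sr; rewrite kr_bottom// subrr.
  - by rewrite lexx ltW.
have ode (s : R) : 0 < s < 1 -> 2 * (1 - s%:C) * krt (0, s) = kr (0, s).
  move=> s01.
  have := @ceq0_closed_itv R (fun r : R => r%:C * (krr (r, s) - q r * k (r, s)) - kr (r, s)
     + 2 * (1 - s%:C) * krt (r, s)) 0 rho 0 rho0.
  rewrite /= mul0r sub0r => H.
  apply/eqP; rewrite -subr_eq0 addrC; apply/eqP; apply: H.
  - apply: ccontD; last by apply: ccontM; [exact: ccont_cst|exact: slice1].
    apply: ccontB; last by apply: slice1; case: ckr.
    apply: ccontM; first exact: ccont_id.
    apply: ccontB; first exact: slice1.
    by apply: ccontM => //; apply: slice1; case: ck.
  - by move=> r rr; exact: pde.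
  - by rewrite lexx ltW.
have zero (s : R) : 0 < s < 1 -> kr (0, s) = 0.
  move=> /andP[s0 s1].
  have cst : (1 - s%:C) * (kr (0, s) * kr (0, s)) = (1 - (0:R)%:C) * (kr (0, 0) * kr (0, 0)).
    apply: (@cconst_of_deriv0 (fun s : R => (1 - s%:C) * (kr (0, s) * kr (0, s))) 0 s (ltW s0)).
      move=> x _; apply: ccontM; first by apply: ccontB; [exact: ccont_cst|exact: ccont_id].
      by apply: ccontM; apply: slice2; case: ckr.
    move=> x /andP[x0 xs]; have x01 : 0 < x < 1 by rewrite x0 (lt_trans xs).
    have d := dkry (_ : 0 <= 0 <= rho) x01; rewrite lexx (ltW rho0) in d.
    have {}d := d isT.
    apply: cderiv_eq.
      apply: cderivM; last exact: (cderivM d d).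
      by apply: cderivB; [exact: cderiv_cst|exact: cderiv_id].
    by have <- := ode x x01; ring.
  move: cst; rewrite kr00 mulr0 mulr0 => /eqP; rewrite mulf_eq0 => /orP[].
    rewrite -(rmorph1 (real_complex R)) -rmorphB => /eqP[] /eqP; rewrite subr_eq0 => /eqP e.
    by move: s1; rewrite -e ltxx.
  by rewrite mulf_eq0 orbb => /eqP.
move=> tt; apply: (@ceq0_closed_itv R (fun t : R => kr (0, t)) 0 1 t ltr01) => //.
by apply: slice2; case: ckr.
Qed.

Lemma kt_left (t : R) : 0 < t < 1 -> kt (0, t) = 0.
Proof.
move=> tt; have d1 := dky (_ : 0 <= 0 <= rho) tt; rewrite lexx (ltW rho0) in d1.
have {}d1 := d1 isT.
have d2 : cderiv (fun t : R => k (0, t)) t 1 0.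
  apply: near_cderiv (cderiv_cst 0 t (1 : R)).
  by apply: near_itv_oo tt _ => s /andP[s0 s1]; rewrite k_left// !ltW.
by rewrite -(cderiv_Cderive d1) (cderiv_Cderive d2).
Qed.

(** Integrating [krr] twice from the side [r = 0], where [k] and [kr] vanish. *)
Lemma goursat_regular : exists2 C, 0 <= C & regular_kernel rho C k kr kt.
Proof.
have [M M0 HM] := ccont_bounded 0 rho 0 1 ckrr.
have cl01 (t : R) : 0 <= clamp 0 1 t <= 1 by apply: clamp_in.
have clr (r : R) : 0 <= r -> 0 <= clamp 0 rho r <= rho /\ clamp 0 rho r <= r.
  move=> r0; split; first by apply: clamp_in; exact: ltW.
  by rewrite /clamp ge_max r0 ge_min lexx orbT.
have bkr (r t : R) : 0 <= r <= rho -> 0 <= t <= 1 -> normc (kr (r, t)) <= 2 * M * r.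
  move=> /andP[r0 rr] tt.
  have := @normc_increment_cst R (fun r : R => kr (r, t)) (fun r : R => krr (r, t)) M 0 r r0.
  rewrite kr_left// !subr0 -mulrA; apply.
  - by move=> x _; apply: slice1; case: ckr.
  - by move=> x /andP[x0 xr]; apply: dkrx; rewrite // x0 (lt_le_trans xr).
  - by move=> x /andP[x0 xr]; apply: HM; rewrite // ltW//= (le_trans (ltW xr)).
have bk (r t : R) : 0 <= r <= rho -> 0 <= t <= 1 -> normc (k (r, t)) <= 4 * M * r ^+ 2.
  move=> /andP[r0 rr] tt.
  have := @normc_increment_cst R (fun r : R => k (r, t)) (fun r : R => kr (r, t)) (2 * M * r) 0 r r0.
  rewrite k_left// !subr0 => H; apply: le_trans (H _ _ _) _.
  - by move=> x _; apply: slice1; case: ck.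
  - by move=> x /andP[x0 xr]; apply: dkx; rewrite // x0 (lt_le_trans xr).
  - move=> x /andP[x0 xr]; apply: le_trans (bkr _ _ _ tt) _.
      by rewrite ltW//= (le_trans (ltW xr)).
    by rewrite ler_wpM2l ?mulr_ge0// ltW.
  - by rewrite expr2; lra.
have C0 : 0 <= 4 * M by rewrite mulr_ge0.
exists (4 * M); [exact: C0|split].
- by case: ck.
- by case: ckr.
- by case: ckt.
- exact: dkx.
- by move=> r t /andP[/ltW r0 /ltW r1] tt; apply: dky; rewrite // r0.
- move=> r t r0; have [h1 h2] := clr _ r0; have [_ ->] := ck.
  rewrite /clamp2 /=; apply: (le_trans (bk _ _ h1 (cl01 t))).
  rewrite ler_wpM2l// ler_pXn2r ?nnegrE//; by case/andP: h1.
- move=> r t r0; have [h1 h2] := clr _ r0; have [_ ->] := ckr.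
  rewrite /clamp2 /=; apply: (le_trans (bkr _ _ h1 (cl01 t))).
  apply: (le_trans (ler_wpM2l _ h2)); first by rewrite mulr_ge0.
  by rewrite ler_wpM2r//; lra.
Qed.

End Goursat.

(** Two kernels [a] and [b] whose operators intertwine the Cauchy-Riemann system
    with the Vekua system of [f], where [phi r = r f'(r) / f(r)]. The identities
    [tp_1] and [tp_2] are equivalent to the two first-order identities of
    [goursat_uniqueness]; exchanging [a] and [b] amounts to replacing [f] by
    [1 / f], that is, [phi] by [- phi]. *)
Record transmutation_pair (rho C : R) (phi : R -> R[i])
    (a ar at' b br bt : plane -> R[i]) : Prop := TransmutationPair {
  tp_a : regular_kernel rho C a ar at';
  tp_b : regular_kernel rho C b br bt;
  tp_1 : forall r t : R, 0 < r < rho -> 0 <= t <= 1 ->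
    r%:C * ar (r, t) - (a (r, t) - b (r, t))
      + (1 - t%:C) * (at' (r, t) - bt (r, t)) - phi r * a (r, t) = 0;
  tp_2 : forall r t : R, 0 < r < rho -> 0 <= t <= 1 ->
    r%:C * br (r, t) + (a (r, t) - b (r, t))
      - (1 - t%:C) * (at' (r, t) - bt (r, t)) + phi r * b (r, t) = 0;
  tp_3 : forall r : R, 0 < r < rho -> a (r, 0) - b (r, 0) = 2 * phi r }.

Lemma transmutation_pair_swap rho C phi a ar at' b br bt :
  transmutation_pair rho C phi a ar at' b br bt ->
  transmutation_pair rho C (fun r => - phi r) b br bt a ar at'.
Proof.
move=> [ra rb h1 h2 h3]; split => //.
- by move=> r t rr tt; rewrite -(h2 r t rr tt); ring.
- by move=> r t rr tt; rewrite -(h1 r t rr tt); ring.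
- by move=> r rr; rewrite mulrN -h3// opprB.
Qed.

Lemma regular_kernel_le rho C C' k kr kt : C <= C' ->
  regular_kernel rho C k kr kt -> regular_kernel rho C' k kr kt.
Proof.
move=> CC' [h1 h2 h3 h4 h5 h6 h7]; split => //.
- by move=> r t r0; rewrite (le_trans (h6 _ _ r0))// ler_wpM2r// exprn_ge0.
- by move=> r t r0; rewrite (le_trans (h7 _ _ r0))// ler_wpM2r.
Qed.

End Kernels.

(** * The kernels of f and 1 / f form a transmutation pair *)

Section KernelTransmutation.
Variable R : realType.
Local Notation plane := (R * R)%type.
Local Notation normc := (@Normc.normc R).

Let eq_of_sub0 (x y z : R[i]) : z = 0 -> x - y = z -> x = y.
Proof. by move=> -> /eqP; rewrite subr_eq0 => /eqP. Qed.

(** Complex version of [schwarz]. *)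
Lemma cschwarz (F Fx Fy Fxy Fyx : plane -> R[i]) (p : plane) :
  (\forall q \near p, cderiv F q (e_x R) (Fx q)) ->
  (\forall q \near p, cderiv F q (e_y R) (Fy q)) ->
  (\forall q \near p, cderiv Fx q (e_y R) (Fxy q)) ->
  (\forall q \near p, cderiv Fy q (e_x R) (Fyx q)) ->
  ccont Fxy p -> ccont Fyx p -> Fxy p = Fyx p.
Proof.
move=> d1 d2 d3 d4 [c1 c2] [c3 c4]; apply: complex_ext.
  apply: (@schwarz R (fun q => complex.Re (F q)) (fun q => complex.Re (Fx q))
    (fun q => complex.Re (Fy q)) (fun q => complex.Re (Fxy q)) (fun q => complex.Re (Fyx q))) => //.
  - by apply: filterS d1 => q [].
  - by apply: filterS d2 => q [].
  - by apply: filterS d3 => q [].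
  - by apply: filterS d4 => q [].
apply: (@schwarz R (fun q => complex.Im (F q)) (fun q => complex.Im (Fx q))
  (fun q => complex.Im (Fy q)) (fun q => complex.Im (Fxy q)) (fun q => complex.Im (Fyx q))) => //.
- by apply: filterS d1 => q [].
- by apply: filterS d2 => q [].
- by apply: filterS d3 => q [].
- by apply: filterS d4 => q [].
Qed.

(** A Goursat kernel, extended to the whole plane together with its partial
    derivatives of order at most two. *)
Lemma is_kernel_data (rho : R) (q q0 : R -> R[i]) (G : plane -> R[i]) : 0 < rho ->
  (forall r : R, ccont q0 r) -> (forall r, 0 < r < rho -> q0 r = q r) ->
  is_kernel rho q G ->
  exists C k kr kt krr krt ktr,
  [/\ 0 <= C /\ regular_kernel rho C k kr kt,
      [/\ forall p, ccont krr p, forall p, ccont krt p & forall p, ccont ktr p],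
      forall r t : R, 0 <= r <= rho -> 0 <= t <= 1 -> k (r, t) = G (r, t),
      [/\ forall r t : R, 0 < r < rho -> 0 < t < 1 ->
            r%:C * (krr (r, t) - q0 r * k (r, t)) - kr (r, t) + 2 * (1 - t%:C) * krt (r, t) = 0,
          forall r : R, 0 < r < rho -> kr (r, 0) = r%:C * q0 r,
          forall t : R, 0 < t < 1 -> k (0, t) = 0 &
          forall t : R, 0 < t < 1 -> kt (0, t) = 0] &
      forall p, rect rho p -> [/\ cderiv k p (e_x R) (kr p), cderiv k p (e_y R) (kt p),
        cderiv kr p (e_x R) (krr p), cderiv kr p (e_y R) (krt p) &
        cderiv kt p (e_x R) (ktr p)] /\ krt p = ktr p].
Proof.
move=> rho0 cq0 q0E [CG pde bot left].
have [k [kr [kt [krr [krt [ktr [[ck ckr ckt] [ckrr ckrt cktr] kG dk ke]]]]]]] := Ck_rect_data rho0 CG.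
have pde' (r t : R) : 0 < r < rho -> 0 < t < 1 ->
    r%:C * (krr (r, t) - q0 r * k (r, t)) - kr (r, t) + 2 * (1 - t%:C) * krt (r, t) = 0.
  move=> rr tt; have rp := (rectP _ _ _).2 (conj rr tt); have [-> -> ->] := ke _ rp.
  have := pde r t rr tt; rewrite q0E// kG; last 2 first.
    by case/andP: rr => /ltW -> /ltW ->.
    by case/andP: tt => /ltW -> /ltW ->.
  by rewrite rmorphB rmorph1.
have bot' (r : R) : 0 <= r < rho -> k (r, 0) = Cintegral 0 r (fun tau => tau%:C * q0 tau).
  move=> /andP[r0 rr]; rewrite kG ?bot ?lexx ?r0 ?ltW ?ler01//.
  apply: eq_Cint => s /andP[s0 sr].
  have [->|sn0] := eqVneq s 0; first by rewrite !mul0r.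
  by rewrite q0E// lt_def sn0 s0 (le_lt_trans sr).
have left' (t : R) : 0 <= t <= 1 -> k (0, t) = 0.
  by move=> tt; rewrite kG ?lexx ?(ltW rho0)// left.
have [C C0 rk] := goursat_regular rho0 cq0 ck ckr ckt ckrr ckrt dk pde' bot' left'.
exists C, k, kr, kt, krr, krt, ktr; split => //.
  split => //.
  - by move=> r rr; exact: (kr_bottom cq0 ck ckr dk bot').
  - by move=> t /andP[/ltW t0 /ltW t1]; apply: left'; rewrite t0.
  - by move=> t tt; exact: (kt_left rho0 ck ckt dk left').
move=> p rp; split; first exact: dk.
apply: (@cschwarz k kr kt) => //.
- by apply: (near_rect _ rp) => r t rr tt; have [] := dk _ ((rectP _ _ _).2 (conj rr tt)).
- by apply: (near_rect _ rp) => r t rr tt; have [] := dk _ ((rectP _ _ _).2 (conj rr tt)).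
- by apply: (near_rect _ rp) => r t rr tt; have [] := dk _ ((rectP _ _ _).2 (conj rr tt)).
- by apply: (near_rect _ rp) => r t rr tt; have [] := dk _ ((rectP _ _ _).2 (conj rr tt)).
Qed.

Variables (rho : R) (q f : R -> R[i]) (Gf Ginv : plane -> R[i]).
Hypothesis rho0 : 0 < rho.
Hypothesis q_C1 : Ck_itv 1 rho q.
Hypothesis f_C2 : Ck_itv 2 rho f.
Hypothesis f_neq0 : forall r : R, 0 <= r <= rho -> f r != 0.
Hypothesis f_eq : forall r : R, 0 < r < rho ->
    Cder (Cder f) r + (r^-1)%:C * Cder f r - q r * f r = 0.
Hypothesis Gf_kernel : is_kernel rho q Gf.
Hypothesis Ginv_kernel : is_kernel rho (q_inv f q) Ginv.

(** The Goursat kernels of [f] and [1 / f] form a transmutation pair. *)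
Lemma kernel_transmutation : exists C phi a ar at' b br bt,
  [/\ 0 <= C, transmutation_pair rho C phi a ar at' b br bt,
      forall r t : R, 0 <= r <= rho -> 0 <= t <= 1 -> a (r, t) = Gf (r, t) /\ b (r, t) = Ginv (r, t),
      forall r : R, ccont phi r &
      forall r : R, 0 < r < rho -> cderiv f r 1 (phi r / r%:C * f r)].
Proof.
have cf0 := Ck_itv1_data rho0 f_C2.
have cq0 := Ck_itv1_data rho0 q_C1.
have [f1 [f2 [cf1 cf2 df ef]]] := Ck_itv2_data rho0 f_C2.
pose f0 (r : R) := f (clamp 0 rho r); pose q0 (r : R) := q (clamp 0 rho r).
have f0n (r : R) : f0 r != 0 by apply: f_neq0; apply: clamp_in; exact: ltW.
have incl (r : R) : 0 < r < rho -> 0 <= r <= rho by case/andP => /ltW -> /ltW ->.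
have f0E (r : R) : 0 < r < rho -> f0 r = f r by move=> /incl rr; rewrite /f0 clampE.
have q0E (r : R) : 0 < r < rho -> q0 r = q r by move=> /incl rr; rewrite /q0 clampE.
pose psi (r : R) := f1 r / f0 r.
have cpsi (r : R) : ccont psi r by apply: ccontM => //; apply: ccontV.
pose phi (r : R) := r%:C * psi r.
have cphi (r : R) : ccont phi r by apply: ccontM => //; exact: ccont_id.
(* [dphi] is [phi']; the equation of [f] turns it into the Riccati equation [rdphi]. *)
pose dphi (r : R) := psi r + r%:C * (f2 r / f0 r - psi r ^+ 2).
have rn0 (r : R) : 0 < r < rho -> r%:C != 0 :> R[i].
  by case/andP=> r0 _; apply: realC_neq0; rewrite gt_eqF.
have dphiE (r : R) : 0 < r < rho -> cderiv phi r 1 (dphi r).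
  move=> rr; have [d1 d2] := df _ rr.
  have d0 : cderiv f0 r 1 (f1 r).
    by apply: near_cderiv d1; apply: near_itv_oo rr _ => s sr; rewrite f0E.
  apply: cderiv_eq; first exact: (cderivM (cderiv_id r) (cderivM d2 (cderivV (f0n r) d0))).
  by rewrite /dphi /psi; have := f0n r; move: (f0 r) => z zn0; field.
have rdphi (r : R) : 0 < r < rho -> r%:C * dphi r = r%:C ^+ 2 * q0 r - phi r ^+ 2.
  move=> rr; have := f_eq rr; have [<- <-] := ef _ rr; rewrite -f0E// -q0E// => e.
  have {}e : f2 r = q0 r * f0 r - (r^-1)%:C * f1 r.
    by apply/eqP; rewrite -subr_eq0 -e; apply/eqP; ring.
  rewrite /dphi /phi /psi e; have := f0n r; have := rn0 r rr.
  rewrite fmorphV /=.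
  by move: (f0 r) (r%:C) (q0 r) (f1 r) => z x qq y xn0 zn0; field; rewrite xn0 zn0.
have [M M0 HM] := @ccont_bounded R (fun p => psi p.1) 0 rho 0 1
  (fun p => @ccont_comp R _ _ (@fst R R) psi p cvg_fst (cpsi p.1)).
have phiC (r : R) : 0 < r < rho -> normc (phi r) <= M * r.
  move=> rr; rewrite Normc.normcM normcR; case/andP: (rr) => r0 _.
  rewrite (gtr0_norm r0) mulrC ler_wpM2r ?(ltW r0)//.
  by apply: (HM r 0); [exact: incl|rewrite lexx ler01].
pose qi (r : R) := 2 * psi r ^+ 2 - q0 r.
have cqi (r : R) : ccont qi r.
  exact: (ccontB (ccontM (ccont_cst _ _) (ccontX 2 (cpsi r))) (cq0 r)).
have qiE (r : R) : 0 < r < rho -> qi r = q_inv f q r.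
  by move=> rr; rewrite /qi /q_inv /psi f0E// q0E//; have [-> _] := ef _ rr.
have [Ca [a [ar [at' [arr [art [atr [[Ca0 ra] [carr cart catr] aE [pa ba la lta] da]]]]]]]] :=
  is_kernel_data rho0 cq0 q0E Gf_kernel.
have [Cb [b [br [bt [brr [brt [btr [[Cb0 rb] [cbrr cbrt cbtr] bE [pb bb lb ltb] db]]]]]]]] :=
  is_kernel_data rho0 cqi qiE Ginv_kernel.
(* On [t = 0] the [r]-derivative of [a - b] is [r (q_f - q_(1/f)) = 2 phi']. *)
have D0 (r : R) : 0 < r < rho -> a (r, 0) - b (r, 0) = 2 * phi r.
  move=> rr; case/andP: (rr) => r0 r1.
  apply/eqP; rewrite -subr_eq0; apply/eqP.
  pose g (s : R) := a (s, 0) - b (s, 0) - 2 * phi s.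
  have cg (s : R) : ccont g s.
    apply: ccontB; last by apply: ccontM; [exact: ccont_cst|exact: cphi].
    by apply: ccontB; apply: slice1; [case: ra|case: rb].
  have -> : a (r, 0) - b (r, 0) - 2 * phi r = g 0.
    apply: (@cconst_of_deriv0 R g 0 r (ltW r0)) => // x /andP[x0 xr].
    have xx : 0 < x < rho by rewrite x0 (lt_trans xr).
    have t0 : 0 <= (0 : R) <= 1 by rewrite lexx ler01.
    apply: cderiv_eq.
      apply: cderivB; first exact: (cderivB (rk_deriv_r ra xx t0) (rk_deriv_r rb xx t0)).
      exact: (cderivM (cderiv_cst _ _ _) (dphiE _ xx)).
    rewrite ba// bb//; apply: (mulfI (rn0 _ xx)).
    have -> : x%:C * (x%:C * q0 x - x%:C * qi x - (0 * phi x + 2 * dphi x)) =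
      x%:C ^+ 2 * (q0 x - qi x) - 2 * (x%:C * dphi x) by ring.
    by rewrite rdphi// /qi /phi; ring.
  have k0 (k kr kt : plane -> R[i]) C : regular_kernel rho C k kr kt -> k (0, 0) = 0.
    move=> rk; apply: normc_eq0P; apply/eqP; rewrite eq_le normc_ge0 andbT.
    by have := rk_bound rk 0 (lexx 0); rewrite expr0n mulr0.
  by rewrite /g (k0 _ _ _ _ ra) (k0 _ _ _ _ rb) /phi mul0r mulr0 !subr0.
have dd r t (rr : 0 < r < rho) (tt : 0 < t < 1) := da _ ((rectP _ _ _).2 (conj rr tt)).
have ee r t (rr : 0 < r < rho) (tt : 0 < t < 1) := db _ ((rectP _ _ _).2 (conj rr tt)).
have uniq (r t : R) : 0 < r < rho -> 0 < t < 1 ->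
  r%:C * (ar (r, t) + br (r, t)) = phi r * (a (r, t) - b (r, t)) /\
  r%:C * (ar (r, t) - br (r, t)) - 2 * (a (r, t) - b (r, t))
    + 2 * (1 - t%:C) * (at' (r, t) - bt (r, t)) = phi r * (a (r, t) + b (r, t)).
  move=> rr tt.
  apply: (@goursat_uniqueness R rho (fun p => a p + b p) (fun p => ar p + br p)
    (fun p => arr p + brr p) (fun p => art p + brt p) (fun p => a p - b p)
    (fun p => ar p - br p) (fun p => at' p - bt p) (fun p => arr p - brr p)
    (fun p => art p - brt p) (fun p => atr p - btr p) phi dphi M).
  - by move=> p; exact: (ccontD (rk_cont ra p) (rk_cont rb p)).
  - by move=> p; exact: (ccontD (rk_cont_r ra p) (rk_cont_r rb p)).
  - by move=> p; exact: (ccontD (carr p) (cbrr p)).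
  - by move=> p; exact: (ccontD (cart p) (cbrt p)).
  - by move=> p; exact: (ccontB (rk_cont ra p) (rk_cont rb p)).
  - by move=> p; exact: (ccontB (rk_cont_r ra p) (rk_cont_r rb p)).
  - by move=> p; exact: (ccontB (rk_cont_t ra p) (rk_cont_t rb p)).
  - exact: cphi.
  - move=> x y hx hy; have [[d1 _ _ _ _] _] := dd _ _ hx hy; have [[e1 _ _ _ _] _] := ee _ _ hx hy.
    exact: (cderivD d1 e1).
  - move=> x y hx hy; have [[_ _ d1 _ _] _] := dd _ _ hx hy; have [[_ _ e1 _ _] _] := ee _ _ hx hy.
    exact: (cderivD d1 e1).
  - move=> x y hx hy; have [[_ _ _ d1 _] _] := dd _ _ hx hy; have [[_ _ _ e1 _] _] := ee _ _ hx hy.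
    exact: (cderivD d1 e1).
  - move=> x y hx hy; have [[d1 _ _ _ _] _] := dd _ _ hx hy; have [[e1 _ _ _ _] _] := ee _ _ hx hy.
    exact: (cderivB d1 e1).
  - move=> x y hx hy; have [[_ d1 _ _ _] _] := dd _ _ hx hy; have [[_ e1 _ _ _] _] := ee _ _ hx hy.
    exact: (cderivB d1 e1).
  - move=> x y hx hy; have [[_ _ d1 _ _] _] := dd _ _ hx hy; have [[_ _ e1 _ _] _] := ee _ _ hx hy.
    exact: (cderivB d1 e1).
  - move=> x y hx hy; have [[_ _ _ _ d1] _] := dd _ _ hx hy; have [[_ _ _ _ e1] _] := ee _ _ hx hy.
    exact: (cderivB d1 e1).
  - by move=> x y hx hy; have [_ ->] := dd _ _ hx hy; have [_ ->] := ee _ _ hx hy.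
  - exact: dphiE.
  - exact: phiC.
  - move=> x y hx hy; rewrite rdphi//.
    have e1 := pa x y hx hy; have e2 := pb x y hx hy.
    have E := congr1 ( *%R x%:C) (f_equal2 (@GRing.add R[i]) e1 e2).
    rewrite addr0 mulr0 in E; apply: (eq_of_sub0 E); rewrite /qi /phi /q0; ring.
  - move=> x y hx hy; rewrite rdphi//.
    have e1 := pa x y hx hy; have e2 := pb x y hx hy.
    have E := congr1 ( *%R x%:C) (f_equal2 (fun u v : R[i] => u - v) e1 e2).
    rewrite subr0 mulr0 in E; apply: (eq_of_sub0 E); rewrite /qi /phi /q0; ring.
  - by move=> x hx; rewrite ba// bb// D0// /qi /phi /q0; ring.
  - by move=> y hy; rewrite la// lb// subr0.
  - by move=> y hy; rewrite lta// ltb// subr0.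
  - by rewrite /phi mul0r.
  - exact: rr.
  - exact: tt.
have two0 : (2 : R[i]) != 0 by rewrite pnatr_eq0.
have CC1 : Ca <= Num.max Ca Cb by rewrite le_max lexx.
have CC2 : Cb <= Num.max Ca Cb by rewrite le_max lexx orbT.
have cl (F : R -> R[i]) (t : R) : ccont F t -> (forall s : R, 0 < s < 1 -> F s = 0) -> 0 <= t <= 1 -> F t = 0.
  by move=> cF F0 tt; exact: (ceq0_closed_itv ltr01 cF F0 tt).
have ct (k : plane -> R[i]) (r t : R) : (forall p, ccont k p) -> ccont (fun t : R => k (r, t)) t.
  exact: slice2.
exists (Num.max Ca Cb), phi, a, ar, at', b, br, bt; split.
- by rewrite le_max Ca0.
- split.
  + exact: regular_kernel_le CC1 ra.
  + exact: regular_kernel_le CC2 rb.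
  + move=> r t rr tt.
    apply: (cl (fun t : R => r%:C * ar (r, t) - (a (r, t) - b (r, t))
      + (1 - t%:C) * (at' (r, t) - bt (r, t)) - phi r * a (r, t))); last exact: tt.
      have h1 := ct a r t (rk_cont ra); have h2 := ct b r t (rk_cont rb).
      have h3 := ct ar r t (rk_cont_r ra).
      have h4 := ct at' r t (rk_cont_t ra); have h5 := ct bt r t (rk_cont_t rb).
      apply: ccontB; last exact: (ccontM (ccont_cst _ _) h1).
      apply: ccontD; first exact: (ccontB (ccontM (ccont_cst _ _) h3) (ccontB h1 h2)).
      exact: (ccontM (ccontB (ccont_cst _ _) (ccont_id t)) (ccontB h4 h5)).
    move=> s ss; have [u1 u2] := uniq r s rr ss; apply: (mulfI two0); rewrite mulr0.
    move/eqP: u1; rewrite -subr_eq0 => /eqP u1; move/eqP: u2; rewrite -subr_eq0 => /eqP u2.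
    have E := f_equal2 (@GRing.add R[i]) u1 u2.
    by rewrite addr0 in E; rewrite -E; ring.
  + move=> r t rr tt.
    apply: (cl (fun t : R => r%:C * br (r, t) + (a (r, t) - b (r, t))
      - (1 - t%:C) * (at' (r, t) - bt (r, t)) + phi r * b (r, t))); last exact: tt.
      have h1 := ct a r t (rk_cont ra); have h2 := ct b r t (rk_cont rb).
      have h3 := ct br r t (rk_cont_r rb).
      have h4 := ct at' r t (rk_cont_t ra); have h5 := ct bt r t (rk_cont_t rb).
      apply: ccontD; last exact: (ccontM (ccont_cst _ _) h2).
      apply: ccontB; first exact: (ccontD (ccontM (ccont_cst _ _) h3) (ccontB h1 h2)).
      exact: (ccontM (ccontB (ccont_cst _ _) (ccont_id t)) (ccontB h4 h5)).
    move=> s ss; have [u1 u2] := uniq r s rr ss; apply: (mulfI two0); rewrite mulr0.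
    move/eqP: u1; rewrite -subr_eq0 => /eqP u1; move/eqP: u2; rewrite -subr_eq0 => /eqP u2.
    have E := f_equal2 (fun u v : R[i] => u - v) u1 u2.
    by rewrite subr0 in E; rewrite -E; ring.
  + exact: D0.
- by move=> r t rr tt; rewrite aE// bE.
- exact: cphi.
- move=> r rr; have [d1 _] := df _ rr; apply: cderiv_eq; first exact: d1.
  rewrite -f0E// /phi /psi; have := rn0 _ rr; have := f0n r.
  by move: (f0 r) (r%:C) => z x zn0 xn0; field; rewrite xn0 zn0.
Qed.

End KernelTransmutation.

(** * Transmutation operators and their intertwining properties *)

Section Operators.
Variable R : realType.
Local Notation plane := (R * R)%type.
Local Notation normc := (@Normc.normc R).
Local Notation cabs := (@cabs R).

Lemma cabs_ge0 (z : plane) : 0 <= cabs z.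
Proof. exact: sqrtr_ge0. Qed.

Lemma sqr_cabs (z : plane) : cabs z ^+ 2 = z.1 ^+ 2 + z.2 ^+ 2.
Proof. by rewrite sqr_sqrtr// addr_ge0 ?sqr_ge0. Qed.

Lemma cabs_fst (z : plane) : `|z.1| <= cabs z.
Proof. by rewrite -(sqrtr_sqr z.1) ler_wsqrtr// lerDl sqr_ge0. Qed.

Lemma cabs_snd (z : plane) : `|z.2| <= cabs z.
Proof. by rewrite -(sqrtr_sqr z.2) ler_wsqrtr// lerDr sqr_ge0. Qed.

Lemma cabs0 : cabs (0, 0) = 0.
Proof. by rewrite /Defs.cabs /= expr0n addr0 sqrtr0. Qed.

Lemma cabs_gt0 (z : plane) : z != (0, 0) -> 0 < cabs z.
Proof.
case: z => x y zn; rewrite sqrtr_gt0 lt_def addr_ge0 ?sqr_ge0// andbT.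
by rewrite paddr_eq0 ?sqr_ge0// !sqrf_eq0.
Qed.

Lemma cabsZ (s : R) (z : plane) : 0 <= s -> cabs (s *: z) = s * cabs z.
Proof.
move=> s0; rewrite /Defs.cabs.
have -> : (s *: z).1 ^+ 2 + (s *: z).2 ^+ 2 = s ^+ 2 * (z.1 ^+ 2 + z.2 ^+ 2).
  by rewrite /= /GRing.scale /=; ring.
by rewrite sqrtrM ?sqr_ge0// sqrtr_sqr ger0_norm.
Qed.

Lemma continuous_cabs : continuous cabs.
Proof.
move=> z; apply: (@cont_comp _ _ _ (fun z : plane => z.1 ^+ 2 + z.2 ^+ 2) Num.sqrt).
  by apply: cvgD; apply: (@continuous_sqr R); [exact: cvg_fst|exact: cvg_snd].
exact: sqrt_continuous.
Qed.

Lemma is_derive_cabs_x (z : plane) : z != (0, 0) -> is_derive z (e_x R) cabs (z.1 / cabs z).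
Proof.
case: z => x y zn; apply/is_derive_e_x.
have r0 := cabs_gt0 zn.
have p0 : 0 < x ^+ 2 + y ^+ 2 by rewrite -(sqr_cabs (x, y)) exprn_gt0.
have d1 : is_derive x 1 (fun r : R => r ^+ 2 + y ^+ 2) (2 * x).
  by apply: is_derive_eq; rewrite /GRing.scale /=; ring.
have h := @is_derive_comp1 R Num.sqrt (fun r : R => r ^+ 2 + y ^+ 2) x _ _ (is_derive1_sqrt p0) d1.
apply: is_derive_eq h _; rewrite -/(cabs (x, y)) /=.
by field; rewrite gt_eqF.
Qed.

Lemma is_derive_cabs_y (z : plane) : z != (0, 0) -> is_derive z (e_y R) cabs (z.2 / cabs z).
Proof.
case: z => x y zn; apply/is_derive_e_y.
have r0 := cabs_gt0 zn.
have p0 : 0 < x ^+ 2 + y ^+ 2 by rewrite -(sqr_cabs (x, y)) exprn_gt0.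
have d1 : is_derive y 1 (fun r : R => x ^+ 2 + r ^+ 2) (2 * y).
  by apply: is_derive_eq; rewrite /GRing.scale /=; ring.
have h := @is_derive_comp1 R Num.sqrt (fun r : R => x ^+ 2 + r ^+ 2) y _ _ (is_derive1_sqrt p0) d1.
apply: is_derive_eq h _; rewrite -/(cabs (x, y)) /=.
by field; rewrite gt_eqF.
Qed.

(** Chain rule for a function of the modulus. *)
Lemma cderiv_radial (u : R -> R[i]) (z v : plane) (c : R) d :
  cderiv u (cabs z) 1 d -> is_derive z v cabs c ->
  cderiv (fun z => u (cabs z)) z v (c%:C * d).
Proof.
move=> [du1 du2] /is_derive_line0 dc.
have e0 : cabs (0 *: v + z) = cabs z by rewrite scale0r add0r.
have -> : c%:C * d = (c * complex.Re d) +i* (c * complex.Im d).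
  by apply: complex_ext; rewrite ?(ReM, ImM) /= !mul0r ?subr0 ?addr0.
split; apply/is_derive_line0.
  apply: (@is_derive_comp1 R (fun r => complex.Re (u r)) (fun t => cabs (t *: v + z))) => //.
  by rewrite e0.
apply: (@is_derive_comp1 R (fun r => complex.Im (u r)) (fun t => cabs (t *: v + z))) => //.
by rewrite e0.
Qed.

Lemma cderiv_scale (h : plane -> R[i]) (c : R) (z v : plane) d :
  cderiv h (c *: z) v d -> cderiv (fun z => h (c *: z)) z v (c%:C * d).
Proof.
move=> [h1 h2].
have -> : c%:C * d = (c * complex.Re d) +i* (c * complex.Im d).
  by apply: complex_ext; rewrite ?(ReM, ImM) /= !mul0r ?subr0 ?addr0.
have key (F : plane -> R) (e : R) : is_derive (c *: z) v F e ->
    is_derive z v (fun z => F (c *: z)) (c * e).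
  move=> /is_derive_line0 dF; apply/is_derive_line0.
  have -> : (fun s : R => F (c *: (s *: v + z))) = (fun s => F ((c * s) *: v + c *: z)).
    by apply/funext => s; rewrite scalerDr scalerA.
  apply: (@is_derive_comp1 R (fun t => F (t *: v + c *: z)) ( *%R c)); first by rewrite mulr0.
  by apply: is_derive_eq; rewrite /GRing.scale /= mulr1.
by split; [exact: (key (fun z => complex.Re (h z)))|exact: (key (fun z => complex.Im (h z)))].
Qed.

Lemma continuous_scale2 (p : plane * R) : {for p, continuous (fun p : plane * R => (p.2 ^+ 2) *: p.1)}.
Proof.
apply: cvgZ; first by apply: (@continuous_sqr R); exact: cvg_snd.
exact: cvg_fst.
Qed.

(** Joint continuity of a kernel in the point and the parameter. *)
Definition jcont (a : plane -> R -> R[i]) :=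
  forall p : plane * R, ccont (fun p => a p.1 p.2) p.

(** The integral operator with kernel [a] along the dilations [z |-> s ^+ 2 *: z]. *)
Definition Op (a : plane -> R -> R[i]) (h : plane -> R[i]) (z : plane) : R[i] :=
  Cintegral 0 1 (fun s => a z s * h (s ^+ 2 *: z)).

Lemma Cint0 : Cintegral 0 1 (fun=> 0 : R[i]) = 0 :> R[i].
Proof.
by apply: complex_ext; rewrite /= -[LHS]/(intab 0 1 _) /= intab_cst ?mul0r.
Qed.

Section OnOmega.
Variable Omega : set plane.
Hypothesis oO : open Omega.
Hypothesis sO : starshaped0 Omega.

Lemma sq01 (s : R) : 0 <= s <= 1 -> 0 <= s ^+ 2 <= 1.
Proof. by move=> /andP[? ?]; rewrite exprn_ge0//= exprn_ile1. Qed.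

Lemma star_sq z (s : R) : Omega z -> 0 <= s <= 1 -> Omega (s ^+ 2 *: z).
Proof. by move=> Oz /sq01 ss; apply: sO.2. Qed.

Lemma near_Omega z (P : plane -> Prop) : (forall y, Omega y -> P y) -> Omega z ->
  \forall y \near z, P y.
Proof. by move=> HP Oz; have := open_nbhs_nbhs (conj oO Oz); apply: filterS. Qed.

Lemma Op_joint a h z (s : R) :
  jcont a ->
  (forall z, Omega z -> ccont h z) -> Omega z -> 0 <= s <= 1 ->
  ccont (fun p : plane * R => a p.1 p.2 * h (p.2 ^+ 2 *: p.1)) (z, s).
Proof.
move=> ca ch Oz ss; apply: ccontM; first exact: ca.
apply: (@ccont_comp R _ _ (fun p : plane * R => (p.2 ^+ 2) *: p.1) h).
  exact: continuous_scale2.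
by apply: ch; exact: star_sq.
Qed.

Lemma Op_integrand a h z :
  jcont a ->
  (forall z, Omega z -> ccont h z) -> Omega z ->
  ccontI 0 1 (fun s => a z s * h (s ^+ 2 *: z)).
Proof.
move=> ca ch Oz s ss.
exact: (@ccont_joint_snd R _ (fun z s => a z s * h (s ^+ 2 *: z)) z s (Op_joint ca ch Oz ss)).
Qed.

Lemma Op_cont a h z :
  jcont a ->
  (forall z, Omega z -> ccont h z) -> Omega z -> ccont (Op a h) z.
Proof.
move=> ca ch Oz; apply: (@ccont_Cint R _ 0 1 (fun z s => a z s * h (s ^+ 2 *: z))) => //.
by apply: near_Omega Oz => y Oy s ss; exact: Op_joint.
Qed.

Lemma Op_deriv a av h hv z v :
  jcont a ->
  jcont av ->
  (forall z (s : R), Omega z -> 0 <= s <= 1 -> cderiv (fun z => a z s) z v (av z s)) ->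
  (forall z, Omega z -> ccont h z) -> (forall z, Omega z -> ccont hv z) ->
  (forall z, Omega z -> cderiv h z v (hv z)) -> Omega z ->
  cderiv (Op a h) z v (Op av h z + Op (fun z s => a z s * (s ^+ 2)%:C) hv z).
Proof.
move=> ca cav da ch chv dh Oz.
have ca2 : jcont (fun z s => a z s * (s ^+ 2)%:C).
  move=> p; apply: ccontM; first exact: ca.
  by apply: ccontR; apply: (@continuous_sqr R); exact: cvg_snd.
rewrite /Op -CintD; [|exact: (Op_integrand cav ch Oz)|exact: (Op_integrand ca2 chv Oz)].
apply: (@cderiv_Cint R _ 0 1 (fun z s => a z s * h (s ^+ 2 *: z))
  (fun z s => av z s * h (s ^+ 2 *: z) + a z s * (s ^+ 2)%:C * hv (s ^+ 2 *: z))) => //.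
apply: near_Omega Oz => y Oy s ss; split.
- exact: Op_joint.
- by apply: ccontD; [exact: Op_joint|exact: (Op_joint ca2)].
- apply: cderiv_eq.
    apply: cderivM; first exact: da.
    by apply: (@cderiv_scale h (s ^+ 2)); apply: dh; exact: star_sq.
  by rewrite /= mulrA.
Qed.

(** [h] is of class [C^1] on [Omega], with partial derivatives [hx] and [hy]. *)
Record C1f (h hx hy : plane -> R[i]) : Prop := MkC1f {
  C1f_c : forall z, Omega z -> ccont h z;
  C1f_cx : forall z, Omega z -> ccont hx z;
  C1f_cy : forall z, Omega z -> ccont hy z;
  C1f_dx : forall z, Omega z -> cderiv h z (e_x R) (hx z);
  C1f_dy : forall z, Omega z -> cderiv h z (e_y R) (hy z) }.

Section Kernel.
Variables (rho C : R) (k kr kt : plane -> R[i]).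
Hypothesis rk : regular_kernel rho C k kr kt.
Hypothesis C0 : 0 <= C.
Hypothesis rhoO : forall z, Omega z -> cabs z < rho.

(** The kernel of [T_k] in the variables [z] and [s], and its derivatives in the two
    coordinates of [z]; at the origin, [z.1 / cabs z] is [0]. *)
Definition ker (k : plane -> R[i]) (z : plane) (s : R) : R[i] := s%:C * k (cabs z, 1 - s ^+ 2).
Definition kerx (z : plane) (s : R) : R[i] := s%:C * ((z.1 / cabs z)%:C * kr (cabs z, 1 - s ^+ 2)).
Definition kery (z : plane) (s : R) : R[i] := s%:C * ((z.2 / cabs z)%:C * kr (cabs z, 1 - s ^+ 2)).

Lemma cont_polar (p : plane * R) : {for p, continuous (fun p : plane * R => (cabs p.1, 1 - p.2 ^+ 2))}.
Proof.
apply: (@cont_pair _ _ _ (fun p : plane * R => cabs p.1) (fun p : plane * R => 1 - p.2 ^+ 2)).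
  by apply: (@cont_comp _ _ _ (@fst plane R) cabs); [exact: cvg_fst|exact: continuous_cabs].
apply: cvgB; first exact: cvg_cst.
by apply: (@continuous_sqr R); exact: cvg_snd.
Qed.

Lemma cont_radial (g : plane -> R[i]) (p : plane * R) : (forall q, ccont g q) ->
  ccont (fun p : plane * R => g (cabs p.1, 1 - p.2 ^+ 2)) p.
Proof.
move=> cg; apply: (@ccont_comp R _ _ (fun p : plane * R => (cabs p.1, 1 - p.2 ^+ 2)) g) => //.
exact: cont_polar.
Qed.

Lemma cont_s (p : plane * R) : ccont (fun p : plane * R => p.2%:C) p.
Proof. by apply: ccontR; exact: cvg_snd. Qed.

Lemma ker_cont (g : plane -> R[i]) : (forall q, ccont g q) -> jcont (ker g).
Proof. by move=> cg p; exact: (ccontM (cont_s p) (cont_radial p cg)). Qed.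

(** Although [c z / cabs z] is discontinuous at the origin, its product with [kr],
    which vanishes there, is continuous. *)
Lemma unit_coord_cont (c : plane -> R) (p : plane * R) :
  continuous c -> (forall z, `|c z| <= cabs z) ->
  ccont (fun p : plane * R => (c p.1 / cabs p.1)%:C * kr (cabs p.1, 1 - p.2 ^+ 2)) p.
Proof.
move=> cc c1; case: p => z s.
have [->|zn] := eqVneq z (0, 0); last first.
  apply: ccontM; last by apply: cont_radial; exact: rk_cont_r rk.
  apply: ccontR; apply: (@cont_comp _ _ _ (@fst plane R) (fun z => c z / cabs z)); first exact: cvg_fst.
  apply: cvgM; first exact: cc.
  by apply: cvgV; [rewrite gt_eqF// cabs_gt0|exact: continuous_cabs].
have small (q : plane * R) :
    normc ((c q.1 / cabs q.1)%:C * kr (cabs q.1, 1 - q.2 ^+ 2)) <= C * cabs q.1.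
  rewrite Normc.normcM normcR -[leRHS]mul1r ler_pM ?normc_ge0 ?normr_ge0//; last first.
    exact: rk_bound_r rk _ _ (cabs_ge0 _).
  rewrite normrM normfV (ger0_norm (cabs_ge0 _)).
  have [->|q0] := eqVneq (cabs q.1) 0; first by rewrite invr0 mulr0.
  by rewrite ler_pdivrMr ?mul1r// lt_def q0 cabs_ge0.
have lim : {for ((0, 0), s), continuous (fun q : plane * R => C * cabs q.1)}.
  apply: cvgM; first exact: cvg_cst.
  by apply: (@cont_comp _ _ _ (@fst plane R) cabs); [exact: cvg_fst|exact: continuous_cabs].
have key (g : plane * R -> R) : (forall q, `|g q| <= C * cabs q.1) ->
    {for ((0, 0), s), continuous g}.
  move=> gb; have g0 : g ((0, 0), s) = 0.
    by apply/normr0_eq0/eqP; rewrite eq_le normr_ge0 andbT (le_trans (gb _))//= cabs0 mulr0.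
  apply/cvgrPdist_le => e e0; rewrite g0.
  move/cvgrPdist_le : lim => /(_ _ e0); apply: filterS => q.
  rewrite /= cabs0 mulr0 !sub0r !normrN => h; rewrite (le_trans (gb q))//.
  by rewrite (le_trans (ler_norm _)).
split; apply: key => q; apply: le_trans (small q); [exact: normRe|exact: normIm].
Qed.

Lemma kerx_cont : jcont kerx.
Proof.
move=> p; apply: ccontM; first exact: cont_s.
by apply: (@unit_coord_cont fst); [move=> z; exact: cvg_fst|exact: cabs_fst].
Qed.

Lemma kery_cont : jcont kery.
Proof.
move=> p; apply: ccontM; first exact: cont_s.
by apply: (@unit_coord_cont snd); [move=> z; exact: cvg_snd|exact: cabs_snd].
Qed.

Lemma onem_sq01 (s : R) : 0 <= s <= 1 -> 0 <= 1 - s ^+ 2 <= 1.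
Proof. by move=> /sq01/andP[? ?]; apply/andP; split; lra. Qed.

Lemma ker_deriv (v z : plane) (s c : R) : Omega z -> 0 <= s <= 1 -> `|v.1| + `|v.2| <= 1 ->
  (z != (0, 0) -> is_derive z v cabs (c / cabs z)) ->
  cderiv (fun z => ker k z s) z v (s%:C * ((c / cabs z)%:C * kr (cabs z, 1 - s ^+ 2))).
Proof.
move=> Oz ss v1 dc; have tt := onem_sq01 ss.
have [z0|zn] := eqVneq z (0, 0); last first.
  have rr : 0 < cabs z < rho by rewrite cabs_gt0// rhoO.
  have d1 := rk_deriv_r rk rr tt.
  apply: cderiv_eq.
    exact: (cderivM (cderiv_cst (s%:C) z v)
      (@cderiv_radial (fun r => k (r, 1 - s ^+ 2)) z v (c / cabs z) _ d1 (dc zn))).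
  by rewrite mul0r add0r.
rewrite z0 cabs0 invr0 mulr0 mul0r mulr0.
have small (y : plane) : normc (ker k y s) <= C * cabs y ^+ 2.
  rewrite /ker Normc.normcM normcR; case/andP: ss => s0 s1.
  rewrite (ger0_norm s0) -[leRHS]mul1r ler_pM ?normc_ge0//.
  exact: rk_bound rk _ _ (cabs_ge0 _).
have cv (h : R) : cabs (h *: v + (0, 0)) ^+ 2 <= `|h| ^+ 2.
  rewrite sqr_cabs.
  have -> : (h *: v + (0, 0)).1 ^+ 2 + (h *: v + (0, 0)).2 ^+ 2 = h ^+ 2 * (v.1 ^+ 2 + v.2 ^+ 2).
    by rewrite /= /GRing.scale /=; ring.
  rewrite -normrX (ger0_norm (sqr_ge0 h)) ler_piMr ?sqr_ge0//.
  rewrite -(real_normK (num_real v.1)) -(real_normK (num_real v.2)).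
    by have := normr_ge0 v.1; have := normr_ge0 v.2; move: v1; set x := `|v.1|; set y := `|v.2|; nra.
have key (g : plane -> R) : (forall y, `|g y| <= C * cabs y ^+ 2) -> is_derive (0, 0) v g 0.
  move=> gb; have g0 : g (0, 0) = 0.
    by apply/normr0_eq0/eqP; rewrite eq_le normr_ge0 andbT (le_trans (gb _))//= cabs0 expr0n mulr0.
  have C1 : 0 < C + 1 by rewrite ltr_wpDl.
  apply/is_derive_epsP => e e0; near=> h.
  rewrite g0 mulr0 !subr0 (le_trans (gb _))//.
  apply: le_trans (ler_wpM2l C0 (cv h)) _.
  rewrite expr2 mulrA ler_wpM2r//.
  have : `|h| <= e / (C + 1).
    near: h; apply/nbhs_ballP; exists (e / (C + 1)); first by rewrite /= divr_gt0.
    by move=> h; rewrite -ball_normE /= sub0r normrN => /ltW.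
  rewrite ler_pdivlMr// => h1; apply: le_trans h1; rewrite mulrC ler_wpM2l//.
  by rewrite lerDl.
split; apply: key => y; apply: le_trans (small y); [exact: normRe|exact: normIm].
Unshelve. all: by end_near. Qed.

Lemma ker_deriv_x (z : plane) (s : R) : Omega z -> 0 <= s <= 1 ->
  cderiv (fun z => ker k z s) z (e_x R) (kerx z s).
Proof.
move=> Oz ss; apply: ker_deriv => //; last exact: is_derive_cabs_x.
by rewrite /= normr1 normr0 addr0.
Qed.

Lemma ker_deriv_y (z : plane) (s : R) : Omega z -> 0 <= s <= 1 ->
  cderiv (fun z => ker k z s) z (e_y R) (kery z s).
Proof.
move=> Oz ss; apply: ker_deriv => //; last exact: is_derive_cabs_y.
by rewrite /= normr1 normr0 add0r.
Qed.

(** The operator of the kernel [k], and the partial derivatives of [Tk h] in terms of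
    those of [h]. *)
Definition Tk (h : plane -> R[i]) (z : plane) : R[i] := h z + Op (ker k) h z.
Definition Tkx (h hx : plane -> R[i]) (z : plane) : R[i] :=
  hx z + (Op kerx h z + Op (fun z s => ker k z s * (s ^+ 2)%:C) hx z).
Definition Tky (h hy : plane -> R[i]) (z : plane) : R[i] :=
  hy z + (Op kery h z + Op (fun z s => ker k z s * (s ^+ 2)%:C) hy z).

Lemma ker2_cont : jcont (fun z s => ker k z s * (s ^+ 2)%:C).
Proof.
move=> p; apply: ccontM; first exact: (ker_cont (rk_cont rk) p).
by apply: ccontR; apply: (@continuous_sqr R); exact: cvg_snd.
Qed.

Lemma Tk_C1 h hx hy : C1f h hx hy -> C1f (Tk h) (Tkx h hx) (Tky h hy).
Proof.
move=> [c cx cy dx dy].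
have ck := ker_cont (rk_cont rk).
split => z Oz.
- exact: (ccontD (c z Oz) (Op_cont ck c Oz)).
- exact: (ccontD (cx z Oz) (ccontD (Op_cont kerx_cont c Oz) (Op_cont ker2_cont cx Oz))).
- exact: (ccontD (cy z Oz) (ccontD (Op_cont kery_cont c Oz) (Op_cont ker2_cont cy Oz))).
- exact: (cderivD (dx z Oz) (Op_deriv ck kerx_cont ker_deriv_x c cx dx Oz)).
- exact: (cderivD (dy z Oz) (Op_deriv ck kery_cont ker_deriv_y c cy dy Oz)).
Qed.

(** Angular derivatives commute with the operator. *)
Lemma Tk_angular h hx hy z : C1f h hx hy -> Omega z ->
  z.1%:C * Tky h hy z - z.2%:C * Tkx h hx z =
  Tk (fun z => z.1%:C * hy z - z.2%:C * hx z) z.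
Proof.
move=> [c cx cy dx dy] Oz.
have ck := ker_cont (rk_cont rk).
have i1 := Op_integrand kery_cont c Oz; have i2 := Op_integrand kerx_cont c Oz.
have i3 := Op_integrand ker2_cont cx Oz; have i4 := Op_integrand ker2_cont cy Oz.
have eq1 : z.1%:C * Op kery h z - z.2%:C * Op kerx h z = 0.
  rewrite /Op -!CintZ// -CintB; last 2 first.
    by move=> s ss; apply: ccontM; [exact: ccont_cst|exact: i1].
    by move=> s ss; apply: ccontM; [exact: ccont_cst|exact: i2].
  rewrite (@eq_Cint R 0 1 _ (fun=> 0)); first exact: Cint0.
  by move=> s _; rewrite /kerx /kery !rmorphM /=; ring.
have eq2 : z.1%:C * Op (fun z s => ker k z s * (s ^+ 2)%:C) hy z -
    z.2%:C * Op (fun z s => ker k z s * (s ^+ 2)%:C) hx z =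
    Op (ker k) (fun z => z.1%:C * hy z - z.2%:C * hx z) z.
  rewrite /Op -!CintZ// -CintB; last 2 first.
    by move=> s ss; apply: ccontM; [exact: ccont_cst|exact: i4].
    by move=> s ss; apply: ccontM; [exact: ccont_cst|exact: i3].
  apply: eq_Cint => s _ /=.
  have e (x : R) : (s ^+ 2 *: x)%:C = (s ^+ 2)%:C * x%:C :> R[i] by rewrite -rmorphM.
  by rewrite !e; ring.
by rewrite /Tk -eq2 /Tky /Tkx -[RHS]addr0 -eq1; ring.
Qed.

End Kernel.

Section Intertwining.
Variables (rho C : R) (phi : R -> R[i]) (a ar at' b br bt : plane -> R[i]).
Hypothesis tp : transmutation_pair rho C phi a ar at' b br bt.
Hypothesis C0 : 0 <= C.
Hypothesis rhoO : forall z, Omega z -> cabs z < rho.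

(** For a transmutation pair, [r d/dr - phi] after [T_a] is [T_b] after [r d/dr].
    By [tp_1] the two integrands differ by the [s]-derivative of [Psi], whose total
    variation [phi h] is given by [tp_3]. *)
Lemma Tk_radial h hx hy z : C1f h hx hy -> Omega z -> z != (0, 0) ->
  z.1%:C * Tkx a ar h hx z + z.2%:C * Tky a ar h hy z - phi (cabs z) * Tk a h z =
  Tk b (fun z => z.1%:C * hx z + z.2%:C * hy z) z.
Proof.
move=> C1h Oz zn; have [c cx cy dx dy] := C1h.
have rr : 0 < cabs z < rho by rewrite cabs_gt0// rhoO.
have rn0 : (cabs z)%:C != 0 :> R[i] by apply: realC_neq0; rewrite gt_eqF// cabs_gt0.
pose r := cabs z; pose Eh (z : plane) := z.1%:C * hx z + z.2%:C * hy z.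
have cEh y : Omega y -> ccont Eh y.
  move=> Oy; apply: ccontD; apply: ccontM; try (by apply: ccontR; first [exact: cvg_fst|exact: cvg_snd]).
    exact: cx.
  exact: cy.
have ra := tp_a tp; have rb := tp_b tp.
have cka := ker_cont (rk_cont ra); have ckb := ker_cont (rk_cont rb).
have i1 := Op_integrand (kerx_cont ra) c Oz.
have i2 := Op_integrand (ker2_cont ra) cx Oz.
have i3 := Op_integrand (kery_cont ra) c Oz.
have i4 := Op_integrand (ker2_cont ra) cy Oz.
have i5 := Op_integrand cka c Oz.
have i6 := Op_integrand ckb cEh Oz.
have cZ (w : R[i]) F : ccontI 0 1 F -> ccontI 0 1 (fun s => w * F s).
  by move=> cF s ss; apply: ccontM; [exact: ccont_cst|exact: cF].
have cDD (F G : R -> R[i]) : ccontI 0 1 F -> ccontI 0 1 G -> ccontI 0 1 (fun s => F s + G s).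
  by move=> cF cG s ss; apply: ccontD; [exact: cF|exact: cG].
have cBB (F G : R -> R[i]) : ccontI 0 1 F -> ccontI 0 1 G -> ccontI 0 1 (fun s => F s - G s).
  by move=> cF cG s ss; apply: ccontB; [exact: cF|exact: cG].
pose Psi (s : R) := 2^-1 * (s%:C ^+ 2 * (a (r, 1 - s ^+ 2) - b (r, 1 - s ^+ 2)) * h (s ^+ 2 *: z)).
pose dPsi (s : R) := s%:C * ((a (r, 1 - s ^+ 2) - b (r, 1 - s ^+ 2) -
    s%:C ^+ 2 * (at' (r, 1 - s ^+ 2) - bt (r, 1 - s ^+ 2))) * h (s ^+ 2 *: z) +
    (a (r, 1 - s ^+ 2) - b (r, 1 - s ^+ 2)) * Eh (s ^+ 2 *: z)).
have cs (s : R) : ccont (fun s : R => s%:C) s by exact: ccont_id.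
have cg (g : plane -> R[i]) (s : R) : (forall q, ccont g q) -> ccont (fun s : R => g (r, 1 - s ^+ 2)) s.
  move=> cg; apply: (@ccont_comp R _ _ (fun s : R => (r, 1 - s ^+ 2)) g) => //.
  apply: cont_pair; first exact: cvg_cst.
  by apply: cvgB; [exact: cvg_cst|exact: exprn_continuous].
have ch (g : plane -> R[i]) (s : R) : (forall y, Omega y -> ccont g y) -> 0 <= s <= 1 ->
    ccont (fun s : R => g (s ^+ 2 *: z)) s.
  move=> cgg ss; apply: (@ccont_comp R _ _ (fun s : R => s ^+ 2 *: z) g).
    by apply: cvgZ; [exact: exprn_continuous|exact: cvg_cst].
  by apply: cgg; exact: star_sq.
have cPsi : ccontI 0 1 Psi.
  move=> s ss; apply: ccontM; first exact: ccont_cst.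
  apply: ccontM; last exact: ch.
  apply: ccontM; first exact: ccontX.
  exact: (ccontB (cg a s (rk_cont ra)) (cg b s (rk_cont rb))).
have cdPsi : ccontI 0 1 dPsi.
  move=> s ss; apply: ccontM; first exact: cs.
  have h1 := ccontB (cg a s (rk_cont ra)) (cg b s (rk_cont rb)).
  have h2 := ccontB (cg at' s (rk_cont_t ra)) (cg bt s (rk_cont_t rb)).
  apply: ccontD; apply: ccontM.
  - exact: (ccontB h1 (ccontM (ccontX 2 (cs s)) h2)).
  - exact: ch.
  - exact: h1.
  - exact: ch.
have dcurve (s : R) : 0 < s < 1 -> cderiv (fun s : R => h (s ^+ 2 *: z)) s 1
    ((2 * s)%:C * (z.1%:C * hx (s ^+ 2 *: z) + z.2%:C * hy (s ^+ 2 *: z))).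
  move=> /andP[s0 s1]; have Os : Omega (s ^+ 2 *: z) by apply: star_sq; rewrite // !ltW.
  have g1 : is_derive s 1 (fun s : R => s ^+ 2 * z.1) (2 * s * z.1).
    by apply: is_derive_eq; rewrite /GRing.scale /=; ring.
  have g2 : is_derive s 1 (fun s : R => s ^+ 2 * z.2) (2 * s * z.2).
    by apply: is_derive_eq; rewrite /GRing.scale /=; ring.
  have := @cderiv_curve R h hx hy (fun s : R => s ^+ 2 * z.1) (fun s : R => s ^+ 2 * z.2) s _ _
    (near_Omega dx Os) (near_Omega dy Os) (cx _ Os) (cy _ Os) g1 g2.
  move=> d; apply: cderiv_eq d _.
  have ez : s ^+ 2 *: z = (s ^+ 2 * z.1, s ^+ 2 * z.2) by [].
  by rewrite ez [(2 * s * z.1)%:C]rmorphM [(2 * s * z.2)%:C]rmorphM /=; ring.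
have dk (g gt : plane -> R[i]) (s : R) : (forall r t : R, 0 < r < rho -> 0 < t < 1 ->
      cderiv (fun t : R => g (r, t)) t 1 (gt (r, t))) -> 0 < s < 1 ->
    cderiv (fun s : R => g (r, 1 - s ^+ 2)) s 1 ((- (2 * s))%:C * gt (r, 1 - s ^+ 2)).
  move=> dg /andP[s0 s1].
  have tt : 0 < 1 - s ^+ 2 < 1.
    have h1 : s ^+ 2 < 1 by rewrite expr_lt1// ltW.
    have h2 : 0 < s ^+ 2 by rewrite exprn_gt0.
    by apply/andP; split; lra.
  have [d1 d2] := dg r _ rr tt.
  have dm : is_derive s 1 (fun s : R => 1 - s ^+ 2) (- (2 * s)).
    by apply: is_derive_eq; rewrite /GRing.scale /=; ring.
  have -> : (- (2 * s))%:C * gt (r, 1 - s ^+ 2) =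
     (- (2 * s) * complex.Re (gt (r, 1 - s ^+ 2))) +i* (- (2 * s) * complex.Im (gt (r, 1 - s ^+ 2))).
    by apply: complex_ext; rewrite ?(ReM, ImM) /= !mul0r ?subr0 ?addr0.
  by split; [exact: (@is_derive_comp1 R (fun t => complex.Re (g (r, t))) (fun s : R => 1 - s ^+ 2))|
    exact: (@is_derive_comp1 R (fun t => complex.Im (g (r, t))) (fun s : R => 1 - s ^+ 2))].
have ftc : Cintegral 0 1 dPsi = phi r * h z.
  rewrite (@Cint_FTC R 0 1 Psi dPsi ltr01 cPsi cdPsi).
    rewrite /Psi !rmorph1 expr1n !expr0n mul0r mul0r mulr0 subr0 mul1r expr1n subrr scale1r.
    rewrite (tp_3 tp rr) mulrA mulrA -/r.
    by rewrite mulVf ?mul1r// pnatr_eq0.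
  move=> s ss; apply: cderiv_eq.
    apply: (cderivM (cderiv_cst _ _ _)).
    apply: cderivM; last exact: dcurve.
    apply: cderivM; last exact: (cderivB (dk _ _ _ (rk_deriv_t ra) ss) (dk _ _ _ (rk_deriv_t rb) ss)).
    under [X in cderiv X]funext do rewrite expr2.
    exact: (cderivM (cderiv_id s) (cderiv_id s)).
  rewrite /dPsi /Eh mul0r add0r rmorphN [(2 * s)%:C]rmorphM rmorph_nat.
  have e (x : R) : (s ^+ 2 *: x)%:C = s%:C ^+ 2 * x%:C :> R[i] by rewrite -rmorphXn -rmorphM.
  rewrite /= !e; move: (h _) (hx _) (hy _) (a _) (b _) (at' _) (bt _) => *.
  by field.
have key : Cintegral 0 1 (fun s => z.1%:C * (kerx ar z s * h (s ^+ 2 *: z)) +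
      z.1%:C * (ker a z s * (s ^+ 2)%:C * hx (s ^+ 2 *: z)) +
      z.2%:C * (kery ar z s * h (s ^+ 2 *: z)) +
      z.2%:C * (ker a z s * (s ^+ 2)%:C * hy (s ^+ 2 *: z)) -
      phi r * (ker a z s * h (s ^+ 2 *: z)) - ker b z s * Eh (s ^+ 2 *: z)) = phi r * h z.
  rewrite -ftc; apply: eq_Cint => s ss.
  have := tp_1 tp rr (onem_sq01 ss); rewrite -/r rmorphB rmorph1 rmorphXn /=.
  rewrite /kerx /kery /ker /dPsi /Eh -/r.
  have e (x : R) : (s ^+ 2 *: x)%:C = s%:C ^+ 2 * x%:C :> R[i] by rewrite -rmorphXn -rmorphM.
  rewrite /= !e !rmorphXn /=.
  have e3 : z.1%:C * (z.1 / r)%:C + z.2%:C * (z.2 / r)%:C = r%:C :> R[i].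
    rewrite -!rmorphM -rmorphD /=; congr (_%:C).
    have -> : z.1 * (z.1 / r) + z.2 * (z.2 / r) = (z.1 ^+ 2 + z.2 ^+ 2) / r by ring.
    by rewrite -sqr_cabs -/r expr2 mulfK// gt_eqF// cabs_gt0.
  move: e3; move: (h _) (hx _) (hy _) (a _) (b _) (at' _) (bt _) (ar _) (phi r).
  move=> vh vhx vhy va vb vat vbt var p e3 e1.
  have E : s%:C * vh * (r%:C * var - (va - vb) + (1 - (1 - s%:C ^+ 2)) * (vat - vbt) - p * va) = 0.
    by rewrite e1 mulr0.
  apply/eqP; rewrite -subr_eq0; apply/eqP; rewrite -E -e3; ring.
have j1 := cZ z.1%:C _ i1; have j2 := cZ z.1%:C _ i2.
have j3 := cZ z.2%:C _ i3; have j4 := cZ z.2%:C _ i4; have j5 := cZ (phi r) _ i5.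
have k2 := cDD _ _ j1 j2; have k3 := cDD _ _ k2 j3; have k4 := cDD _ _ k3 j4.
have k5 := cBB _ _ k4 j5.
move: key; rewrite (CintB k5 i6) (CintB k4 j5) (CintD k3 j4) (CintD k2 j3) (CintD j1 j2).
rewrite (CintZ _ i1) (CintZ _ i2) (CintZ _ i3) (CintZ _ i4) (CintZ _ i5) => key.
have {}key : z.1%:C * Op (kerx ar) h z + z.1%:C * Op (fun z s => ker a z s * (s ^+ 2)%:C) hx z +
   z.2%:C * Op (kery ar) h z + z.2%:C * Op (fun z s => ker a z s * (s ^+ 2)%:C) hy z -
   phi r * Op (ker a) h z - Op (ker b) Eh z = phi r * h z by exact: key.
rewrite /Tk /Tkx /Tky -/r.
apply/eqP; rewrite -subr_eq0; apply/eqP.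
move/eqP: key; rewrite -subr_eq0 => /eqP <-; rewrite -/Eh.
ring.
Qed.

End Intertwining.
End OnOmega.
End Operators.

(** * Inversion of the transmutation operators *)

Section Limits.
Variable R : realType.
Local Notation plane := (R * R)%type.
Local Notation normc := (@Normc.normc R).

Lemma cvg_half_pow (c : R) : c * (1 / 2) ^+ n @[n --> \oo] --> (0 : R).
Proof.
rewrite -[X in _ --> X](mulr0 c); apply: cvgM; first exact: cvg_cst.
by apply: cvg_expr; rewrite ger0_norm; lra.
Qed.

Lemma le_half_pow0 (x c : R) : (forall n, x <= c * (1 / 2) ^+ n) -> x <= 0.
Proof. by move=> H; apply: (cvgr_to_ge (cvg_half_pow c)); apply: nearW. Qed.

Lemma normc_half_pow0 (x : R[i]) (c : R) : (forall n, normc x <= c * (1 / 2) ^+ n) -> x = 0.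
Proof.
move=> H; apply: normc_eq0P; apply/eqP; rewrite eq_le normc_ge0 andbT.
exact: le_half_pow0 H.
Qed.

(** A sequence with geometrically decreasing increments converges, with the
    same rate. *)
Lemma geometric_limit (u : nat -> R) (A : R) :
  (forall n, `|u n.+1 - u n| <= A * (1 / 2) ^+ n) ->
  forall n, `|limn u - u n| <= 2 * A * (1 / 2) ^+ n.
Proof.
move=> ub.
have A0 : 0 <= A by have := le_trans (normr_ge0 _) (ub 0%N); rewrite expr0 mulr1.
pose e n : R := 2 * A * (1 / 2) ^+ n.
have eS n : e n.+1 = e n - A * (1 / 2) ^+ n by rewrite /e exprS; field.
have e0 n : 0 <= e n by rewrite /e mulr_ge0 ?mulr_ge0 ?exprn_ge0// divr_ge0.
pose v n := u n - e n; pose w n := u n + e n.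
have vnd : nondecreasing_seq v.
  apply/nondecreasing_seqP => n; rewrite /v eS.
  by have := ub n; rewrite ler_norml => /andP[+ _]; lra.
have wni : nonincreasing_seq w.
  apply/nonincreasing_seqP => n; rewrite /w eS.
  by have := ub n; rewrite ler_norml => /andP[_]; lra.
have vw n m : v n <= w m.
  have [nm|/ltnW mn] := leqP n m.
    by rewrite (le_trans (vnd _ _ nm))// /v /w; have := e0 m; lra.
  by apply: le_trans (wni _ _ mn); rewrite /v /w; have := e0 n; lra.
have cv : cvgn v.
  apply: nondecreasing_is_cvgn => //; exists (w 0%N) => _ [n _ <-]; exact: vw.
have ce : e n @[n --> \oo] --> (0 : R) by exact: cvg_half_pow.
have uE : u = (fun n => v n + e n) by apply/funext => n; rewrite /v subrK.
have ulim : limn u = limn v.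
  by apply/cvg_lim => //; rewrite uE -[X in _ --> X]addr0; apply: cvgD.
move=> n; rewrite ulim ler_norml; apply/andP; split.
  have : v n <= limn v by apply: nondecreasing_cvgn_le.
  by rewrite /v -/(e n); lra.
have : limn v <= w n by apply: limr_le => //; apply: nearW => m; exact: vw.
by rewrite /w -/(e n); lra.
Qed.

(** Limit of a sequence of complex numbers, componentwise. *)
Definition climn (u : nat -> R[i]) : R[i] :=
  limn (fun n => complex.Re (u n)) +i* limn (fun n => complex.Im (u n)).

Lemma cgeometric_limit (u : nat -> R[i]) (A : R) :
  (forall n, normc (u n.+1 - u n) <= A * (1 / 2) ^+ n) ->
  forall n, normc (climn u - u n) <= 4 * A * (1 / 2) ^+ n.
Proof.
move=> ub n; have -> : 4 * A * (1 / 2) ^+ n = 2 * (2 * A * (1 / 2) ^+ n) by ring.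
apply: normc_le2; rewrite ?(ReD, ImD, ReN, ImN) /=.
  apply: (@geometric_limit (fun n => complex.Re (u n)) A) => m.
  by apply: le_trans (ub m); rewrite -ReN -ReD normRe.
apply: (@geometric_limit (fun n => complex.Im (u n)) A) => m.
by apply: le_trans (ub m); rewrite -ImN -ImD normIm.
Qed.

Lemma small_half_pow (c e : R) : 0 < e -> exists n, c * (1 / 2) ^+ n <= e.
Proof.
move=> e0; have /cvgrPdist_le/(_ _ e0)[n _ /(_ n (leqnn n))] := cvg_half_pow c.
rewrite /= sub0r normrN => h; exists n; exact: le_trans (ler_norm _) h.
Qed.

Section RealLimit.
Variables (V : normedModType R) (f p : nat -> V -> R) (F P : V -> R) (z0 v : V) (A : R).
Hypothesis fF : \forall y \near z0, forall n, `|F y - f n y| <= A * (1 / 2) ^+ n.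

(** Continuity and differentiability pass to limits that are locally
    geometric. *)
Lemma continuous_geometric : (forall n, {for z0, continuous (f n)}) -> {for z0, continuous F}.
Proof.
move=> cf; apply/cvgrPdist_le => e e0; have e3 : 0 < e / 3 by rewrite divr_gt0.
have [n hn] := small_half_pow A e3.
near=> y.
have h1 : `|F y - f n y| <= e / 3 by apply: le_trans hn; near: y; apply: filterS fF.
have h2 : `|F z0 - f n z0| <= e / 3 by apply: le_trans hn; exact: (nbhs_singleton fF).
have h3 : `|f n z0 - f n y| <= e / 3 by near: y; move/cvgrPdist_le : (cf n); apply.
by move: h1 h2 h3; rewrite !ler_norml => /andP[? ?] /andP[? ?] /andP[? ?]; apply/andP; split; lra.
Unshelve. all: by end_near. Qed.

Hypothesis pP : \forall y \near z0, forall n, `|P y - p n y| <= A * (1 / 2) ^+ n.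
Hypothesis dfp : \forall y \near z0, forall n, is_derive y v (f n) (p n y).

Lemma is_derive_geometric : is_derive z0 v F (P z0).
Proof.
apply/is_derive_epsP => e e0; have e4 : 0 < e / 4 by rewrite divr_gt0.
have A0 : 0 <= A.
  by have := le_trans (normr_ge0 _) (nbhs_singleton pP 0%N); rewrite expr0 mulr1.
have [n hn] := small_half_pow A e4.
have hm m : (n <= m)%N -> A * (1 / 2) ^+ m <= e / 4.
  move=> nm; apply: le_trans hn; rewrite ler_wpM2l// ler_wiXn2l//; lra.
near=> h.
have seg : forall t : R, `|t| <= `|h| -> (forall n, `|P (t *: v + z0) - p n (t *: v + z0)| <= A * (1 / 2) ^+ n)
    /\ (forall n, is_derive (t *: v + z0) v (f n) (p n (t *: v + z0))).
  near: h; apply: (@near_segment R V z0 v (fun y => (forall n, `|P y - p n y| <= A * (1 / 2) ^+ n) /\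
    (forall n, is_derive y v (f n) (p n y)))).
  exact: (@filterI _ _ (nbhs_filter z0) _ _ pP dfp).
have h1 : `|f n (h *: v + z0) - f n z0 - h * p n z0| <= e / 4 * `|h|.
  near: h; have := nbhs_singleton dfp n => /is_derive_epsP; exact.
have h2 : `|P z0 - p n z0| <= e / 4 by apply: le_trans hn; exact: (nbhs_singleton pP).
have h3 : `|(F (h *: v + z0) - f n (h *: v + z0)) - (F z0 - f n z0)| <= e / 2 * `|h|.
  have FI : forall m, `|F (h *: v + z0) - f m (h *: v + z0)| <= A * (1 / 2) ^+ m.
    have : forall t : R, `|t| <= `|h| -> forall m, `|F (t *: v + z0) - f m (t *: v + z0)| <= A * (1 / 2) ^+ m.
      near: h; exact: (@near_segment R V z0 v (fun y => forall m, `|F y - f m y| <= A * (1 / 2) ^+ m)).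
    by apply.
  have F0 : forall m, `|F z0 - f m z0| <= A * (1 / 2) ^+ m by exact: (nbhs_singleton fF).
  rewrite -subr_le0; apply: (@le_half_pow0 _ (2 * A)) => k; rewrite lerBlDr.
  pose m := maxn n k.
  have nm : (n <= m)%N by exact: leq_maxl.
  have km : A * (1 / 2) ^+ m <= A * (1 / 2) ^+ k.
    by rewrite ler_wpM2l// ler_wiXn2l ?leq_maxr//; lra.
  have h4 : `|(f m (h *: v + z0) - f n (h *: v + z0)) - (f m z0 - f n z0)| <= e / 2 * `|h|.
    have := @mean_value_ineq R (fun t => f m (t *: v + z0) - f n (t *: v + z0))
      (fun t => p m (t *: v + z0) - p n (t *: v + z0)) h 0 (e / 2).
    rewrite scale0r add0r mulr0 subr0; apply => t th; have [s1 s2] := seg t th.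
      apply: is_deriveB; exact: (@is_derive_line R V).
    rewrite subr0; have := s1 m; have := s1 n; have := hm m nm.
    by rewrite !ler_norml => ? /andP[? ?] /andP[? ?]; apply/andP; split; lra.
  have := FI m; have := F0 m.
  by move: h4; rewrite !ler_norml => /andP[? ?] /andP[? ?] /andP[? ?]; apply/andP; split; lra.
have hh := normr_ge0 h.
have h5 : `|h * (P z0 - p n z0)| <= e / 4 * `|h| by rewrite normrM mulrC ler_wpM2r.
by move: h1 h3 h5; rewrite !ler_norml => /andP[? ?] /andP[? ?] /andP[? ?]; apply/andP; split; lra.
Unshelve. all: by end_near. Qed.

End RealLimit.
End Limits.

Section Volterra.
Variable R : realType.
Local Notation plane := (R * R)%type.
Local Notation normc := (@Normc.normc R).
Local Notation cabs := (@cabs R).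
Variable Omega : set plane.
Hypothesis oO : open Omega.
Hypothesis sO : starshaped0 Omega.

(** In the weight [expR (lam * cabs z)] a kernel bounded by [L * cabs z * s] gains
    the factor [L / lam]. *)
Lemma Op_bound (a : plane -> R -> R[i]) h (L B lam : R) z : 0 < lam -> 0 <= L -> 0 <= B ->
  jcont a -> (forall z, Omega z -> ccont h z) -> Omega z ->
  (forall s : R, 0 <= s <= 1 -> normc (a z s) <= L * cabs z * s) ->
  (forall s : R, 0 <= s <= 1 -> normc (h (s ^+ 2 *: z)) <= B * expR (lam * cabs (s ^+ 2 *: z))) ->
  normc (Op a h z) <= L * B / lam * expR (lam * cabs z).
Proof.
move=> lam0 L0 B0 ca ch Oz aL hB.
pose G (s : R) := L * cabs z * s * (B * expR (lam * (s ^+ 2 * cabs z))).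
pose P (s : R) := L * B / (2 * lam) * expR (lam * (s ^+ 2 * cabs z)).
have dP (s : R) : is_derive s 1 P (G s).
  by rewrite /P; apply: is_derive_eq; rewrite /G /GRing.scale /=; field; rewrite gt_eqF.
have cG : contI 0 1 G.
  move=> s _.
  have dG : derivable G s 1 by apply: ex_derive.
  exact/differentiable_continuous/derivable1_diffP.
have := @normc_Cint_le R 0 1 (fun s => a z s * h (s ^+ 2 *: z)) G (Op_integrand sO ca ch Oz) cG.
move=> H; apply: (le_trans (H _)).
  move=> s ss; rewrite Normc.normcM /G ler_pM ?normc_ge0 ?aL//.
  by rewrite -cabsZ ?hB// exprn_ge0//; case/andP: ss.
rewrite (@intab_FTC R 0 1 P G ltr01) //; last first.
  by move=> s _; exact: is_derive_continuous (dP s).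
rewrite /P expr1n mul1r expr0n mul0r mulr0 expR0 mulr1.
have -> : 2 * (L * B / (2 * lam) * expR (lam * cabs z) - L * B / (2 * lam)) =
  L * B / lam * expR (lam * cabs z) - L * B / lam by field; rewrite gt_eqF.
by rewrite gerBl divr_ge0 ?mulr_ge0// ltW.
Qed.

(** A continuous function is bounded on the segments from the origin to the
    points near [z0]. *)
Lemma ray_bounded (F : plane -> R[i]) z0 : (forall z, Omega z -> ccont F z) -> Omega z0 ->
  exists2 A, 0 <= A & \forall y \near z0, forall s : R, 0 <= s <= 1 -> normc (F (s ^+ 2 *: y)) <= A.
Proof.
move=> cF Oz.
pose f (z : plane) (s : R) := normc (F (s ^+ 2 *: z)).
have cf (z : plane) (s : R) : Omega z -> 0 <= s <= 1 -> {for (z, s), continuous (fun p => f p.1 p.2)}.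
  move=> O1 ss; apply: (@continuous_normc R _ (fun p : plane * R => F (p.2 ^+ 2 *: p.1))).
  apply: (@ccont_comp R _ _ (fun p : plane * R => (p.2 ^+ 2) *: p.1) F); first exact: continuous_scale2.
  by apply: cF; exact: star_sq.
have c0 : {within `[0, 1], continuous (f z0)}.
  by apply: contI_within => s ss; apply: joint_cont_snd; exact: cf.
have [m _ Hm] := EVT_max (@ler01 R) c0.
exists (f z0 m + 1); first by rewrite addr_ge0// normc_ge0.
have := @tube_continuity R _ 0 1 f z0 (fun s => cf z0 s Oz) 1 ltr01.
apply: filterS => y Hy s ss; have := Hy s ss.
have : f z0 s <= f z0 m by apply: Hm; rewrite in_itv.
by rewrite ler_norml /f => ? /andP[_ ?]; lra.
Qed.

Section VK.
Variables (rho C : R) (k kr kt : plane -> R[i]).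
Hypothesis rk : regular_kernel rho C k kr kt.
Hypothesis C0 : 0 <= C.
Hypothesis rho0 : 0 < rho.
Hypothesis rhoO : forall z, Omega z -> cabs z < rho.

(* [L] bounds the kernels in [ker_bound] and after; [lam] makes each of the
   operators gain a factor [1 / 8]. *)
Let L := C * (rho + 1).
Let lam := 8 * L + 1.
Let L0 : 0 <= L. Proof. by rewrite mulr_ge0// addr_ge0// ltW. Qed.
Let lam0 : 0 < lam. Proof. by rewrite /lam ltr_wpDl// mulr_ge0. Qed.

Lemma ker_bound z (s : R) : Omega z -> 0 <= s <= 1 -> normc (ker k z s) <= L * cabs z * s.
Proof.
move=> Oz /andP[s0 s1]; rewrite Normc.normcM normcR (ger0_norm s0) mulrC ler_wpM2r//.
apply: le_trans (rk_bound rk _ (cabs_ge0 z)) _.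
rewrite /L -mulrA ler_wpM2l// expr2 ler_wpM2r ?cabs_ge0//.
by have := rhoO Oz; lra.
Qed.

Lemma coord_div_le1 (c : plane -> R) (z : plane) : (forall z, `|c z| <= cabs z) ->
  `|c z / cabs z| <= 1.
Proof.
move=> cz; rewrite normrM normfV (ger0_norm (cabs_ge0 z)).
have [->|z0] := eqVneq (cabs z) 0; first by rewrite invr0 mulr0.
by rewrite ler_pdivrMr ?mul1r// lt_def z0 cabs_ge0.
Qed.

Let kerc_bound (c : plane -> R) z (s : R) : (forall z, `|c z| <= cabs z) -> Omega z -> 0 <= s <= 1 ->
  normc (s%:C * ((c z / cabs z)%:C * kr (cabs z, 1 - s ^+ 2))) <= L * cabs z * s.
Proof.
move=> cz Oz /andP[s0 s1]; rewrite !Normc.normcM !normcR (ger0_norm s0) mulrC ler_wpM2r//.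
rewrite -[leRHS]mul1r ler_pM ?normc_ge0 ?normr_ge0 ?coord_div_le1//.
apply: le_trans (rk_bound_r rk _ (cabs_ge0 z)) _.
by rewrite /L -mulrA ler_wpM2l// ler_peMl ?cabs_ge0//; move: rho0; lra.
Qed.

Lemma kerx_bound z (s : R) : Omega z -> 0 <= s <= 1 -> normc (kerx kr z s) <= L * cabs z * s.
Proof. by apply: (@kerc_bound fst); exact: cabs_fst. Qed.

Lemma kery_bound z (s : R) : Omega z -> 0 <= s <= 1 -> normc (kery kr z s) <= L * cabs z * s.
Proof. by apply: (@kerc_bound snd); exact: cabs_snd. Qed.

Lemma ker2_bound z (s : R) : Omega z -> 0 <= s <= 1 ->
  normc (ker k z s * (s ^+ 2)%:C) <= L * cabs z * s.
Proof.
move=> Oz ss; rewrite Normc.normcM normcR -[leRHS]mulr1.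
rewrite ler_pM ?normc_ge0 ?normr_ge0 ?ker_bound// ger0_norm; by case/andP: (sq01 ss).
Qed.

Let LB (B : R) : 0 <= B -> L * B / lam <= B / 8.
Proof.
move=> B0; rewrite ler_pdivrMr// -subr_ge0.
have -> : B / 8 * lam - L * B = B / 8 by rewrite /lam; field.
by rewrite divr_ge0.
Qed.

Let half_arith (P E x y : R) : 0 <= P * E -> x <= P / 8 * E -> y <= P / 8 * E ->
  x <= P * E / 2 /\ x + y <= P * E / 2.
Proof. by move=> *; split; lra. Qed.

(** The operators divide weighted bounds by [8]. *)
Lemma Op_contract (a : plane -> R -> R[i]) h (B : R) z : 0 <= B ->
  jcont a -> (forall z, Omega z -> ccont h z) -> Omega z ->
  (forall z (s : R), Omega z -> 0 <= s <= 1 -> normc (a z s) <= L * cabs z * s) ->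
  (forall s : R, 0 <= s <= 1 -> normc (h (s ^+ 2 *: z)) <= B * expR (lam * cabs (s ^+ 2 *: z))) ->
  normc (Op a h z) <= B / 8 * expR (lam * cabs z).
Proof.
move=> B0 ca ch Oz aL hB; apply: le_trans (Op_bound lam0 L0 B0 ca ch Oz (aL z ^~ Oz) hB) _.
by rewrite ler_wpM2r ?expR_ge0// LB.
Qed.

Let exp_ge1 (z : plane) : 1 <= expR (lam * cabs z).
Proof. by rewrite -[leLHS]expR0 ler_expR mulr_ge0 ?cabs_ge0// ltW. Qed.

Let ck : jcont (ker k). Proof. exact: ker_cont (rk_cont rk). Qed.

Lemma Tk_injective h : (forall z, Omega z -> ccont h z) ->
  (forall z, Omega z -> Tk k h z = 0) -> forall z, Omega z -> h z = 0.
Proof.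
move=> ch Th z Oz.
have [A A0 /nbhs_singleton HA] := ray_bounded ch Oz.
have main n : forall s : R, 0 <= s <= 1 ->
    normc (h (s ^+ 2 *: z)) <= A * (1 / 2) ^+ n * expR (lam * cabs (s ^+ 2 *: z)).
  elim: n => [|n IH] s ss.
    by rewrite expr0 mulr1 (le_trans (HA s ss))// ler_peMr.
  have Os := star_sq sO Oz ss.
  have -> : h (s ^+ 2 *: z) = - Op (ker k) h (s ^+ 2 *: z).
    by apply/eqP; rewrite -subr_eq0 opprK; apply/eqP; exact: Th.
  rewrite normcN.
  have B0 : 0 <= A * (1 / 2) ^+ n by rewrite mulr_ge0// exprn_ge0// divr_ge0.
  apply: le_trans (Op_contract B0 ck ch Os ker_bound _) _.
    move=> t tt; rewrite scalerA -exprMn; apply: IH.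
    case/andP: ss => ? ?; case/andP: tt => ? ?.
    by rewrite mulr_ge0//= mulr_ile1.
  rewrite ler_wpM2r ?expR_ge0// exprS; lra.
have := main ^~ 1; rewrite expr1n scale1r => H.
apply: (@normc_half_pow0 R _ (A * expR (lam * cabs z))) => n.
by have := H n; rewrite ler01 lexx mulrAC; apply.
Qed.

Lemma C1fB u ux uy v vx vy : C1f Omega u ux uy -> C1f Omega v vx vy ->
  C1f Omega (fun z => u z - v z) (fun z => ux z - vx z) (fun z => uy z - vy z).
Proof.
move=> [u1 u2 u3 u4 u5] [v1 v2 v3 v4 v5]; split => z Oz.
- exact: (ccontB (u1 z Oz) (v1 z Oz)).
- exact: (ccontB (u2 z Oz) (v2 z Oz)).
- exact: (ccontB (u3 z Oz) (v3 z Oz)).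
- exact: (cderivB (u4 z Oz) (v4 z Oz)).
- exact: (cderivB (u5 z Oz) (v5 z Oz)).
Qed.

(* The partial derivatives of [Op (ker k) h]. *)
Let Kx h hx (z : plane) : R[i] := Op (kerx kr) h z + Op (fun z s => ker k z s * (s ^+ 2)%:C) hx z.
Let Ky h hy (z : plane) : R[i] := Op (kery kr) h z + Op (fun z s => ker k z s * (s ^+ 2)%:C) hy z.

Lemma OpK_C1 h hx hy : C1f Omega h hx hy -> C1f Omega (Op (ker k) h) (Kx h hx) (Ky h hy).
Proof.
move=> [c cx cy dx dy].
have c2 := ker2_cont rk; have c3 := kerx_cont rk; have c4 := kery_cont rk.
split => z Oz.
- exact: (Op_cont oO sO ck c Oz).
- exact: (ccontD (Op_cont oO sO c3 c Oz) (Op_cont oO sO c2 cx Oz)).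
- exact: (ccontD (Op_cont oO sO c4 c Oz) (Op_cont oO sO c2 cy Oz)).
- exact: (Op_deriv oO sO ck c3 (ker_deriv_x rk C0 rhoO) c cx dx Oz).
- exact: (Op_deriv oO sO ck c4 (ker_deriv_y rk C0 rhoO) c cy dy Oz).
Qed.

Lemma OpB (a : plane -> R -> R[i]) u v z : jcont a -> (forall z, Omega z -> ccont u z) ->
  (forall z, Omega z -> ccont v z) -> Omega z ->
  Op a (fun z => u z - v z) z = Op a u z - Op a v z.
Proof.
move=> ca cu cv Oz; rewrite /Op -CintB; [|exact: (Op_integrand sO ca cu Oz)|exact: (Op_integrand sO ca cv Oz)].
by apply: eq_Cint => s _; rewrite mulrBr.
Qed.

Section Picard.
Variables (g gx gy : plane -> R[i]).
Hypothesis gC1 : C1f Omega g gx gy.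

(** Successive approximations of the solution [h] of [Tk k h = g], together with
    their partial derivatives. *)
Fixpoint picard (n : nat) : (plane -> R[i]) * (plane -> R[i]) * (plane -> R[i]) :=
  if n is n'.+1 then
    let: (h, hx, hy) := picard n' in
    (fun z => g z - Op (ker k) h z, fun z => gx z - Kx h hx z, fun z => gy z - Ky h hy z)
  else (g, gx, gy).

Let h n := (picard n).1.1.
Let hx n := (picard n).1.2.
Let hy n := (picard n).2.

Let hS n z : h n.+1 z = g z - Op (ker k) (h n) z.
Proof. by rewrite /h /=; case: (picard n) => -[]. Qed.
Let hxS n z : hx n.+1 z = gx z - Kx (h n) (hx n) z.
Proof. by rewrite /hx /h /=; case: (picard n) => -[]. Qed.
Let hyS n z : hy n.+1 z = gy z - Ky (h n) (hy n) z.
Proof. by rewrite /hy /h /=; case: (picard n) => -[]. Qed.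

Let hC1 n : C1f Omega (h n) (hx n) (hy n).
Proof.
elim: n => [|n IH]; first exact: gC1.
have := C1fB gC1 (OpK_C1 IH).
by rewrite /h /hx /hy /=; case: (picard n) => -[].
Qed.

Let d n z := h n.+1 z - h n z.
Let dx n z := hx n.+1 z - hx n z.
Let dy n z := hy n.+1 z - hy n z.
Let dC1 n : C1f Omega (d n) (dx n) (dy n).
Proof. exact: C1fB (hC1 n.+1) (hC1 n). Qed.

Let dS n z : Omega z -> d n.+1 z = - Op (ker k) (d n) z.
Proof.
move=> Oz; rewrite {1}/d (hS n.+1) (hS n).
by rewrite (OpB ck (C1f_c (hC1 n.+1)) (C1f_c (hC1 n)) Oz); ring.
Qed.

Let dxS n z : Omega z -> dx n.+1 z = - Kx (d n) (dx n) z.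
Proof.
move=> Oz; rewrite {1}/dx (hxS n.+1) (hxS n) /Kx.
rewrite (OpB (kerx_cont rk) (C1f_c (hC1 n.+1)) (C1f_c (hC1 n)) Oz).
by rewrite (OpB (ker2_cont rk) (C1f_cx (hC1 n.+1)) (C1f_cx (hC1 n)) Oz); ring.
Qed.

Let dyS n z : Omega z -> dy n.+1 z = - Ky (d n) (dy n) z.
Proof.
move=> Oz; rewrite {1}/dy (hyS n.+1) (hyS n) /Ky.
rewrite (OpB (kery_cont rk) (C1f_c (hC1 n.+1)) (C1f_c (hC1 n)) Oz).
by rewrite (OpB (ker2_cont rk) (C1f_cy (hC1 n.+1)) (C1f_cy (hC1 n)) Oz); ring.
Qed.

Let picard_weighted (A : R) n : 0 <= A -> forall z, Omega z ->
  (forall s : R, 0 <= s <= 1 -> [/\ normc (d 0 (s ^+ 2 *: z)) <= A,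
      normc (dx 0 (s ^+ 2 *: z)) <= A & normc (dy 0 (s ^+ 2 *: z)) <= A]) ->
  forall s : R, 0 <= s <= 1 ->
  let y := s ^+ 2 *: z in let M := A * (1 / 2) ^+ n * expR (lam * cabs y) in
  [/\ normc (d n y) <= M, normc (dx n y) <= M & normc (dy n y) <= M].
Proof.
move=> A0 z Oz dA; elim: n => [|n IH] s ss y M.
  have [h1 h2 h3] := dA s ss; rewrite /M expr0 mulr1.
  by split; [apply: (le_trans h1)|apply: (le_trans h2)|apply: (le_trans h3)]; rewrite ler_peMr.
have Oy : Omega y := star_sq sO Oz ss.
have B0 : 0 <= A * (1 / 2) ^+ n by rewrite mulr_ge0// exprn_ge0// divr_ge0.
have IH' t : 0 <= t <= 1 -> let B := A * (1 / 2) ^+ n * expR (lam * cabs (t ^+ 2 *: y)) in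
   [/\ normc (d n (t ^+ 2 *: y)) <= B, normc (dx n (t ^+ 2 *: y)) <= B & normc (dy n (t ^+ 2 *: y)) <= B].
  move=> tt; rewrite /y scalerA -exprMn; apply: IH.
  case/andP: ss => ? ?; case/andP: tt => ? ?.
  by rewrite mulr_ge0//= mulr_ile1.
have [c cx cy _ _] := dC1 n.
have b0 := Op_contract B0 ck c Oy ker_bound (fun t tt => let: And3 H _ _ := IH' t tt in H).
have b1 := Op_contract B0 (kerx_cont rk) c Oy kerx_bound (fun t tt => let: And3 H _ _ := IH' t tt in H).
have b2 := Op_contract B0 (kery_cont rk) c Oy kery_bound (fun t tt => let: And3 H _ _ := IH' t tt in H).
have b3 := Op_contract B0 (ker2_cont rk) cx Oy ker2_bound (fun t tt => let: And3 _ H _ := IH' t tt in H).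
have b4 := Op_contract B0 (ker2_cont rk) cy Oy ker2_bound (fun t tt => let: And3 _ _ H := IH' t tt in H).
have E0 := expR_ge0 (lam * cabs y).
have ME : M = (A * (1 / 2) ^+ n) * expR (lam * cabs y) / 2 by rewrite /M exprS; field.
have BE0 : 0 <= A * (1 / 2) ^+ n * expR (lam * cabs y) by rewrite mulr_ge0.
rewrite dS// dxS// dyS// !normcN ME; split.
- exact: (half_arith BE0 b0 b0).1.
- exact: le_trans (le_normcD _ _) (half_arith BE0 b1 b3).2.
- exact: le_trans (le_normcD _ _) (half_arith BE0 b2 b4).2.
Qed.

Let picard_bound z0 : Omega z0 -> exists2 A, 0 <= A & \forall z \near z0,
  forall s : R, 0 <= s <= 1 -> forall n,
  [/\ normc (d n (s ^+ 2 *: z)) <= A * (1 / 2) ^+ n,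
      normc (dx n (s ^+ 2 *: z)) <= A * (1 / 2) ^+ n &
      normc (dy n (s ^+ 2 *: z)) <= A * (1 / 2) ^+ n].
Proof.
move=> Oz0; have [c cx cy _ _] := dC1 0.
have [A1 A10 H1] := ray_bounded c Oz0.
have [A2 A20 H2] := ray_bounded cx Oz0.
have [A3 A30 H3] := ray_bounded cy Oz0.
pose A := A1 + A2 + A3; have A0 : 0 <= A by rewrite !addr_ge0.
exists (A * expR (lam * rho)); first by rewrite mulr_ge0// expR_ge0.
near=> z => s ss n.
have Oz : Omega z by near: z; exact: (@near_Omega R Omega oO z0 Omega (fun _ => id) Oz0).
have key : forall s : R, 0 <= s <= 1 -> [/\ normc (d 0 (s ^+ 2 *: z)) <= A,
      normc (dx 0 (s ^+ 2 *: z)) <= A & normc (dy 0 (s ^+ 2 *: z)) <= A].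
  have k1 : forall s : R, 0 <= s <= 1 -> normc (d 0 (s ^+ 2 *: z)) <= A1 by near: z.
  have k2 : forall s : R, 0 <= s <= 1 -> normc (dx 0 (s ^+ 2 *: z)) <= A2 by near: z.
  have k3 : forall s : R, 0 <= s <= 1 -> normc (dy 0 (s ^+ 2 *: z)) <= A3 by near: z.
  move=> t tt; rewrite /A; split.
  - by apply: (le_trans (k1 t tt)); lra.
  - by apply: (le_trans (k2 t tt)); lra.
  - by apply: (le_trans (k3 t tt)); lra.
have := picard_weighted n A0 Oz key ss; cbv zeta.
have Os : Omega (s ^+ 2 *: z) by exact: star_sq.
have le_M : A * (1 / 2) ^+ n * expR (lam * cabs (s ^+ 2 *: z)) <= A * expR (lam * rho) * (1 / 2) ^+ n.
  rewrite [leRHS]mulrAC ler_wpM2l//; first by rewrite mulr_ge0// exprn_ge0// divr_ge0.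
  by rewrite ler_expR ler_pM2l// ltW// rhoO.
by move=> [p1 p2 p3]; split; apply: le_trans le_M.
Unshelve. all: by end_near. Qed.

(** [Tk k] is onto the functions of class [C^1] on [Omega]. *)
Lemma Tk_surjective : exists w wx wy, C1f Omega w wx wy /\ forall z, Omega z -> Tk k w z = g z.
Proof.
pose w z := climn (h ^~ z); pose wx z := climn (hx ^~ z); pose wy z := climn (hy ^~ z).
have lims z0 : Omega z0 -> exists2 A, 0 <= A & \forall z \near z0,
    forall s : R, 0 <= s <= 1 -> forall n,
    [/\ normc (w (s ^+ 2 *: z) - h n (s ^+ 2 *: z)) <= A * (1 / 2) ^+ n,
        normc (wx (s ^+ 2 *: z) - hx n (s ^+ 2 *: z)) <= A * (1 / 2) ^+ n &
        normc (wy (s ^+ 2 *: z) - hy n (s ^+ 2 *: z)) <= A * (1 / 2) ^+ n].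
  move=> /picard_bound[A A0 HA]; exists (4 * A); first by rewrite mulr_ge0.
  apply: filterS HA => z Hz s ss n; split; apply: cgeometric_limit => m; by have [] := Hz s ss m.
have lims1 z0 : Omega z0 -> exists A, \forall z \near z0, forall n,
    [/\ normc (w z - h n z) <= A * (1 / 2) ^+ n, normc (wx z - hx n z) <= A * (1 / 2) ^+ n &
        normc (wy z - hy n z) <= A * (1 / 2) ^+ n].
  move=> /lims[A A0 HA]; exists A; apply: filterS HA => z Hz n.
  by have := Hz 1 _ n; rewrite expr1n scale1r ler01 lexx; apply.
have ReB (x y : R[i]) : complex.Re x - complex.Re y = complex.Re (x - y) by rewrite ReD ReN.
have ImB (x y : R[i]) : complex.Im x - complex.Im y = complex.Im (x - y) by rewrite ImD ImN.
have cont (u : plane -> R[i]) (un : nat -> plane -> R[i]) :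
    (forall z0, Omega z0 -> exists A, \forall z \near z0, forall n, normc (u z - un n z) <= A * (1 / 2) ^+ n) ->
    (forall n z, Omega z -> ccont (un n) z) -> forall z, Omega z -> ccont u z.
  move=> ul cun z Oz; have [A HA] := ul z Oz; split.
    apply: (@continuous_geometric R _ (fun n y => complex.Re (un n y)) _ z A).
      by apply: filterS HA => y Hy n; rewrite ReB (le_trans (normRe _)).
    by move=> n; have [] := cun n z Oz.
  apply: (@continuous_geometric R _ (fun n y => complex.Im (un n y)) _ z A).
    by apply: filterS HA => y Hy n; rewrite ImB (le_trans (normIm _)).
  by move=> n; have [] := cun n z Oz.
have der (u p : plane -> R[i]) (un pn : nat -> plane -> R[i]) v :
    (forall z0, Omega z0 -> exists A, \forall z \near z0, forall n, normc (u z - un n z) <= A * (1 / 2) ^+ n /\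
      normc (p z - pn n z) <= A * (1 / 2) ^+ n) ->
    (forall n z, Omega z -> cderiv (un n) z v (pn n z)) -> forall z, Omega z -> cderiv u z v (p z).
  move=> ul dun z Oz; have [A HA] := ul z Oz; split.
    apply: (@is_derive_geometric R _ (fun n y => complex.Re (un n y)) (fun n y => complex.Re (pn n y)) _
      (fun y => complex.Re (p y)) z v A).
    - by apply: filterS HA => y Hy n; have [h1 _] := Hy n; rewrite ReB (le_trans (normRe _)).
    - by apply: filterS HA => y Hy n; have [_ h1] := Hy n; rewrite ReB (le_trans (normRe _)).
    - by apply: near_Omega Oz => // y Oy n; have [] := dun n y Oy.
  apply: (@is_derive_geometric R _ (fun n y => complex.Im (un n y)) (fun n y => complex.Im (pn n y)) _
    (fun y => complex.Im (p y)) z v A).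
  - by apply: filterS HA => y Hy n; have [h1 _] := Hy n; rewrite ImB (le_trans (normIm _)).
  - by apply: filterS HA => y Hy n; have [_ h1] := Hy n; rewrite ImB (le_trans (normIm _)).
  - by apply: near_Omega Oz => // y Oy n; have [] := dun n y Oy.
have wC1 : C1f Omega w wx wy.
  split.
  - apply: (cont w h); last by move=> n; exact: C1f_c (hC1 n).
    by move=> z /lims1[A HA]; exists A; apply: filterS HA => y Hy n; have [] := Hy n.
  - apply: (cont wx hx); last by move=> n; exact: C1f_cx (hC1 n).
    by move=> z /lims1[A HA]; exists A; apply: filterS HA => y Hy n; have [] := Hy n.
  - apply: (cont wy hy); last by move=> n; exact: C1f_cy (hC1 n).
    by move=> z /lims1[A HA]; exists A; apply: filterS HA => y Hy n; have [] := Hy n.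
  - apply: (der w wx h hx); last by move=> n; exact: C1f_dx (hC1 n).
    by move=> z /lims1[A HA]; exists A; apply: filterS HA => y Hy n; have [] := Hy n.
  - apply: (der w wy h hy); last by move=> n; exact: C1f_dy (hC1 n).
    by move=> z /lims1[A HA]; exists A; apply: filterS HA => y Hy n; have [] := Hy n.
exists w, wx, wy; split => // z Oz.
have [A A0 /nbhs_singleton HA] := lims z Oz.
have zero : Tk k w z - g z = 0.
  apply: (@normc_half_pow0 R _ (A + A * expR (lam * cabs z))) => n.
  have cdiff y : Omega y -> ccont (fun y => w y - h n y) y.
    by move=> Oy; exact: (ccontB (C1f_c wC1 Oy) (C1f_c (hC1 n) Oy)).
  have -> : Tk k w z - g z = (w z - h n.+1 z) + Op (ker k) (fun y => w y - h n y) z.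
    rewrite /Tk (OpB ck (C1f_c wC1) (C1f_c (hC1 n)) Oz) hS; ring.
  have h1 : normc (w z - h n.+1 z) <= A * (1 / 2) ^+ n.
    have [] := HA 1 _ n.+1; rewrite ?ler01 ?lexx// expr1n scale1r => h1 _ _.
    by apply: (le_trans h1); rewrite ler_wpM2l// ler_wiXn2l//; lra.
  have B0 : 0 <= A * (1 / 2) ^+ n by rewrite mulr_ge0// exprn_ge0// divr_ge0.
  have h2 := Op_contract B0 ck cdiff Oz ker_bound.
  have {}h2 : normc (Op (ker k) (fun y => w y - h n y) z) <= A * (1 / 2) ^+ n / 8 * expR (lam * cabs z).
    by apply: h2 => s ss; have [h2 _ _] := HA s ss n; rewrite (le_trans h2)// ler_peMr.
  have BE0 : 0 <= A * (1 / 2) ^+ n * expR (lam * cabs z) by rewrite mulr_ge0 ?expR_ge0.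
  rewrite (le_trans (le_normcD _ _))// mulrDl; apply: lerD => //.
  by apply: (le_trans h2); rewrite [leRHS]mulrAC; lra.
by apply/eqP; rewrite -subr_eq0 zero.
Qed.

End Picard.
End VK.
End Volterra.

(** * The area measure *)

Section plane_measure.
Variable R : realType.
Notation plane := (R * R)%type.
Notation mplane := (measurableTypeR R * measurableTypeR R)%type.
Notation mu := (@lebesgue_measure R).

(** An open set is the union of the rectangles with rational sides that it
    contains. *)
Lemma open_plane_measurable (U : set plane) : open U -> measurable (U : set mplane).
Proof.
move=> oU.
pose F (r : rat * rat * rat * rat) : set mplane :=
  let Q := `](ratr r.1.1.1), (ratr r.1.1.2)[%classic `*` `](ratr r.1.2), (ratr r.2)[%classic in
  if `[< Q `<=` U >] then Q else set0.
have -> : (U : set mplane) = \bigcup_r F r.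
  apply/seteqP; split=> [[x y] Uxy|z [r _]]; last first.
    by rewrite /F /=; case: asboolP => // QU; exact: QU.
  have /near_planeP[e e0 H] : \forall z \near (x, y), U z by exact: open_nbhs_nbhs.
  have /rat_in_itvoo[a1 ha1] : x - e < x by rewrite ltrBlDr ltrDl.
  have /rat_in_itvoo[a2 ha2] : x < x + e by rewrite ltrDl.
  have /rat_in_itvoo[b1 hb1] : y - e < y by rewrite ltrBlDr ltrDl.
  have /rat_in_itvoo[b2 hb2] : y < y + e by rewrite ltrDl.
  exists (a1, a2, b1, b2) => //; rewrite /F /=; case: asboolP => QU; last first.
    exfalso; apply: QU => -[x' y'] /= []; rewrite !in_itv /= => /andP[u1 u2] /andP[u3 u4].
    move: ha1 ha2 hb1 hb2; rewrite !in_itv /= => /andP[? ?] /andP[? ?] /andP[? ?] /andP[? ?].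
    have := H (x' - x) (y' - y); rewrite !(addrC x) !(addrC y) !subrK; apply.
      by rewrite ltr_norml; apply/andP; split; lra.
    by rewrite ltr_norml; apply/andP; split; lra.
  move: ha1 ha2 hb1 hb2; rewrite !in_itv /= => /andP[_ ?] /andP[? _] /andP[_ ?] /andP[? _].
  by split; rewrite /= in_itv /=; apply/andP.
apply: countable_bigcupT_measurable => [|r]; first exact: countableP.
rewrite /F /=; case: asboolP => _; last exact: measurable0.
by apply: measurableX; exact: measurable_itv.
Qed.

Lemma open_plane_measurable_fun (D : set plane) (F : plane -> R) :
  open D -> (forall z, D z -> {for z, continuous F}) ->
  measurable_fun (D : set mplane) F.
Proof.
move=> oD cF mD; apply: (measurability _ (RGenOInfty.measurableE R)) => //.
move=> _ [_ [a ->] <-]; apply: open_plane_measurable.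
rewrite openE => z [Dz Fz]; apply: filterI; first exact: open_nbhs_nbhs.
have /cF /(_ `]a, +oo[%classic) := Dz; apply.
by apply: open_nbhs_nbhs; split.
Qed.

Lemma dilation_measurable (c : R) :
  measurable_fun [set: mplane] (fun z : mplane => (c * z.1, c * z.2) : mplane).
Proof.
apply: measurable_fun_pair; apply: measurable_funM => //; exact: measurable_cst.
Qed.

Lemma lebesgue_dilation (c : R) (A : set R) : 0 < c -> measurable A ->
  (c%:E * mu [set x | A (c * x)%R] = mu A)%E.
Proof.
move=> c0 mA.
have mf : measurable_fun [set: measurableTypeR R] (fun x => c * x : measurableTypeR R).
  by apply: measurable_funM => //; exact: measurable_cst.
pose m1 : {measure set (measurableTypeR R) -> \bar R} :=
  mscale (NngNum (ltW c0)) (pushforward mu (fun x => c * x : measurableTypeR R)).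
apply/esym; apply: (@lebesgue_measure_unique R (m1 mf)) => //= _ [[a b]] _ <-.
rewrite /m1 /mscale /pushforward /=.
rewrite [pushforward _ _ _](_ : _ = mu `](a / c), (b / c)]%classic); last first.
  congr (mu _); apply/seteqP; split => x /=; rewrite !in_itv /= ltr_pdivrMr// ler_pdivlMr// mulrC//.
rewrite !lebesgue_measure_itv/= !lte_fin ltr_pM2r ?invr_gt0//.
case: ifP => _; last by rewrite mule0.
by rewrite -EFinM; congr EFin; field; rewrite gt_eqF.
Qed.

Lemma area_dilation (c : R) (A : set mplane) : 0 < c -> measurable A ->
  ((c ^+ 2)%:E * area R [set z | A (c * z.1, c * z.2)%R] = area R A)%E.
Proof.
move=> c0 mA; have mf := @dilation_measurable c.
have c2 : 0 <= c ^+ 2 by rewrite exprn_ge0// ltW.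
pose m1 : {measure set mplane -> \bar R} :=
  mscale (NngNum c2) (pushforward (area R) (fun z : mplane => (c * z.1, c * z.2) : mplane)).
apply/esym; apply: (@product_measure_unique _ _ _ _ R mu mu (m1 mf)) => //= X Y mX mY.
rewrite /m1 /mscale /pushforward /=.
have mc (Z : set R) : measurable Z -> measurable [set x | Z (c * x)].
  move=> mZ; rewrite -[X in measurable X]setTI.
  by apply: (measurable_funM (measurable_cst c) (@measurable_id _ _ _)).
rewrite [pushforward _ _ _](_ : _ = (mu [set x | X (c * x)%R] * mu [set x | Y (c * x)%R])%E);
  last exact: (product_measure1E mu mu (mc _ mX) (mc _ mY)).
by rewrite -(lebesgue_dilation c0 mX) -(lebesgue_dilation c0 mY) expr2 EFinM muleACA.
Qed.

Lemma integral_dilation (c : R) (F : mplane -> \bar R) : 0 < c ->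
  measurable_fun (setT : set mplane) F -> (forall z, (0 <= F z)%E) ->
  ((c ^+ 2)%:E * \int[area R]_z F (c * z.1, c * z.2)%R = \int[area R]_z F z)%E.
Proof.
move=> c0 mF F0; have mf := @dilation_measurable c.
have c2 : 0 <= c ^+ 2 by rewrite exprn_ge0// ltW.
pose m0 : {measure set mplane -> \bar R} :=
  pushforward (area R) (fun z : mplane => (c * z.1, c * z.2) : mplane).
pose m1 : {measure set mplane -> \bar R} := mscale (NngNum c2) (m0 mf).
transitivity (\int[m1]_z F z)%E; last first.
  by apply: eq_measure_integral => A mA _; exact: area_dilation.
have F0' (z : mplane) : setT z -> (0 <= F z)%E by move=> _; exact: F0.
rewrite (@ge0_integral_mscale _ _ R (m0 mf) setT measurableT (NngNum c2) F mF F0').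
have E := @ge0_integral_pushforward _ _ _ _ R _ mf (area R) setT F measurableT mF
  (fun z _ => F0 z).
rewrite preimage_setT in E.
by apply: (eq_trans _ (esym (congr1 (fun x : \bar R => ((c ^+ 2)%:E * x)%E) E))).
Qed.

Lemma intab_EFin (a b : R) (F : R -> R) : contI a b F ->
  (\int[mu]_(x in `[a, b]) (F x)%:E)%E = (intab a b F)%:E.
Proof.
move=> cF; rewrite /intab /Rintegral fineK//; apply: integrable_fin_num => //.
exact: contI_integrable.
Qed.

(** Tube lemma for a segment. *)
Lemma near_tube (V : topologicalType) (a b : R) (P : V -> R -> Prop) (z0 : V) :
  (forall s, a <= s <= b -> \forall p \near (z0, s), P p.1 p.2) ->
  \forall z \near z0, forall s, a <= s <= b -> P z s.
Proof.
move=> nP.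
have /compact_near_coveringP := @segment_compact R a b.
move=> /(_ V (nbhs z0) (fun z s => P z s)) H.
have : \forall z \near z0, `[a, b] `<=` (fun s => P z s).
  apply: H => s; rewrite /= in_itv /= => /nP [[A B] /= [nA nB] AB].
  by exists (B, A) => //= -[s' z] [/= Bs' Az]; exact: (AB (z, s') (conj Az Bs')).
by apply: filterS => z Hz s sab; apply: Hz; rewrite /= in_itv.
Qed.

Section rectangle.
Variables (Omega : set plane) (a b c d : R) (f : plane -> R).
Hypothesis oO : open Omega.
Hypothesis QO : forall x y, a <= x <= b -> c <= y <= d -> Omega (x, y).
Hypothesis cf : forall z, Omega z -> {for z, continuous f}.
Hypothesis ab : a <= b.
Hypothesis cd : c <= d.

Let Q : set mplane := (`[a, b] `*` `[c, d])%classic.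

Lemma contI_slice_x (y : R) : c <= y <= d -> contI a b (fun x => f (x, y)).
Proof.
move=> yh x xh; apply: (@cont_comp _ _ _ (fun x => (x, y)) f); last exact/cf/QO.
by apply: cont_pair; [exact: cvg_id|exact: cvg_cst].
Qed.

Lemma contI_slice_y (x : R) : a <= x <= b -> contI c d (fun y => f (x, y)).
Proof.
move=> xh y yh; apply: (@cont_comp _ _ _ (fun y => (x, y)) f); last exact/cf/QO.
by apply: cont_pair; [exact: cvg_cst|exact: cvg_id].
Qed.

Lemma contI_int_x : contI a b (fun x => intab c d (fun y => f (x, y))).
Proof.
move=> x xh; apply: (@continuous_intab _ _ c d (fun x y => f (x, y))) => //.
have : \forall z \near x, forall s, c <= s <= d -> Omega (z, s).
  apply: near_tube => s sh; have := open_nbhs_nbhs (conj oO (QO xh sh)).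
  by apply: filterS => -[].
apply: filterS => z zO s sh.
have -> : (fun p : R * R => f (p.1, p.2)) = f by apply/funext => -[].
by apply: cf; exact: zO.
Qed.

Lemma contI_int_y : contI c d (fun y => intab a b (fun x => f (x, y))).
Proof.
move=> y yh; apply: (@continuous_intab _ _ a b (fun y x => f (x, y))) => //.
have : \forall z \near y, forall s, a <= s <= b -> Omega (s, z).
  apply: near_tube => s sh; have := open_nbhs_nbhs (conj oO (QO sh yh)).
  move=> [[A B] /= [nA nB] AB]; exists (B, A) => //= -[u v] [/= Bu Av].
  exact: (AB (v, u) (conj Av Bu)).
apply: filterS => z zO s sh.
apply: (@cont_comp _ _ _ (fun p : R * R => (p.2, p.1)) f); last exact/cf/zO.
by apply: cont_pair; [exact: cvg_snd|exact: cvg_fst].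
Qed.

Hypothesis f0 : forall z, Omega z -> 0 <= f z.

Let mQ : measurable Q. Proof. by apply: measurableX; exact: measurable_itv. Qed.
Let QO' : Q `<=` Omega.
Proof. by move=> -[x y] [/=]; rewrite !in_itv; exact: QO. Qed.

Let mF : measurable_fun (setT : set mplane) ((EFin \o (f : mplane -> R)) \_ Q).
Proof.
apply/(measurable_restrictT _ mQ); apply/measurable_EFinP.
apply: (measurable_funS _ QO'); first exact: open_plane_measurable.
exact: open_plane_measurable_fun.
Qed.

Let F0 (z : mplane) : (0 <= ((EFin \o (f : mplane -> R)) \_ Q) z)%E.
Proof.
rewrite patchE; case: ifPn => // /set_mem /QO' ?; rewrite lee_fin; exact: f0.
Qed.

Lemma area_integral_rect :
  (\int[area R]_(z in Q) (f z)%:E)%E = (intab a b (fun x => intab c d (fun y => f (x, y))))%:E.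
Proof.
rewrite integral_mkcond (fubini_tonelli1 _ mF F0) -(intab_EFin contI_int_x).
rewrite [RHS]integral_mkcond; apply: eq_integral => x _; rewrite /fubini_F patchE.
case: ifPn => [/set_mem|/negP nx].
  rewrite /= in_itv /= => xh; rewrite -(intab_EFin (contI_slice_y xh)) [RHS]integral_mkcond.
  apply: eq_integral => y _; rewrite !patchE /= in_setX.
  by have -> : x \in `[a, b]%classic by apply/mem_set; rewrite /= in_itv.
rewrite integral0_eq// => y _; rewrite patchE in_setX.
by have -> : (x \in `[a, b]%classic) = false by apply/negP.
Qed.

Lemma area_integral_rect_swap :
  (\int[area R]_(z in Q) (f z)%:E)%E = (intab c d (fun y => intab a b (fun x => f (x, y))))%:E.
Proof.
rewrite integral_mkcond (fubini_tonelli2 _ mF F0) -(intab_EFin contI_int_y).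
rewrite [RHS]integral_mkcond; apply: eq_integral => y _; rewrite /fubini_G patchE.
case: ifPn => [/set_mem|/negP nx].
  rewrite /= in_itv /= => yh; rewrite -(intab_EFin (contI_slice_x yh)) [RHS]integral_mkcond.
  apply: eq_integral => x _; rewrite !patchE /= in_setX andbC.
  by have -> : y \in `[c, d]%classic by apply/mem_set; rewrite /= in_itv.
rewrite integral0_eq// => x _; rewrite patchE in_setX andbC.
by have -> : (y \in `[c, d]%classic) = false by apply/negP.
Qed.

End rectangle.

Lemma area_sigma_finite : sigma_finite (setT : set mplane) (area R).
Proof.
exists (fun n => `[- n%:R, n%:R]%classic `*` `[- n%:R, n%:R]%classic).
  apply/seteqP; split => // -[x y] _.
  exists (Num.truncn (Num.max `|x| `|y|)).+1 => //.
  have : Num.max `|x| `|y| <= (Num.truncn (Num.max `|x| `|y|)).+1%:R.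
    by apply/ltW/truncnS_gt.
  by rewrite ge_max !ler_norml => /andP[h1 h2]; split; rewrite /= in_itv.
move=> n; have mI : measurable (`[(- n%:R)%R, n%:R%R]%classic : set R) by exact: measurable_itv.
split; first exact: measurableX.
rewrite [area R _](product_measure1E mu mu mI mI).
have l : (mu (`[(- n%:R)%R, n%:R%R]%classic : set R) < +oo)%E.
  by rewrite lebesgue_measure_itv /=; case: ifP => _; rewrite ?ltry// -EFinD ltry.
have l0 : (0 <= mu (`[(- n%:R)%R, n%:R%R]%classic : set R))%E by exact: measure_ge0.
by apply: lte_mul_pinfty; rewrite // ge0_fin_numE.
Qed.

Section rays.
Variables (Omega : set plane) (F : plane -> R) (s1 : R).
Hypothesis oO : open Omega.
Hypothesis sO : starshaped0 Omega.
Hypothesis cF : forall z, Omega z -> {for z, continuous F}.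
Hypothesis F0 : forall z, Omega z -> 0 <= F z.
Hypothesis s10 : 0 < s1.
Hypothesis s11 : s1 <= 1.

Let Ft : mplane -> \bar R := (EFin \o (F : mplane -> R)) \_ (Omega : set mplane).

Let mO : measurable (Omega : set mplane). Proof. exact: open_plane_measurable. Qed.

Let mFt : measurable_fun (setT : set mplane) Ft.
Proof.
apply/(measurable_restrictT _ mO); apply/measurable_EFinP.
exact: open_plane_measurable_fun.
Qed.

Let Ft0 z : (0 <= Ft z)%E.
Proof. by rewrite /Ft patchE; case: ifPn => // /set_mem ?; rewrite lee_fin; exact: F0. Qed.

(* The integrand, extended by zero to the whole of the plane times the line. *)
Let K (p : mplane * measurableTypeR R) : \bar R :=
  (Ft (p.2 ^+ 2 * p.1.1, p.2 ^+ 2 * p.1.2)%R * (\1_(`[s1, 1]%classic) p.2)%:E)%E.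

Let mK : measurable_fun (setT : set (mplane * measurableTypeR R)) K.
Proof.
apply: emeasurable_funM.
  apply: (measurableT_comp mFt).
  have m2 : measurable_fun (setT : set (mplane * measurableTypeR R)) (fun p => p.2 ^+ 2 : R).
    exact: measurable_funX.
  apply: measurable_fun_pair; apply: measurable_funM => //.
    exact: (measurableT_comp measurable_fst measurable_fst).
  exact: (measurableT_comp measurable_snd measurable_fst).
apply/measurable_EFinP; apply: (measurableT_comp _ measurable_snd).
by apply: measurable_indic; exact: measurable_itv.
Qed.

Let K0 p : (0 <= K p)%E.
Proof. by apply: mule_ge0 => //; rewrite lee_fin. Qed.

(** Integration over dilations is bounded in [L^1]: the substitution [w = s ^+ 2 *: z]
    costs the factor [s ^- 4 <= s1 ^- 4]. *)
Lemma integral_rays :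
  (\int[area R]_(z in Omega) (intab s1 1 (fun s : R => F (s ^+ 2 *: z)))%:E <=
   ((s1 ^+ 4)^-1)%:E * \int[area R]_(z in Omega) (F z)%:E)%E.
Proof.
have scaleE (s : R) (z : plane) : s ^+ 2 *: z = (s ^+ 2 * z.1, s ^+ 2 * z.2) by [].
have IE : (\int[area R]_(z in Omega) (F z)%:E)%E = (\int[area R]_z Ft z)%E.
  by rewrite integral_mkcond.
have KE z : Omega z ->
    ((intab s1 1 (fun s : R => F (s ^+ 2 *: z)))%:E = \int[mu]_s K (z, s))%E.
  move=> zO; rewrite -intab_EFin; last first.
    move=> s /andP[h1 h2]; apply: (@cont_comp _ _ _ (fun s : R => s ^+ 2 *: z) F).
      by apply: cvgZl; exact: exprn_continuous.
    by apply: cF; apply: star_sq => //; rewrite h2 (le_trans (ltW s10)).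
  rewrite integral_mkcond; apply: eq_integral => s _; rewrite patchE /K /= indicE.
  case: ifPn => [/set_mem|_]; last by rewrite mule0.
  rewrite /= in_itv /= => /andP[h1 h2]; rewrite mule1 /Ft patchE -scaleE mem_set//.
  by apply: star_sq => //; rewrite h2 (le_trans (ltW s10)).
have mG : measurable_fun (setT : set mplane) (fun z => (\int[mu]_s K (z, s))%E).
  exact: (measurable_fun_fubini_tonelli_F _ mK K0).
apply: (@le_trans _ _ (\int[area R]_z \int[mu]_s K (z, s))%E).
  rewrite (eq_integral (fun z => (\int[mu]_s K (z, s))%E)); last first.
    by move=> z /set_mem; exact: KE.
  by apply: ge0_subset_integral => // z _; exact: integral_ge0.
have fA := area_sigma_finite.
pose fM := @Measure_isSigmaFinite.Build _ _ R (mu \x mu)%E fA.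
pose m2 : {sigma_finite_measure set mplane -> \bar R} := HB.pack (mu \x mu)%E fM.
have FT : (\int[area R]_z \int[mu]_s K (z, s))%E = (\int[mu]_s \int[area R]_z K (z, s))%E.
  exact: (@fubini_tonelli _ _ _ _ R m2 mu K mK K0).
rewrite IE FT.
have h4 : 0 <= (s1 ^+ 4)^-1 by rewrite invr_ge0 exprn_ge0// ltW.
have lT : (mu (`[s1, 1%R]%classic : set R) <= 1)%E.
  rewrite lebesgue_measure_itv /=; case: ifP => _; last by rewrite lee_fin.
  by rewrite -EFinD lee_fin gerDl oppr_le0 ltW.
set I := (\int[area R]_z Ft z)%E.
have I0 : (0 <= I)%E by exact: integral_ge0.
have mI : measurable_fun (setT : set (measurableTypeR R)) (fun s : R => (\1_(`[s1, 1]%classic) s : R)%:E).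
  apply/measurable_EFinP.
  by apply: measurable_indic; exact: measurable_itv.
apply: (@le_trans _ _ (\int[mu]_s (((s1 ^+ 4)^-1)%:E * I * (\1_(`[s1, 1]%classic) s)%:E))%E).
  apply: ge0_le_integral => //.
  - by move=> s _; exact: integral_ge0.
  - exact: (@measurable_fun_fubini_tonelli_G _ _ _ _ R m2 K mK K0).
  - exact: (measurable_funeM _ mI).
  - move=> s _; rewrite /K /= indicE.
    have [/set_mem|_] := boolP (s \in _); last first.
      by rewrite integral0_eq ?mule0// => z _; rewrite mule0.
    rewrite /= in_itv /= => /andP[h1 h2]; rewrite mule1.
    have s0 : 0 < s by rewrite (lt_le_trans s10).
    under eq_integral do rewrite mule1.
    have E := integral_dilation (exprn_gt0 2 s0) mFt Ft0.
    rewrite /I -E muleA -EFinM -exprM -[leLHS]mul1e lee_wpmul2r//.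
      by apply: integral_ge0 => z _.
    by rewrite lee_fin mulrC ler_pdivlMr ?exprn_gt0// mul1r lerXn2r// nnegrE ltW.
rewrite ge0_integralZl//; last by apply: mule_ge0; rewrite // lee_fin.
rewrite integral_indic// setIT -[leRHS]mule1.
by apply: lee_wpmul2l; [apply: mule_ge0; rewrite // lee_fin|exact: lT].
Qed.

End rays.
End plane_measure.

(** * Mean value inequality for conjugate functions *)

Section mean_value.
Variable R : realType.
Notation plane := (R * R)%type.
Notation mplane := (measurableTypeR R * measurableTypeR R)%type.

(** The square of the positive part, a function of class [C^1]. *)
Definition pos2 (t : R) : R := Num.max 0 t ^+ 2.

Lemma pos2_ge0 t : 0 <= pos2 t. Proof. exact: sqr_ge0. Qed.

Lemma pos2_le0 t : t <= 0 -> pos2 t = 0.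
Proof. by move=> t0; rewrite /pos2 max_l// expr0n. Qed.

Lemma pos2_le t b : 0 <= b -> t <= b -> pos2 t <= b ^+ 2.
Proof.
move=> b0 tb; have h : Num.max 0 t <= b by rewrite ge_max b0.
by rewrite /pos2 lerXn2r ?nnegrE// le_max lexx.
Qed.

(* Tangent lines of the square from below. *)
Lemma pos2_ge t l : 0 <= l -> 2 * l * t - l ^+ 2 <= pos2 t.
Proof.
move=> l0; rewrite /pos2; have h : t <= Num.max 0 t by rewrite le_max lexx orbT.
move: (Num.max 0 t) h => m h; have : 0 <= l * (m - t) by rewrite mulr_ge0 ?subr_ge0.
by have := sqr_ge0 (m - l); nra.
Qed.

Lemma is_derive_pos2 (t : R) : is_derive t 1 pos2 (2 * Num.max 0 t).
Proof.
apply/is_derive_epsP => e e0; near=> h.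
have he : `|h| <= e.
  near: h; apply/nbhs_ballP; exists e => //= h.
  by rewrite -ball_normE /= sub0r normrN => /ltW.
have key : `|pos2 (t + h) - pos2 t - 2 * Num.max 0 t * h| <= `|h| * `|h|.
  rewrite -normrM -expr2 (ger0_norm (sqr_ge0 h)) /pos2 ler_norml.
  have [t0|t0] := leP 0 t; have [th0|th0] := leP 0 (t + h); apply/andP; split; nra.
have -> : h *: 1 + t = t + h by rewrite [h *: 1]mulr1 addrC.
by rewrite (mulrC h) (le_trans key)// ler_wpM2r.
Unshelve. all: by end_near. Qed.

Lemma continuous_pos2 (t : R) : {for t, continuous pos2}.
Proof. exact: is_derive_continuous (is_derive_pos2 t). Qed.

(** Differentiation under a double integral over a rectangle. *)
Lemma is_derive_intab2 (a b c d : R) (f fs : R -> R -> R -> R)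
    (D : set ((R * R) * R)) (s0 : R) :
  a <= b -> c <= d -> open D ->
  (forall p, D p -> {for p, continuous (fun p => f p.1.1 p.1.2 p.2)}) ->
  (forall p, D p -> {for p, continuous (fun p => fs p.1.1 p.1.2 p.2)}) ->
  (forall s x y, D ((s, x), y) -> is_derive s 1 (fun s => f s x y) (fs s x y)) ->
  (forall x y, a <= x <= b -> c <= y <= d -> D ((s0, x), y)) ->
  is_derive s0 1 (fun s => intab a b (fun x => intab c d (f s x)))
    (intab a b (fun x => intab c d (fs s0 x))).
Proof.
move=> ab cd oD cf cfs df D0.
have nD : \forall s \near s0, forall x, a <= x <= b ->
    \forall q \near (s, x), forall y, c <= y <= d -> D (q, y).
  apply: near_tube => x xh.
  have : \forall q \near (s0, x), forall y, c <= y <= d -> D (q, y).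
    apply: near_tube => y yh; have := open_nbhs_nbhs (conj oD (D0 _ _ xh yh)).
    by apply: filterS => -[].
  move/nbhs_interior; apply: filterS => -[s' x'] /=; exact.
apply: (@is_derive_intab _ _ a b (fun s x => intab c d (f s x))
  (fun s x => intab c d (fs s x))) => //.
apply: filterS nD => s nD x xh; have nx := nD x xh; split.
- apply: (@continuous_intab _ _ c d (fun q y => f q.1 q.2 y) (s, x)) => //.
  by apply: filterS nx => q Dq y yh; apply: cf; exact: Dq.
- apply: (@continuous_intab _ _ c d (fun q y => fs q.1 q.2 y) (s, x)) => //.
  by apply: filterS nx => q Dq y yh; apply: cfs; exact: Dq.
- apply: (@is_derive_intab _ _ c d (fun s y => f s x y) (fun s y => fs s x y)) => //.
  have : \forall s' \near s, forall y, c <= y <= d -> D ((s', x), y).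
    have cs : {for s, continuous (fun t : R => (t, x))}.
      by apply: cont_pair; [exact: cvg_id|exact: cvg_cst].
    exact: (cs _ nx).
  apply: filterS => s' Ds y yh; have Dy := Ds y yh; split; last exact: df.
  + apply: (@cont_comp _ _ _ (fun p : R * R => ((p.1, x), p.2)) (fun p => f p.1.1 p.1.2 p.2));
      last exact: cf.
    apply: cont_pair; last exact: cvg_snd.
    by apply: cont_pair; [exact: cvg_fst|exact: cvg_cst].
  + apply: (@cont_comp _ _ _ (fun p : R * R => ((p.1, x), p.2)) (fun p => fs p.1.1 p.1.2 p.2));
      last exact: cfs.
    apply: cont_pair; last exact: cvg_snd.
    by apply: cont_pair; [exact: cvg_fst|exact: cvg_cst].
Qed.

(** Fubini's theorem for a continuous function on a rectangle. *)
Lemma intab_swap (Omega : set plane) (a b c d : R) (P : plane -> R) : open Omega ->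
  (forall x y, a <= x <= b -> c <= y <= d -> Omega (x, y)) ->
  (forall z, Omega z -> {for z, continuous P}) -> a <= b -> c <= d ->
  intab a b (fun x => intab c d (fun y => P (x, y))) =
  intab c d (fun y => intab a b (fun x => P (x, y))).
Proof.
move=> oO QO cP ab cd.
(* The polarisation P = ((P + 1)^2 - (P^2 + 1)) / 2 reduces to nonnegative functions. *)
pose P1 z := (P z + 1) ^+ 2; pose P2 z := P z ^+ 2 + 1.
have c1 z : Omega z -> {for z, continuous P1}.
  move=> zO; apply: continuous_sqr; apply: cvgD; [exact: cP|exact: cvg_cst].
have c2 z : Omega z -> {for z, continuous P2}.
  move=> zO; apply: cvgD; [apply: continuous_sqr; exact: cP|exact: cvg_cst].
have p1 z : Omega z -> 0 <= P1 z by rewrite sqr_ge0.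
have p2 z : Omega z -> 0 <= P2 z by rewrite addr_ge0 ?sqr_ge0.
have e1 := area_integral_rect oO QO c1 cd p1.
rewrite (area_integral_rect_swap oO QO c1 ab p1) in e1.
have e2 := area_integral_rect oO QO c2 cd p2.
rewrite (area_integral_rect_swap oO QO c2 ab p2) in e2.
have {}e1 := EFin_inj e1; have {}e2 := EFin_inj e2.
have PE z : P z = 2^-1 * P1 z - 2^-1 * P2 z by rewrite /P1 /P2; field.
have cZ (k p q : R) F : contI p q F -> contI p q (fun s : R => k * F s).
  by move=> cF s sh; apply: cvgM; [exact: cvg_cst|exact: cF].
transitivity (2^-1 * intab a b (fun x => intab c d (fun y => P1 (x, y))) -
    2^-1 * intab a b (fun x => intab c d (fun y => P2 (x, y)))).
  have i1 := contI_int_x oO QO c1 cd; have i2 := contI_int_x oO QO c2 cd.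
  rewrite -(intabZ _ i1) -(intabZ _ i2) -intabB; [|exact: cZ..].
  apply: eq_intab => x xh.
  have j1 := contI_slice_y QO c1 xh; have j2 := contI_slice_y QO c2 xh.
  rewrite -(intabZ _ j1) -(intabZ _ j2) -intabB; [|exact: cZ..].
  by apply: eq_intab => y _.
rewrite -e1 -e2.
have i1 := contI_int_y oO QO c1 ab; have i2 := contI_int_y oO QO c2 ab.
rewrite -(intabZ _ i1) -(intabZ _ i2) -intabB; [|exact: cZ..].
apply: eq_intab => x xh.
have j1 := contI_slice_x QO c1 xh; have j2 := contI_slice_x QO c2 xh.
rewrite -(intabZ _ j1) -(intabZ _ j2) -intabB; [|exact: cZ..].
by apply: eq_intab => y _.
Qed.

(** Two real functions satisfying the Cauchy-Riemann equations, with their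
    partial derivatives [u1 = u_x = v_y] and [u2 = u_y = - v_x]. *)
Record conjugate_pair (Omega : set plane) (u v u1 u2 : plane -> R) : Prop := {
  cp_u : forall z, Omega z -> {for z, continuous u};
  cp_v : forall z, Omega z -> {for z, continuous v};
  cp_u1 : forall z, Omega z -> {for z, continuous u1};
  cp_u2 : forall z, Omega z -> {for z, continuous u2};
  cp_ux : forall z, Omega z -> is_derive z (e_x R) u (u1 z);
  cp_uy : forall z, Omega z -> is_derive z (e_y R) u (u2 z);
  cp_vx : forall z, Omega z -> is_derive z (e_x R) v (- u2 z);
  cp_vy : forall z, Omega z -> is_derive z (e_y R) v (u1 z)
}.

(** Iterated integrals over a rectangle are linear and monotone. *)
Section iterated.
Variables (Omega : set plane) (a b c d : R).
Hypothesis oO : open Omega.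
Hypothesis QO : forall x y, a <= x <= b -> c <= y <= d -> Omega (x, y).
Hypothesis cd : c <= d.
Notation II f := (intab a b (fun x => intab c d (fun y => f (x, y)))).
Implicit Types f g : plane -> R.

Lemma intab2D f g : (forall z, Omega z -> {for z, continuous f}) ->
  (forall z, Omega z -> {for z, continuous g}) ->
  II (fun z => f z + g z) = II f + II g.
Proof.
move=> cf cg; rewrite -(intabD (contI_int_x oO QO cf cd) (contI_int_x oO QO cg cd)).
apply: eq_intab => x xh.
by rewrite -(intabD (contI_slice_y QO cf xh) (contI_slice_y QO cg xh)).
Qed.

Lemma intab2Z (k : R) f : (forall z, Omega z -> {for z, continuous f}) ->
  II (fun z => k * f z) = k * II f.
Proof.
move=> cf; rewrite -(intabZ k (contI_int_x oO QO cf cd)).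
by apply: eq_intab => x xh; rewrite -(intabZ k (contI_slice_y QO cf xh)).
Qed.

Lemma le_intab2 f g : (forall z, Omega z -> {for z, continuous f}) ->
  (forall z, Omega z -> {for z, continuous g}) ->
  (forall x y, a <= x <= b -> c <= y <= d -> f (x, y) <= g (x, y)) -> II f <= II g.
Proof.
move=> cf cg fg; apply: (le_intab (contI_int_x oO QO cf cd) (contI_int_x oO QO cg cd)).
move=> x xh; apply: (le_intab (contI_slice_y QO cf xh) (contI_slice_y QO cg xh)) => y yh.
exact: fg.
Qed.

End iterated.

Lemma intab_quadratic (y0 d al be : R) : 0 < d ->
  intab (y0 - d) (y0 + d) (fun y => al - be * (y - y0) ^+ 2) =
  2 * d * al - 2 / 3 * be * d ^+ 3.
Proof.
move=> d0; pose G (y : R) := al * (y - y0) - be / 3 * (y - y0) ^+ 3.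
have dG (y : R) : is_derive y 1 G (al - be * (y - y0) ^+ 2).
  by apply: is_derive_eq; rewrite /GRing.scale /=; field.
rewrite (_ : intab _ _ _ = G (y0 + d) - G (y0 - d)); first by rewrite /G; field.
apply: (@intab_FTC _ _ _ G).
- by lra.
- by move=> y _; exact: is_derive_continuous (dG y).
- move=> y _; apply: cvgB; first exact: cvg_cst.
  apply: cvgM; first exact: cvg_cst.
  apply: (@continuous_sqr _ _ (fun y : R => y - y0)).
  by apply: cvgB; [exact: cvg_id|exact: cvg_cst].
Qed.

Lemma mean_square_arith (d u0 m I J : R) : 0 < d -> 0 <= I -> 4 / 9 * d ^+ 6 <= m ->
  J <= d ^+ 4 * I -> 0 <= J - u0 ^+ 2 * m -> d ^+ 2 * u0 ^+ 2 <= 3 * I.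
Proof.
move=> d0 I0 hm JI J0.
have um : u0 ^+ 2 * (4 / 9 * d ^+ 6) <= u0 ^+ 2 * m by rewrite ler_wpM2l ?sqr_ge0.
have d4 : 0 < d ^+ 4 by rewrite exprn_gt0.
have : d ^+ 4 * (4 / 9 * (d ^+ 2 * u0 ^+ 2)) <= d ^+ 4 * I.
  rewrite (_ : d ^+ 4 * _ = u0 ^+ 2 * (4 / 9 * d ^+ 6)); last by ring.
  by lra.
by rewrite ler_pM2l//; lra.
Qed.

Section square.
Variables (Omega : set plane) (u v u1 u2 : plane -> R) (x0 y0 d : R).
Hypothesis oO : open Omega.
Hypothesis cp : conjugate_pair Omega u v u1 u2.
Hypothesis d0 : 0 < d.
Hypothesis QO : forall x y, `|x - x0| <= d -> `|y - y0| <= d -> Omega (x, y).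

Let a := x0 - d.
Let b := x0 + d.
Let c := y0 - d.
Let e := y0 + d.

(* [chi] is radial about [(x0, y0)] and vanishes outside the disc of radius [d];
   its derivative in the direction [w] at [z] is [- 2 w . (z - (x0, y0)) * chi' z]. *)
Let chi (z : plane) : R := pos2 (d ^+ 2 - (z.1 - x0) ^+ 2 - (z.2 - y0) ^+ 2).
Let chi' (z : plane) : R := 2 * Num.max 0 (d ^+ 2 - (z.1 - x0) ^+ 2 - (z.2 - y0) ^+ 2).
(* The dilations about the centre of the square. *)
Let pt (s : R) (z : plane) : plane := (x0 + s * (z.1 - x0), y0 + s * (z.2 - y0)).

Let ab : a <= b. Proof. by have := d0; rewrite /a /b; lra. Qed.
Let ce : c <= e. Proof. by have := d0; rewrite /c /e; lra. Qed.

Let QO' x y : a <= x <= b -> c <= y <= e -> Omega (x, y).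
Proof.
move=> /andP[h1 h2] /andP[h3 h4]; apply: QO; rewrite ler_norml; apply/andP; split;
  move: h1 h2 h3 h4; rewrite /a /b /c /e; lra.
Qed.

Let ptO s x y : 0 <= s <= 1 -> a <= x <= b -> c <= y <= e -> Omega (pt s (x, y)).
Proof.
move=> /andP[s0 s1] /andP[h1 h2] /andP[h3 h4]; apply: QO; rewrite /= addrC addKr normrM ger0_norm//;
  rewrite -[d]mul1r ler_pM// ler_norml; apply/andP; split;
  move: h1 h2 h3 h4; rewrite /a /b /c /e; lra.
Qed.

Let cont_pt (z : plane) s : {for z, continuous (pt s)}.
Proof.
apply: cont_pair; apply: cvgD; try exact: cvg_cst; apply: cvgM; try exact: cvg_cst;
  apply: cvgB; try exact: cvg_cst; [exact: cvg_fst|exact: cvg_snd].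
Qed.

Let cont_pt3 (p : (R * R) * R) : {for p, continuous (fun p => pt p.1.1 (p.1.2, p.2))}.
Proof.
have f11 : {for p, continuous (fun p : (R * R) * R => p.1.1)}.
  by apply: (@cont_comp _ _ _ fst fst); exact: cvg_fst.
have f12 : {for p, continuous (fun p : (R * R) * R => p.1.2)}.
  by apply: (@cont_comp _ _ _ fst snd); [exact: cvg_fst|exact: cvg_snd].
apply: cont_pair; apply: cvgD; try exact: cvg_cst; apply: cvgM => //;
  apply: cvgB => //; try exact: cvg_cst; exact: cvg_snd.
Qed.

Let cont_r2 (z : plane) : {for z, continuous (fun z : plane => d ^+ 2 - (z.1 - x0) ^+ 2 - (z.2 - y0) ^+ 2)}.
Proof.
apply: cvgB; first apply: cvgB; first exact: cvg_cst.
  apply: (@continuous_sqr _ _ (fun z : plane => z.1 - x0)).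
  by apply: cvgB; [exact: cvg_fst|exact: cvg_cst].
apply: (@continuous_sqr _ _ (fun z : plane => z.2 - y0)).
by apply: cvgB; [exact: cvg_snd|exact: cvg_cst].
Qed.

Let cont_chi (z : plane) : {for z, continuous chi}.
Proof. apply: (cont_comp (@cont_r2 z)); exact: continuous_pos2. Qed.

Let D : set ((R * R) * R) := [set p | Omega (pt p.1.1 (p.1.2, p.2))].

Let oD : open D.
Proof. by move: oO; rewrite !openE => H p /H; exact: cont_pt3. Qed.

Let is_derive_pt (u' : plane -> R) (w1 w2 : plane -> R) s x y :
  (forall z, Omega z -> is_derive z (e_x R) u' (w1 z)) ->
  (forall z, Omega z -> is_derive z (e_y R) u' (w2 z)) ->
  (forall z, Omega z -> {for z, continuous w1}) ->
  (forall z, Omega z -> {for z, continuous w2}) ->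
  Omega (pt s (x, y)) ->
  [/\ is_derive s 1 (fun s => u' (pt s (x, y)))
        ((x - x0) * w1 (pt s (x, y)) + (y - y0) * w2 (pt s (x, y))),
      is_derive x 1 (fun x => u' (pt s (x, y))) (s * w1 (pt s (x, y))) &
      is_derive y 1 (fun y => u' (pt s (x, y))) (s * w2 (pt s (x, y)))].
Proof.
move=> h1 h2 c1 c2 zO; have nO : \forall q \near pt s (x, y), Omega q by exact: open_nbhs_nbhs.
have n1 : \forall q \near pt s (x, y), is_derive q (e_x R) u' (w1 q).
  by apply: filterS nO; exact: h1.
have n2 : \forall q \near pt s (x, y), is_derive q (e_y R) u' (w2 q).
  by apply: filterS nO; exact: h2.
have lin (k m n t : R) : is_derive t 1 (fun t : R => k + m * (t - n)) m.
  by apply: is_derive_eq; rewrite /GRing.scale /=; ring.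
have lin' (k m t : R) : is_derive t 1 (fun t : R => k + t * m) m.
  by apply: is_derive_eq; rewrite /GRing.scale /=; ring.
split.
- exact: (is_derive_curve (g1 := fun t => x0 + t * (x - x0)) (g2 := fun t => y0 + t * (y - y0))
    (t := s) n1 n2 (c1 _ zO) (c2 _ zO) (lin' x0 (x - x0) s) (lin' y0 (y - y0) s)).
- have h := is_derive_curve (g1 := fun t => x0 + s * (t - x0)) (g2 := fun=> y0 + s * (y - y0))
    (t := x) (d1 := s) (d2 := 0) n1 n2 (c1 _ zO) (c2 _ zO) (lin x0 s x0 x) (is_derive_cst _ x 1).
  by rewrite mul0r addr0 in h.
- have h := is_derive_curve (g2 := fun t => y0 + s * (t - y0)) (g1 := fun=> x0 + s * (x - x0))
    (t := y) (d1 := 0) (d2 := s) n1 n2 (c1 _ zO) (c2 _ zO) (is_derive_cst _ y 1)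
    (lin y0 s y0 y).
  by rewrite mul0r add0r in h.
Qed.

Let F (s : R) := intab a b (fun x => intab c e (fun y => chi (x, y) * u (pt s (x, y)))).

Let cont_u3 (w : plane -> R) (p : (R * R) * R) : (forall z, Omega z -> {for z, continuous w}) ->
  D p -> {for p, continuous (fun p => w (pt p.1.1 (p.1.2, p.2)))}.
Proof.
by move=> cw Dp; apply: (cont_comp (f := fun p => pt p.1.1 (p.1.2, p.2)) (g := w)) => //; exact: cw.
Qed.

Let cont_12_2 (w : plane -> R) (p : (R * R) * R) : (forall z, {for z, continuous w}) ->
  {for p, continuous (fun p => w (p.1.2, p.2))}.
Proof.
move=> cw; apply: (cont_comp (f := fun p => (p.1.2, p.2)) (g := w)); last exact: cw.
apply: cont_pair; last exact: cvg_snd.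
by apply: (cont_comp (f := fst) (g := snd)); [exact: cvg_fst|exact: cvg_snd].
Qed.

Let cont_x (z : plane) : {for z, continuous (fun z : plane => z.1 - x0)}.
Proof. by apply: cvgB; [exact: cvg_fst|exact: cvg_cst]. Qed.

Let cont_y (z : plane) : {for z, continuous (fun z : plane => z.2 - y0)}.
Proof. by apply: cvgB; [exact: cvg_snd|exact: cvg_cst]. Qed.

Let dF (s : R) : 0 <= s <= 1 -> is_derive s 1 F (intab a b (fun x => intab c e (fun y =>
  chi (x, y) * ((x - x0) * u1 (pt s (x, y)) + (y - y0) * u2 (pt s (x, y)))))).
Proof.
move=> sh; apply: (@is_derive_intab2 a b c e (fun s x y => chi (x, y) * u (pt s (x, y)))
  (fun s x y => chi (x, y) * ((x - x0) * u1 (pt s (x, y)) + (y - y0) * u2 (pt s (x, y)))) D) => //.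
- move=> p Dp; apply: (@cvgM _ _ _ _ (fun p => chi (p.1.2, p.2))); first exact: cont_12_2.
  exact: (cont_u3 (cp_u cp)).
- move=> p Dp; apply: (@cvgM _ _ _ _ (fun p => chi (p.1.2, p.2))); first exact: cont_12_2.
  apply: cvgD; apply: cvgM.
  + exact: (@cont_12_2 (fun z => z.1 - x0) p cont_x).
  + exact: (cont_u3 (cp_u1 cp)).
  + exact: (@cont_12_2 (fun z => z.2 - y0) p cont_y).
  + exact: (cont_u3 (cp_u2 cp)).
- move=> t x y Dp; have [h _ _] := is_derive_pt (cp_ux cp) (cp_uy cp) (cp_u1 cp) (cp_u2 cp) Dp.
  have h' := is_deriveM (is_derive_cst (chi (x, y)) t 1) h.
  by apply: is_derive_eq h' _; rewrite /GRing.scale /=; ring.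
- by move=> x y xh yh; exact: ptO.
Qed.

Let cont_chi' (z : plane) : {for z, continuous chi'}.
Proof.
have -> : chi' = fun z => (d ^+ 2 - (z.1 - x0) ^+ 2 - (z.2 - y0) ^+ 2) +
    `|d ^+ 2 - (z.1 - x0) ^+ 2 - (z.2 - y0) ^+ 2|.
  apply/funext => w; rewrite /chi'; move: (_ - _ - _) => t.
  by have [t0|t0] := leP 0 t; [rewrite ger0_norm|rewrite ltr0_norm]; lra.
by apply: cvgD; [exact: cont_r2|apply: cvg_norm; exact: cont_r2].
Qed.

Let dchi_y (x y : R) : is_derive y 1 (fun y => chi (x, y)) (- 2 * (y - y0) * chi' (x, y)).
Proof.
have h : is_derive y 1 (fun y => d ^+ 2 - (x - x0) ^+ 2 - (y - y0) ^+ 2) (- 2 * (y - y0)).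
  by apply: is_derive_eq; rewrite /GRing.scale /=; ring.
exact: (is_derive_comp1 (is_derive_pos2 _) h).
Qed.

Let dchi_x (x y : R) : is_derive x 1 (fun x => chi (x, y)) (- 2 * (x - x0) * chi' (x, y)).
Proof.
have h : is_derive x 1 (fun x => d ^+ 2 - (x - x0) ^+ 2 - (y - y0) ^+ 2) (- 2 * (x - x0)).
  by apply: is_derive_eq; rewrite /GRing.scale /=; ring.
exact: (is_derive_comp1 (is_derive_pos2 _) h).
Qed.

Let chi_edge (x y : R) : d ^+ 2 <= (x - x0) ^+ 2 \/ d ^+ 2 <= (y - y0) ^+ 2 -> chi (x, y) = 0.
Proof.
move=> h; apply: pos2_le0 => /=; have := sqr_ge0 (x - x0); have := sqr_ge0 (y - y0).
by case: h; lra.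
Qed.

(* The radial derivative of [u] is the angular derivative of [v], and the angular
   derivative of a function integrates to zero against a radial weight. *)
Let dF0 (s : R) : 0 < s -> s <= 1 -> intab a b (fun x => intab c e (fun y =>
  chi (x, y) * ((x - x0) * u1 (pt s (x, y)) + (y - y0) * u2 (pt s (x, y))))) = 0.
Proof.
move=> s0 s1; have s01 : 0 <= s <= 1 by rewrite ltW.
pose Ds : set plane := [set z | Omega (pt s z)].
have oDs : open Ds by move: oO; rewrite !openE => H p /H; exact: cont_pt.
have QDs x y : a <= x <= b -> c <= y <= e -> Ds (x, y) by exact: ptO.
have cw (w : plane -> R) : (forall z, Omega z -> {for z, continuous w}) ->
    forall z, Ds z -> {for z, continuous (fun z => w (pt s z))}.
  by move=> cw z Dz; apply: (cont_comp (@cont_pt z s)); exact: cw.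
pose f z := chi z * ((z.1 - x0) * u1 (pt s z) + (z.2 - y0) * u2 (pt s z)).
(* The angular derivative of chi * (v o pt s) is A - B with A a y-derivative
   and B an x-derivative, since chi is radial. *)
pose A z := (z.1 - x0) * (chi z * (s * u1 (pt s z)) + - 2 * (z.2 - y0) * chi' z * v (pt s z)).
pose B z := (z.2 - y0) * (chi z * (s * - u2 (pt s z)) + - 2 * (z.1 - x0) * chi' z * v (pt s z)).
have cst (k : R) (z : plane) : {for z, continuous (fun=> k : R)} by exact: cvg_cst.
have cM (g h : plane -> R) z : {for z, continuous g} -> {for z, continuous h} ->
    {for z, continuous (fun z => g z * h z)} by exact: cvgM.
have cD (g h : plane -> R) z : {for z, continuous g} -> {for z, continuous h} ->
    {for z, continuous (fun z => g z + h z)} by exact: cvgD.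
have cN (g : plane -> R) z : {for z, continuous g} ->
    {for z, continuous (fun z => - g z)} by exact: cvgN.
have cA z : Ds z -> {for z, continuous A}.
  move=> Dz; have w1 := cw _ (cp_u1 cp) _ Dz; have w2 := cw _ (cp_v cp) _ Dz.
  apply: (cM); first exact: cont_x.
  apply: (cD); first by apply: (cM) => //; apply: (cM).
  by do 2 (apply: (cM) => //); apply: (cM) => //; exact: cont_y.
have cB z : Ds z -> {for z, continuous B}.
  move=> Dz; have w1 := cw _ (cp_u2 cp) _ Dz; have w2 := cw _ (cp_v cp) _ Dz.
  apply: (cM); first exact: cont_y.
  apply: (cD); first by apply: (cM) => //; apply: (cM) => //; exact: cN.
  by do 2 (apply: (cM) => //); apply: (cM) => //; exact: cont_x.
have cf z : Ds z -> {for z, continuous f}.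
  move=> Dz; have w1 := cw _ (cp_u1 cp) _ Dz; have w2 := cw _ (cp_u2 cp) _ Dz.
  apply: (cM) => //; apply: (cD); apply: (cM) => //.
have fAB z : s * f z = A z - B z by rewrite /f /A /B; ring.
have iA x : a <= x <= b -> intab c e (fun y => A (x, y)) = 0.
  move=> xh; pose G (y : R) := (x - x0) * (chi (x, y) * v (pt s (x, y))).
  rewrite (_ : intab c e _ = G e - G c); last apply: (@intab_FTC _ c e G).
  - rewrite /G !chi_edge ?mul0r ?mulr0 ?subrr//; right; rewrite /c /e.
      by rewrite (_ : y0 - d - y0 = - d) ?sqrrN//; ring.
    by rewrite (_ : y0 + d - y0 = d)//; ring.
  - by have := d0; rewrite /c /e; lra.
  - move=> y yh; apply: (contI_slice_y (Omega := Ds) (a := a) (b := b) (c := c) (d := e)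
      (f := fun z => (z.1 - x0) * (chi z * v (pt s z)))) => // z Dz.
    by have w2 := cw _ (cp_v cp) _ Dz; apply: (cM); [exact: cont_x|apply: (cM)].
  - exact: (contI_slice_y QDs cA).
  - move=> y /andP[y1 y2]; have yh : c <= y <= e by rewrite !ltW.
    have [_ _ h] := is_derive_pt (cp_vx cp) (cp_vy cp) (fun z zO => cvgN (cp_u2 cp zO))
      (cp_u1 cp) (QDs _ _ xh yh).
    have h' := is_deriveM (is_derive_cst (x - x0) y 1) (is_deriveM (dchi_y x y) h).
    by apply: is_derive_eq h' _; rewrite /A /GRing.scale /=; ring.
have iB y : c <= y <= e -> intab a b (fun x => B (x, y)) = 0.
  move=> yh; pose G (x : R) := (y - y0) * (chi (x, y) * v (pt s (x, y))).
  rewrite (_ : intab a b _ = G b - G a); last apply: (@intab_FTC _ a b G).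
  - rewrite /G !chi_edge ?mul0r ?mulr0 ?subrr//; left; rewrite /a /b.
      by rewrite (_ : x0 - d - x0 = - d) ?sqrrN//; ring.
    by rewrite (_ : x0 + d - x0 = d)//; ring.
  - by have := d0; rewrite /a /b; lra.
  - move=> x xh; apply: (contI_slice_x (Omega := Ds) (a := a) (b := b) (c := c) (d := e)
      (f := fun z => (z.2 - y0) * (chi z * v (pt s z)))) => // z Dz.
    by have w2 := cw _ (cp_v cp) _ Dz; apply: (cM); [exact: cont_y|apply: (cM)].
  - exact: (contI_slice_x QDs cB).
  - move=> x /andP[y1 y2]; have xh : a <= x <= b by rewrite !ltW.
    have [_ h _] := is_derive_pt (cp_vx cp) (cp_vy cp) (fun z zO => cvgN (cp_u2 cp zO))
      (cp_u1 cp) (QDs _ _ xh yh).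
    have h' := is_deriveM (is_derive_cst (y - y0) x 1) (is_deriveM (dchi_x x y) h).
    by apply: is_derive_eq h' _; rewrite /B /GRing.scale /=; ring.
apply/eqP; rewrite -(mulrI_eq0 _ (mulfI (lt0r_neq0 s0))); apply/eqP.
rewrite -(intabZ s (contI_int_x oDs QDs cf ce)).
transitivity (- intab a b (fun x => intab c e (fun y => B (x, y)))).
  rewrite -[RHS]mulN1r -(intabZ (-1) (contI_int_x oDs QDs cB ce)).
  apply: eq_intab => x xh; rewrite -(intabZ s (contI_slice_y QDs cf xh)).
  transitivity (intab c e (fun y => A (x, y) - B (x, y))); first by apply: eq_intab => y _.
  rewrite intabB; [|exact: (contI_slice_y QDs cA)|exact: (contI_slice_y QDs cB)].
  by rewrite iA// sub0r mulN1r.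
rewrite (intab_swap oDs QDs cB ab ce).
rewrite (@eq_intab _ c e _ (fun=> 0)) ?intab_cst ?mul0r ?oppr0//.
Qed.

(** The weighted mean value property. *)
Let mean_chi : intab a b (fun x => intab c e (fun y => chi (x, y) * u (x, y))) =
  u (x0, y0) * intab a b (fun x => intab c e (fun y => chi (x, y))).
Proof.
have F1 : F 1 = intab a b (fun x => intab c e (fun y => chi (x, y) * u (x, y))).
  apply: eq_intab => x _; apply: eq_intab => y _; congr (_ * u _).
  by rewrite /pt /= !mul1r !subrKC.
have F00 : F 0 = u (x0, y0) * intab a b (fun x => intab c e (fun y => chi (x, y))).
  rewrite -(@intab2Z Omega a b c e oO QO' ce (u (x0, y0)) chi) => [|z _]; last exact: cont_chi.
  apply: eq_intab => x _; apply: eq_intab => y _.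
  by rewrite /pt /= !mul0r !addr0 mulrC.
have cF : contI 0 1 F by move=> s sh; exact: is_derive_continuous (dF sh).
have H : intab 0 1 (fun=> 0) = F 1 - F 0.
  apply: (@intab_FTC _ 0 1 F (fun=> 0) ltr01 cF (@contI_cst R 0 1 0)) => s /andP[s0 s1].
  by rewrite -(dF0 s0 (ltW s1)); apply: dF; rewrite !ltW.
by apply/eqP; rewrite -subr_eq0 -F1 -F00 -H intab_cst// mul0r.
Qed.

(* Bounding [pos2] from below by its tangent at [l = d ^+ 2 / 3]. *)
Let chi_mass : 4 / 9 * d ^+ 6 <= intab a b (fun x => intab c e (fun y => chi (x, y))).
Proof.
pose l := d ^+ 2 / 3; have l0 : 0 <= l by rewrite divr_ge0// sqr_ge0.
pose p (z : plane) := 2 * l * (d ^+ 2 - (z.1 - x0) ^+ 2 - (z.2 - y0) ^+ 2) - l ^+ 2.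
have cp' z : Omega z -> {for z, continuous p}.
  move=> _; apply: cvgB; last exact: cvg_cst.
  by apply: cvgM; [exact: cvg_cst|exact: cont_r2].
have := le_intab2 oO QO' ce cp' (fun z _ => @cont_chi z)
  (fun x y _ _ => pos2_ge (d ^+ 2 - (x - x0) ^+ 2 - (y - y0) ^+ 2) l0).
apply: le_trans; rewrite le_eqVlt; apply/orP; left; apply/eqP.
have e1 x : intab c e (fun y => p (x, y)) =
    (2 * d * (2 * l * d ^+ 2 - l ^+ 2) - 4 / 3 * l * d ^+ 3) - 4 * d * l * (x - x0) ^+ 2.
  transitivity (intab c e (fun y => (2 * l * (d ^+ 2 - (x - x0) ^+ 2) - l ^+ 2)
      - 2 * l * (y - y0) ^+ 2)); first by apply: eq_intab => y _; rewrite /p /=; ring.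
  by rewrite intab_quadratic//; field.
under [RHS]eq_intab do rewrite e1.
by rewrite intab_quadratic// /l; field.
Qed.

(** A point value is controlled by the [L^2] norm over a square. *)
Lemma sqr_le_mean_square : d ^+ 2 * u (x0, y0) ^+ 2 <=
  3 * intab (x0 - d) (x0 + d) (fun x => intab (y0 - d) (y0 + d) (fun y => u (x, y) ^+ 2)).
Proof.
rewrite -/a -/b -/c -/e; set u0 := u (x0, y0); set I := intab a b _.
set m := intab a b (fun x => intab c e (fun y => chi (x, y))).
have cu := cp_u cp; have cc z : Omega z -> {for z, continuous chi} by move=> _; exact: cont_chi.
have c1 z : Omega z -> {for z, continuous (fun z => u z ^+ 2)}.
  by move=> zO; apply: continuous_sqr; exact: cu.
have c2 z : Omega z -> {for z, continuous (fun z => chi z * u z ^+ 2)}.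
  by move=> zO; apply: cvgM; [exact: cc|exact: c1].
have c3 z : Omega z -> {for z, continuous (fun z => chi z * u z)}.
  by move=> zO; apply: cvgM; [exact: cc|exact: cu].
have c4 z : Omega z -> {for z, continuous (fun z => - 2 * u0 * (chi z * u z))}.
  by move=> zO; apply: cvgM; [exact: cvg_cst|exact: c3].
have c5 z : Omega z -> {for z, continuous (fun z => u0 ^+ 2 * chi z)}.
  by move=> zO; apply: cvgM; [exact: cvg_cst|exact: cc].
have c6 z : Omega z -> {for z, continuous (fun z => - 2 * u0 * (chi z * u z) + u0 ^+ 2 * chi z)}.
  by move=> zO; apply: cvgD; [exact: c4|exact: c5].
pose J := intab a b (fun x => intab c e (fun y => chi (x, y) * u (x, y) ^+ 2)).
have c7 z : Omega z -> {for z, continuous (fun z => d ^+ 4 * u z ^+ 2)}.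
  by move=> zO; apply: cvgM; [exact: cvg_cst|exact: c1].
have JI : J <= d ^+ 4 * I.
  rewrite -(intab2Z oO QO' ce (d ^+ 4) c1); apply: (le_intab2 oO QO' ce c2 c7) => x y xh yh.
  rewrite ler_wpM2r ?sqr_ge0// (_ : d ^+ 4 = (d ^+ 2) ^+ 2); last by ring.
  apply: pos2_le; first exact: sqr_ge0.
  by have := sqr_ge0 (x - x0); have := sqr_ge0 (y - y0) => /=; lra.
have J0 : 0 <= J - u0 ^+ 2 * m.
  have : 0 <= intab a b (fun x => intab c e (fun y => chi (x, y) * (u (x, y) - u0) ^+ 2)).
    apply: intab_ge0 => x _; apply: intab_ge0 => y _.
    by rewrite mulr_ge0 ?sqr_ge0// pos2_ge0.
  rewrite (_ : intab _ _ _ = J - u0 ^+ 2 * m)//.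
  transitivity (intab a b (fun x => intab c e (fun y =>
      chi (x, y) * u (x, y) ^+ 2 + (- 2 * u0 * (chi (x, y) * u (x, y)) + u0 ^+ 2 * chi (x, y))))).
    by apply: eq_intab => x _; apply: eq_intab => y _; ring.
  rewrite (intab2D oO QO' ce c2 c6) (intab2D oO QO' ce c4 c5) (intab2Z oO QO' ce _ c3).
  by rewrite (intab2Z oO QO' ce _ cc) mean_chi -/u0 -/m -/J; ring.
have I0 : 0 <= I by apply: intab_ge0 => x _; apply: intab_ge0 => y _; exact: sqr_ge0.
exact: (mean_square_arith d0 I0 chi_mass JI J0).
Qed.

End square.
End mean_value.

(** * Integral inequalities along rays and over squares *)

Section L2_bounds.
Variable R : realType.
Notation plane := (R * R)%type.
Notation mplane := (measurableTypeR R * measurableTypeR R)%type.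
Notation mu := (@lebesgue_measure R).
Local Notation normc := (@Normc.normc R).
Local Notation cabs := (@cabs R).

Section primitive.
Variable F : R -> R.
Hypothesis cF : forall s : R, {for s, continuous F}.

Let cI (a b : R) : contI a b F. Proof. by move=> s _; exact: cF. Qed.
Let G (x : R) := intab (-1) x F.
Let dG (x : R) : -1 < x -> is_derive x 1 G (F x).
Proof. by move=> h; apply: (@intab_deriv _ (-1) (x + 1)) => //; rewrite h; lra. Qed.

Lemma intab_deriv_cont (x : R) : 0 < x -> is_derive x 1 (fun y => intab 0 y F) (F x).
Proof. by move=> h; apply: (@intab_deriv _ 0 (x + 1)) => //; rewrite h; lra. Qed.

Let intabE (a b : R) : 0 <= a -> a < b -> intab a b F = G b - G a.
Proof.
move=> a0 ab; apply: (@intab_FTC _ a b G) => //.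
  by move=> s /andP[h _]; apply: is_derive_continuous; apply: dG; lra.
by move=> s /andP[h _]; apply: dG; lra.
Qed.

Lemma intab_split (a b : R) : 0 < a -> a < b -> intab 0 b F = intab 0 a F + intab a b F.
Proof.
move=> a0 ab; rewrite !intabE//; [ring|exact: ltW|exact: lt_trans ab].
Qed.

Lemma intab_rescale (s : R) : 0 < s -> intab 0 1 (fun t => s * F (s * t)) = intab 0 s F.
Proof.
move=> s0; rewrite intabE//.
have ds (t : R) : is_derive t 1 (fun t : R => s * t) s.
  by apply: is_derive_eq; rewrite /GRing.scale /=; ring.
have dGs (t : R) : 0 <= t -> is_derive t 1 (fun t => G (s * t)) (s * F (s * t)).
  move=> t0; apply: is_derive_comp1 (ds t); apply: dG.
  by rewrite (lt_le_trans (ltrN10 _))// mulr_ge0// ltW.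
pose H (t : R) := G (s * t).
rewrite (_ : intab 0 1 _ = H 1 - H 0); first by rewrite /H mulr1 mulr0.
apply: (@intab_FTC _ 0 1 H) => //.
- by move=> t /andP[t0 _]; exact: is_derive_continuous (dGs t t0).
- move=> t _; apply: cvgM; first exact: cvg_cst.
  apply: (@cont_comp _ _ _ (fun t : R => s * t) F) => //.
  exact: is_derive_continuous (ds t).
- by move=> t /andP[t0 _]; apply: dGs; exact: ltW.
Qed.

End primitive.

(** Gronwall's inequality for [p], integrated against [t]. As [L / s ^+ 2] is not
    bounded near [0], the bound [M] of [p] on [[0, s1]] is needed. *)
Lemma gronwall (p b : R -> R) (L s1 M : R) : 0 <= L -> 0 < s1 -> s1 < 1 ->
  (forall s : R, {for s, continuous p}) -> (forall s : R, {for s, continuous b}) ->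
  (forall s : R, 0 <= b s) -> (forall s : R, 0 <= p s) ->
  (forall s : R, 0 <= s <= s1 -> p s <= M) -> 0 <= M ->
  (forall s : R, 0 < s <= 1 -> p s <= b s + L / s ^+ 2 * intab 0 s (fun t => t * p t)) ->
  intab 0 1 (fun t => t * p t) <= expR (L / s1) * (M + intab s1 1 b).
Proof.
move=> L0 s10 s11 cp cb b0 p0 pM M0 hp.
pose q (t : R) := t * p t.
have cq (s : R) : {for s, continuous q} by apply: cvgM; [exact: cvg_id|exact: cp].
pose P (s : R) := intab 0 s q; pose l := L / s1.
have l0 : 0 <= l by rewrite divr_ge0// ltW.
have dP (s : R) : 0 < s -> is_derive s 1 P (q s) by exact: intab_deriv_cont.
(* [E] is nonincreasing on [[s1, 1]]. *)
pose E (s : R) := expR (- (l * s)) * P s - intab 0 s b.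
have dexp (s : R) : is_derive s 1 (fun s : R => expR (- (l * s))) (- l * expR (- (l * s))).
  have h : is_derive s 1 (fun s : R => - (l * s)) (- l).
    by apply: is_derive_eq; rewrite /GRing.scale /=; ring.
  exact: (is_derive_comp1 (is_derive_expR _) h).
pose e (s : R) := expR (- (l * s)) * (q s - l * P s) - b s.
have dE (s : R) : 0 < s -> is_derive s 1 E (e s).
  move=> s0; have h := is_deriveB (is_deriveM (dexp s) (dP s s0)) (intab_deriv_cont cb s0).
  by apply: is_derive_eq h _; rewrite /e /GRing.scale /=; ring.
have P0 (s : R) : 0 <= P s.
  by apply: intab_ge0 => t /andP[t0 _]; rewrite mulr_ge0.
have e0 (s : R) : s1 <= s -> s <= 1 -> e s <= 0.
  move=> h1 h2; have s0 : 0 < s by exact: lt_le_trans h1.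
  have hq : q s <= b s + l * P s.
    have := hp s; rewrite s0 h2 => /(_ isT) h.
    apply: (@le_trans _ _ (s * (b s + L / s ^+ 2 * P s))); first by rewrite ler_wpM2l// ltW.
    rewrite mulrDr; apply: lerD; first by rewrite ler_piMl.
    have -> : s * (L / s ^+ 2 * P s) = L * P s * s^-1 by field; rewrite gt_eqF.
    have -> : l * P s = L * P s * s1^-1 by rewrite /l; field; rewrite gt_eqF.
    by rewrite ler_wpM2l ?mulr_ge0// lef_pV2.
  have x0 : 0 <= expR (- (l * s)) by exact: expR_ge0.
  have x1 : expR (- (l * s)) <= 1 by rewrite -expR0 ler_expR oppr_le0 mulr_ge0// ltW.
  have : expR (- (l * s)) * (q s - l * P s) <= expR (- (l * s)) * b s.
    by rewrite ler_wpM2l//; lra.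
  have : expR (- (l * s)) * b s <= 1 * b s by rewrite ler_wpM2r.
  by rewrite /e; lra.
have h1 : 0 < (1 : R) by exact: ltr01.
have cE (s : R) : 0 < s -> {for s, continuous E}.
  by move=> /dE; exact: is_derive_continuous.
have ce (s : R) : 0 < s -> {for s, continuous e}.
  move=> s0; apply: cvgB; last exact: cb.
  apply: cvgM; first exact: is_derive_continuous (dexp s).
  apply: cvgB; first exact: cq.
  by apply: cvgM; [exact: cvg_cst|exact: is_derive_continuous (dP s s0)].
have : E 1 - E s1 <= 0.
  have <- : intab s1 1 e = E 1 - E s1.
    apply: (@intab_FTC _ s1 1 E).
    - exact: s11.
    - by move=> s /andP[s1s _]; apply: cE; exact: lt_le_trans s1s.
    - by move=> s /andP[s1s _]; apply: ce; exact: lt_le_trans s1s.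
    - by move=> s /andP[s1s _]; apply: dE; exact: lt_trans s1s.
  rewrite (@le_trans _ _ (intab s1 1 (fun=> 0)))//; last by rewrite intab_cst ?mul0r// ltW.
  apply: le_intab; [|exact: contI_cst|by move=> s /andP[]; exact: e0].
  by move=> s /andP[s1s _]; apply: ce; exact: lt_le_trans s1s.
rewrite /E (intab_split cb s10 s11) mulr1 => H.
have PM : P s1 <= M.
  have cM := @contI_cst R 0 s1 M.
  apply: (@le_trans _ _ (intab 0 s1 (fun=> M))).
    apply: le_intab => // t /andP[t0 t1]; rewrite /q -[leRHS]mul1r.
    by apply: ler_pM => //; [exact: le_trans (ltW s11)|apply: pM; rewrite t0].
  by rewrite intab_cst; [rewrite subr0 ler_piMr// ltW|exact: ltW].
have x1 : expR (- (l * s1)) * P s1 <= P s1.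
  by rewrite ler_piMl// -expR0 ler_expR oppr_le0 mulr_ge0// ltW.
have : expR (- l) * P 1 <= M + intab s1 1 b by lra.
by rewrite expRN mulrC ler_pdivrMr ?expR_gt0// mulrC.
Qed.

(** Jensen's inequality on an interval of length at most [1]. *)
Lemma sqr_intab_le (b : R) (F : R -> R) : 0 <= b -> b <= 1 -> contI b 1 F ->
  intab b 1 F ^+ 2 <= intab b 1 (fun s => F s ^+ 2).
Proof.
move=> b0 b1 cF; set m := intab b 1 F.
have c2 : contI b 1 (fun s => F s ^+ 2) by move=> s /cF; exact: continuous_sqr.
have c1 : contI b 1 (fun s => - 2 * m * F s).
  by move=> s sh; apply: cvgM; [exact: cvg_cst|exact: cF].
have c0 := @contI_cst R b 1 (m ^+ 2).
have c3 : contI b 1 (fun s => - 2 * m * F s + m ^+ 2).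
  by move=> s sh; apply: cvgD; [exact: c1|exact: c0].
have : 0 <= intab b 1 (fun s => (F s - m) ^+ 2) by apply: intab_ge0 => s _; exact: sqr_ge0.
rewrite (_ : intab b 1 _ = intab b 1 (fun s => F s ^+ 2) + (- 2 * m * m + m ^+ 2 * (1 - b))).
  have : 0 <= m ^+ 2 * b by rewrite mulr_ge0 ?sqr_ge0.
  by rewrite expr2; nra.
rewrite -(intab_cst _ b1) -(intabZ _ cF) -intabD// -intabD//.
by apply: eq_intab => s _; ring.
Qed.

(** The closed square with centre [z] and half-side [d]. *)
Definition sq (z : plane) (d : R) : set mplane :=
  (`[z.1 - d, z.1 + d] `*` `[z.2 - d, z.2 + d])%classic.

Lemma sqP z d x y : sq z d (x, y) <-> `|x - z.1| <= d /\ `|y - z.2| <= d.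
Proof.
rewrite /sq /= !in_itv /= !ler_distl; split=> -[/andP[h1 h2] /andP[h3 h4]]; split; apply/andP; split; lra.
Qed.

(** The square of the [L^2] norm over [D]. *)
Definition E2 (D : set plane) (u : plane -> R[i]) : \bar R :=
  (\int[area R]_(z in D) (normc (u z) ^+ 2)%:E)%E.

(** Point values are controlled by [L^2] norms over squares. *)
Definition submean (Omega : set plane) (u : plane -> R[i]) :=
  forall z d, 0 < d -> sq z d `<=` Omega ->
    ((d ^+ 2 * normc (u z) ^+ 2)%:E <= 3%:E * E2 (sq z d) u)%E.

Section domain.
Variable Omega : set plane.
Hypothesis oO : open Omega.

Let mO : measurable (Omega : set mplane). Proof. exact: open_plane_measurable. Qed.

Lemma measurable_sqr_normc (D : set plane) (u : plane -> R[i]) : D `<=` Omega ->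
  measurable (D : set mplane) ->
  (forall z, Omega z -> ccont u z) ->
  measurable_fun (D : set mplane) (fun z : mplane => (normc (u z) ^+ 2)%:E).
Proof.
move=> DO mD cu; apply/measurable_EFinP; apply: (measurable_funS mO DO).
apply: (@open_plane_measurable_fun R Omega (fun z => normc (u z) ^+ 2)) => // z zO.
by apply: continuous_sqr; apply: continuous_normc; exact: cu.
Qed.

Let le_add_sub (x d : R) : 0 <= d -> x - d <= x + d.
Proof. by move=> d0; lra. Qed.

Lemma sq_measurable z d : measurable (sq z d).
Proof. by apply: measurableX; exact: measurable_itv. Qed.

Lemma E2_subset (D : set plane) (u : plane -> R[i]) : D `<=` Omega ->
  measurable (D : set mplane) -> (forall z, Omega z -> ccont u z) -> (E2 D u <= E2 Omega u)%E.
Proof.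
move=> DO mD cu; apply: ge0_subset_integral => //; first exact: measurable_sqr_normc.
by move=> z _; rewrite lee_fin sqr_ge0.
Qed.

Lemma E2_ge0 (D : set plane) (u : plane -> R[i]) : (0 <= E2 D u)%E.
Proof. by apply: integral_ge0 => z _; rewrite lee_fin sqr_ge0. Qed.

Lemma integral_sq_cst z d k : 0 <= d -> 0 <= k -> sq z d `<=` Omega ->
  (\int[area R]_(w in sq z d) (k%:E) = (4 * d ^+ 2 * k)%:E)%E.
Proof.
move=> d0 k0 sO.
have sO' x y : z.1 - d <= x <= z.1 + d -> z.2 - d <= y <= z.2 + d -> Omega (x, y).
  by move=> hx hy; apply: sO; split; rewrite /= in_itv.
have cc w : Omega w -> {for w, continuous (fun=> k : R)} by move=> _; exact: cvg_cst.
have le1 : z.1 - d <= z.1 + d by apply: le_add_sub; exact: d0.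
have le2 : z.2 - d <= z.2 + d by apply: le_add_sub; exact: d0.
rewrite (area_integral_rect oO sO' cc le2) => [|//].
by rewrite !intab_cst//; congr EFin; ring.
Qed.

(** Two complex functions with [u_x = v_y = u1] and [u_y = - v_x = u2]. *)
Record cauchy_riemann (u v u1 u2 : plane -> R[i]) : Prop := {
  cr_u : C1f Omega u u1 u2;
  cr_v : C1f Omega v (fun z => - u2 z) u1 }.

Lemma cauchy_riemann_swap u v u1 u2 : cauchy_riemann u v u1 u2 ->
  cauchy_riemann v (fun z => - u z) (fun z => - u2 z) u1.
Proof.
move=> [[a1 a2 a3 a4 a5] [b1 b2 b3 b4 b5]]; split; first by split.
split=> z zO; [exact/ccontN/a1|exact/ccontN/a2| |exact/cderivN/a4|exact/cderivN/a5].
exact/ccontN/a3.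
Qed.

Lemma cauchy_riemann_submean u v u1 u2 : cauchy_riemann u v u1 u2 -> submean Omega u.
Proof.
move=> [[a1 a2 a3 a4 a5] [b1 b2 b3 b4 b5]] z d d0 sO.
have QO x y : `|x - z.1| <= d -> `|y - z.2| <= d -> Omega (x, y).
  by move=> hx hy; apply: sO; apply/sqP.
have cpR : conjugate_pair Omega (fun z => complex.Re (u z)) (fun z => complex.Re (v z))
    (fun z => complex.Re (u1 z)) (fun z => complex.Re (u2 z)).
  split=> w wO; [by have [] := a1 w wO|by have [] := b1 w wO|by have [] := a2 w wO|
    by have [] := a3 w wO|by have [] := a4 w wO|by have [] := a5 w wO| |by have [] := b5 w wO].
  by have [] := b4 w wO; rewrite ReN.
have cpI : conjugate_pair Omega (fun z => complex.Im (u z)) (fun z => complex.Im (v z))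
    (fun z => complex.Im (u1 z)) (fun z => complex.Im (u2 z)).
  split=> w wO; [by have [] := a1 w wO|by have [] := b1 w wO|by have [] := a2 w wO|
    by have [] := a3 w wO|by have [] := a4 w wO|by have [] := a5 w wO| |by have [] := b5 w wO].
  by have [_] := b4 w wO; rewrite ImN.
have mR := sqr_le_mean_square oO cpR d0 QO.
have mI := sqr_le_mean_square oO cpI d0 QO.
have sO' x y : z.1 - d <= x <= z.1 + d -> z.2 - d <= y <= z.2 + d -> Omega (x, y).
  by move=> hx hy; apply: sO; split; rewrite /= in_itv.
have le1 : z.1 - d <= z.1 + d by apply: le_add_sub; exact: ltW.
have le2 : z.2 - d <= z.2 + d by apply: le_add_sub; exact: ltW.
have cR w : Omega w -> {for w, continuous (fun w => complex.Re (u w) ^+ 2)}.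
  by move=> wO; apply: continuous_sqr; have [] := a1 w wO.
have cI w : Omega w -> {for w, continuous (fun w => complex.Im (u w) ^+ 2)}.
  by move=> wO; apply: continuous_sqr; have [] := a1 w wO.
have cN w : Omega w -> {for w, continuous (fun w => normc (u w) ^+ 2)}.
  by move=> wO; apply: continuous_sqr; apply: continuous_normc; exact: a1.
rewrite /E2 (area_integral_rect oO sO' cN le2) => [|w _]; last exact: sqr_ge0.
rewrite -EFinM lee_fin sqr_normc mulrDr.
have -> : intab (z.1 - d) (z.1 + d) (fun x => intab (z.2 - d) (z.2 + d) (fun y => normc (u (x, y)) ^+ 2)) =
    intab (z.1 - d) (z.1 + d) (fun x => intab (z.2 - d) (z.2 + d) (fun y => complex.Re (u (x, y)) ^+ 2)) +
    intab (z.1 - d) (z.1 + d) (fun x => intab (z.2 - d) (z.2 + d) (fun y => complex.Im (u (x, y)) ^+ 2)).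
  rewrite -(intab2D oO sO' le2 cR cI).
  by apply: eq_intab => x _; apply: eq_intab => y _; rewrite sqr_normc.
by rewrite -surjective_pairing in mR mI; rewrite mulrDr; exact: lerD mR mI.
Qed.

End domain.
End L2_bounds.

(** * Two-sided L^2 bounds *)

Section L2_operator.
Variable R : realType.
Notation plane := (R * R)%type.
Notation mplane := (measurableTypeR R * measurableTypeR R)%type.
Local Notation normc := (@Normc.normc R).
Local Notation cabs := (@cabs R).

Lemma sqr_le_sum (a b c k : R) : 0 <= a -> 0 <= b -> 0 <= c -> a <= b + c -> c <= k ->
  a ^+ 2 <= 2 * b ^+ 2 + 2 * k ^+ 2.
Proof.
move=> a0 b0 c0 abc ck; have h : a ^+ 2 <= (b + k) ^+ 2.
  by rewrite lerXn2r ?nnegrE//; lra.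
by apply: (le_trans h); have := sqr_ge0 (b - k); nra.
Qed.

(** A supremum whose square is bounded in terms of half of itself; finiteness of
    [sup E] makes the absorption legitimate. *)
Lemma sup_square_le (N I : R) (E : set R) : E !=set0 -> has_ubound E -> 0 <= I -> N = sup E ->
  0 <= N -> (forall x, E x -> 0 <= x) -> (forall x, E x -> x ^+ 2 <= 24 * I + N ^+ 2 / 2) ->
  N ^+ 2 <= 48 * I.
Proof.
move=> E0 ubE I0 NE N0 Ep EN.
pose r := Num.sqrt (24 * I + N ^+ 2 / 2).
have p0 : 0 <= 24 * I + N ^+ 2 / 2 by have := sqr_ge0 N; lra.
have Nr : N <= r.
  rewrite NE; apply: ge_sup => // x Ex; rewrite /r -(ger0_norm (Ep x Ex)) -sqrtr_sqr.
  by apply: ler_wsqrtr; exact: EN.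
have : N ^+ 2 <= r ^+ 2 by rewrite lerXn2r ?nnegrE ?sqrtr_ge0.
by rewrite /r sqr_sqrtr//; lra.
Qed.

Variable Omega : set plane.
Hypothesis oO : open Omega.
Hypothesis sO : starshaped0 Omega.
Variables (K : plane -> R -> R[i]) (L : R).
Hypothesis cK : jcont K.
Hypothesis L0 : 0 <= L.
Hypothesis hK : forall z (s : R), Omega z -> 0 <= s <= 1 -> normc (K z s) <= L * cabs z * s.

(** The operator [h + Op K h] for a kernel of Volterra type. *)
Definition TK (h : plane -> R[i]) (z : plane) : R[i] := h z + Op K h z.

Lemma Op_le h (B : R -> R) z : (forall z, Omega z -> ccont h z) -> Omega z -> contI 0 1 B ->
  (forall s : R, 0 <= s <= 1 -> normc (h (s ^+ 2 *: z)) <= B s) ->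
  normc (Op K h z) <= 2 * L * cabs z * intab 0 1 (fun s => s * B s).
Proof.
move=> ch zO cB hB.
have cG : contI 0 1 (fun s => s * B s).
  by move=> s sh; apply: cvgM; [exact: cvg_id|exact: cB].
have cLG : contI 0 1 (fun s => L * cabs z * (s * B s)).
  by move=> s sh; apply: cvgM; [exact: cvg_cst|exact: cG].
apply: le_trans (normc_Cint_le (Op_integrand sO cK ch zO) cLG _) _ => [s sh|].
  rewrite Normc.normcM mulrA; apply: ler_pM; rewrite ?normc_ge0//; last exact: hB.
  exact: hK.
by rewrite intabZ// !mulrA.
Qed.

Lemma TK_cont h : (forall z, Omega z -> ccont h z) -> forall z, Omega z -> ccont (TK h) z.
Proof. by move=> ch z zO; apply: ccontD; [exact: ch|exact: (Op_cont oO sO cK ch zO)]. Qed.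

Lemma normc_TK_ge h z : normc (h z) <= normc (TK h z) + normc (Op K h z).
Proof.
have e1 : h z = TK h z - Op K h z by rewrite /TK addrK.
by rewrite {1}e1 normcB.
Qed.

Lemma cabs_le_sum (z : plane) : cabs z <= `|z.1| + `|z.2|.
Proof.
rewrite -[leRHS]ger0_norm ?addr_ge0// -sqrtr_sqr /Defs.cabs; apply: ler_wsqrtr.
have n1 := normr_ge0 z.1; have n2 := normr_ge0 z.2.
by rewrite -(real_normK (num_real z.1)) -(real_normK (num_real z.2)); nra.
Qed.

Lemma E2_sq_le (u g : plane -> R[i]) z d k :
  (forall z, Omega z -> ccont u z) -> (forall z, Omega z -> ccont g z) ->
  0 <= d -> 0 <= k -> sq z d `<=` Omega ->
  (forall w, sq z d w -> normc (u w) ^+ 2 <= 2 * normc (g w) ^+ 2 + k) ->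
  (E2 (sq z d) u <= 2%:E * E2 Omega g + (4 * d ^+ 2 * k)%:E)%E.
Proof.
move=> cu cg d0 k0 sqO hw; have ms := sq_measurable z d.
apply: (@le_trans _ _ (\int[area R]_(w in sq z d) (2%:E * (normc (g w) ^+ 2)%:E + k%:E))%E).
  apply: ge0_le_integral => //.
  - by move=> w _; rewrite lee_fin sqr_ge0.
  - exact: (measurable_sqr_normc oO sqO ms cu).
  - apply: emeasurable_funD => //; apply: measurable_funeM.
    exact: (measurable_sqr_normc oO sqO ms cg).
rewrite ge0_integralD//; last 2 first.
- by move=> w _; rewrite mule_ge0// lee_fin// sqr_ge0.
- apply: measurable_funeM; exact: (measurable_sqr_normc oO sqO ms cg).
rewrite ge0_integralZl//; last 2 first.
- exact: (measurable_sqr_normc oO sqO ms cg).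
- by move=> w _; rewrite lee_fin sqr_ge0.
rewrite (integral_sq_cst oO d0 k0 sqO) leeD2r// lee_pmul2l//.
exact: (E2_subset oO sqO ms cg).
Qed.

Section local.
Variable e : R.
Hypothesis e0 : 0 < e.
Hypothesis eO : forall x y : R, `|x| <= e -> `|y| <= e -> Omega (x, y).
Hypothesis Le : 56 * (L * e) <= 1.

(* The maximum norm, whose balls are squares. *)
Let mx (z : plane) : R := Num.max `|z.1| `|z.2|.

Let mxO z : mx z <= e -> Omega z.
Proof. by rewrite /mx ge_max; case: z => x y /= /andP[]; exact: eO. Qed.

Let mx_scale (s : R) z : 0 <= s <= 1 -> mx (s ^+ 2 *: z) <= mx z.
Proof.
move=> sh; have /andP[q0 q1] := sq01 sh.
have -> : s ^+ 2 *: z = (s ^+ 2 * z.1, s ^+ 2 * z.2) by [].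
have h a : `|s ^+ 2 * a| = s ^+ 2 * `|a| by rewrite normrM ger0_norm.
rewrite /mx ge_max !le_max /= !h.
by rewrite !ler_piMl ?orbT// ?normr_ge0.
Qed.

(** Near the origin [u] is bounded by the [L^2] norm of [TK u]. The supremum [N]
    of [(e - mx w) * normc (u w)] over the square bounds [Op K u] on smaller
    squares; as [L * e] is small, the point estimate yields
    [N ^+ 2 <= 24 * I + N ^+ 2 / 2], where [I] is the squared [L^2] norm of [TK u]. *)
Lemma local_bound (u : plane -> R[i]) : (forall z, Omega z -> ccont u z) -> submean Omega u ->
  forall x y : R, `|x| <= e / 2 -> `|y| <= e / 2 ->
  ((normc (u (x, y)) ^+ 2)%:E <= (192 / e ^+ 2)%:E * E2 Omega (TK u))%E.
Proof.
move=> cu su x y hx hy.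
have cg := TK_cont cu.
have c0 : 0 < 192 / e ^+ 2 by rewrite divr_gt0// exprn_gt0.
have := E2_ge0 Omega (TK u); case EI : (E2 Omega (TK u)) => [I| |] // I0; last first.
  by rewrite gt0_muley ?lte_fin// leey.
rewrite lee_fin in I0.
pose E : set R := [set ((e - mx w) * normc (u w))%R | w in [set w : plane | mx w <= e]].
have E0 : E !=set0.
  exists ((e - mx (0, 0)) * normc (u (0, 0))), (0, 0) => //=.
  by rewrite /mx /= normr0 maxxx ltW.
have Ep r : E r -> 0 <= r.
  by move=> [w /= we <-]; rewrite mulr_ge0 ?normc_ge0// subr_ge0.
have ubE : has_ubound E.
  pose F (p : plane) := u (clamp (- e) e p.1, clamp (- e) e p.2).
  have cF p : ccont F p.
    apply: (@ccont_comp R _ _ (fun p : plane => (clamp (- e) e p.1, clamp (- e) e p.2)) u).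
      apply: cont_pair; apply: (@cont_comp _ _ _ _ (clamp (- e) e));
        solve [exact: cvg_fst|exact: cvg_snd|exact: continuous_clamp].
    have le1 : - e <= e by rewrite ge0_cp ?ltW.
    by apply: cu; apply: eO; rewrite ler_norml clamp_in.
  have [M M0 HM] := ccont_bounded (- e) e (- e) e cF.
  exists (e * M) => r [[a b] /=]; rewrite /mx /= ge_max => /andP[ha hb] <-.
  rewrite !ler_norml in ha hb.
  have := HM a b ha hb; rewrite /F /= !clampE// => h.
  apply: ler_pM; rewrite ?normc_ge0//; first by rewrite subr_ge0 ge_max !ler_norml ha hb.
  by rewrite gerBl le_max normr_ge0.
pose N := sup E.
have EN r : E r -> r <= N by move=> Er; exact: ub_le_sup.
have N0 : 0 <= N by have [r Er] := E0; apply: le_trans (Ep r Er) (EN r Er).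
have key r : E r -> r ^+ 2 <= 24 * I + N ^+ 2 / 2.
  move=> [z /= ze <-]; have [me|me] := eqVneq (mx z) e.
    by rewrite me subrr mul0r expr0n /= addr_ge0 ?divr_ge0 ?mulr_ge0 ?sqr_ge0.
  have d0' : 0 < e - mx z by rewrite subr_gt0 lt_neqAle me.
  pose d := (e - mx z) / 2; have d0 : 0 < d by rewrite divr_gt0.
  have sqm w : sq z d w -> d <= e - mx w.
    case: w => a b /sqP[ha hb].
    suff : mx (a, b) <= mx z + d by rewrite /d; lra.
    have h1 : `|z.1| <= mx z by rewrite le_max lexx.
    have h2 : `|z.2| <= mx z by rewrite le_max lexx orbT.
    rewrite ge_max /=; apply/andP; split.
      by rewrite -(subrK z.1 a) (le_trans (ler_normD _ _))// addrC lerD.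
    by rewrite -(subrK z.2 b) (le_trans (ler_normD _ _))// addrC lerD.
  have sqO : sq z d `<=` Omega by move=> w /sqm h; apply: mxO; lra.
  have sup_w w : sq z d w -> normc (Op K u w) <= N / d / 14.
    move=> ws; have wO := sqO _ ws; have wd := sqm _ ws.
    have hB (s : R) : 0 <= s <= 1 -> normc (u (s ^+ 2 *: w)) <= N / d.
      move=> sh; have h1 := mx_scale w sh.
      rewrite ler_pdivlMr// mulrC; apply: (@le_trans _ _ ((e - mx (s ^+ 2 *: w)) * normc (u (s ^+ 2 *: w)))).
        by rewrite ler_wpM2r ?normc_ge0//; lra.
      by apply: EN; exists (s ^+ 2 *: w) => //=; lra.
    have nd0 : 0 <= N / d by rewrite divr_ge0// ltW.
    apply: le_trans (Op_le cu wO (@contI_cst R 0 1 (N / d)) hB) _.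
    have i1 : intab 0 1 (fun s : R => s * (N / d)) <= N / d.
      rewrite -[leRHS]mulr1 -[X in _ <= _ * X]subr0 -intab_cst//; apply: le_intab.
      - by move=> s _; apply: cvgM; [exact: cvg_id|exact: cvg_cst].
      - exact: contI_cst.
      - by move=> s /andP[s0 s1]; rewrite ler_piMl.
    have i0 : 0 <= intab 0 1 (fun s : R => s * (N / d)).
      by apply: intab_ge0 => s /andP[s0 _]; rewrite mulr_ge0.
    have cw : cabs w <= 2 * e.
      apply: le_trans (cabs_le_sum w) _.
      have : mx w <= e by lra.
      by rewrite /mx ge_max => /andP[]; lra.
    have cw0 := cabs_ge0 w.
    have k14 : 2 * L * cabs w <= 14^-1.
      have : L * cabs w <= L * (2 * e) by rewrite ler_wpM2l.
      by have := Le; lra.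
    rewrite mulrC; apply: ler_pM => //.
    by rewrite !mulr_ge0.
  have k0 : 0 <= 2 * (N / d / 14) ^+ 2 by rewrite mulr_ge0// sqr_ge0.
  have hw w : sq z d w -> normc (u w) ^+ 2 <= 2 * normc (TK u w) ^+ 2 + 2 * (N / d / 14) ^+ 2.
    by move=> ws; apply: sqr_le_sum (normc_TK_ge u w) (sup_w w ws); exact: normc_ge0.
  have h1 := su z d d0 sqO.
  have h2 := E2_sq_le cu cg (ltW d0) k0 sqO hw.
  have k3 : (0 <= 3%:E :> \bar R)%E by rewrite lee_fin.
  rewrite EI in h2.
  have h : d ^+ 2 * normc (u z) ^+ 2 <= 3 * (2 * I + 4 * d ^+ 2 * (2 * (N / d / 14) ^+ 2)).
    by rewrite -lee_fin; exact: (le_trans h1 (lee_wpmul2l k3 h2)).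
  have -> : (e - mx z) * normc (u z) = 2 * (d * normc (u z)) by rewrite /d; field.
  have sqE (p q : R) : (2 * (p * q)) ^+ 2 = 2 ^+ 2 * (p ^+ 2 * q ^+ 2) by ring.
  rewrite sqE; apply: (@le_trans _ _ (2 ^+ 2 * (3 * (2 * I + 4 * d ^+ 2 * (2 * (N / d / 14) ^+ 2))))).
    by rewrite ler_pM2l// exprn_gt0.
  rewrite (_ : 4 * d ^+ 2 * (2 * (N / d / 14) ^+ 2) = N ^+ 2 * (8 / 196)); last by field; rewrite gt_eqF.
  by have := sqr_ge0 N; lra.
have NI : N ^+ 2 <= 48 * I := sup_square_le E0 ubE I0 erefl N0 Ep key.
rewrite -EFinM lee_fin.
have mh : mx (x, y) <= e / 2 by rewrite ge_max hx hy.
have h1 : (e - mx (x, y)) * normc (u (x, y)) <= N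
  by apply: EN; exists (x, y) => //=; apply: le_trans mh _; have := e0; lra.
have h2 : e / 2 * normc (u (x, y)) <= N.
  by apply: le_trans h1; rewrite ler_wpM2r ?normc_ge0//; move: (mx _) mh => m; lra.
have h3 : (e / 2 * normc (u (x, y))) ^+ 2 <= N ^+ 2.
  by rewrite lerXn2r// nnegrE// mulr_ge0 ?normc_ge0// divr_ge0// ltW.
rewrite mulrAC ler_pdivlMr ?exprn_gt0//.
have sqE (p q : R) : (p / 2 * q) ^+ 2 = q ^+ 2 * p ^+ 2 / 4 by field.
by rewrite sqE in h3; move: (le_trans h3 NI); lra.
Qed.

End local.

(** The analogue of [local_bound] for [u] itself. *)
Lemma submean_local (e : R) (u : plane -> R[i]) : 0 < e ->
  (forall x y : R, `|x| <= e -> `|y| <= e -> Omega (x, y)) ->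
  (forall z, Omega z -> ccont u z) -> submean Omega u ->
  forall x y : R, `|x| <= e / 2 -> `|y| <= e / 2 ->
  ((normc (u (x, y)) ^+ 2)%:E <= (192 / e ^+ 2)%:E * E2 Omega u)%E.
Proof.
move=> e0 eO cu su x y hx hy.
have e2 : 0 < e / 2 by rewrite divr_gt0.
have sqO : sq (x, y) (e / 2) `<=` Omega.
  move=> [a b] /sqP[/= ha hb]; apply: eO.
    by rewrite -(subrK x a) (le_trans (ler_normD _ _))// [leRHS]splitr lerD.
  by rewrite -(subrK y b) (le_trans (ler_normD _ _))// [leRHS]splitr lerD.
have k3 : (0 <= 3%:E :> \bar R)%E by rewrite lee_fin.
have h := le_trans (su _ _ e2 sqO) (lee_wpmul2l k3 (E2_subset oO sqO (sq_measurable _ _) cu)).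
have := E2_ge0 Omega u; move: h; case: (E2 Omega u) => [I| |] //; last first.
  by move=> _ _; rewrite gt0_muley ?lte_fin ?divr_gt0 ?exprn_gt0// leey.
rewrite -!EFinM !lee_fin => h I0.
rewrite mulrAC ler_pdivlMr ?exprn_gt0//.
by move: h; rewrite exprMn; lra.
Qed.

(** Modulus of [h] along the segment from the origin to [z], at [s ^+ 2 *: z]; it is
    extended by constants so as to be continuous on the whole line. *)
Definition ray (h : plane -> R[i]) (z : plane) (s : R) : R := normc (h (clamp 0 1 s ^+ 2 *: z)).

Lemma rayE h z (s : R) : 0 <= s <= 1 -> ray h z s = normc (h (s ^+ 2 *: z)).
Proof. by move=> sh; rewrite /ray clampE. Qed.

Lemma ray_cont h z (s : R) : (forall z, Omega z -> ccont h z) -> Omega z ->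
  {for s, continuous (ray h z)}.
Proof.
move=> ch zO; apply: (@continuous_normc R _ (fun s : R => h (clamp 0 1 s ^+ 2 *: z))).
apply: (@ccont_comp R _ _ (fun s : R => clamp 0 1 s ^+ 2 *: z) h).
  apply: cvgZl; apply: (@continuous_sqr R _ (clamp 0 1)); exact: continuous_clamp.
by apply: ch; apply: star_sq => //; apply: clamp_in.
Qed.

Variable rho : R.
Hypothesis rho0 : 0 < rho.
Hypothesis rhoO : forall z, Omega z -> cabs z < rho.

Lemma Op_ray h z : (forall z, Omega z -> ccont h z) -> Omega z ->
  normc (Op K h z) <= 2 * L * rho * intab 0 1 (fun s => s * ray h z s).
Proof.
move=> ch zO; have cr (s : R) := @ray_cont _ _ s ch zO.
have h1 := @Op_le h (ray h z) z ch zO (fun s _ => cr s).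
have h2 (s : R) : 0 <= s <= 1 -> normc (h (s ^+ 2 *: z)) <= ray h z s by move=> /rayE ->.
apply: le_trans (h1 h2) _; rewrite ler_wpM2r//.
  by apply: intab_ge0 => s /andP[s0 _]; rewrite mulr_ge0// normc_ge0.
by rewrite ler_wpM2l ?mulr_ge0// ltW// rhoO.
Qed.

(** If [h] is bounded by [M] near the origin, then [TK h] is controlled by [h] along
    rays, and conversely by Gronwall's inequality. *)
Section two_bounds.
Variables (s1 M : R) (h : plane -> R[i]).
Hypothesis s10 : 0 < s1.
Hypothesis s11 : s1 < 1.
Hypothesis ch : forall z, Omega z -> ccont h z.
Hypothesis M0 : 0 <= M.
Hypothesis hM : forall z (s : R), Omega z -> 0 <= s <= s1 -> normc (h (s ^+ 2 *: z)) <= M.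

Notation lk := (2 * L * rho).
Let lk0 : 0 <= lk. Proof. by rewrite !mulr_ge0// ltW. Qed.

Lemma TK_ray_le z : Omega z ->
  normc (TK h z) <= (1 + lk) * (normc (h z) + M + intab s1 1 (ray h z)).
Proof.
move=> zO; have cr (s : R) := @ray_cont _ _ s ch zO.
have r0 s : 0 <= ray h z s by exact: normc_ge0.
have i0 : 0 <= intab s1 1 (ray h z) by apply: intab_ge0.
have h1 : intab 0 1 (fun s => s * ray h z s) <= M + intab s1 1 (ray h z).
  have cq (s : R) : {for s, continuous (fun s : R => s * ray h z s)}.
    by apply: cvgM; [exact: cvg_id|exact: cr].
  rewrite (intab_split cq s10 s11) lerD//.
    have cM := @contI_cst R 0 s1 M.
    apply: (@le_trans _ _ (intab 0 s1 (fun=> M))).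
      apply: le_intab => // t /andP[t0 t1]; rewrite -[leRHS]mul1r.
      apply: ler_pM => //; first exact: le_trans (ltW s11).
      by rewrite rayE ?hM// t0// (le_trans t1)// ltW.
    by rewrite intab_cst; [rewrite subr0 ler_piMr// ltW|exact: ltW].
  apply: le_intab => // t /andP[t0 t1]; rewrite ler_piMl//.
apply: le_trans (le_normcD _ _) _; have := Op_ray ch zO => h2.
have h3 : lk * intab 0 1 (fun s => s * ray h z s) <= lk * (M + intab s1 1 (ray h z)).
  by rewrite ler_wpM2l.
have n0 := normc_ge0 (h z).
have : 0 <= lk * normc (h z) by rewrite mulr_ge0.
by have := M0; lra.
Qed.

Lemma ray_le_TK z : Omega z ->
  normc (h z) <= (1 + lk * expR (lk / s1)) * (normc (TK h z) + M + intab s1 1 (ray (TK h) z)).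
Proof.
move=> zO; have cg := TK_cont ch; have cr (s : R) := @ray_cont _ _ s ch zO; have cb (s : R) := @ray_cont _ _ s cg zO.
have r0 s : 0 <= ray h z s by exact: normc_ge0.
have b0 s : 0 <= ray (TK h) z s by exact: normc_ge0.
have pM (s : R) : 0 <= s <= s1 -> ray h z s <= M.
  by move=> /andP[a b]; rewrite rayE ?hM// a// (le_trans b)// ltW.
have hp (s : R) : 0 < s <= 1 -> ray h z s <= ray (TK h) z s +
    lk / s ^+ 2 * intab 0 s (fun t => t * ray h z t).
  move=> /andP[p0 p1]; have sh : 0 <= s <= 1 by rewrite ltW.
  have sO' := star_sq sO zO sh; rewrite !rayE//.
  apply: le_trans (normc_TK_ge _ _) _; rewrite lerD2l.
  apply: le_trans (Op_ray ch sO') _; rewrite -[leRHS]mulrA ler_wpM2l//.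
  have cq (t : R) : {for t, continuous (fun t : R => t * ray h z t)}.
    by apply: cvgM; [exact: cvg_id|exact: cr].
  rewrite -(intab_rescale cq p0) ler_pdivlMl ?exprn_gt0//.
  have c1 (t : R) : 0 <= t <= 1 -> {for t, continuous (fun t : R => t * ray h (s ^+ 2 *: z) t)}.
    by move=> _; apply: cvgM; [exact: cvg_id|exact: ray_cont].
  rewrite -(intabZ _ c1) le_eqVlt; apply/orP; left; apply/eqP; apply: eq_intab => t th.
  have sth : 0 <= s * t <= 1.
    move: th => /andP[t0 t1]; rewrite mulr_ge0 ?(ltW p0)//= -[leRHS]mulr1.
    by apply: ler_pM => //; exact: ltW.
  have -> : ray h (s ^+ 2 *: z) t = ray h z (s * t).
    by rewrite rayE// rayE// scalerA -exprMn (mulrC t).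
  by ring.
have G := gronwall lk0 s10 s11 cr cb b0 r0 pM M0 hp.
apply: le_trans (normc_TK_ge _ _) _.
have h1 := Op_ray ch zO.
have h2 : lk * intab 0 1 (fun s => s * ray h z s) <=
    lk * (expR (lk / s1) * (M + intab s1 1 (ray (TK h) z))) by rewrite ler_wpM2l.
have i0 : 0 <= intab s1 1 (ray (TK h) z) by apply: intab_ge0.
have x0 : 0 <= lk * expR (lk / s1) by rewrite mulr_ge0// expR_ge0.
have n0 : 0 <= lk * expR (lk / s1) * normc (TK h z) by rewrite mulr_ge0// normc_ge0.
by have := M0; lra.
Qed.

End two_bounds.

(** An integral inequality along rays turns into an [L^2] inequality. *)
Lemma E2_from_rays (F H : plane -> R[i]) (s1 M c : R) : 0 < s1 -> s1 < 1 -> 0 <= c ->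
  (forall z, Omega z -> ccont F z) -> (forall z, Omega z -> ccont H z) ->
  (forall z, Omega z -> normc (F z) <= c * (normc (H z) + M + intab s1 1 (ray H z))) ->
  (E2 Omega F <= (3 * c ^+ 2)%:E * (E2 Omega H + (M ^+ 2)%:E * area R Omega +
     ((s1 ^+ 4)^-1)%:E * E2 Omega H))%E.
Proof.
move=> s10 s11 c0 cF cH FH.
have mO : measurable (Omega : set mplane) by exact: open_plane_measurable.
pose I (z : plane) := intab s1 1 (fun s : R => normc (H (s ^+ 2 *: z)) ^+ 2).
have cN z : Omega z -> {for z, continuous (fun z => normc (H z) ^+ 2)}.
  by move=> zO; apply: continuous_sqr; apply: continuous_normc; exact: cH.
have I0 z : 0 <= I z by apply: intab_ge0 => s _; exact: sqr_ge0.
have cI z : Omega z -> {for z, continuous I}.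
  move=> zO; apply: (@continuous_intab _ _ s1 1 (fun (z : plane) (s : R) => normc (H (s ^+ 2 *: z)) ^+ 2)).
    exact: ltW.
  have := open_nbhs_nbhs (conj oO zO); apply: filterS => y yO s /andP[a b].
  apply: continuous_sqr; apply: (@continuous_normc R _ (fun p : plane * R => H (p.2 ^+ 2 *: p.1))).
  apply: (@ccont_comp R _ _ (fun p : plane * R => (p.2 ^+ 2) *: p.1) H); first exact: continuous_scale2.
  by apply: cH; apply: star_sq => //; rewrite b (le_trans (ltW s10)).
have mI : measurable_fun (Omega : set mplane) (fun z : mplane => (I z)%:E).
  by apply/measurable_EFinP; exact: open_plane_measurable_fun.
have mF := measurable_sqr_normc oO (@subset_refl _ Omega) mO cF.
have mH := measurable_sqr_normc oO (@subset_refl _ Omega) mO cH.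
have mM : measurable_fun (Omega : set mplane) (fun z : mplane => (M ^+ 2)%:E) by exact: measurable_cst.
have pH (z : mplane) : (0 <= (normc (H z) ^+ 2)%:E)%E by rewrite lee_fin sqr_ge0.
have pM : (0 <= (M ^+ 2)%:E)%E by rewrite lee_fin sqr_ge0.
have pI (z : mplane) : (0 <= (I z)%:E)%E by rewrite lee_fin.
have c30 : (0 <= (3 * c ^+ 2)%:E)%E by rewrite lee_fin mulr_ge0// sqr_ge0.
have mHM := emeasurable_funD mH mM; have mS := emeasurable_funD mHM mI.
apply: (@le_trans _ _ (\int[area R]_(z in Omega)
    ((3 * c ^+ 2)%:E * ((normc (H z) ^+ 2)%:E + (M ^+ 2)%:E + (I z)%:E)))%E).
  apply: ge0_le_integral => //.
  - by move=> z _; rewrite lee_fin sqr_ge0.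
  - exact: measurable_funeM.
  - move=> z zO; rewrite -!EFinD -EFinM lee_fin.
    have cr (s : R) := @ray_cont _ _ s cH zO.
    have h1 := sqr_intab_le (ltW s10) (ltW s11) (fun s _ => cr s).
    have h2 : intab s1 1 (fun s => ray H z s ^+ 2) = I z.
      apply: eq_intab => s /andP[a b]; rewrite rayE// b andbT.
      exact: le_trans (ltW s10) a.
    rewrite h2 in h1; have i0 : 0 <= intab s1 1 (ray H z) by apply: intab_ge0 => s _; exact: normc_ge0.
    have n0 := normc_ge0 (H z); have f0 := normc_ge0 (F z); have := FH z zO.
    move: h1 i0 n0 f0; move: (intab s1 1 _) (I z) (normc (H z)) (normc (F z)) => i J n f h1 i0 n0 f0 hf.
    have h3 : f ^+ 2 <= (c * (n + M + i)) ^+ 2.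
      by rewrite lerXn2r ?nnegrE//; exact: le_trans hf.
    apply: (le_trans h3); rewrite exprMn.
    have -> : 3 * c ^+ 2 * (n ^+ 2 + M ^+ 2 + J) = c ^+ 2 * (3 * (n ^+ 2 + M ^+ 2 + J)) by ring.
    apply: ler_wpM2l; first exact: sqr_ge0.
    have := sqr_ge0 (n - M); have := sqr_ge0 (n - i); have := sqr_ge0 (M - i); nra.
rewrite ge0_integralZl//; last by move=> z _; rewrite !adde_ge0.
rewrite lee_wpmul2l//.
rewrite ge0_integralD//; last by move=> z _; rewrite adde_ge0.
rewrite ge0_integralD//.
have R1 := integral_rays oO sO cN (fun z _ => sqr_ge0 (normc (H z))) s10.
apply: leeD; last exact: R1.
by rewrite leeD2l// integral_cst.
Qed.

Lemma near_origin_ray (e : R) : 0 < e ->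
  exists s1 : R, [/\ 0 < s1, s1 < 1 & forall z (s : R), Omega z -> 0 <= s <= s1 ->
    `|(s ^+ 2 *: z).1| <= e /\ `|(s ^+ 2 *: z).2| <= e].
Proof.
move=> e0; pose s1 := Num.min (1 / 2) (e / rho).
have er : 0 < e / rho by rewrite divr_gt0.
have s10 : 0 < s1 by rewrite lt_min er andbT; lra.
have s1h : s1 <= 1 / 2 by rewrite ge_min lexx.
have s1e : s1 * rho <= e by rewrite -ler_pdivlMr// ge_min lexx orbT.
exists s1; split=> // [|z s zO /andP[sa sb]]; first by lra.
have q : cabs (s ^+ 2 *: z) <= e.
  rewrite cabsZ ?sqr_ge0//; apply: le_trans s1e; apply: ler_pM; rewrite ?sqr_ge0 ?cabs_ge0//.
    rewrite expr2 -[leRHS]mulr1; apply: ler_pM => //; lra.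
  exact/ltW/rhoO.
by split; apply: le_trans q; [exact: cabs_fst|exact: cabs_snd].
Qed.

Hypothesis area_fin : (area R Omega < +oo)%E.

(** On functions with the point estimate, [TK] is bounded above and below in
    [L^2]. *)
Theorem TK_equivalence : exists2 C : R, 0 <= C &
  forall u, (forall z, Omega z -> ccont u z) -> submean Omega u ->
    (E2 Omega (TK u) <= C%:E * E2 Omega u)%E /\ (E2 Omega u <= C%:E * E2 Omega (TK u))%E.
Proof.
have [e1 e10 He1] : exists2 e, 0 < e & forall x y : R, `|x| < e -> `|y| < e -> Omega (x, y).
  have /near_planeP[e e0 H] : \forall z \near ((0 : R), (0 : R)), Omega z.
    by apply: open_nbhs_nbhs; split => //; exact: sO.1.
  by exists e => // x y hx hy; rewrite -[x]add0r -[y]add0r; exact: H.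
pose e := Num.min (e1 / 2) (1 / (56 * (L + 1))).
have l1 : 0 < L + 1 by rewrite ltr_wpDl.
have e0 : 0 < e by rewrite lt_min !divr_gt0// mulr_gt0.
have ee1 : e < e1 by rewrite gt_min; apply/orP; left; lra.
have eO (x y : R) : `|x| <= e -> `|y| <= e -> Omega (x, y).
  by move=> hx hy; apply: He1; exact: le_lt_trans ee1.
have Le : 56 * (L * e) <= 1.
  have : e <= 1 / (56 * (L + 1)) by rewrite ge_min lexx orbT.
  rewrite ler_pdivlMr ?mulr_gt0// => h; nra.
have e2 : 0 < e / 2 by rewrite divr_gt0.
have [s1 [s10 s11 hs1]] := near_origin_ray e2.
have [A AE] : exists A : R, area R Omega = A%:E.
  exists (fine (area R Omega)); rewrite fineK// ge0_fin_numE//.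
have A0 : 0 <= A by rewrite -lee_fin -AE.
pose N := 192 / e ^+ 2; have N0 : 0 < N by rewrite divr_gt0// exprn_gt0.
pose c1 := 1 + 2 * L * rho; pose c2 := 1 + 2 * L * rho * expR (2 * L * rho / s1).
have lk0 : 0 <= 2 * L * rho by rewrite !mulr_ge0// ltW.
have c10 : 0 <= c1 by rewrite addr_ge0.
have c20 : 0 <= c2 by rewrite addr_ge0// mulr_ge0// expR_ge0.
pose B := 1 + N * A + (s1 ^+ 4)^-1.
have i40 : 0 <= (s1 ^+ 4)^-1 by rewrite invr_ge0 exprn_ge0// ltW.
have B0 : 0 <= B by rewrite !addr_ge0// mulr_ge0// ltW.
pose C1 := 3 * c1 ^+ 2 * B; pose C2 := 3 * c2 ^+ 2 * B.
have k10 : 0 <= 3 * c1 ^+ 2 by rewrite mulr_ge0 ?sqr_ge0.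
have k20 : 0 <= 3 * c2 ^+ 2 by rewrite mulr_ge0 ?sqr_ge0.
have C10 : 0 <= C1 by rewrite mulr_ge0.
have C20 : 0 <= C2 by rewrite mulr_ge0.
have core (F H u : plane -> R[i]) (c : R) : 0 <= c ->
    (forall z, Omega z -> ccont F z) -> (forall z, Omega z -> ccont H z) ->
    (forall x y : R, `|x| <= e / 2 -> `|y| <= e / 2 ->
      ((normc (u (x, y)) ^+ 2)%:E <= N%:E * E2 Omega H)%E) ->
    (forall M, 0 <= M -> (forall z (s : R), Omega z -> 0 <= s <= s1 -> normc (u (s ^+ 2 *: z)) <= M) ->
      forall z, Omega z -> normc (F z) <= c * (normc (H z) + M + intab s1 1 (ray H z))) ->
    (E2 Omega F <= (3 * c ^+ 2 * B + 1)%:E * E2 Omega H)%E.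
  move=> c0 cF cH hN hF; have k0 : 0 <= 3 * c ^+ 2 by rewrite mulr_ge0 ?sqr_ge0.
  have K0 : 0 < 3 * c ^+ 2 * B + 1 by rewrite ltr_wpDl// mulr_ge0.
  have := E2_ge0 Omega H; case EI : (E2 Omega H) => [I| |] // I0; last first.
    by rewrite gt0_muley ?lte_fin// leey.
  rewrite lee_fin in I0; rewrite EI in hN.
  pose M := Num.sqrt (N * I); have M0 : 0 <= M by exact: sqrtr_ge0.
  have M2 : M ^+ 2 = N * I by rewrite sqr_sqrtr// mulr_ge0// ltW.
  have hM z (s : R) : Omega z -> 0 <= s <= s1 -> normc (u (s ^+ 2 *: z)) <= M.
    move=> zO sh; have [h1 h2] := hs1 z s zO sh.
    have := hN _ _ h1 h2; rewrite -surjective_pairing -EFinM lee_fin -M2 => h.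
    by rewrite -(ler_pXn2r (ltn0Sn 1)) ?nnegrE ?normc_ge0.
  have := E2_from_rays s10 s11 c0 cF cH (hF M M0 hM).
  rewrite AE EI M2 => h; apply: (le_trans h).
  rewrite [leLHS](_ : _ = (3 * c ^+ 2 * (I + N * I * A + (s1 ^+ 4)^-1 * I))%:E)//.
  rewrite -EFinM lee_fin.
  by rewrite /B; lra.
exists (Num.max (3 * c1 ^+ 2 * B + 1) (3 * c2 ^+ 2 * B + 1)).
  by rewrite le_max addr_ge0// mulr_ge0.
move=> u cu su; have cg := TK_cont cu; split.
  apply: (@le_trans _ _ ((3 * c1 ^+ 2 * B + 1)%:E * E2 Omega u)%E).
    apply: (core _ _ u _ c10 cg cu) => [x y hx hy|M M0 hM z zO].
      exact: (submean_local e0 eO cu su hx hy).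
    exact: TK_ray_le.
  by rewrite lee_wpmul2r ?E2_ge0// lee_fin le_max lexx.
apply: (@le_trans _ _ ((3 * c2 ^+ 2 * B + 1)%:E * E2 Omega (TK u))%E).
  apply: (core _ _ u _ c20 cu cg) => [x y hx hy|M M0 hM z zO].
    exact: (local_bound e0 eO Le cu su hx hy).
  exact: ray_le_TK.
by rewrite lee_wpmul2r ?E2_ge0// lee_fin le_max lexx orbT.
Qed.

End L2_operator.

(** * Generalized Bergman spaces in components *)

Section spaces.
Variable R : realType.
Notation plane := (R * R)%type.
Notation mplane := (measurableTypeR R * measurableTypeR R)%type.
Local Notation normc := (@Normc.normc R).
Local Notation cabs := (@cabs R).

Variable Omega : set plane.
Hypothesis oO : open Omega.

Let nO z : Omega z -> \forall y \near z, Omega y.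
Proof. by move=> zO; exact: open_nbhs_nbhs. Qed.

Lemma C1f_ext h h' hx hy hx' hy' : (forall z, Omega z -> h z = h' z) ->
  (forall z, Omega z -> hx z = hx' z) -> (forall z, Omega z -> hy z = hy' z) ->
  C1f Omega h hx hy -> C1f Omega h' hx' hy'.
Proof.
move=> e0 e1 e2 [c cx cy dx dy].
have n0 z : Omega z -> \forall y \near z, h y = h' y by move=> /nO; apply: filterS.
have n1 z : Omega z -> \forall y \near z, hx y = hx' y by move=> /nO; apply: filterS.
have n2 z : Omega z -> \forall y \near z, hy y = hy' y by move=> /nO; apply: filterS.
split=> z zO.
- exact: near_ccont (n0 z zO) (c z zO).
- exact: near_ccont (n1 z zO) (cx z zO).
- exact: near_ccont (n2 z zO) (cy z zO).
- rewrite -e1//; exact: near_cderiv (n0 z zO) (dx z zO).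
- rewrite -e2//; exact: near_cderiv (n0 z zO) (dy z zO).
Qed.

Lemma C1f_unique h hx hy hx' hy' z : C1f Omega h hx hy -> C1f Omega h hx' hy' -> Omega z ->
  hx z = hx' z /\ hy z = hy' z.
Proof.
move=> [_ _ _ dx dy] [_ _ _ dx' dy'] zO; split.
  by rewrite -(cderiv_Cderive (dx z zO)) (cderiv_Cderive (dx' z zO)).
by rewrite -(cderiv_Cderive (dy z zO)) (cderiv_Cderive (dy' z zO)).
Qed.

Let within_for (u : plane -> R) : {within Omega, continuous u} <->
  forall z, Omega z -> {for z, continuous u}.
Proof.
rewrite (continuous_open_subspace u oO); split=> H z.
  by move=> zO; apply: H; rewrite inE.
by rewrite inE; exact: H.
Qed.

Let Ck1P (u : plane -> R) : Ck (axes R) 1 Omega u <->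
  [/\ forall z, Omega z -> {for z, continuous u},
      forall z, Omega z -> {for z, continuous ('D_(e_x R) u)},
      forall z, Omega z -> {for z, continuous ('D_(e_y R) u)} &
      forall z, Omega z -> derivable u z (e_x R) /\ derivable u z (e_y R)].
Proof.
have ey : e_y R \in axes R by rewrite !inE eqxx orbT.
split=> [[/within_for cu H]|[cu cx cy d]].
  have [dx [/within_for cx _]] := H (e_x R) (mem_head _ _).
  have [dy [/within_for cy _]] := H (e_y R) ey.
  split; [exact: cu|exact: cx|exact: cy|move=> z zO].
  by split; [exact: dx|exact: dy].
split; first exact/within_for.
move=> v; rewrite !inE => /orP[/eqP ->|/eqP ->]; split.
- by move=> p /d[].
- exact: (conj ((within_for _).2 cx) I).
- by move=> p /d[].
- exact: (conj ((within_for _).2 cy) I).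
Qed.

Lemma CkC1_C1f (h : plane -> R[i]) :
  CkC (axes R) 1 Omega h <-> C1f Omega h (Cderive h (e_x R)) (Cderive h (e_y R)).
Proof.
split=> [[/Ck1P[c1 c2 c3 c4] /Ck1P[d1 d2 d3 d4]]|[c cx cy dx dy]].
  split=> z zO.
  - by split; [exact: c1|exact: d1].
  - by split; [exact: c2|exact: d2].
  - by split; [exact: c3|exact: d3].
  - by split; apply/derivableP; [exact: (c4 z zO).1|exact: (d4 z zO).1].
  - by split; apply/derivableP; [exact: (c4 z zO).2|exact: (d4 z zO).2].
split; apply/Ck1P; split=> z zO.
- by have [] := c z zO.
- exact: (cx z zO).1.
- exact: (cy z zO).1.
- by split; [have [[]] := dx z zO|have [[]] := dy z zO].
- by have [] := c z zO.
- exact: (cx z zO).2.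
- exact: (cy z zO).2.
- by split; [have [_ []] := dx z zO|have [_ []] := dy z zO].
Qed.

Lemma C1f_Cderive h hx hy : C1f Omega h hx hy ->
  C1f Omega h (Cderive h (e_x R)) (Cderive h (e_y R)).
Proof.
move=> H; apply: (C1f_ext (h := h) (hx := hx) (hy := hy)) => // z zO.
  by have [_ _ _ dx _] := H; rewrite (cderiv_Cderive (dx z zO)).
by have [_ _ _ _ dy] := H; rewrite (cderiv_Cderive (dy z zO)).
Qed.

Let Ck2_closure (u : plane -> R) : Ck_closure (axes R) 2 Omega u ->
  [/\ forall z, Omega z -> {for z, continuous u},
      forall z, Omega z -> {for z, continuous ('D_(e_x R) u)},
      forall z, Omega z -> {for z, continuous ('D_(e_y R) u)} &
      forall z, Omega z -> derivable u z (e_x R) /\ derivable u z (e_y R)].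
Proof.
have ey : e_y R \in axes R by rewrite !inE eqxx orbT.
have ext (w w' : plane -> R) : {within closure Omega, continuous w'} -> {in Omega, w =1 w'} ->
    forall z, Omega z -> {for z, continuous w}.
  move=> /(continuous_subspaceW (@subset_closure _ Omega)) /within_for cw e z zO.
  have nw : \forall y \near z, w' y = w y.
    by apply: filterS (nO zO) => y yO; apply/esym/e; rewrite inE.
  have [//] : ccont (fun z => (w z)%:C) z.
  apply: (near_ccont (u := fun z => (w' z)%:C)); first by apply: filterS nw => y ->.
  by apply: ccontR; exact: cw.
move=> [cu [_ H]].
have [dx [[wx [cwx ex]] _]] := H (e_x R) (mem_head _ _).
have [dy [[wy [cwy ey']] _]] := H (e_y R) ey.
split.
- exact: (ext u u cu).
- exact: (ext _ _ cwx ex).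
- exact: (ext _ _ cwy ey').
- by move=> z zO; split; [exact: dx|exact: dy].
Qed.

Lemma CkC2_closure_C1f (h : plane -> R[i]) : CkC_closure (axes R) 2 Omega h ->
  C1f Omega h (Cderive h (e_x R)) (Cderive h (e_y R)).
Proof. by move=> [/Ck2_closure h1 /Ck2_closure h2]; apply/CkC1_C1f; split; apply/Ck1P; [exact: h1|exact: h2]. Qed.

(** The Vekua equation [dbar W = (dbar g / g) * conjB W] for [W = u + j v], in terms
    of partial derivatives. *)
Definition vekua (g gx gy u v ux uy vx vy : plane -> R[i]) (z : plane) :=
  ux z - vy z = (g z)^-1 * (gx z * u z + gy z * v z) /\
  vx z + uy z = (g z)^-1 * (gy z * u z - gx z * v z).

Lemma vekuaP (g : plane -> R[i]) (W : plane -> bicomplex R) z :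
  dbar W z = ((g z)^-1 *: dbar (fun p => Bicomplex (g p) 0) z) * conjB (W z) <->
  vekua g (Cderive g (e_x R)) (Cderive g (e_y R)) (fun z => Sc (W z)) (fun z => Vec (W z))
    (Cderive (fun z => Sc (W z)) (e_x R)) (Cderive (fun z => Sc (W z)) (e_y R))
    (Cderive (fun z => Vec (W z)) (e_x R)) (Cderive (fun z => Vec (W z)) (e_y R)) z.
Proof.
have d0 v : Cderive (fun=> 0 : R[i]) v z = 0 by exact: cderiv_Cderive (cderiv_cst _ _ _).
have c0 : (2^-1 : R[i]) != 0 by rewrite invr_eq0 pnatr_eq0.
rewrite /dbar /Bderive /vekua /= !d0; move: (2^-1) c0 => c c0.
have e1 (ux uy vy gi gx gy u v : R[i]) :
    c * (ux + (0 * uy - 1 * vy)) =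
      gi * (c * (gx + (0 * gy - 1 * 0))) * u - gi * (c * (0 + (0 * 0 + 1 * gy))) * - v <->
    ux - vy = gi * (gx * u + gy * v).
  have -> : c * (ux + (0 * uy - 1 * vy)) = c * (ux - vy) by ring.
  have -> : gi * (c * (gx + (0 * gy - 1 * 0))) * u - gi * (c * (0 + (0 * 0 + 1 * gy))) * - v =
    c * (gi * (gx * u + gy * v)) by ring.
  by split=> [/(mulfI c0)|->].
have e2 (vx vy uy gi gx gy u v : R[i]) :
    c * (vx + (0 * vy + 1 * uy)) =
      gi * (c * (gx + (0 * gy - 1 * 0))) * - v + gi * (c * (0 + (0 * 0 + 1 * gy))) * u <->
    vx + uy = gi * (gy * u - gx * v).
  have -> : c * (vx + (0 * vy + 1 * uy)) = c * (vx + uy) by ring.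
  have -> : gi * (c * (gx + (0 * gy - 1 * 0))) * - v + gi * (c * (0 + (0 * 0 + 1 * gy))) * u =
    c * (gi * (gy * u - gx * v)) by ring.
  by split=> [/(mulfI c0)|->].
split=> [H|[/e1 h1 /e2 h2]].
  by split; [apply/e1; exact: (congr1 (@Sc R) H)|apply/e2; exact: (congr1 (@Vec R) H)].
rewrite -[LHS]bpairK -[RHS]bpairK; congr (pairb (_, _)); [exact: h1|exact: h2].
Qed.

Lemma vekua_ext g gx gy u v ux uy vx vy u' v' ux' uy' vx' vy' z :
  u z = u' z -> v z = v' z -> ux z = ux' z -> uy z = uy' z -> vx z = vx' z -> vy z = vy' z ->
  vekua g gx gy u v ux uy vx vy z -> vekua g gx gy u' v' ux' uy' vx' vy' z.
Proof. by rewrite /vekua => <- <- <- <- <- <-. Qed.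

Lemma L2C_E2 (u : plane -> R[i]) : (forall z, Omega z -> ccont u z) ->
  L2C Omega u <-> (E2 Omega u < +oo)%E.
Proof.
move=> cu; have mO : measurable (Omega : set mplane) by exact: open_plane_measurable.
have mu2 := measurable_sqr_normc oO (@subset_refl _ Omega) mO cu.
have fE : (\int[area R]_(z in Omega) `|(normc (u z) ^+ 2)%:E|)%E = E2 Omega u.
  by apply: eq_integral => z _; rewrite gee0_abs// lee_fin sqr_ge0.
split=> [[_ _ /integrableP[_]]|H]; first by rewrite fE.
split.
- by apply: open_plane_measurable_fun => // z zO; have [] := cu z zO.
- by apply: open_plane_measurable_fun => // z zO; have [] := cu z zO.
- by apply/integrableP; split; [exact: mu2|rewrite fE].
Qed.

Lemma L2normE (W : plane -> bicomplex R) :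
  (forall z, Omega z -> ccont (fun z => Sc (W z)) z) ->
  (forall z, Omega z -> ccont (fun z => Vec (W z)) z) ->
  L2norm Omega W = Num.sqrt (fine (E2 Omega (fun z => Sc (W z)) + E2 Omega (fun z => Vec (W z)))).
Proof.
move=> cS cV; have mO : measurable (Omega : set mplane) by exact: open_plane_measurable.
have mS := measurable_sqr_normc oO (@subset_refl _ Omega) mO cS.
have mV := measurable_sqr_normc oO (@subset_refl _ Omega) mO cV.
rewrite /L2norm /Rintegral; congr (Num.sqrt (fine _)).
rewrite -ge0_integralD//.
- apply: eq_integral => z _; rewrite -EFinD /absB sqr_sqrtr//.
  by rewrite addr_ge0// sqr_ge0.
- by move=> z _; rewrite lee_fin sqr_ge0.
- by move=> z _; rewrite lee_fin sqr_ge0.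
Qed.

(** Characterisation of the generalized Bergman space in terms of the two
    components. *)
Section bergman.
Variables g gx gy : plane -> R[i].
Hypothesis gC1 : C1f Omega g gx gy.

Lemma A2_intro (W : plane -> bicomplex R) ux uy vx vy :
  C1f Omega (fun z => Sc (W z)) ux uy -> C1f Omega (fun z => Vec (W z)) vx vy ->
  (E2 Omega (fun z => Sc (W z)) < +oo)%E -> (E2 Omega (fun z => Vec (W z)) < +oo)%E ->
  (forall z, Omega z -> vekua g gx gy (fun z => Sc (W z)) (fun z => Vec (W z)) ux uy vx vy z) ->
  A2 Omega g W.
Proof.
move=> hu hv Eu Ev H; split.
- by split; apply/CkC1_C1f; [exact: C1f_Cderive hu|exact: C1f_Cderive hv].
- by split; apply/L2C_E2 => //; [exact: C1f_c hu|exact: C1f_c hv].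
- move=> z zO; apply/vekuaP; have := H z zO.
  have [e1 e2] := C1f_unique gC1 (C1f_Cderive gC1) zO.
  have [e3 e4] := C1f_unique hu (C1f_Cderive hu) zO.
  have [e5 e6] := C1f_unique hv (C1f_Cderive hv) zO.
  by rewrite /vekua e1 e2 e3 e4 e5 e6.
Qed.

Lemma A2_elim (W : plane -> bicomplex R) : A2 Omega g W -> exists ux uy vx vy,
  [/\ C1f Omega (fun z => Sc (W z)) ux uy, C1f Omega (fun z => Vec (W z)) vx vy,
     (E2 Omega (fun z => Sc (W z)) < +oo)%E, (E2 Omega (fun z => Vec (W z)) < +oo)%E &
     forall z, Omega z -> vekua g gx gy (fun z => Sc (W z)) (fun z => Vec (W z)) ux uy vx vy z].
Proof.
move=> [[/CkC1_C1f hu /CkC1_C1f hv] [lu lv] H].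
exists (Cderive (fun z => Sc (W z)) (e_x R)), (Cderive (fun z => Sc (W z)) (e_y R)),
  (Cderive (fun z => Vec (W z)) (e_x R)), (Cderive (fun z => Vec (W z)) (e_y R)); split => //.
- by apply/L2C_E2 => //; exact: C1f_c hu.
- by apply/L2C_E2 => //; exact: C1f_c hv.
- move=> z zO; have /vekuaP := H z zO.
  have [e1 e2] := C1f_unique gC1 (C1f_Cderive gC1) zO.
  by rewrite /vekua e1 e2.
Qed.

End bergman.

Lemma A2_ext (g : plane -> R[i]) gx gy (W W' : plane -> bicomplex R) : C1f Omega g gx gy ->
  (forall z, Omega z -> W z = W' z) -> A2 Omega g W -> A2 Omega g W'.
Proof.
move=> gC1 e /(A2_elim gC1)[ux [uy [vx [vy [hu hv Eu Ev H]]]]].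
have eE (p : bicomplex R -> R[i]) : E2 Omega (fun z => p (W' z)) = E2 Omega (fun z => p (W z)).
  by apply: eq_integral => z /set_mem zO; rewrite e.
apply: (A2_intro gC1 (ux := ux) (uy := uy) (vx := vx) (vy := vy)).
- by apply: C1f_ext hu => // z zO; rewrite e.
- by apply: C1f_ext hv => // z zO; rewrite e.
- by rewrite (eE (@Sc R)).
- by rewrite (eE (@Vec R)).
- by move=> z zO; apply: vekua_ext (H z zO) => //; rewrite e.
Qed.

End spaces.

(** * Transmutation pairs and the Vekua equation *)

Section transmutation.
Variable R : realType.
Notation plane := (R * R)%type.
Notation mplane := (measurableTypeR R * measurableTypeR R)%type.
Local Notation normc := (@Normc.normc R).
Local Notation cabs := (@cabs R).
Variable Omega : set plane.
Hypothesis oO : open Omega.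
Hypothesis sO : starshaped0 Omega.

(** The Vekua system at [z != 0] in polar form: radial derivatives of one component
    are expressed through angular derivatives of the other. *)
Lemma polar_system (z : plane) (p q k1 k2 ux uy vx vy u v : R[i]) : z != (0, 0) ->
  z.1%:C * p + z.2%:C * q = k1 -> z.1%:C * q - z.2%:C * p = k2 ->
  (ux - vy = p * u + q * v /\ vx + uy = q * u - p * v) <->
  (z.1%:C * ux + z.2%:C * uy - k1 * u - k2 * v = z.1%:C * vy - z.2%:C * vx /\
   z.1%:C * vx + z.2%:C * vy + k1 * v - k2 * u = - (z.1%:C * uy - z.2%:C * ux)).
Proof.
move=> zn <- <-; pose D1 := ux - vy - (p * u + q * v); pose D2 := vx + uy - (q * u - p * v).
have r0 : z.1%:C ^+ 2 + z.2%:C ^+ 2 != 0 :> R[i].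
  have -> : z.1%:C ^+ 2 + z.2%:C ^+ 2 = (z.1 ^+ 2 + z.2 ^+ 2)%:C :> R[i].
    by rewrite rmorphD !rmorphXn.
  by apply: realC_neq0; rewrite -sqr_cabs expf_neq0// gt_eqF// cabs_gt0.
have e1 : z.1%:C * ux + z.2%:C * uy - (z.1%:C * p + z.2%:C * q) * u - (z.1%:C * q - z.2%:C * p) * v -
    (z.1%:C * vy - z.2%:C * vx) = z.1%:C * D1 + z.2%:C * D2 by rewrite /D1 /D2; ring.
have e2 : z.1%:C * vx + z.2%:C * vy + (z.1%:C * p + z.2%:C * q) * v - (z.1%:C * q - z.2%:C * p) * u -
    - (z.1%:C * uy - z.2%:C * ux) = z.1%:C * D2 - z.2%:C * D1 by rewrite /D1 /D2; ring.
split=> -[h1 h2].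
  have d1 : D1 = 0 by rewrite /D1 h1 subrr.
  have d2 : D2 = 0 by rewrite /D2 h2 subrr.
  by split; apply/eqP; rewrite -subr_eq0 ?e1 ?e2 d1 d2 !mulr0 ?subr0 ?addr0.
have f1 : z.1%:C * D1 + z.2%:C * D2 = 0 by rewrite -e1 h1 subrr.
have f2 : z.1%:C * D2 - z.2%:C * D1 = 0 by rewrite -e2 h2 subrr.
split; apply/eqP; rewrite -subr_eq0 -/D1 -/D2; apply/eqP; apply: (mulfI r0); rewrite mulr0.
  have -> : (z.1%:C ^+ 2 + z.2%:C ^+ 2) * D1 =
    z.1%:C * (z.1%:C * D1 + z.2%:C * D2) - z.2%:C * (z.1%:C * D2 - z.2%:C * D1) by ring.
  by rewrite f1 f2 !mulr0 subr0.
have -> : (z.1%:C ^+ 2 + z.2%:C ^+ 2) * D2 =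
  z.2%:C * (z.1%:C * D1 + z.2%:C * D2) + z.1%:C * (z.1%:C * D2 - z.2%:C * D1) by ring.
by rewrite f1 f2 !mulr0 addr0.
Qed.

(** An identity between continuous functions need only be checked off the
    origin. *)
Lemma ccont_at0 (D : plane -> R[i]) : ccont D (0, 0) ->
  (forall z, Omega z -> z != (0, 0) -> D z = 0) -> D (0, 0) = 0.
Proof.
move=> cD H; have /near_planeP[e e0 He] : \forall z \near ((0 : R), (0 : R)), Omega z.
  by apply: open_nbhs_nbhs; split => //; exact: sO.1.
apply: (@ceq0_closed_itv _ (fun t : R => D (t, 0)) 0 e 0) => //.
- apply: (@ccont_comp R _ _ (fun t : R => (t, 0)) D) => //.
  by apply: cont_pair; [exact: cvg_id|exact: cvg_cst].
- move=> t /andP[t0 te]; apply: H; last by rewrite xpair_eqE gt_eqF.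
  by rewrite -[t]add0r -[X in (_, X)](addr0 0); apply: He; rewrite ?normr0// gtr0_norm.
- by rewrite lexx ltW.
Qed.

(** The Cartesian system follows from its polar form off the origin. *)
Lemma vekua_from_polar g gx gy u v ux uy vx vy (phi : R -> R[i]) :
  C1f Omega g gx gy -> C1f Omega u ux uy -> C1f Omega v vx vy ->
  (forall z, Omega z -> g z != 0) ->
  (forall z, Omega z -> z != (0, 0) -> z.1%:C * gx z + z.2%:C * gy z = phi (cabs z) * g z) ->
  (forall z, Omega z -> z != (0, 0) -> z.1%:C * gy z - z.2%:C * gx z = 0) ->
  (forall z, Omega z -> z != (0, 0) ->
    z.1%:C * ux z + z.2%:C * uy z - phi (cabs z) * u z = z.1%:C * vy z - z.2%:C * vx z /\
    z.1%:C * vx z + z.2%:C * vy z + phi (cabs z) * v z = - (z.1%:C * uy z - z.2%:C * ux z)) ->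
  forall z, Omega z -> vekua g gx gy u v ux uy vx vy z.
Proof.
move=> [g1 g2 g3 _ _] [u1 u2 u3 _ _] [v1 v2 v3 _ _] gn Eg Tg H.
have off z : Omega z -> z != (0, 0) -> vekua g gx gy u v ux uy vx vy z.
  move=> zO zn; have gz := gn z zO.
  have k1 : z.1%:C * (gx z / g z) + z.2%:C * (gy z / g z) = phi (cabs z).
    by rewrite !mulrA -mulrDl Eg// mulfK.
  have k2 : z.1%:C * (gy z / g z) - z.2%:C * (gx z / g z) = 0.
    by rewrite !mulrA -mulrBl Tg// mul0r.
  have [_ P] := polar_system (ux z) (uy z) (vx z) (vy z) (u z) (v z) zn k1 k2.
  have [h1 h2] := H z zO zn; have [|q1 q2] := P.
    by rewrite !mul0r !subr0; split.
  by split; [rewrite q1|rewrite q2]; ring.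
move=> z zO; have [z0|] := eqVneq z (0, 0); last exact: off.
pose D1 z := ux z - vy z - (g z)^-1 * (gx z * u z + gy z * v z).
pose D2 z := vx z + uy z - (g z)^-1 * (gy z * u z - gx z * v z).
have cD1 : ccont D1 z.
  by apply: ccontB; [apply: ccontB; auto|apply: ccontM; [apply: ccontV; auto|apply: ccontD; apply: ccontM; auto]].
have cD2 : ccont D2 z.
  by apply: ccontB; [apply: ccontD; auto|apply: ccontM; [apply: ccontV; auto|apply: ccontB; apply: ccontM; auto]].
rewrite z0 in cD1 cD2 *.
have h1 : D1 (0, 0) = 0.
  by apply: ccont_at0 cD1 _ => w wO wn; have [h _] := off w wO wn; rewrite /D1 h subrr.
have h2 : D2 (0, 0) = 0.
  by apply: ccont_at0 cD2 _ => w wO wn; have [_ h] := off w wO wn; rewrite /D2 h subrr.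
by split; apply/eqP; rewrite -subr_eq0; apply/eqP; [exact: h1|exact: h2].
Qed.

Lemma polar_from_vekua g gx gy u v ux uy vx vy (phi : R -> R[i]) z :
  g z != 0 -> z != (0, 0) ->
  z.1%:C * gx z + z.2%:C * gy z = phi (cabs z) * g z ->
  z.1%:C * gy z - z.2%:C * gx z = 0 ->
  vekua g gx gy u v ux uy vx vy z ->
  z.1%:C * ux z + z.2%:C * uy z - phi (cabs z) * u z = z.1%:C * vy z - z.2%:C * vx z /\
  z.1%:C * vx z + z.2%:C * vy z + phi (cabs z) * v z = - (z.1%:C * uy z - z.2%:C * ux z).
Proof.
move=> gz zn Eg Tg [h1 h2].
have k1 : z.1%:C * (gx z / g z) + z.2%:C * (gy z / g z) = phi (cabs z).
  by rewrite !mulrA -mulrDl Eg// mulfK.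
have k2 : z.1%:C * (gy z / g z) - z.2%:C * (gx z / g z) = 0.
  by rewrite !mulrA -mulrBl Tg// mul0r.
have [P _] := polar_system (ux z) (uy z) (vx z) (vy z) (u z) (v z) zn k1 k2.
have [|q1 q2] := P; first by split; [rewrite h1|rewrite h2]; ring.
by move: q1 q2; rewrite !mul0r !subr0; split.
Qed.

Lemma C1f_cst1 : C1f Omega (fun=> 1) (fun=> 0) (fun=> 0).
Proof. by split=> z _; [exact: ccont_cst|exact: ccont_cst|exact: ccont_cst|exact: cderiv_cst|exact: cderiv_cst]. Qed.

Variables (rho C : R) (phi : R -> R[i]) (a ar at' b br bt : plane -> R[i]).
Hypothesis rho0 : 0 < rho.
Hypothesis rhoO : forall z, Omega z -> cabs z < rho.
Hypothesis C0 : 0 <= C.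
Hypothesis tp : transmutation_pair rho C phi a ar at' b br bt.
Hypothesis area_fin : (area R Omega < +oo)%E.
Variables g gx gy : plane -> R[i].
Hypothesis gC1 : C1f Omega g gx gy.
Hypothesis gn : forall z, Omega z -> g z != 0.
Hypothesis gE : forall z, Omega z -> z != (0, 0) ->
  z.1%:C * gx z + z.2%:C * gy z = phi (cabs z) * g z.
Hypothesis gT : forall z, Omega z -> z != (0, 0) -> z.1%:C * gy z - z.2%:C * gx z = 0.

Let ra := tp_a tp.
Let rb := tp_b tp.
Let tp' := transmutation_pair_swap tp.

Lemma Tk_congr (k : plane -> R[i]) h h' z : Omega z -> (forall w, Omega w -> h w = h' w) ->
  Tk k h z = Tk k h' z.
Proof.
move=> zO e; rewrite /Tk e//; congr (_ + _).
by apply: eq_Cint => s sh; rewrite e//; exact: star_sq.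
Qed.

Lemma Tk_opp k kr kt h z : regular_kernel rho C k kr kt ->
  (forall z, Omega z -> ccont h z) -> Omega z -> Tk k (fun z => - h z) z = - Tk k h z.
Proof.
move=> rk ch zO; rewrite /Tk opprD; congr (_ + _).
rewrite /Op -(CintN (Op_integrand sO (ker_cont (rk_cont rk)) ch zO)).
by apply: eq_Cint => s _; rewrite mulrN.
Qed.

Let ccont1 (z : plane) : ccont (fun z : plane => z.1%:C) z.
Proof. by apply: ccontR; exact: cvg_fst. Qed.

Let ccont2 (z : plane) : ccont (fun z : plane => z.2%:C) z.
Proof. by apply: ccontR; exact: cvg_snd. Qed.

Lemma ccont_angular h hx hy z : C1f Omega h hx hy -> Omega z ->
  ccont (fun z : plane => z.1%:C * hy z - z.2%:C * hx z) z.
Proof.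
move=> H zO; apply: ccontB; apply: ccontM;
  [exact: ccont1|exact: (C1f_cy H)|exact: ccont2|exact: (C1f_cx H)].
Qed.

Lemma ccont_radial h hx hy z : C1f Omega h hx hy -> Omega z ->
  ccont (fun z : plane => z.1%:C * hx z + z.2%:C * hy z) z.
Proof.
move=> H zO; apply: ccontD; apply: ccontM;
  [exact: ccont1|exact: (C1f_cx H)|exact: ccont2|exact: (C1f_cy H)].
Qed.

(** The pair of operators maps conjugate pairs to solutions of the Vekua
    equation. *)
Lemma transmutation_forward u v ux uy vx vy :
  C1f Omega u ux uy -> C1f Omega v vx vy ->
  (forall z, Omega z -> ux z = vy z /\ uy z = - vx z) ->
  forall z, Omega z -> vekua g gx gy (Tk a u) (Tk b v)
    (Tkx a ar u ux) (Tky a ar u uy) (Tkx b br v vx) (Tky b br v vy) z.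
Proof.
move=> hu hv cr; have Tu := Tk_C1 oO sO ra C0 rhoO hu; have Tv := Tk_C1 oO sO rb C0 rhoO hv.
apply: (vekua_from_polar gC1 Tu Tv gn gE gT) => z zO zn; split.
  rewrite (Tk_radial oO sO tp rhoO hu zO zn) (Tk_angular sO rb hv zO).
  by apply: Tk_congr => // w wO; have [-> ->] := cr w wO; ring.
have := Tk_radial oO sO tp' rhoO hv zO zn; rewrite mulNr opprK => ->.
rewrite (Tk_angular sO ra hu zO).
rewrite -(Tk_opp ra (fun w wO => ccont_angular hu wO) zO).
by apply: Tk_congr => // w wO; have [-> ->] := cr w wO; ring.
Qed.

(** Conversely, only conjugate pairs are mapped to solutions. *)
Lemma transmutation_backward u v ux uy vx vy :
  C1f Omega u ux uy -> C1f Omega v vx vy ->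
  (forall z, Omega z -> vekua g gx gy (Tk a u) (Tk b v)
    (Tkx a ar u ux) (Tky a ar u uy) (Tkx b br v vx) (Tky b br v vy) z) ->
  forall z, Omega z -> vekua (fun=> 1) (fun=> 0) (fun=> 0) u v ux uy vx vy z.
Proof.
move=> hu hv H.
have c1 := C1f_cst1.
pose P1 (z : plane) := (z.1%:C * ux z + z.2%:C * uy z) - (z.1%:C * vy z - z.2%:C * vx z).
pose P2 (z : plane) := (z.1%:C * vx z + z.2%:C * vy z) - - (z.1%:C * uy z - z.2%:C * ux z).
have cP1 z : Omega z -> ccont P1 z.
  by move=> zO; apply: ccontB; [exact: ccont_radial hu zO|exact: ccont_angular hv zO].
have cP2 z : Omega z -> ccont P2 z.
  by move=> zO; apply: ccontB; [exact: ccont_radial hv zO|apply: ccontN; exact: ccont_angular hu zO].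
have pol z (zO : Omega z) (zn : z != (0, 0)) :=
  polar_from_vekua (gn zO) zn (gE zO zn) (gT zO zn) (H z zO).
have TB k kr kt h h' z : regular_kernel rho C k kr kt -> (forall z, Omega z -> ccont h z) ->
    (forall z, Omega z -> ccont h' z) -> Omega z ->
    Tk k (fun z => h z - h' z) z = Tk k h z - Tk k h' z.
  move=> rk ch ch' zO; rewrite /Tk (OpB sO (ker_cont (rk_cont rk)) ch ch' zO); ring.
have T1 z : Omega z -> z != (0, 0) -> Tk b P1 z = 0.
  move=> zO zn; have [h1 _] := pol z zO zn.
  rewrite (TB _ _ _ _ _ _ rb (fun w wO => ccont_radial hu wO) (fun w wO => ccont_angular hv wO) zO).
  by rewrite -(Tk_radial oO sO tp rhoO hu zO zn) -(Tk_angular sO rb hv zO) h1 subrr.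
have T2 z : Omega z -> z != (0, 0) -> Tk a P2 z = 0.
  move=> zO zn; have [_ h2] := pol z zO zn.
  rewrite (TB _ _ _ _ _ _ ra (fun w wO => ccont_radial hv wO)
    (fun w wO => ccontN (ccont_angular hu wO)) zO).
  rewrite (Tk_opp ra (fun w wO => ccont_angular hu wO) zO) -(Tk_angular sO ra hu zO).
  have := Tk_radial oO sO tp' rhoO hv zO zn; rewrite mulNr opprK => <-.
  by rewrite h2 subrr.
have Tcont k kr kt h z : regular_kernel rho C k kr kt -> (forall z, Omega z -> ccont h z) ->
    Omega z -> ccont (Tk k h) z.
  move=> rk ch zO; apply: ccontD; first exact: ch.
  exact: (Op_cont oO sO (ker_cont (rk_cont rk)) ch zO).
have zero (D : plane -> R[i]) : (forall z, Omega z -> ccont D z) ->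
    (forall z, Omega z -> z != (0, 0) -> D z = 0) -> forall z, Omega z -> D z = 0.
  move=> cD D0 z zO; have [z0|] := eqVneq z (0, 0); last exact: D0.
  by rewrite z0; apply: ccont_at0 D0; rewrite -z0; exact: cD.
have Z1 := Tk_injective sO rb C0 rho0 rhoO cP1 (zero _ (fun z zO => Tcont _ _ _ _ z rb cP1 zO) T1).
have Z2 := Tk_injective sO ra C0 rho0 rhoO cP2 (zero _ (fun z zO => Tcont _ _ _ _ z ra cP2 zO) T2).
apply: (@vekua_from_polar (fun=> 1) (fun=> 0) (fun=> 0) u v ux uy vx vy (fun=> 0)) => //.
- by move=> z _ _; rewrite !mulr0 mul0r addr0.
- by move=> z _ _; rewrite !mulr0 subr0.
- move=> z zO _; rewrite !mul0r subr0 addr0; split; apply/eqP; rewrite -subr_eq0; apply/eqP.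
    exact: Z1.
  exact: Z2.
Qed.

Lemma vekua1P (u v ux uy vx vy : plane -> R[i]) (z : plane) :
  vekua (fun=> 1) (fun=> 0) (fun=> 0) u v ux uy vx vy z <-> ux z = vy z /\ uy z = - vx z.
Proof.
rewrite /vekua !mul0r addr0 subr0 mulr0; split=> -[h1 h2]; split.
- by apply/eqP; rewrite -subr_eq0 h1.
- by apply/eqP; rewrite -addr_eq0 addrC h2.
- by rewrite h1 subrr.
- by rewrite h2 subrr.
Qed.

Lemma conjugate_submean u v ux uy vx vy : C1f Omega u ux uy -> C1f Omega v vx vy ->
  (forall z, Omega z -> ux z = vy z /\ uy z = - vx z) -> submean Omega u /\ submean Omega v.
Proof.
move=> hu hv cr; have H : cauchy_riemann Omega u v ux uy.
  split=> //; apply: (C1f_ext oO _ _ _ hv) => // z zO; have [e1 e2] := cr z zO.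
    by rewrite e2 opprK.
  by rewrite e1.
split; first exact: (cauchy_riemann_submean oO H).
exact: (cauchy_riemann_submean oO (cauchy_riemann_swap H)).
Qed.

Variables G1 G2 : plane -> R[i].
Hypothesis abG : forall r t : R, 0 <= r <= rho -> 0 <= t <= 1 ->
  a (r, t) = G1 (r, t) /\ b (r, t) = G2 (r, t).

Lemma TB_Tk (W : plane -> bicomplex R) z : Omega z ->
  TB G1 G2 W z = Bicomplex (Tk a (fun z => Sc (W z)) z) (Tk b (fun z => Vec (W z)) z).
Proof.
move=> zO; have r01 : 0 <= cabs z <= rho by rewrite cabs_ge0 ltW// rhoO.
by rewrite /TB; congr Bicomplex; congr (_ + _); apply: eq_Cint => s sh;
  have [e1 e2] := abG r01 (onem_sq01 sh); rewrite /ker ?e1 ?e2.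
Qed.

Let cS (W : plane -> bicomplex R) := forall z, Omega z -> ccont (fun z => Sc (W z)) z.
Let cV (W : plane -> bicomplex R) := forall z, Omega z -> ccont (fun z => Vec (W z)) z.

Lemma TB_injective (V W : plane -> bicomplex R) : cS V -> cV V -> cS W -> cV W ->
  (forall z, Omega z -> TB G1 G2 V z = TB G1 G2 W z) -> forall z, Omega z -> V z = W z.
Proof.
move=> c1 c2 c3 c4 H.
have inj k kr kt u v : regular_kernel rho C k kr kt -> (forall z, Omega z -> ccont u z) ->
    (forall z, Omega z -> ccont v z) -> (forall z, Omega z -> Tk k u z = Tk k v z) ->
    forall z, Omega z -> u z = v z.
  move=> rk cu cv e z zO; apply/eqP; rewrite -subr_eq0; apply/eqP.
  apply: (Tk_injective sO rk C0 rho0 rhoO (h := fun z => u z - v z)) zO => w wO.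
    by apply: ccontB; auto.
  rewrite /Tk (OpB sO (ker_cont (rk_cont rk)) cu cv wO).
  by have /eqP := e w wO; rewrite -subr_eq0 /Tk => /eqP <-; ring.
have e1 := inj _ _ _ _ _ ra c1 c3 _; have e2 := inj _ _ _ _ _ rb c2 c4 _.
move=> z zO; rewrite -[LHS]bpairK -[RHS]bpairK /bpair; congr (pairb (_, _)).
  by apply: e1 => // w wO; have := H w wO; rewrite !TB_Tk// => -[].
by apply: e2 => // w wO; have := H w wO; rewrite !TB_Tk// => -[].
Qed.

Lemma TB_linear (c : R[i]) (V W : plane -> bicomplex R) z : cS V -> cV V -> cS W -> cV W ->
  Omega z -> TB G1 G2 (fun p => c *: V p + W p) z = c *: TB G1 G2 V z + TB G1 G2 W z.
Proof.
move=> c1 c2 c3 c4 zO; rewrite !TB_Tk//.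
have lin k kr kt u v : regular_kernel rho C k kr kt -> (forall z, Omega z -> ccont u z) ->
    (forall z, Omega z -> ccont v z) ->
    Tk k (fun z => c * u z + v z) z = c * Tk k u z + Tk k v z.
  move=> rk cu cv; have ck := ker_cont (rk_cont rk).
  have i1 := Op_integrand sO ck cu zO; have i2 := Op_integrand sO ck cv zO.
  have i3 : ccontI 0 1 (fun s : R => c * (ker k z s * u (s ^+ 2 *: z))).
    by move=> s sh; apply: ccontM; [exact: ccont_cst|exact: i1].
  rewrite /Tk /Op (_ : Cintegral 0 1 _ =
    Cintegral 0 1 (fun s : R => c * (ker k z s * u (s ^+ 2 *: z)) + ker k z s * v (s ^+ 2 *: z))).
    by rewrite CintD// CintZ//; ring.
  by apply: eq_Cint => s _; ring.
have -> : Tk a (fun p => Sc (c *: V p + W p)) z =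
    c * Tk a (fun z => Sc (V z)) z + Tk a (fun z => Sc (W z)) z by exact: (lin _ _ _ _ _ ra c1 c3).
have -> : Tk b (fun p => Vec (c *: V p + W p)) z =
    c * Tk b (fun z => Vec (V z)) z + Tk b (fun z => Vec (W z)) z by exact: (lin _ _ _ _ _ rb c2 c4).
by [].
Qed.

(* The square of the [L^2] norm. *)
Let nrm (W : plane -> bicomplex R) : \bar R :=
  (E2 Omega (fun z => Sc (W z)) + E2 Omega (fun z => Vec (W z)))%E.

Lemma L2norm_le (V W : plane -> bicomplex R) (k : R) : 0 <= k -> cS V -> cV V -> cS W -> cV W ->
  (nrm W < +oo)%E -> (nrm V <= k%:E * nrm W)%E -> L2norm Omega V <= Num.sqrt k * L2norm Omega W.
Proof.
move=> k0 c1 c2 c3 c4 fW VW; rewrite !(L2normE oO)// -/(nrm V) -/(nrm W) -sqrtrM//.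
have W0 : (0 <= nrm W)%E by rewrite adde_ge0// E2_ge0.
have V0 : (0 <= nrm V)%E by rewrite adde_ge0// E2_ge0.
move: VW fW W0 V0; case: (nrm W) => [w| |] // VW _ W0 V0.
move: VW V0; case: (nrm V) => [v| |] //; rewrite -EFinM /= ?lee_fin => vw v0.
by apply: ler_wsqrtr.
Qed.

(** The [L^2] equivalence for the operator of a regular kernel. *)
Lemma kernel_equivalence k kr kt : regular_kernel rho C k kr kt -> exists2 c : R, 0 <= c &
  forall u, (forall z, Omega z -> ccont u z) -> submean Omega u ->
    (E2 Omega (Tk k u) <= c%:E * E2 Omega u)%E /\ (E2 Omega u <= c%:E * E2 Omega (Tk k u))%E.
Proof.
move=> rk; have L0 : 0 <= C * (rho + 1) by rewrite mulr_ge0// addr_ge0// ltW.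
have hK z (s : R) : Omega z -> 0 <= s <= 1 -> normc (ker k z s) <= C * (rho + 1) * cabs z * s.
  by move=> zO sh; exact: (ker_bound rk C0 rhoO zO sh).
exact: (TK_equivalence oO sO (ker_cont (rk_cont rk)) L0 hK rho0 rhoO area_fin).
Qed.

Notation A21 := (A2 Omega (fun=> 1)).
Notation A2g := (A2 Omega g).

Lemma A2_cont (g' gx' gy' : plane -> R[i]) W : C1f Omega g' gx' gy' -> A2 Omega g' W ->
  [/\ cS W, cV W & (nrm W < +oo)%E].
Proof.
move=> h /(A2_elim oO h)[ux [uy [vx [vy [hu hv Eu Ev _]]]]]; split; first exact: C1f_c hu.
  exact: C1f_c hv.
exact: lte_add_pinfty.
Qed.

Lemma TB_C1f (W : plane -> bicomplex R) ux uy vx vy :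
  C1f Omega (fun z => Sc (W z)) ux uy -> C1f Omega (fun z => Vec (W z)) vx vy ->
  C1f Omega (fun z => Sc (TB G1 G2 W z)) (Tkx a ar (fun z => Sc (W z)) ux)
    (Tky a ar (fun z => Sc (W z)) uy) /\
  C1f Omega (fun z => Vec (TB G1 G2 W z)) (Tkx b br (fun z => Vec (W z)) vx)
    (Tky b br (fun z => Vec (W z)) vy).
Proof.
move=> hu hv; split; [apply: (C1f_ext oO _ _ _ (Tk_C1 oO sO ra C0 rhoO hu))|
  apply: (C1f_ext oO _ _ _ (Tk_C1 oO sO rb C0 rhoO hv))] => // z zO; by rewrite TB_Tk.
Qed.

Lemma nrm_equivalence : exists2 c : R, 0 <= c & forall W, A21 W ->
  [/\ cS (TB G1 G2 W), cV (TB G1 G2 W), (nrm (TB G1 G2 W) <= c%:E * nrm W)%E &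
    (nrm W <= c%:E * nrm (TB G1 G2 W))%E].
Proof.
have [ca ca0 Ha] := kernel_equivalence ra; have [cb cb0 Hb] := kernel_equivalence rb.
exists (Num.max ca cb) => [|W]; first by rewrite le_max ca0.
move=> /(A2_elim oO C1f_cst1)[ux [uy [vx [vy [hu hv Eu Ev H]]]]].
have cr z : Omega z -> ux z = vy z /\ uy z = - vx z by move=> /H /vekua1P.
have [su sv] := conjugate_submean hu hv cr.
have [a1 a2] := Ha _ (C1f_c hu) su; have [b1 b2] := Hb _ (C1f_c hv) sv.
have [t1 t2] := TB_C1f hu hv.
have eS : E2 Omega (fun z => Sc (TB G1 G2 W z)) = E2 Omega (Tk a (fun z => Sc (W z))).
  by apply: eq_integral => z /set_mem zO; rewrite TB_Tk.
have eV : E2 Omega (fun z => Vec (TB G1 G2 W z)) = E2 Omega (Tk b (fun z => Vec (W z))).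
  by apply: eq_integral => z /set_mem zO; rewrite TB_Tk.
have la : (ca%:E <= (Num.max ca cb)%:E)%E by rewrite lee_fin le_max lexx.
have lb : (cb%:E <= (Num.max ca cb)%:E)%E by rewrite lee_fin le_max lexx orbT.
split; [exact: C1f_c t1|exact: C1f_c t2| |]; rewrite /nrm eS eV.
  rewrite (ge0_muleDr _ (E2_ge0 _ _) (E2_ge0 _ _)); apply: leeD.
    by apply: le_trans a1 _; rewrite lee_wpmul2r ?E2_ge0.
  by apply: le_trans b1 _; rewrite lee_wpmul2r ?E2_ge0.
rewrite (ge0_muleDr _ (E2_ge0 _ _) (E2_ge0 _ _)); apply: leeD.
  by apply: le_trans a2 _; rewrite lee_wpmul2r ?E2_ge0.
by apply: le_trans b2 _; rewrite lee_wpmul2r ?E2_ge0.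
Qed.

Lemma nrm_fin W V (k : R) : 0 <= k -> (nrm V < +oo)%E -> (nrm W <= k%:E * nrm V)%E ->
  (E2 Omega (fun z => Sc (W z)) < +oo)%E /\ (E2 Omega (fun z => Vec (W z)) < +oo)%E.
Proof.
move=> k0 fV WV.
have fW : (nrm W < +oo)%E.
  by apply: le_lt_trans WV _; apply: lte_mul_pinfty; rewrite ?lee_fin.
split; apply: le_lt_trans fW; [rewrite leeDl|rewrite leeDr] => //; exact: E2_ge0.
Qed.

Lemma TB_maps W : A21 W -> A2g (TB G1 G2 W).
Proof.
move=> WA; have [c c0 /(_ W WA)[h1 h2 h3 h4]] := nrm_equivalence.
have [_ _ fW] := A2_cont C1f_cst1 WA.
have [f1 f2] := nrm_fin c0 fW h3.
have [ux [uy [vx [vy [hu hv Eu Ev H]]]]] := A2_elim oO C1f_cst1 WA.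
have cr z : Omega z -> ux z = vy z /\ uy z = - vx z by move=> /H /vekua1P.
have [t1 t2] := TB_C1f hu hv.
apply: (A2_intro oO gC1 t1 t2 f1 f2) => z zO.
by apply: vekua_ext (transmutation_forward hu hv cr zO) => //; rewrite TB_Tk.
Qed.

Lemma TB_onto W' : A2g W' -> exists2 W, A21 W & forall z, Omega z -> TB G1 G2 W z = W' z.
Proof.
move=> /(A2_elim oO gC1)[Ux [Uy [Vx [Vy [hU hV EU EV H]]]]].
have [u [ux [uy [hu Tu]]]] := Tk_surjective oO sO ra C0 rho0 rhoO hU.
have [v [vx [vy [hv Tv]]]] := Tk_surjective oO sO rb C0 rho0 rhoO hV.
pose W z := Bicomplex (u z) (v z).
have eW z : Omega z -> TB G1 G2 W z = W' z.
  by move=> zO; rewrite TB_Tk//= Tu// Tv//; case: (W' z).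
have Cu := Tk_C1 oO sO ra C0 rhoO hu; have Cv := Tk_C1 oO sO rb C0 rhoO hv.
have hVk z : Omega z -> vekua g gx gy (Tk a u) (Tk b v)
    (Tkx a ar u ux) (Tky a ar u uy) (Tkx b br v vx) (Tky b br v vy) z.
  move=> zO; have [e1 e2] := C1f_unique (C1f_ext oO Tu (fun _ _ => erefl) (fun _ _ => erefl) Cu) hU zO.
  have [e3 e4] := C1f_unique (C1f_ext oO Tv (fun _ _ => erefl) (fun _ _ => erefl) Cv) hV zO.
  by apply: vekua_ext (H z zO) => //; rewrite ?Tu ?Tv.
have hCR := transmutation_backward hu hv hVk.
have cr z : Omega z -> ux z = vy z /\ uy z = - vx z by move=> /hCR /vekua1P.
have [su sv] := conjugate_submean hu hv cr.
exists W => //; apply: (A2_intro oO C1f_cst1 (W := W) hu hv) => //.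
  have [ca ca0 Ha] := kernel_equivalence ra; have [_] := Ha _ (C1f_c hu) su.
  move=> h; apply: le_lt_trans h _; apply: lte_mul_pinfty; rewrite ?lee_fin//.
  rewrite (_ : E2 _ _ = E2 Omega (fun z => Sc (W' z)))//.
  by apply: eq_integral => z /set_mem zO; rewrite Tu.
have [cb cb0 Hb] := kernel_equivalence rb; have [_] := Hb _ (C1f_c hv) sv.
move=> h; apply: le_lt_trans h _; apply: lte_mul_pinfty; rewrite ?lee_fin//.
rewrite (_ : E2 _ _ = E2 Omega (fun z => Vec (W' z)))//.
by apply: eq_integral => z /set_mem zO; rewrite Tv.
Qed.

(** The operators of a transmutation pair for [g] are isomorphisms of the Bergman
    spaces. *)
Theorem transmutation_isomorphism : bounded_invertible Omega A21 A2g (TB G1 G2).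
Proof.
have [c c0 Hc] := nrm_equivalence.
have c1C1 := C1f_cst1.
split.
  split; first exact: TB_maps.
    move=> k V W VA WA z zO; have [? ? _] := A2_cont c1C1 VA; have [? ? _] := A2_cont c1C1 WA.
    exact: TB_linear.
  exists (Num.sqrt c) => W WA; have [h1 h2 h3 h4] := Hc W WA.
  have [w1 w2 fW] := A2_cont c1C1 WA; exact: L2norm_le.
(* [TB G1 G2] is a bijection between the two spaces up to equality on [Omega]; its
   inverse is obtained by choice. *)
pose P W' W := [/\ cS W, cV W & forall z, Omega z -> TB G1 G2 W z = W' z].
pose S W' := match pselect (exists W, P W' W) with
  left h => projT1 (cid h) | right _ => (fun=> 0) end.
have SP W' : (exists W, P W' W) -> P W' (S W').
  by move=> h; rewrite /S; case: pselect => // h'; exact: (projT2 (cid h')).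
have uniq W' V W : P W' V -> P W' W -> forall z, Omega z -> V z = W z.
  move=> [v1 v2 v3] [w1 w2 w3]; apply: TB_injective => // z zO; by rewrite v3// w3.
have P21 W' : A2g W' -> exists2 W, A21 W & P W' W.
  move=> /TB_onto[W WA e]; exists W => //; have [? ? _] := A2_cont c1C1 WA; by split.
have PS W' : A2g W' -> P W' (S W') by move=> /P21[W _ h]; apply: SP; exists W.
have SA W' : A2g W' -> A21 (S W').
  move=> WA; have [W W1 h] := P21 _ WA.
  by apply: (A2_ext oO c1C1 _ W1) => z zO; exact: uniq h (PS _ WA) z zO.
exists S; split.
- split; first exact: SA.
    move=> k V W VA WA z zO; have [v1 v2 v3] := PS V VA; have [w1 w2 w3] := PS W WA.
    have lc (p q : plane -> R[i]) : (forall z, Omega z -> ccont p z) ->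
        (forall z, Omega z -> ccont q z) -> forall z, Omega z -> ccont (fun z => k * p z + q z) z.
      by move=> cp cq y yO; apply: ccontD; [apply: ccontM; [exact: ccont_cst|exact: cp]|exact: cq].
    have h : P (fun p => k *: V p + W p) (fun p => k *: S V p + S W p).
      split; [exact: (lc _ _ v1 w1)|exact: (lc _ _ v2 w2)|move=> y yO].
      by rewrite TB_linear// v3// w3.
    by apply: (uniq _ _ _ (SP _ _) h) => //; exists (fun p => k *: S V p + S W p).
  exists (Num.sqrt c) => W WA; have [w1 w2 w3] := PS W WA.
  have [h1 h2 h3 h4] := Hc _ (SA W WA); have [g1 g2 fW] := A2_cont gC1 WA.
  apply: L2norm_le => //.
  rewrite (_ : nrm W = nrm (TB G1 G2 (S W)))//; congr (_ + _)%E;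
    by apply: eq_integral => z /set_mem zO; rewrite w3.
- move=> W WA z zO; have [w1 w2 _] := A2_cont c1C1 WA.
  by apply: (uniq _ _ _ (PS _ (TB_maps WA))) => //; split.
- by move=> W WA z zO; have [_ _] := PS W WA; exact.
Qed.

End transmutation.

(** * The isomorphism theorem *)

Section domain_radius.
Variable R : realType.
Notation plane := (R * R)%type.
Notation mplane := (measurableTypeR R * measurableTypeR R)%type.
Local Notation cabs := (@cabs R).
Variable Omega : set plane.
Hypothesis oO : open Omega.
Hypothesis bO : bounded_set Omega.

(** Strict, as [Omega] is open. *)
Lemma cabs_lt_rhoOf z : Omega z -> cabs z < rhoOf Omega.
Proof.
move=> zO.
have [M [Mr HM]] : bounded_set Omega := bO.
have ubO : has_ubound [set cabs w | w in Omega].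
  exists (2 * (`|M| + 1)) => _ [w wO <-].
  have M1 : M < `|M| + 1 by rewrite (le_lt_trans (ler_norm M))// ltrDl.
  have /= := HM _ M1 w wO; rewrite prod_normE ge_max => /andP[h1 h2].
  by apply: le_trans (cabs_le_sum w) _; lra.
have [w wO zw] : exists2 w, Omega w & cabs z < cabs w.
  case: z zO => x y zO.
  have /near_planeP[e e0 He] : \forall w \near (x, y), Omega w by exact: open_nbhs_nbhs.
  pose h : R := (if 0 <= x then 1 else -1) * (e / 2).
  have hh : `|h| < e.
    rewrite normrM (gtr0_norm (divr_gt0 e0 _))//.
    by case: ifP => _; rewrite ?normrN normr1 mul1r; lra.
  exists (x + h, y); first by have := He h 0 hh; rewrite normr0 addr0; exact.
  rewrite -ltr_sqr ?nnegrE ?cabs_ge0// !sqr_cabs /= ltrD2r sqrrD -addrA ltrDl.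
  have e2 : 0 < e / 2 by rewrite divr_gt0.
  rewrite /h; case: ifPn => [x0|]; last rewrite -ltNge => x0.
    rewrite mul1r; have : 0 <= x * (e / 2) by rewrite mulr_ge0// ltW.
    have : 0 < (e / 2) ^+ 2 by rewrite exprn_gt0.
    by rewrite mulr2n; lra.
  rewrite mulN1r; have : 0 < - x * (e / 2) by rewrite mulr_gt0// oppr_gt0.
  have : 0 < (e / 2) ^+ 2 by rewrite exprn_gt0.
  by rewrite mulr2n sqrrN; lra.
by apply: lt_le_trans zw _; apply: ub_le_sup => //; exists w.
Qed.

Lemma area_finite : (area R Omega < +oo)%E.
Proof.
pose o : plane := (0, 0); pose r : R := `|rhoOf Omega|; have r0 : 0 <= r by exact: normr_ge0.
have Or : (Omega : set mplane) `<=` sq o r.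
  move=> [x y] zO; have h := cabs_lt_rhoOf zO; apply/sqP; rewrite /= !subr0.
  have l := le_trans (ltW h) (ler_norm _).
  by split; apply: le_trans l; [exact: (cabs_fst (x, y))|exact: (cabs_snd (x, y))].
have ms := @sq_measurable R o r.
have mO : measurable (Omega : set mplane) by exact: open_plane_measurable.
have h : (area R (sq o r) = (4 * r ^+ 2 * 1)%:E)%E.
  rewrite -(@integral_sq_cst R setT openT o r 1 r0 ler01 (fun _ _ => I)).
  by rewrite integral_cst// mul1e.
apply: le_lt_trans (_ : (area R (sq o r) < +oo)%E); last by rewrite h ltry.
by apply: le_measure => //; rewrite inE.
Qed.

End domain_radius.

Theorem proposition36 (R : realType) (Omega : set (R * R)%type)
  (q f : R -> R[i]) (Gf Ginv : (R * R)%type -> R[i])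
  (Omega_open : open Omega) (Omega_connected : connected Omega)
  (Omega_bounded : bounded_set Omega) (Omega_star : starshaped0 Omega)
  (q_C1 : Ck_itv 1 (rhoOf Omega) q)
  (f_C2 : Ck_itv 2 (rhoOf Omega) f)
  (f_neq0 : forall r : R, 0 <= r <= rhoOf Omega -> f r != 0)
  (f_eq : forall r : R, 0 < r < rhoOf Omega ->
    Cder (Cder f) r + (r^-1)%:C * Cder f r - q r * f r = 0)
  (f_0 : f 0 = 1)
  (f_lim : Normc.normc (r%:C * Cder f r) @[r --> (0 : R)^'+] --> (0 : R))
  (f_radial_C2 : CkC_closure (axes R) 2 Omega (fun z => f (cabs z)))
  (Gf_kernel : is_kernel (rhoOf Omega) q Gf)
  (Ginv_kernel : is_kernel (rhoOf Omega) (q_inv f q) Ginv) :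
  bounded_invertible Omega
    (A2 Omega (fun=> 1)) (A2 Omega (fun z => f (cabs z))) (TB Gf Ginv) /\
  bounded_invertible Omega
    (A2 Omega (fun=> 1)) (A2 Omega (fun z => (f (cabs z))^-1)) (TB Ginv Gf).
Proof.
have rhoO z : Omega z -> cabs z < rhoOf Omega by exact: cabs_lt_rhoOf.
have rho0 : 0 < rhoOf Omega by apply: le_lt_trans (rhoO _ Omega_star.1); exact: cabs_ge0.
have aF := area_finite Omega_open Omega_bounded.
have [C [phi [a [ar [at' [b [br [bt [C0 tp aG _ df]]]]]]]]] :=
  kernel_transmutation rho0 q_C1 f_C2 f_neq0 f_eq Gf_kernel Ginv_kernel.
pose g (z : R * R) := f (cabs z).
pose gx := Cderive g (e_x R); pose gy := Cderive g (e_y R).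
have gC1 : C1f Omega g gx gy by exact: CkC2_closure_C1f.
have gn z : Omega z -> g z != 0.
  by move=> zO; apply: f_neq0; rewrite cabs_ge0 ltW// rhoO.
have dg z : Omega z -> z != (0, 0) ->
    gx z = (z.1 / cabs z)%:C * (phi (cabs z) / (cabs z)%:C * g z) /\
    gy z = (z.2 / cabs z)%:C * (phi (cabs z) / (cabs z)%:C * g z).
  move=> zO zn; have rr : 0 < cabs z < rhoOf Omega by rewrite cabs_gt0// rhoO.
  by split; apply: cderiv_Cderive; apply: cderiv_radial (df _ rr) _;
    [exact: is_derive_cabs_x|exact: is_derive_cabs_y].
have rE z : z != (0, 0) -> (cabs z)%:C != 0 :> R[i] /\
    z.1%:C * z.1%:C + z.2%:C * z.2%:C = (cabs z)%:C * (cabs z)%:C :> R[i].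
  move=> zn; split; first by apply: realC_neq0; rewrite gt_eqF// cabs_gt0.
  by rewrite -!expr2 -!rmorphXn -rmorphD sqr_cabs.
have gE z : Omega z -> z != (0, 0) -> z.1%:C * gx z + z.2%:C * gy z = phi (cabs z) * g z.
  move=> zO zn; have [-> ->] := dg z zO zn; have [rn rr] := rE z zn.
  rewrite !rmorphM !fmorphV /=.
  have -> : z.1%:C * (z.1%:C * (cabs z)%:C^-1 * (phi (cabs z) / (cabs z)%:C * g z)) +
      z.2%:C * (z.2%:C * (cabs z)%:C^-1 * (phi (cabs z) / (cabs z)%:C * g z)) =
      (z.1%:C * z.1%:C + z.2%:C * z.2%:C) * ((cabs z)%:C^-1 * (phi (cabs z) / (cabs z)%:C * g z)).
    by ring.
  by rewrite rr; field.
have gT z : Omega z -> z != (0, 0) -> z.1%:C * gy z - z.2%:C * gx z = 0.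
  move=> zO zn; have [-> ->] := dg z zO zn; rewrite !rmorphM /=; ring.
(* For [1 / f], exchange the kernels and change the sign of [phi]. *)
split; first exact: (transmutation_isomorphism Omega_open Omega_star rho0 rhoO C0 tp aF gC1 gn gE gT aG).
pose hx z := - gx z / g z ^+ 2; pose hy z := - gy z / g z ^+ 2.
have hC1 : C1f Omega (fun z => (g z)^-1) hx hy.
  have [c cx cy dx dy] := gC1; split=> z zO.
  - exact: ccontV (gn z zO) (c z zO).
  - apply: ccontM; first exact/ccontN/cx.
    by apply: ccontV; [rewrite expf_neq0// gn|apply: ccontX; exact: c].
  - apply: ccontM; first exact/ccontN/cy.
    by apply: ccontV; [rewrite expf_neq0// gn|apply: ccontX; exact: c].
  - exact: cderivV (gn z zO) (dx z zO).
  - exact: cderivV (gn z zO) (dy z zO).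
apply: (transmutation_isomorphism Omega_open Omega_star rho0 rhoO C0
  (transmutation_pair_swap tp) aF hC1).
- by move=> z zO; rewrite invr_neq0// gn.
- move=> z zO zn; have gz := gn z zO; rewrite /hx /hy.
  have -> : z.1%:C * (- gx z / g z ^+ 2) + z.2%:C * (- gy z / g z ^+ 2) =
    - (z.1%:C * gx z + z.2%:C * gy z) / g z ^+ 2 by ring.
  by rewrite gE//; field.
- move=> z zO zn; rewrite /hx /hy.
  have -> : z.1%:C * (- gy z / g z ^+ 2) - z.2%:C * (- gx z / g z ^+ 2) =
    - (z.1%:C * gy z - z.2%:C * gx z) / g z ^+ 2 by ring.
  by rewrite gT// oppr0 mul0r.
- by move=> r t rr tt; have [-> ->] := aG r t rr tt.
Qed.
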